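(* Assume that \(\mathcal{S}\subseteq\{\text{full},\text{almost full},\text{bowtie}\}\) is nonempty. A graph \(G\) is \(\mathcal{S}\)-restricted if and only if the skeleton+ of each of its 3-connected components is \(\mathcal{S}\)-restricted.
   Context: All graphs are finite, simple and undirected. A drawing of a graph maps vertices injectively to points of the plane and edges to simple curves between their endpoints avoiding other vertices, with finitely many transversal crossings. A drawing is 1-planar if every edge is involved in at most one crossing and adjacent edges do not cross. For a crossing between edges \(uv\) and \(xy\) consider the pairs \(\{u,x\},\{u,y\},\{v,x\},\{v,y\}\); its type is full if all four are edges, almost full if exactly three are, bowtie if exactly two disjoint ones are, arrow if exactly two sharing a vertex are, chair if exactly one is, X if none is. A drawing (graph) is \(\mathcal{S}\)-restricted if it is (admits a drawing that is) 1-planar with all crossing types in \(\mathcal{S}\). For a 2-connected graph, consider its SPR-tree (the decomposition into triconnected components): every node \(x\) has a skeleton \(\mathrm{sk}(x)\), a multigraph on a subset of the vertices whose edges are real (edges of the graph) or virtual (each virtual edge \(uv\) corresponding to a 2-separator \(\{u,v\}\) and paired with a virtual edge of an adjacent node); S-nodes have cycles as skeletons, P-nodes dipoles, R-nodes 3-connected simple graphs. The 3-connected components of a 2-connected graph are the skeletons of its R-nodes; the 3-connected components of an arbitrary graph are those of its 2-connected components (blocks). The skeleton+ of a node \(x\) is the graph with vertex set \(V(\mathrm{sk}(x))\) together with, for each virtual edge \(uv\) of \(\mathrm{sk}(x)\), a new vertex \(t_{uv}\); its edges are the real edges of \(\mathrm{sk}(x)\), the edges \(ut_{uv}, t_{uv}v\)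 for each virtual edge \(uv\), and the edge \(uv\) for each virtual edge \(uv\) of \(\mathrm{sk}(x)\) such that \(uv\) is an edge of \(G\). *)

(* Defs.v *)
From HB Require Import structures.
From mathcomp Require Import all_boot all_order all_algebra.
From mathcomp Require Import all_classical all_reals all_analysis.

Set Implicit Arguments.
Unset Strict Implicit.
Unset Printing Implicit Defensive.

Import Order.TTheory GRing.Theory Num.Theory.
Import numFieldTopology.Exports numFieldNormedType.Exports.

Record sgraph := SGraph {
  vert :> finType;
  adj : rel vert;
  adj_sym : symmetric adj;
  adj_irrefl : irreflexive adj }.

(* The edge with endpoints u and v; edges are identified with 2-element sets. *)
Definition edge (V : finType) (u v : V) : {set V} := [set u; v]%SET.

Definition edges (G : sgraph) : {set {set G}} :=
  [set a : {set G} | [exists u, exists v, adj u v && (a == edge u v)]]%SET.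

Definition connected_on (V : finType) (r : rel V) (A : {set V}) : Prop :=
  {in A &, forall u v,
     connect [rel x y | [&& x \in A, y \in A & r x y]] u v}.

Definition k_connected (k : nat) (V : finType) (r : rel V) (A : {set V}) : Prop :=
  (k < #|A|)%N /\
  forall X : {set V}, (#|X| < k)%N -> connected_on r (A :\: X)%SET.

Section Induced.
Variables (G : sgraph) (B : {set G}).

Definition induced_adj : rel {v : G | v \in B} :=
  fun u v => adj (val u) (val v).

Lemma induced_adj_sym : symmetric induced_adj.
Proof. by move=> u v; rewrite /induced_adj adj_sym. Qed.

Lemma induced_adj_irrefl : irreflexive induced_adj.
Proof. by move=> u; rewrite /induced_adj adj_irrefl. Qed.

Definition induced_subgraph : sgraph := SGraph induced_adj_sym induced_adj_irrefl.

End Induced.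

(* Blocks with at least three vertices. The remaining blocks (bridges and
   isolated vertices) are not 2-connected and have no SPR-tree. Blocks are
   induced subgraphs, so the vertex set determines the block. *)
Definition biconnected_component (G : sgraph) (B : {set G}) : Prop :=
  k_connected 2 (@adj G) B /\
  forall C : {set G}, B \subset C -> k_connected 2 (@adj G) C -> C = B.

Inductive node_kind := Snode | Pnode | Rnode.

(* sk_edge collects the edges of all the skeletons, sk_node e being the node
   to whose skeleton e belongs. Parallel edges are allowed. The values of twin
   matter only at virtual edges. *)
Record spr_data (H : sgraph) := SprData {
  node : finType;
  kind : node -> node_kind;
  sk_vert : node -> {set H};
  sk_edge : finType;
  sk_node : sk_edge -> node;
  sk_ends : sk_edge -> {set H};
  virtual : pred sk_edge;
  twin : sk_edge -> sk_edge }.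

Section Spr.
Variables (H : sgraph) (T : spr_data H).

Definition sk_edges (x : node T) : {set sk_edge T} :=
  [set e | sk_node e == x]%SET.

Definition sk_adj (x : node T) : rel H :=
  fun u v => [exists e in sk_edges x, sk_ends e == edge u v].

Definition is_cycle (x : node T) : Prop :=
  [/\ (2 < #|sk_vert x|)%N,
      connected_on (sk_adj x) (sk_vert x) &
      {in sk_vert x, forall v, #|[set e in sk_edges x | v \in sk_ends e]%SET| = 2}].

(* Skeletons of P-nodes have at least three edges; otherwise a superfluous
   P-node with one real edge could be attached to any node. *)
Definition is_dipole (x : node T) : Prop :=
  #|sk_vert x| = 2 /\ (2 < #|sk_edges x|)%N.

Definition is_3connected_simple (x : node T) : Prop :=
  {in sk_edges x &, injective (@sk_ends H T)} /\
  k_connected 3 (sk_adj x) (sk_vert x).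

Definition tree_adj : rel (node T) :=
  fun x y => [exists e, [&& virtual e, sk_node e == x & sk_node (twin e) == y]].

Definition tree_adj_at (v : H) : rel (node T) :=
  fun x y => [exists e, [&& virtual e, v \in sk_ends e,
                            sk_node e == x & sk_node (twin e) == y]].

Record is_spr_tree : Prop := IsSprTree {
  spr_ends_card : forall e : sk_edge T, #|sk_ends e| = 2;
  spr_ends_sub : forall e : sk_edge T, sk_ends e \subset sk_vert (sk_node e);
  spr_kind : forall x : node T,
    match kind x with
    | Snode => is_cycle x
    | Pnode => is_dipole x
    | Rnode => is_3connected_simple x
    end;
  spr_twin_virtual : forall e : sk_edge T, virtual e -> virtual (twin e);
  spr_twinK : forall e : sk_edge T, virtual e -> twin (twin e) = e;
  spr_twin_ends : forall e : sk_edge T, virtual e -> sk_ends (twin e) = sk_ends e;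
  spr_twin_node : forall e : sk_edge T, virtual e -> sk_node (twin e) != sk_node e;
  (* the pairs of twins are the edges of a tree: a connected graph with one
     edge less than it has vertices *)
  spr_nonempty : (0 < #|node T|)%N;
  spr_connected : forall x y : node T, connect tree_adj x y;
  spr_acyclic : #|[set e : sk_edge T | virtual e]%SET| = (#|node T|.-1).*2;
  (* no two S-nodes and no two P-nodes are adjacent *)
  spr_reduced : forall x y : node T, tree_adj x y -> kind x = kind y -> kind x = Rnode;
  (* gluing the skeletons along the pairs of twins and deleting the virtual
     edges yields H: every edge of H is real in exactly one skeleton, and the
     copies of a vertex are identified exactly through twins incident to it *)
  spr_real_edge : forall e : sk_edge T, ~~ virtual e -> sk_ends e \in edges H;
  spr_real_ex : forall a, a \in edges H ->
    exists2 e : sk_edge T, ~~ virtual e & sk_ends e = a;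
  spr_real_inj : forall e f : sk_edge T, ~~ virtual e -> ~~ virtual f ->
    sk_ends e = sk_ends f -> e = f;
  spr_vert_ex : forall v : H, exists x : node T, v \in sk_vert x;
  spr_vert_connected : forall (v : H) (x y : node T),
    v \in sk_vert x -> v \in sk_vert y -> connect (tree_adj_at v) x y }.

Section SkeletonPlus.
Variable x : node T.

(* inl v is a vertex of the skeleton, inr e is the new vertex of the virtual
   edge e *)
Definition skp_vert : finType :=
  ({v : H | v \in sk_vert x} +
   {e : sk_edge T | (e \in sk_edges x) && virtual e})%type.

(* The condition u != v is automatic when T is an SPR-tree. *)
Definition skp_adj : rel skp_vert := fun a b =>
  match a, b with
  | inl u, inl v =>
      (u != v) &&
      [exists e in sk_edges x,
         (sk_ends e == edge (val u) (val v)) &&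
         (virtual e ==> adj (val u) (val v))]
  | inl u, inr e => val u \in sk_ends (val e)
  | inr e, inl u => val u \in sk_ends (val e)
  | inr _, inr _ => false
  end.

Lemma skp_adj_sym : symmetric skp_adj.
Proof.
move=> [u|e] [v|f] //=; rewrite eq_sym; congr andb; apply: eq_existsb => e.
by rewrite adj_sym /edge finset.setUC.
Qed.

Lemma skp_adj_irrefl : irreflexive skp_adj.
Proof. by move=> [u|e] //=; rewrite eqxx. Qed.

Definition skeleton_plus : sgraph := SGraph skp_adj_sym skp_adj_irrefl.

End SkeletonPlus.
End Spr.

Inductive crossing_type := Full | AlmostFull | Bowtie | Arrow | Chair | Xcross.

Definition type_of_crossing (G : sgraph) (u v x y : G) : crossing_type :=
  match (adj u x + adj u y + adj v x + adj v y)%N with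
  | 0 => Xcross
  | 1 => Chair
  | 2 => if (adj u x && adj v y) || (adj u y && adj v x) then Bowtie else Arrow
  | 3 => AlmostFull
  | _ => Full
  end.

Local Open Scope ring_scope.
Local Open Scope classical_set_scope.

Section Drawing.
Variable R : realType.

Definition plane : topologicalType := (R * R)%type.

Definition simple_curve (a b : plane) (A : set plane) : Prop :=
  exists gamma : R -> plane,
    [/\ {within `[0, 1], continuous gamma},
        {in `[0, 1] &, injective gamma},
        gamma 0 = a, gamma 1 = b & gamma @` `[0, 1] = A].

(* Some local chart, i.e., a homeomorphism phi from the plane onto an open
   neighbourhood of p, turns A and B into the two coordinate axes. *)
Definition transversal_at (p : plane) (A B : set plane) : Prop :=
  exists phi : plane -> plane,
    [/\ continuous phi, injective phi,
        (forall U : set plane, open U -> open (phi @` U)), phi (0, 0) = p &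
        phi @^-1` A = [set q | q.2 = 0] /\ phi @^-1` B = [set q | q.1 = 0]].

Record drawing_data (G : sgraph) := DrawingData {
  pos : G -> plane;
  curve : {set G} -> set plane }.

Definition crosses (G : sgraph) (D : drawing_data G) (a b : {set G}) (p : plane) :=
  [/\ a \in edges G, b \in edges G, a != b, curve D a p /\ curve D b p &
      ~ range (pos D) p].

Record is_drawing (G : sgraph) (D : drawing_data G) : Prop := IsDrawing {
  pos_inj : injective (pos D);
  curve_simple : forall u v : G, adj u v ->
    simple_curve (pos D u) (pos D v) (curve D (edge u v));
  curve_avoids : forall (a : {set G}) (w : G), a \in edges G -> w \notin a ->
    ~ curve D a (pos D w);
  crosses_finite : forall a b : {set G}, finite_set [set p | crosses D a b p];
  crosses_transversal : forall (a b : {set G}) (p : plane),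
    crosses D a b p -> transversal_at p (curve D a) (curve D b) }.

(* A crossing of the edge a is a pair of another edge and a point. *)
Definition one_planar (G : sgraph) (D : drawing_data G) : Prop :=
  [/\ is_drawing D,
      (forall (a b c : {set G}) (p q : plane),
         crosses D a b p -> crosses D a c q -> b = c /\ p = q) &
      (forall (a b : {set G}) (p : plane), crosses D a b p ->
         (a :&: b)%SET = finset.set0)].

Definition restricted_drawing (S : set crossing_type) (G : sgraph)
    (D : drawing_data G) : Prop :=
  one_planar D /\
  forall (u v x y : G) (p : plane),
    crosses D (edge u v) (edge x y) p -> S (type_of_crossing u v x y).

Definition restricted (S : set crossing_type) (G : sgraph) : Prop :=
  exists D : drawing_data G, restricted_drawing S D.

End Drawing.

(* Main.v *)
(** The only property of the crossing types in S that matters is that, when uv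
    crosses xy, two disjoint edges join {u, v} to {x, y}.

    Drawings are modified by four operations: contracting an uncrossed edge;
    rerouting an edge e that crosses f along f to an end of f, after which neither
    e nor f is crossed; inserting a path along an arc that meets the drawing only in
    its ends; and opening up a vertex of degree two in each of two drawings and
    placing one drawing inside the other, which yields k-sums for k at most 2.

    From G to the skeletons: let W be the set of vertices that a virtual edge uv of
    the skeleton separates from it.  If a vertex of W is adjacent to u and v, it
    serves as t_uv.  Otherwise, if uv is crossed by an edge ab inside W with a
    adjacent to u, rerouting ab along uv to v makes a serve as t_uv.  In the
    remaining case no edge at W is crossed by an edge that is kept, so a walk from
    u to v through W is an arc along which the path u, t_uv, v can be inserted.

    From the skeletons to G: if an edge u t_uv of the skeleton+ is crossed, then the
    crossing edge ends at v, and the path u, t_uv, v can be rerouted along it.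
    When all edges at the vertices t_uv are uncrossed, the skeletons are glued
    by 2-sums along the tree, S- and P-nodes being drawn on two pages of a book,
    and the blocks by 1-sums.

    SPR-trees exist: split skeletons along 2-separators as long as possible, then
    merge adjacent S-nodes and adjacent P-nodes as long as possible. *)
From mathcomp Require Import all_boot all_order all_algebra.
From mathcomp Require Import all_classical all_reals all_analysis.
From mathcomp Require Import ring lra zify.
Require Import Defs.

Set Implicit Arguments.
Unset Strict Implicit.
Unset Printing Implicit Defensive.

(** * Trees of skeletons *)

(** The curves of a drawing are arbitrary arcs, so every modification has to come from explicit maps
    of the plane. An uncrossed edge is contracted by finding a polygonal arc in its neighbourhood
    and collapsing that arc segment by segment; since a curve may behave wildly near its ends, it is
    made straight there beforehand. Transversality refers to local charts only, so every map that is
    a homeomorphism near the crossings preserves it. Gluing two drawings at a vertex would in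
    general require the cyclic orders of the edges to match. With at most two edges at the vertex
    there is nothing to match; this is why 2-sums use the vertices t_uv and leave the identification
    of u and v to contractions. Crossing types are kept under control by one graph [big], of which
    H, every skeleton+ and all intermediate graphs are, up to renaming, induced subgraphs: the type
    of a crossing depends only on the adjacencies between its four ends and is thus inherited. *)

Section ArcCount.
Variables (N A : finType) (Pa : {set A}) (tl hd : A -> N) (rev : A -> A).
Hypothesis revP : forall a, a \in Pa -> [/\ rev a \in Pa, tl (rev a) = hd a & hd (rev a) = tl a].

Definition arc_rel : rel N := fun x y => [exists a in Pa, (tl a == x) && (hd a == y)].

(** Grow a set of nodes one at a time: an arc that leaves the set and its reverse are both new. As
    [pt_acyclic] provides exactly this number of arcs, every pair of twins turns out to be a bridge
    of the tree. *)
Lemma arcs_lower : (forall x y, connect arc_rel x y) -> ((#|N|.-1).*2 <= #|Pa|)%N.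
Proof.
move=> con; case: (posnP #|N|) => [->//|N0].
have /card_gt0P[x0 _] : (0 < #|[pred x : N | true]|)%N by [].
suff [S [B [_ BP _ SN BS]]] : exists (S : {set N}) (B : {set A}), [/\ x0 \in S, B \subset Pa,
    {in B, forall a, tl a \in S /\ hd a \in S}, #|S| = #|N| & ((#|S|.-1).*2 <= #|B|)%N].
  by rewrite -SN; apply: leq_trans BS _; exact: subset_leq_card.
elim: {-2}#|N| (leqnn #|N|) N0 => // -[|k] IH kN _.
  exists [set x0]%SET, finset.set0; split; rewrite ?finset.sub0set ?inE ?cards1 //.
  by move=> a; rewrite finset.in_set0.
have [S [B [x0S BP Bin SN BS]]] := IH (ltnW kN) isT.
have [y yS] : exists y, y \notin S.
  apply/existsP; rewrite -negb_forall; apply/negP => /forallP SA.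
  by have : #|S| = #|N| by [apply: eq_card => y; rewrite SA]; rewrite SN => E; rewrite E ltnn in kN.
have [a aP /andP[ta ha]] : exists2 a, a \in Pa & (tl a \in S) && (hd a \notin S).
  apply/exists_inP; apply: contraNT yS => /exists_inPn H.
  have cl x z : x \in S -> arc_rel x z -> z \in S.
    move=> xS /exists_inP[a aP /andP[/eqP ta /eqP ha]].
    by have := H a aP; rewrite ta ha xS /= negbK.
  have /connectP[p pp ->] := con x0 y.
  suff walk : forall x, x \in S -> path arc_rel x p -> last x p \in S by exact: walk.
  by elim: p {pp} => //= z p IHp x xS /andP[/(cl _ _ xS) zS]; exact: IHp.
have [rP rt rh] := revP aP.
have aB : a \notin B by apply: contraNN ha => /Bin[].
have rB : rev a \notin B by apply: contraNN ha => /Bin[]; rewrite rt.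
have ar : a != rev a by apply: contraNneq ha => E; rewrite -rt -E.
exists (hd a |: S)%SET, (a |: (rev a |: B))%SET; split.
- by rewrite !inE x0S orbT.
- by apply/fintype.subsetP => b; rewrite !inE => /or3P[/eqP ->|/eqP ->|/(fintype.subsetP BP)].
- move=> b; rewrite !inE => /or3P[/eqP ->|/eqP ->|/Bin[-> ->]]; rewrite ?rt ?rh ?ta ?eqxx ?orbT //.
- by rewrite cardsU1 ha SN.
- rewrite cardsU1 ha /= cardsU1 !inE negb_or ar aB /= cardsU1 rB /= !add1n.
  by rewrite SN /= in BS *; rewrite doubleS !ltnS.
Qed.

End ArcCount.

(* An SPR-tree without the conditions on the kinds of the nodes. *)
Record pre_tree (H : sgraph) (T : spr_data H) : Prop := PreTree {
  pt_ends_card : forall e : sk_edge T, #|sk_ends e| = 2;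
  pt_ends_sub : forall e : sk_edge T, sk_ends e \subset sk_vert (sk_node e);
  pt_twin_virtual : forall e : sk_edge T, virtual e -> virtual (twin e);
  pt_twinK : forall e : sk_edge T, virtual e -> twin (twin e) = e;
  pt_twin_ends : forall e : sk_edge T, virtual e -> sk_ends (twin e) = sk_ends e;
  pt_twin_node : forall e : sk_edge T, virtual e -> sk_node (twin e) != sk_node e;
  pt_nonempty : (0 < #|node T|)%N;
  pt_connected : forall x y : node T, connect (@tree_adj H T) x y;
  pt_acyclic : #|[set e : sk_edge T | virtual e]%SET| = (#|node T|.-1).*2;
  pt_real_edge : forall e : sk_edge T, ~~ virtual e -> sk_ends e \in edges H;
  pt_real_ex : forall a, a \in edges H -> exists2 e : sk_edge T, ~~ virtual e & sk_ends e = a;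
  pt_real_inj : forall e f : sk_edge T, ~~ virtual e -> ~~ virtual f ->
    sk_ends e = sk_ends f -> e = f;
  pt_vert_ex : forall v : H, exists x : node T, v \in sk_vert x;
  pt_vert_connected : forall (v : H) (x y : node T),
    v \in sk_vert x -> v \in sk_vert y -> connect (tree_adj_at (T := T) v) x y }.

Lemma spr_pre_tree (H : sgraph) (T : spr_data H) : is_spr_tree T -> pre_tree T.
Proof. by case. Qed.

Section TreeFacts.
Variables (H : sgraph) (T : spr_data H).
Hypothesis hT : pre_tree T.
Implicit Types (e f : sk_edge T) (x y z : node T).

Lemma edges_adj (u v : H) : (edge u v \in edges H) = adj u v.
Proof.
apply/idP/idP => [|uv]; last by rewrite inE; apply/existsP; exists u; apply/existsP; exists v; rewrite uv eqxx.
rewrite inE => /existsP[a /existsP[b /andP[ab /eqP E]]].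
have : a \in edge u v by rewrite E !inE eqxx.
have : b \in edge u v by rewrite E !inE eqxx orbT.
have anb : a != b by apply: contraTneq ab => ->; rewrite adj_irrefl.
rewrite !inE => /orP[/eqP bE|/eqP bE] /orP[/eqP aE|/eqP aE]; rewrite ?aE ?bE ?eqxx // in ab anb *.
by rewrite adj_sym.
Qed.

Definition tree_rel e : rel (node T) :=
  arc_rel ([set f | virtual f] :\ e :\ twin e)%SET (@sk_node H T) (fun f => sk_node (twin f)).

(** The component of the tree beyond [e], after the link formed by [e] and [twin e] has been cut. *)
Definition far e : {set node T} := [set z | connect (tree_rel e) (sk_node (twin e)) z]%SET.

Lemma twin_inj e f : virtual e -> virtual f -> twin e = twin f -> e = f.
Proof. by move=> ve vf E; rewrite -(pt_twinK hT ve) E (pt_twinK hT vf). Qed.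

Lemma twin_neq e : virtual e -> twin e != e.
Proof. by move=> ve; apply: contraNneq (pt_twin_node hT ve) => ->. Qed.

Lemma tree_relP e x y : reflect (exists f, [/\ virtual f, f != e, f != twin e,
  sk_node f = x & sk_node (twin f) = y]) (tree_rel e x y).
Proof.
apply: (iffP exists_inP) => [[f]|[f [vf fe ft <- <-]]].
  by rewrite !inE => /and3P[ft fe vf] /andP[/eqP <- /eqP <-]; exists f.
by exists f; rewrite ?inE ?vf ?fe ?ft ?eqxx.
Qed.

Lemma tree_rel_sym e : virtual e -> symmetric (tree_rel e).
Proof.
move=> ve x y; apply/idP/idP => /tree_relP[f [vf fe ft <- <-]]; apply/tree_relP; exists (twin f).
  split; rewrite ?(pt_twin_virtual hT) ?(pt_twinK hT) //.
  - by apply: contraNneq ft => E; rewrite -E (pt_twinK hT).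
  - by apply: contraNneq fe => /(twin_inj vf ve) ->.
split; rewrite ?(pt_twin_virtual hT) ?(pt_twinK hT) //.
- by apply: contraNneq ft => E; rewrite -E (pt_twinK hT).
- by apply: contraNneq fe => /(twin_inj vf ve) ->.
Qed.

(** Otherwise all nodes would remain connected without [e] and [twin e], with two arcs fewer than
    [arcs_lower] demands. *)
Lemma near_far e : virtual e -> sk_node e \notin far e.
Proof.
move=> ve; rewrite inE; apply/negP => con.
have vt := pt_twin_virtual hT ve.
have symc : connect_sym (tree_rel e).
  by apply: sym_connect_sym; exact: tree_rel_sym.
have all_con x y : connect (tree_rel e) x y.
  apply: (connect_sub _ (pt_connected hT x y)) => {}x {}y /existsP[f /and3P[vf /eqP <- /eqP <-]].
  case: (eqVneq f e) => [->|fe]; first by rewrite symc.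
  case: (eqVneq f (twin e)) => [->|ft]; first by rewrite (pt_twinK hT).
  by apply: connect1; apply/tree_relP; exists f.
have := @arcs_lower (node T) (sk_edge T) ([set f | virtual f] :\ e :\ twin e)%SET (@sk_node H T)
  (fun f => sk_node (twin f)) (@twin H T) _ all_con.
have h : forall f, f \in ([set f | virtual f] :\ e :\ twin e)%SET ->
    [/\ twin f \in ([set f | virtual f] :\ e :\ twin e)%SET, sk_node (twin f) = sk_node (twin f) &
       sk_node (twin (twin f)) = sk_node f].
  move=> f; rewrite !inE => /and3P[ft fe vf]; rewrite (pt_twinK hT) // (pt_twin_virtual hT) // andbT.
  split => //; apply/andP; split; first by apply: contraNneq fe => /(twin_inj vf ve) ->.
  by apply: contraNneq ft => <-; rewrite (pt_twinK hT).
move=> /(_ h); have := pt_acyclic hT.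
rewrite (cardsD1 e) inE ve (cardsD1 (twin e)) !inE twin_neq // vt /= !add1n => <-.
by rewrite ltnNge leqnSn.
Qed.

Lemma far_twin_node e : sk_node (twin e) \in far e.
Proof. by rewrite inE connect0. Qed.

Lemma far_step e f : virtual e -> virtual f -> f != e -> f != twin e ->
  (sk_node f \in far e) = (sk_node (twin f) \in far e).
Proof.
move=> ve vf fe ft; rewrite !inE.
have r1 : tree_rel e (sk_node f) (sk_node (twin f)) by apply/tree_relP; exists f.
have r2 : tree_rel e (sk_node (twin f)) (sk_node f) by rewrite (tree_rel_sym ve).
by apply/idP/idP => h; apply: (connect_trans h); exact: connect1.
Qed.

Lemma cross_far e x y : virtual e -> tree_adj x y -> x \notin far e -> y \in far e -> x = sk_node e.
Proof.
move=> ve /existsP[f /and3P[vf /eqP <- /eqP <-]] xn yf.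
case: (eqVneq f e) => [->//|fe]; case: (eqVneq f (twin e)) => [E|ft].
  by rewrite E far_twin_node in xn.
by rewrite (far_step ve vf fe ft) yf in xn.
Qed.

(** The nodes that contain [v] are connected by links incident to [v], and the only link between the
    two sides is that of [e]. *)
Lemma far_ends e v x z : virtual e -> x \notin far e -> z \in far e ->
  v \in sk_vert x -> v \in sk_vert z -> v \in sk_ends e.
Proof.
move=> ve xn zf vx vz; have /connectP[p pp zE] := pt_vert_connected hT vx vz.
rewrite {}zE in zf vz *; elim: p x xn {vx} pp zf vz => [|y p IH] x xn /=.
  by move=> _ zf; rewrite zf in xn.
case/andP=> /existsP[f /and4P[vf vE /eqP fx /eqP fy]] pp zf vz.
case: (boolP (y \in far e)) => yf; last exact: (IH y).
case: (eqVneq f e) => [<-//|fe]; case: (eqVneq f (twin e)) => [E|ft].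
  by rewrite -(pt_twin_ends hT ve) -E.
by move: xn; rewrite -fx (far_step ve vf fe ft) fy yf.
Qed.

Lemma far_compl e z : virtual e -> (z \in far (twin e)) = (z \notin far e).
Proof.
move=> ve; have vt := pt_twin_virtual hT ve.
have tr : tree_rel (twin e) =2 tree_rel e.
  move=> x y; apply/tree_relP/tree_relP => -[f [vf h1 h2 h3 h4]]; exists f; split => //.
    by rewrite (pt_twinK hT) in h2.
  by rewrite (pt_twinK hT).
have farE w : (w \in far (twin e)) = connect (tree_rel e) (sk_node e) w.
  by rewrite inE (pt_twinK hT) // (eq_connect tr).
have symc : connect_sym (tree_rel e) by apply: sym_connect_sym; exact: tree_rel_sym.
apply/idP/idP => [|zn].
  rewrite farE => h; apply/negP => zf; have := near_far ve; rewrite inE.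
  by rewrite inE symc in zf; rewrite symc (connect_trans h zf).
rewrite farE.
have /connectP[p pp zE] := pt_connected hT (sk_node e) z.
rewrite {}zE in zn *; suff : forall w, connect (tree_rel e) (sk_node e) w || (w \in far e) ->
    path (@tree_adj H T) w p -> connect (tree_rel e) (sk_node e) (last w p) || (last w p \in far e).
  by move=> /(_ (sk_node e)); rewrite connect0 => /(_ isT pp); rewrite (negbTE zn) orbF.
elim: p {pp zn} => //= y p IH w hw /andP[/existsP[f /and3P[vf /eqP fw /eqP fy]] pp].
apply: IH => //; case: (eqVneq f e) => [E|fe].
  by rewrite -fy E far_twin_node orbT.
case: (eqVneq f (twin e)) => [E|ft]; first by rewrite -fy E (pt_twinK hT) // connect0.
have r1 : tree_rel e w y by apply/tree_relP; exists f.
case/orP: hw => hw; first by rewrite (connect_trans hw (connect1 r1)).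
by rewrite -fy -(far_step ve vf fe ft) fw hw orbT.
Qed.

Lemma far_disjoint e f z : virtual e -> virtual f -> sk_node e = sk_node f -> e != f ->
  z \in far e -> z \notin far f.
Proof.
move=> ve vf ef ne.
have hx := near_far ve.
have h1 : sk_node (twin e) \notin far f.
  have et : e != twin f by apply: contraNneq (pt_twin_node hT vf) => <-; rewrite ef.
  by rewrite -(far_step vf ve ne et) ef near_far.
rewrite inE => /connectP[p pp ->].
suff : forall w, w \notin far f -> w \in far e -> path (tree_rel e) w p -> last w p \notin far f.
  by apply => //; exact: far_twin_node.
elim: p {pp} => //= y p IH w wf we /andP[r1 pp].
have ye : y \in far e by move: we; rewrite !inE => we; rewrite (connect_trans we (connect1 r1)).
apply: IH => //; apply/negP => yf; move: r1 => /tree_relP[k [vk ke kt kw ky]].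
have tk : tree_adj w y by apply/existsP; exists k; rewrite vk kw ky !eqxx.
have E := cross_far vf tk wf yf.
by rewrite ef -E we in hx.
Qed.

(** Take the first edge of a simple path from [x] to [z]. The path never returns to [x], so its
    remainder avoids this link and stays beyond it. *)
Lemma far_cover x z : z != x -> exists e, [/\ virtual e, sk_node e = x & z \in far e].
Proof.
move=> zx; have /connectP[p0 pp0 zE] := pt_connected hT x z.
rewrite {}zE in zx *; case/shortenP: pp0 zx => -[|y p] /=; first by rewrite eqxx.
case/andP=> /existsP[e /and3P[ve /eqP ex /eqP ey]] pp /and3P[xp _ _] _ zx.
exists e; split => //; rewrite inE ey; apply/connectP; exists p => //.
move: xp; rewrite inE negb_or => /andP[xy xp].
elim: p y pp xy xp {ey zx} => //= w p IH y /andP[/existsP[f /and3P[vf /eqP fy /eqP fw]] pp] xy.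
rewrite inE negb_or => /andP[xw xp]; rewrite IH // andbT.
apply/tree_relP; exists f; split => //.
  by apply: contraNneq xy => E; rewrite -ex -E fy.
by apply: contraNneq xw => E; rewrite -fw E (pt_twinK hT) // ex.
Qed.

(** If the real copy of uv belongs to another node, that node lies beyond some virtual edge of [x],
    and [far_ends] puts both u and v into its separator. Hence a skeleton+ contains all edges of [H]
    between its vertices, and it is an induced piece of a larger graph. *)
Lemma sk_pair x u v : u \in sk_vert x -> v \in sk_vert x -> adj u v ->
  exists2 e, e \in sk_edges x & sk_ends e = edge u v.
Proof.
move=> ux vx uv; have uvE : edge u v \in edges H by rewrite edges_adj.
have [f vf fE] := pt_real_ex hT uvE.
case: (eqVneq (sk_node f) x) => [fx|fx]; first by exists f => //; rewrite inE fx.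
have [e [ve ex zf]] := far_cover fx.
have inz w : w \in edge u v -> w \in sk_vert (sk_node f).
  by rewrite -fE; exact: (fintype.subsetP (pt_ends_sub hT f)).
have xn : x \notin far e by rewrite -ex near_far.
exists e; first by rewrite inE ex.
have nuv : u != v by apply: contraTneq uv => ->; rewrite adj_irrefl.
apply/esym/eqP; rewrite eqEcard (pt_ends_card hT) cards2 nuv andbT.
apply/fintype.subsetP => w wuv; apply: (far_ends ve xn zf _ (inz _ wuv)).
by move: wuv; rewrite !inE => /orP[/eqP ->|/eqP ->].
Qed.

Lemma adj_far e u v : virtual e -> (exists2 z, z \in far e & u \in sk_vert z) ->
  u \notin sk_ends e -> adj u v -> exists2 z, z \in far e & v \in sk_vert z.
Proof.
move=> ve [z zf uz] ue uv; have uvE : edge u v \in edges H by rewrite edges_adj.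
have [f vf fE] := pt_real_ex hT uvE; exists (sk_node f).
  apply: contraNT ue => fn; apply: (far_ends ve fn zf) => //.
  by apply: (fintype.subsetP (pt_ends_sub hT f)); rewrite fE !inE eqxx.
by apply: (fintype.subsetP (pt_ends_sub hT f)); rewrite fE !inE eqxx orbT.
Qed.

End TreeFacts.

Import Order.TTheory GRing.Theory Num.Theory.
Import numFieldTopology.Exports numFieldNormedType.Exports.

Local Open Scope ring_scope.
Local Open Scope classical_set_scope.

(** * Arcs in the plane *)

Section PlaneTopology.
Variable R : realType.
Local Notation P := (R * R)%type.

Section ContinuityRules.
Variable T : topologicalType.
Implicit Types (f g : T -> R) (F G : T -> P).

Lemma cont_pair f g : continuous f -> continuous g -> continuous (fun t => (f t, g t)).
Proof. by move=> cf cg t; exact: (cvg_pair (cf t) (cg t)). Qed.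

Lemma cont_fst F : continuous F -> continuous (fun t => (F t).1).
Proof. by move=> cF t; apply: (continuous_comp (cF t)); exact: cvg_fst. Qed.

Lemma cont_snd F : continuous F -> continuous (fun t => (F t).2).
Proof. by move=> cF t; apply: (continuous_comp (cF t)); exact: cvg_snd. Qed.

Lemma cont_max f g : continuous f -> continuous g ->
  continuous (fun t => Num.max (f t) (g t)).
Proof. by move=> cf cg t; apply: continuous_max; [exact: cf|exact: cg]. Qed.

Lemma cont_min f g : continuous f -> continuous g ->
  continuous (fun t => Num.min (f t) (g t)).
Proof. by move=> cf cg t; apply: continuous_min; [exact: cf|exact: cg]. Qed.

Lemma cont_mul f g : continuous f -> continuous g -> continuous (fun t => f t * g t).
Proof. by move=> cf cg t; apply: (continuousM (cf t)); exact: cg. Qed.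

Lemma cont_add f g : continuous f -> continuous g -> continuous (fun t => f t + g t).
Proof. by move=> cf cg t; apply: (continuousD (cf t)); exact: cg. Qed.

Lemma cont_opp f : continuous f -> continuous (fun t => - f t).
Proof. by move=> cf t; apply: (continuousN (cf t)). Qed.

Lemma cont_abs f : continuous f -> continuous (fun t => `|f t|).
Proof. by move=> cf t; apply: (continuous_comp (cf t)); exact: norm_continuous. Qed.

Lemma cont_cst (c : R) : continuous (fun _ : T => c).
Proof. by move=> t; exact: cvg_cst. Qed.

Lemma cont_addv F G : continuous F -> continuous G -> continuous (fun t => F t + G t).
Proof. by move=> cf cg t; apply: (continuousD (cf t)); exact: cg. Qed.

Lemma cont_cstv (c : P) : continuous (fun _ : T => c).
Proof. by move=> t; exact: cvg_cst. Qed.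

Lemma cont_scalev f F : continuous f -> continuous F -> continuous (fun t => f t *: F t).
Proof.
move=> cf cF; apply: (@cont_pair (fun t => f t * (F t).1) (fun t => f t * (F t).2)).
  by apply: cont_mul => //; exact: cont_fst.
by apply: cont_mul => //; exact: cont_snd.
Qed.

Lemma cont_normv F : continuous F -> continuous (fun t => `|F t|).
Proof. by move=> cf t; apply: (continuous_comp (cf t)); exact: norm_continuous. Qed.

End ContinuityRules.

Lemma cont_comp (T U W : topologicalType) (f : T -> U) (g : U -> W) :
  continuous f -> continuous g -> continuous (fun t => g (f t)).
Proof. by move=> cf cg t; apply: (continuous_comp (cf t)); exact: cg. Qed.

Lemma cont_id (T : topologicalType) : continuous (fun t : T => t).
Proof. by move=> t. Qed.

Lemma pext (x y : P) : x.1 = y.1 -> x.2 = y.2 -> x = y.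
Proof. by case: x y => [? ?] [? ?] /= -> ->. Qed.

Lemma paddE1 (x y : P) : (x + y).1 = x.1 + y.1. Proof. by []. Qed.
Lemma paddE2 (x y : P) : (x + y).2 = x.2 + y.2. Proof. by []. Qed.
Lemma poppE1 (x : P) : (- x).1 = - x.1. Proof. by []. Qed.
Lemma poppE2 (x : P) : (- x).2 = - x.2. Proof. by []. Qed.
Lemma pscaleE1 k (x : P) : (k *: x).1 = k * x.1. Proof. by []. Qed.
Lemma pscaleE2 k (x : P) : (k *: x).2 = k * x.2. Proof. by []. Qed.
Definition pE := (paddE1, paddE2, poppE1, poppE2, pscaleE1, pscaleE2).

(** The norm of the plane is the maximum norm: all discs and circles below are squares. *)
Lemma pnorm (x : P) : `|x| = Num.max `|x.1| `|x.2|.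
Proof. by []. Qed.

Lemma pnorm_lt (x : P) e : (`|x| < e) = (`|x.1| < e) && (`|x.2| < e).
Proof. by rewrite pnorm gt_max. Qed.

Lemma pnorm_le (x : P) e : (`|x| <= e) = (`|x.1| <= e) && (`|x.2| <= e).
Proof. by rewrite pnorm ge_max. Qed.

Lemma nbhs_plane (x : P) (A : set P) :
  nbhs x A <-> exists2 e : R, 0 < e & forall y : P, `|x - y| < e -> A y.
Proof.
split=> [/nbhs_normP[e e0 eA]|[e e0 eA]]; first by exists e => // y; exact: eA.
by apply: (nbhs_normP x A).2; exists e.
Qed.

Lemma nbhs_real (x : R) (A : set R) :
  nbhs x A <-> exists2 e : R, 0 < e & forall y : R, `|x - y| < e -> A y.
Proof.
split=> [/nbhs_normP[e e0 eA]|[e e0 eA]]; first by exists e => // y; exact: eA.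
by apply: (nbhs_normP x A).2; exists e.
Qed.

Lemma open_plane (A : set P) :
  open A <-> forall x, A x -> exists2 e : R, 0 < e & forall y : P, `|x - y| < e -> A y.
Proof.
rewrite openE; split=> oA x Ax; first by apply/nbhs_plane; exact: oA.
by rewrite /interior; apply/nbhs_plane; exact: oA.
Qed.

Lemma hausdorff_plane : hausdorff_space (P : topologicalType).
Proof. exact: norm_hausdorff. Qed.

Lemma closed_away (A : set P) (x : P) : closed A -> ~ A x ->
  exists2 e : R, 0 < e & forall y, A y -> e <= `|x - y|.
Proof.
move=> cA Ax; have oA : open (~` A) by exact: closed_openC.
have [e e0 eH] := (open_plane _).1 oA x Ax.
by exists e => // y Ay; rewrite leNgt; apply/negP => /eH; apply.
Qed.

Definition cball (b : P) (r : R) : set P := [set x | `|b - x| <= r].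

Lemma cball_closed b r : closed (cball b r).
Proof.
have -> : cball b r = (fun x : P => `|b - x|) @^-1` [set y | y <= r] by [].
apply: preimage_closed; last exact: closed_le.
move=> x _; apply: cont_normv => {}x.
by apply: (@continuousB _ _ _ (fun=> b) id); [exact: cvg_cst|exact: cvg_id].
Qed.

Definition inI (t : R) := (0 <= t) && (t <= 1).

Definition clamp (t : R) := Num.max 0 (Num.min 1 t).

Lemma clampI t : inI (clamp t).
Proof. by rewrite /inI /clamp le_max lexx /= ge_max ler01 ge_min lexx. Qed.

Lemma clamp_id t : inI t -> clamp t = t.
Proof. by rewrite /clamp => /andP[t0 t1]; rewrite (min_idPr t1) (max_idPr t0). Qed.

Lemma clamp_cont : continuous clamp.
Proof.
by apply: cont_max; [exact: cont_cst|apply: cont_min; [exact: cont_cst|exact: cont_id]].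
Qed.

(** A simple curve whose parametrisation is extended to the whole line without leaving [A], so that
    continuity is global. The extension by constants is given by [clamp]. *)
Definition arc (a b : P) (A : set P) := exists g : R -> P,
  [/\ continuous g, (forall s t, inI s -> inI t -> g s = g t -> s = t),
      g 0 = a /\ g 1 = b, (forall t, A (g t)) &
      forall x, A x -> exists2 t, inI t & g t = x].

Lemma inI_itv t : inI t = (t \in `[0, 1]%R).
Proof. by rewrite in_itv. Qed.

Lemma inI_set (t : R) : (t \in (`[0, 1]%classic : set R)) = inI t.
Proof. by apply/idP/idP; rewrite inE /= in_itv. Qed.

Lemma inI0 : inI 0. Proof. by rewrite /inI lexx ler01. Qed.
Lemma inI1 : inI 1. Proof. by rewrite /inI lexx ler01. Qed.

Lemma arcP a b A : simple_curve (R := R) a b A <-> arc a b A.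
Proof.
split=> [[g [cg gi g0 g1 gA]]|[g [cg gi [g0 g1] gA Ag]]]; last first.
  exists g; split => //; first exact: continuous_subspaceT.
    by move=> s t; rewrite !inI_set; exact: gi.
  apply/seteqP; split=> [x [t _ <-]|x /Ag[t tI <-]]; first exact: gA.
  by exists t => //=; rewrite -inI_itv.
exists (g \o clamp); split => /=.
- move=> t; have /subspace_continuousP H := cg.
  have := H (clamp t); rewrite /= -inI_itv => /(_ (clampI t)) H1.
  move=> A0 /H1; rewrite /nbhs /= => H2.
  have := clamp_cont H2; rewrite nbhs_simpl /=.
  apply: filterS => s /=; apply; rewrite /= -inI_itv; exact: clampI.
- by move=> s t sI tI; rewrite !clamp_id // => /gi; apply; rewrite inI_set.
- by rewrite !clamp_id ?inI0 ?inI1.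
- by move=> t; rewrite -gA; exists (clamp t) => //=; rewrite -inI_itv; exact: clampI.
- move=> x; rewrite -gA => -[t /=]; rewrite -inI_itv => tI <-; exists t => //.
  by rewrite clamp_id.
Qed.

Lemma arc_compact a b A : arc a b A -> compact A.
Proof.
case=> g [cg _ _ gA Ag].
have -> : A = g @` `[0, 1].
  apply/seteqP; split=> [x /Ag[t tI <-]|x [t _ <-]]; last exact: gA.
  by exists t => //=; rewrite -inI_itv.
apply: continuous_compact; first exact: continuous_subspaceT.
exact: segment_compact.
Qed.

Lemma arc_closed a b A : arc a b A -> closed A.
Proof. by move/arc_compact; apply: compact_closed; exact: hausdorff_plane. Qed.

Lemma arc_ends a b A : arc a b A -> [/\ A a, A b & a != b].
Proof.
case=> g [cg gi [<- <-] gA _]; split => //; apply/eqP.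
by move/(gi _ _ inI0 inI1)/eqP; rewrite eq_sym oner_eq0.
Qed.

Lemma arc_rev a b A : arc a b A -> arc b a A.
Proof.
case=> g [cg gi [g0 g1] gA Ag]; exists (fun t => g (1 - t)); split => //.
- apply: (@cont_comp _ _ _ (fun t : R => 1 - t) g) => //.
  by apply: cont_add; [exact: cont_cst|apply: cont_opp; exact: cont_id].
- move=> s t sI tI E; have I1 : inI (1 - s) by move: sI; rewrite /inI; lra.
  have I2 : inI (1 - t) by move: tI; rewrite /inI; lra.
  by have := gi _ _ I1 I2 E; lra.
- by rewrite subr0 subrr.
- move=> x /Ag[t tI <-]; exists (1 - t); first by move: tI; rewrite /inI; lra.
  by congr g; lra.
Qed.

Lemma arc_image (psi : P -> P) a b A : (forall x, A x -> {for x, continuous psi}) ->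
  (forall x y, A x -> A y -> psi x = psi y -> x = y) ->
  arc a b A -> arc (psi a) (psi b) (psi @` A).
Proof.
move=> cpsi ipsi [g [cg gi [g0 g1] gA Ag]]; exists (psi \o g); split => /=.
- by move=> t; apply: (continuous_comp (cg t)); exact: cpsi.
- by move=> s t sI tI E; apply: gi => //; exact: ipsi.
- by rewrite g0 g1.
- by move=> t; exists (g t).
- by move=> _ [x /Ag[t tI <-] <-]; exists t.
Qed.

Lemma arc_sub (g : R -> P) (s t : R) : continuous g ->
  (forall s t, inI s -> inI t -> g s = g t -> s = t) ->
  0 <= s -> s < t -> t <= 1 ->
  arc (g s) (g t) [set x | exists2 r, s <= r <= t & g r = x].
Proof.
move=> cg gi s0 st t1; have ts0 : t - s != 0 by lra.
have tsp : 0 < t - s by lra.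
exists (fun r => g (s + clamp r * (t - s))); split => /=.
- apply: (@cont_comp _ _ _ (fun r : R => s + clamp r * (t - s)) g) => //.
  by apply: cont_add; [exact: cont_cst|apply: cont_mul; [exact: clamp_cont|exact: cont_cst]].
- have H r : inI r -> inI (s + r * (t - s)).
    rewrite /inI => /andP[r0 r1]; apply/andP; split; nra.
  move=> x y xI yI; rewrite !clamp_id // => E; have /addrI := gi _ _ (H _ xI) (H _ yI) E.
  by move/(mulIf ts0).
- by rewrite !clamp_id ?inI0 ?inI1 // mul0r addr0 mul1r addrC subrK.
- move=> r; exists (s + clamp r * (t - s)) => //.
  have := clampI r; rewrite /inI; move: (clamp r) => c /andP[c0 c1].
  by apply/andP; split; nra.
- move=> x [r /andP[sr rt] <-]; exists ((r - s) / (t - s)).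
    by rewrite /inI divr_ge0 ?ler_pdivrMr ?mul1r; lra.
  rewrite clamp_id; last by rewrite /inI divr_ge0 ?ler_pdivrMr ?mul1r; lra.
  by congr g; rewrite divfK //; lra.
Qed.

Lemma arc_split a b A p : arc a b A -> A p -> p != a -> p != b ->
  exists A1 A2, [/\ arc a p A1, arc p b A2, A = A1 `|` A2 & A1 `&` A2 = [set p]].
Proof.
case=> g [cg gi [g0 g1] gA Ag] /Ag[t tI gt] pa pb.
have t0 : 0 < t.
  rewrite lt_neqAle; move: (tI) => /andP[-> _]; rewrite andbT eq_sym.
  by apply/eqP => t0; move: pa; rewrite -gt t0 g0 eqxx.
have t1 : t < 1.
  rewrite lt_neqAle; move: (tI) => /andP[_ ->]; rewrite andbT.
  by apply/eqP => t1; move: pb; rewrite -gt t1 g1 eqxx.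
have a1 := arc_sub cg gi (lexx 0) t0 (ltW t1).
have a2 := arc_sub cg gi (ltW t0) t1 (lexx 1).
rewrite g0 gt in a1; rewrite gt g1 in a2.
eexists; eexists; split; [exact: a1|exact: a2| |].
  apply/seteqP; split=> [x /Ag[r /andP[r0 r1] <-]|x [[r _ <-]|[r _ <-]]] //.
  by case: (lerP r t) => rt; [left|right]; exists r => //; apply/andP; split => //; exact: ltW.
apply/seteqP; split=> [x [[r /andP[r0 rt] <-] [s /andP[ts s1]]]|x ->].
  move=> E; have rs : s = r by apply: gi => //; rewrite /inI; lra.
  by rewrite -gt; congr g; lra.
by split; exists t => //; rewrite ?lexx ?ltW.
Qed.

Lemma arc_cat a b c A B : arc a b A -> arc b c B -> A `&` B `<=` [set b] ->
  arc a c (A `|` B).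
Proof.
case=> g [cg gi [g0 g1] gA Ag] [h [ch hi [h0 h1] hB Bh]] AB.
(* While one summand moves, the other one rests at [b], and [b] is subtracted: a single continuous
   formula covers both halves. *)
pose f t := g (clamp (2 * t)) + h (clamp (2 * t - 1)) - b.
have fl t : t <= 1 / 2 -> f t = g (clamp (2 * t)).
  move=> t2; rewrite /f [clamp (_ - 1)](_ : _ = 0) ?h0 ?addrK //.
  by rewrite /clamp; apply/max_idPl; rewrite ge_min; apply/orP; right; lra.
have fr t : 1 / 2 <= t -> f t = h (clamp (2 * t - 1)).
  move=> t2; rewrite /f [clamp (2 * t)](_ : _ = 1) ?g1 ?[b + _]addrC ?addrK //.
  by rewrite /clamp (@min_idPl _ _ 1 (2 * t) _) ?(@max_idPr _ _ 0 1 _) //; lra.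
have I2 t : inI t -> t <= 1/2 -> inI (2 * t) by rewrite /inI; lra.
have I3 t : inI t -> 1/2 <= t -> inI (2 * t - 1) by rewrite /inI; lra.
exists f; split.
- apply: cont_addv; last exact: cont_cstv.
  apply: cont_addv.
    apply: (@cont_comp _ _ _ (fun t : R => clamp (2 * t)) g) => //.
    apply: (@cont_comp _ _ _ (fun t : R => 2 * t) clamp); last exact: clamp_cont.
    by apply: cont_mul; [exact: cont_cst|exact: cont_id].
  apply: (@cont_comp _ _ _ (fun t : R => clamp (2 * t - 1)) h) => //.
  apply: (@cont_comp _ _ _ (fun t : R => 2 * t - 1) clamp); last exact: clamp_cont.
  apply: cont_add; last exact: cont_cst.
  by apply: cont_mul; [exact: cont_cst|exact: cont_id].
- have mix s t : inI s -> inI t -> s <= 1/2 -> 1/2 <= t -> f s = f t -> s = t.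
    move=> sI tI s2 t2; rewrite fl // fr // !clamp_id ?I2 ?I3 // => E.
    have /AB /= Eb : (A `&` B) (g (2 * s)) by split => //; rewrite E.
    have : g (2 * s) = g 1 by rewrite Eb g1.
    move/(gi _ _ (I2 _ sI s2) inI1) => Hs.
    have : h (2 * t - 1) = h 0 by rewrite -E Eb h0.
    by move/(hi _ _ (I3 _ tI t2) inI0) => Ht; lra.
  move=> s t sI tI; case: (lerP s (1/2)) => s2; case: (lerP t (1/2)) => t2.
  + by rewrite !fl // !clamp_id ?I2 // => /(gi _ _ (I2 _ sI s2) (I2 _ tI t2)); lra.
  + by apply: mix => //; exact: ltW.
  + by move=> E; apply/esym; apply: (mix) => //; exact: ltW.
  + rewrite !fr ?ltW // !clamp_id ?I3 ?ltW //.
    by move/(hi _ _ (I3 _ sI (ltW s2)) (I3 _ tI (ltW t2))); lra.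
- rewrite (fl 0); last by lra.
  rewrite (fr 1); last by lra.
  have -> : 2 * 1 - 1 = 1 :> R by lra.
  by rewrite mulr0 !clamp_id ?inI0 ?inI1.
- by move=> t; case: (lerP t (1/2)) => t2; [left; rewrite fl|right; rewrite fr // ltW].
- move=> x [/Ag|/Bh] [t tI <-].
    exists (t / 2); first by move: tI; rewrite /inI; lra.
    rewrite fl; last by move: tI; rewrite /inI; lra.
    by rewrite (_ : 2 * _ = t) ?clamp_id //; lra.
  exists ((t + 1) / 2); first by move: tI; rewrite /inI; lra.
  rewrite fr; last by move: tI; rewrite /inI; lra.
  by rewrite (_ : 2 * _ - 1 = t) ?clamp_id //; lra.
Qed.

(** The parameter is the supremum of those with value in [F]. Cutting a curve there leaves a tail
    that does not return to [F]; all shortcuts and cuts of curves below are made in this way. *)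
Lemma last_hit (g : R -> P) (F : set P) : continuous g -> closed F -> F (g 0) ->
  exists t, [/\ inI t, F (g t) & forall s, t < s -> s <= 1 -> ~ F (g s)].
Proof.
move=> cg cF F0; pose K := [set t | inI t /\ F (g t)].
have K0 : K 0 by split => //; exact: inI0.
have hK : has_sup K.
  by split; [exists 0|exists 1 => t [/andP[_ t1] _]].
have Kle t : K t -> t <= sup K by move=> Kt; apply: sup_upper_bound.
have s0 : 0 <= sup K by exact: Kle.
have s1 : sup K <= 1 by apply: ge_sup; [exists 0|move=> t [/andP[_ t1] _]].
exists (sup K); split; first by rewrite /inI s0 s1.
  apply: contrapT => nF.
  have oF : open (g @^-1` (~` F)) by apply: open_comp => //; exact: closed_openC.
  have : nbhs (sup K) (g @^-1` (~` F)) by apply: open_nbhs_nbhs; split.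
  move/nbhs_normP => [e /= e0 He].
  have [t Kt /= et] := sup_adherent e0 hK.
  have := He t; case: (Kt) => _ Ft /=; apply => //.
  by rewrite ger0_norm ?subr_ge0 ?Kle // ltrBlDr -ltrBlDl.
move=> s ts s1' Fs; have : K s by split => //; rewrite /inI; lra.
by move/Kle; lra.
Qed.

Definition seg (a b : P) : set P := [set x | exists2 t, inI t & x = a + t *: (b - a)].

Lemma seg_arc a b : a != b -> arc a b (seg a b).
Proof.
move=> ab; exists (fun t => a + clamp t *: (b - a)); split.
- apply: cont_addv; first exact: cont_cstv.
  by apply: cont_scalev; [exact: clamp_cont|exact: cont_cstv].
- move=> s t sI tI; rewrite !clamp_id // => /addrI /eqP.
  rewrite -subr_eq0 -scalerBl scaler_eq0 !subr_eq0 => /orP[/eqP //|/eqP E].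
  by rewrite E eqxx in ab.
- by rewrite !clamp_id ?inI0 ?inI1 // scale0r addr0 scale1r addrC subrK.
- by move=> t; exists (clamp t) => //; exact: clampI.
- by move=> x [t tI ->]; exists t => //; rewrite clamp_id.
Qed.

Lemma seg_l a b : seg a b a.
Proof. by exists 0; [exact: inI0|rewrite scale0r addr0]. Qed.

Lemma seg_r a b : seg a b b.
Proof. by exists 1; [exact: inI1|rewrite scale1r addrC subrK]. Qed.

Lemma seg_sym a b : seg a b = seg b a.
Proof.
have H c d : seg c d `<=` seg d c.
  move=> x [t tI ->]; exists (1 - t); first by move: tI; rewrite /inI; lra.
  by apply: pext; rewrite !pE; ring.
by apply/seteqP; split; exact: H.
Qed.

(* Openness of a horizontal reparametrisation needs no explicit inverse: the
   intermediate value theorem is applied on each horizontal line. *)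
Lemma mono_open (g : P -> R) (O : set P) : continuous g -> open O ->
  (forall x x' y, O (x, y) -> O (x', y) -> x < x' -> g (x, y) < g (x', y)) ->
  forall U, open U -> U `<=` O -> open ((fun q => (g q, q.2)) @` U).
Proof.
move=> cg oO gm U oU UO; apply/open_plane => _ [xy Uxy <-] /=.
have [x [y xyE]] : exists x y : R, xy = (x, y) by case: xy {Uxy} => a b; exists a, b.
rewrite xyE /= in Uxy *.
have [d d0 dU] := (open_plane _).1 oU _ Uxy.
pose h := d / 2; have h0 : 0 < h by rewrite /h; lra.
have Uin x' y' : `|x - x'| <= h -> `|y - y'| < d -> U (x', y').
  by move=> H1 H2; apply: dU; rewrite pnorm_lt /= H2 andbT (le_lt_trans H1) // /h; lra.
have yy : `|y - y| < d by rewrite subrr normr0.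
have lo : g (x - h, y) < g (x, y).
  apply: gm; [apply: UO; apply: Uin => //| exact: UO | by lra].
  by rewrite ler_norml; lra.
have hi : g (x, y) < g (x + h, y).
  apply: gm; [exact: UO | apply: UO; apply: Uin => // | by lra].
  by rewrite ler_norml; lra.
pose e : R := Num.min (g (x, y) - g (x - h, y)) (g (x + h, y) - g (x, y)) / 2.
have e0 : 0 < e by rewrite /e divr_gt0 // lt_min; apply/andP; split; lra.
have near_y z : exists2 k : R, 0 < k & forall y', `|y - y'| < k -> `|g (z, y) - g (z, y')| < e.
  have : nbhs (g (z, y)) [set r | `|g (z, y) - r| < e] by apply/nbhs_real; exists e.
  move/(cg (z, y)) => /nbhs_plane[k k0 kH]; exists k => // y' yk.
  by apply: kH; rewrite pnorm_lt /= subrr normr0 k0.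
have [k1 k10 H1] := near_y (x - h); have [k2 k20 H2] := near_y (x + h).
have emin : e * 2 = Num.min (g (x, y) - g (x - h, y)) (g (x + h, y) - g (x, y)).
  by rewrite /e divfK.
have el : e * 2 <= g (x, y) - g (x - h, y) by rewrite emin ge_min lexx.
have er : e * 2 <= g (x + h, y) - g (x, y) by rewrite emin ge_min lexx orbT.
exists (Num.min e (Num.min d (Num.min k1 k2))); first by rewrite !lt_min e0 d0 k10 k20.
move=> [v y']; rewrite pnorm_lt /= !lt_min => /andP[/andP[ve _] /and4P[_ yd yk1 yk2]].
have A1 := H1 _ yk1; have A2 := H2 _ yk2.
have [c cI cv] : exists2 c, c \in `[x - h, x + h]%R & g (c, y') = v.
  apply: (@IVT _ (fun c => g (c, y'))); first by lra.
    apply: continuous_subspaceT.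
    apply: (@cont_comp _ _ _ (fun c : R => (c, y')) g) => //.
    by apply: cont_pair; [exact: cont_id|exact: cont_cst].
  rewrite ge_min le_max; move: ve A1 A2; rewrite !ltr_norml => /andP[v1 v2] /andP[a1 a2] /andP[b1 b2].
  by apply/andP; split; apply/orP; [left|right]; lra.
exists (c, y') => /=; last by rewrite cv.
apply: Uin => //; move: cI; rewrite in_itv /= ler_norml => /andP[c1 c2]; lra.
Qed.

End PlaneTopology.

(** * Drawings *)

Section PlaneDrawings.
Variable R : realType.
Local Notation P := (R * R)%type.

Lemma cont_inv (T : topologicalType) (f : T -> R) : continuous f -> (forall t, f t != 0) ->
  continuous (fun t => (f t)^-1).
Proof. by move=> cf f0 t; apply: cvgV => //; exact: cf. Qed.

(** A homeomorphism of the line onto the open interval from -e to e that fixes 0. Applied to both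
    coordinates, it confines a chart to a given neighbourhood of a crossing and respects the
    axes. *)
Definition squeeze (e r : R) : R := e * (r / (1 + `|r|)).

Lemma squeeze_cont e : continuous (squeeze e).
Proof.
apply: cont_mul; first exact: cont_cst.
apply: cont_mul; first exact: cont_id.
apply: cont_inv.
  by apply: cont_add; [exact: cont_cst|apply: cont_abs; exact: cont_id].
by move=> t; have := normr_ge0 t; lra.
Qed.

Lemma squeeze_mono e x y : 0 < e -> x < y -> squeeze e x < squeeze e y.
Proof.
move=> e0 xy; rewrite /squeeze ltr_pM2l //.
have px : 0 < 1 + `|x| by have := normr_ge0 x; lra.
have py : 0 < 1 + `|y| by have := normr_ge0 y; lra.
rewrite ltr_pdivrMr // mulrAC ltr_pdivlMr //.
case: (lerP 0 x) => x0.
  by rewrite !ger0_norm; nra.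
case: (lerP 0 y) => y0; first by rewrite (ger0_norm y0) (ltr0_norm x0); nra.
by rewrite (ltr0_norm y0) (ltr0_norm x0); nra.
Qed.

Lemma squeeze_lt e r : 0 < e -> `|squeeze e r| < e.
Proof.
move=> e0; rewrite /squeeze normrM normrM normfV (gtr0_norm e0).
have p : 0 < 1 + `|r| by have := normr_ge0 r; lra.
rewrite (gtr0_norm p) gtr_pMr // ltr_pdivrMr // mul1r; lra.
Qed.

Lemma squeeze_eq0 e r : 0 < e -> squeeze e r = 0 -> r = 0.
Proof.
move=> e0 /eqP; rewrite /squeeze mulf_eq0 gt_eqF //= mulf_eq0 invr_eq0 => /orP[/eqP //|].
by rewrite gt_eqF //; have := normr_ge0 r; lra.
Qed.

Lemma swap_open (U : set P) : open U -> open ((fun q : P => (q.2, q.1)) @` U).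
Proof.
move=> oU; have -> : (fun q : P => (q.2, q.1)) @` U = (fun q : P => (q.2, q.1)) @^-1` U.
  apply/seteqP; split=> [_ [[x y] Uxy <-] //|[x y] /= Uyx].
  by exists (y, x).
apply: open_comp => // q _; apply: cont_pair.
  by apply: cont_snd; exact: cont_id.
by apply: cont_fst; exact: cont_id.
Qed.

Lemma squeeze2_open e (U : set P) : 0 < e -> open U ->
  open ((fun q : P => (squeeze e q.1, squeeze e q.2)) @` U).
Proof.
move=> e0 oU.
have mo (W : set P) : open W -> open ((fun q : P => (squeeze e q.1, q.2)) @` W).
  move=> oW; apply: (@mono_open R (fun q => squeeze e q.1) setT) => //.
  - apply: (@cont_comp _ _ _ (fun q : P => q.1) (squeeze e)); last exact: squeeze_cont.
    by apply: cont_fst; exact: cont_id.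
  - exact: openT.
  - by move=> x x' y _ _ /= xx; exact: squeeze_mono.
have := swap_open (mo _ (swap_open (mo _ oU))).
congr open; apply/seteqP; split.
  by move=> _ [_ [_ [_ [q Uq <-] <-] <-] <-] /=; exists q.
move=> _ [q Uq <-]; exists (squeeze e q.2, squeeze e q.1) => //.
exists (q.2, squeeze e q.1) => //; exists (squeeze e q.1, q.2) => //.
by exists q.
Qed.

Lemma transversal_shrink (p : P) (A B W : set P) : open W -> W p ->
  transversal_at (R := R) p A B ->
  exists phi : P -> P,
    [/\ continuous phi, injective phi, (forall U : set P, open U -> open (phi @` U)),
        phi (0, 0) = p & [/\ forall q, W (phi q),
          forall q, A (phi q) <-> q.2 = 0 & forall q, B (phi q) <-> q.1 = 0]].
Proof.
move=> oW Wp [phi [cphi iphi ophi phi0 [phA phB]]].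
have oV : open (phi @^-1` W) by apply: open_comp => // q _; exact: cphi.
have V0 : (phi @^-1` W) (0, 0) by rewrite /preimage /= phi0.
have [e e0 eV] := (open_plane _).1 oV _ V0.
pose s (q : P) : P := (squeeze e q.1, squeeze e q.2).
have cs : continuous s.
  apply: cont_pair.
    apply: (@cont_comp _ _ _ (fun q : P => q.1) (squeeze e)); last exact: squeeze_cont.
    by apply: cont_fst; exact: cont_id.
  apply: (@cont_comp _ _ _ (fun q : P => q.2) (squeeze e)); last exact: squeeze_cont.
  by apply: cont_snd; exact: cont_id.
have sqi x y : squeeze e x = squeeze e y -> x = y.
  case: (ltgtP x y) => // xy E; have := squeeze_mono e0 xy; rewrite E ltxx //.
have sq0 : squeeze e 0 = 0 by rewrite /squeeze mul0r mulr0.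
exists (phi \o s); split.
- by move=> q; apply: (continuous_comp (cs q)); exact: cphi.
- by move=> [x y] [x' y'] /iphi [] /sqi -> /sqi ->.
- move=> U oU; rewrite -image_comp; apply: ophi; exact: squeeze2_open.
- by rewrite /= /s /= sq0.
- split=> q.
  + apply: eV; rewrite pnorm_lt /= !sub0r !normrN.
    by rewrite !squeeze_lt.
  + rewrite -[A _]/((phi @^-1` A) (s q)) phA /=; split=> [/squeeze_eq0 -> //|->].
    by [].
  + rewrite -[B _]/((phi @^-1` B) (s q)) phB /=; split=> [/squeeze_eq0 -> //|->].
    by [].
Qed.

(** A chart shrunk into [O] may be composed with [psi], which needs to be a homeomorphism onto its
    image only there. *)
Lemma transversal_transport (psi : P -> P) (O : set P) (p : P) (A B A' B' : set P) :
  open O -> O p -> (forall x, O x -> {for x, continuous psi}) ->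
  (forall x y, O x -> O y -> psi x = psi y -> x = y) ->
  (forall U, open U -> U `<=` O -> open (psi @` U)) ->
  (forall x, O x -> A' (psi x) <-> A x) -> (forall x, O x -> B' (psi x) <-> B x) ->
  transversal_at (R := R) p A B -> transversal_at (R := R) (psi p) A' B'.
Proof.
move=> oO Op cpsi ipsi opsi AA BB /(transversal_shrink oO Op).
move=> [phi [cphi iphi ophi phi0 [phO phA phB]]].
exists (psi \o phi); split.
- by move=> q; apply: (continuous_comp (cphi q)); exact: cpsi.
- by move=> x y /= E; apply: iphi; exact: ipsi.
- move=> U oU; rewrite -image_comp; apply: opsi; first exact: ophi.
  by move=> _ [q _ <-].
- by rewrite /= phi0.
- by split; apply/seteqP; split=> q /=; rewrite ?AA ?BB ?phA ?phB.
Qed.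

Lemma transversal_local (W : set P) (p : P) (A B A' B' : set P) : open W -> W p ->
  (forall x, W x -> A' x <-> A x) -> (forall x, W x -> B' x <-> B x) ->
  transversal_at (R := R) p A B -> transversal_at (R := R) p A' B'.
Proof.
move=> oW Wp AA BB; apply: (@transversal_transport id W) => //.
  by move=> x _; exact: cvg_id.
by move=> U oU _; rewrite image_id.
Qed.

(* Only the vertices in Va and the edges in Ea are drawn, and only pairs of edges
   related by X may cross. *)
Record pdraw (V E : finType) (Va : {set V}) (Ea : {set E}) (src dst : E -> V)
    (X : E -> E -> Prop) (pos : V -> P) (cv : E -> set P) : Prop := PDraw {
  pd_inj : {in Va &, injective pos};
  pd_ends : forall e, e \in Ea -> src e \in Va /\ dst e \in Va;
  pd_arc : forall e, e \in Ea -> arc (pos (src e)) (pos (dst e)) (cv e);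
  pd_avoid : forall e w, e \in Ea -> w \in Va -> cv e (pos w) -> w = src e \/ w = dst e;
  pd_cross : forall e f p, e \in Ea -> f \in Ea -> e != f -> cv e p -> cv f p ->
    (forall w, w \in Va -> pos w <> p) -> X e f /\ transversal_at (R := R) p (cv e) (cv f);
  pd_one : forall e f g p q, e \in Ea -> f \in Ea -> g \in Ea -> e != f -> e != g ->
    cv e p -> cv f p -> cv e q -> cv g q ->
    (forall w, w \in Va -> pos w <> p) -> (forall w, w \in Va -> pos w <> q) ->
    f = g /\ p = q }.

Definition drawable (V E : finType) (Va : {set V}) (Ea : {set E}) (src dst : E -> V)
    (X : E -> E -> Prop) := exists pos cv, pdraw Va Ea src dst X pos cv.

Section Basics.
Variables (V E : finType) (Va : {set V}) (Ea : {set E}) (src dst : E -> V).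
Variables (X : E -> E -> Prop) (pos : V -> P) (cv : E -> set P).
Hypothesis D : pdraw Va Ea src dst X pos cv.

Lemma pd_neq e : e \in Ea -> src e != dst e.
Proof.
move=> eE; have [_ _ A] := arc_ends (pd_arc D eE).
by apply: contraNN A => /eqP ->.
Qed.

(** The map [psi] is a homeomorphism on [O] and may collapse the complement of [O]. A curve survives
    because it has at most one point in the complement, and that point is one of its ends; crossings
    lie in [O]. The map [r] renames the vertices that become identified. *)
Lemma pdraw_transport (psi : P -> P) (O : set P) (Va' : {set V}) (Ea' : {set E})
    (r : V -> V) :
  Va' \subset Va -> Ea' \subset Ea -> open O ->
  (forall x y, O x -> O y -> psi x = psi y -> x = y) ->
  (forall U, open U -> U `<=` O -> open (psi @` U)) ->
  (forall e x, e \in Ea' -> cv e x -> {for x, continuous psi}) ->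
  (forall x, O x -> {for x, continuous psi}) ->
  (forall x y, O x -> ~ O y -> psi x <> psi y) ->
  (forall e x, e \in Ea' -> cv e x -> ~ O x ->
     pos (src e) = x \/ pos (dst e) = x) ->
  (forall e x y, e \in Ea' -> cv e x -> cv e y -> ~ O x -> ~ O y -> x = y) ->
  {in Va', forall w, r w = w} ->
  (forall e, e \in Ea' -> [/\ r (src e) \in Va', r (dst e) \in Va',
     psi (pos (r (src e))) = psi (pos (src e)) & psi (pos (r (dst e))) = psi (pos (dst e))]) ->
  {in Va' &, forall w w', psi (pos w) = psi (pos w') -> w = w'} ->
  pdraw Va' Ea' (r \o src) (r \o dst) X (psi \o pos) (fun e => psi @` cv e).
Proof.
move=> sV sE oO ipsi opsi cpsi cpsi' dpsi onO uniqO rid rends injV.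
have inj_on_cv e x y : e \in Ea' -> cv e x -> cv e y -> psi x = psi y -> x = y.
  move=> eE cx cy; case: (pselect (O x)) => Ox; case: (pselect (O y)) => Oy.
  - exact: ipsi.
  - by move/(dpsi _ _ Ox Oy).
  - by move/esym/(dpsi _ _ Oy Ox).
  - by move=> _; exact: (uniqO e).
have sub e : e \in Ea' -> e \in Ea by exact: (fintype.subsetP sE).
have subV w : w \in Va' -> w \in Va by exact: (fintype.subsetP sV).
have notO e x : e \in Ea' -> cv e x -> ~ O x -> exists2 w, w \in Va' & psi (pos w) = psi x.
  move=> eE cx Ox; have [rs rd prs prd] := rends e eE.
  by case: (onO e x eE cx Ox) => <-; [exists (r (src e))|exists (r (dst e))].
have crossO e f q : e \in Ea' -> f \in Ea' -> e != f -> (psi @` cv e) q -> (psi @` cv f) q ->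
    (forall w, w \in Va' -> psi (pos w) <> q) ->
    exists x, [/\ O x, psi x = q, cv e x, cv f x & forall w, w \in Va -> pos w <> x].
  move=> eE fE ef [x cx <-] [y cy yx] nv.
  have Ox : O x.
    by apply: contrapT => /(notO _ _ eE cx)[w wV]; exact: nv.
  have Oy : O y.
    by apply: contrapT => /(notO _ _ fE cy)[w wV]; rewrite yx; exact: nv.
  have xy : y = x by exact: ipsi.
  exists x; split => //; first by rewrite -xy.
  move=> w wV wx; have ce : cv e (pos w) by rewrite wx.
  have [rs rd prs prd] := rends e eE.
  case: (pd_avoid D (sub _ eE) wV ce) => ww.
    by apply: (nv _ rs); rewrite prs -ww wx.
  by apply: (nv _ rd); rewrite prd -ww wx.
have cvO e x : e \in Ea' -> O x -> (psi @` cv e) (psi x) <-> cv e x.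
  move=> eE Ox; split=> [[y cy yx]|cx]; last by exists x.
  case: (pselect (O y)) => Oy; first by rewrite -(ipsi _ _ Oy Ox yx).
  by case: (dpsi _ _ Ox Oy).
split.
- by move=> w w' wV w'V /=; exact: injV.
- by move=> e eE; have [] := rends e eE.
- move=> e eE /=; have [_ _ -> ->] := rends e eE.
  apply: arc_image; last exact: (pd_arc D (sub _ eE)).
    by move=> x cx; exact: (cpsi e).
  by move=> x y; exact: (inj_on_cv e).
- move=> e w eE wV [x cx /= xw].
  have [rs rd prs prd] := rends e eE.
  have fin v : v = src e \/ v = dst e -> pos v = x -> w = r (src e) \/ w = r (dst e).
    case=> -> vx; [left|right]; apply: injV => //; first by rewrite prs vx xw.
    by rewrite prd vx xw.
  case: (pselect (O x)) => Ox.
    case: (pselect (O (pos w))) => Ow; last by case: (dpsi _ _ Ox Ow).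
    have xE : pos w = x by rewrite (ipsi _ _ Ox Ow xw).
    apply: (fin w) => //; apply: (pd_avoid D (sub _ eE) (subV _ wV)).
    by rewrite xE.
  by case: (onO e x eE cx Ox) => vx; [apply: (fin (src e))|apply: (fin (dst e))] => //; [left|right].
- move=> e f q eE fE ef ce cf nv.
  have [x [Ox xq cx cx' nvx]] := crossO e f q eE fE ef ce cf nv.
  have [Xef tr] := pd_cross D (sub _ eE) (sub _ fE) ef cx cx' nvx.
  split => //; rewrite -xq.
  apply: (@transversal_transport psi O x (cv e) (cv f)) => //.
    by move=> y Oy; exact: cvO.
  by move=> y Oy; exact: cvO.
- move=> e f g p q eE fE gE ef eg cep cfp ceq cgq nvp nvq.
  have [x [Ox xp cx cx' nvx]] := crossO e f p eE fE ef cep cfp nvp.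
  have [y [Oy yq cy cy' nvy]] := crossO e g q eE gE eg ceq cgq nvq.
  have [-> xy] := pd_one D (sub _ eE) (sub _ fE) (sub _ gE) ef eg cx cx' cy cy' nvx nvy.
  by split => //; rewrite -xp -yq xy.
Qed.

Lemma pdraw_relabel (V' E' : finType) (Va' : {set V'}) (Ea' : {set E'}) (src' dst' : E' -> V')
    (X' : E' -> E' -> Prop) (s : V' -> V) (i : E' -> E) :
  {in Va' &, injective s} -> {in Ea' &, injective i} ->
  (forall w, w \in Va' -> s w \in Va) -> (forall e, e \in Ea' -> i e \in Ea) ->
  (forall e, e \in Ea' -> [/\ src' e \in Va', dst' e \in Va' &
     (s (src' e) = src (i e) /\ s (dst' e) = dst (i e)) \/
     (s (src' e) = dst (i e) /\ s (dst' e) = src (i e))]) ->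
  (forall e f, e \in Ea' -> f \in Ea' -> e != f -> X (i e) (i f) -> X' e f) ->
  pdraw Va' Ea' src' dst' X' (pos \o s) (cv \o i).
Proof.
move=> si ii sV iE ends XX.
have nv e q : e \in Ea' -> cv (i e) q -> (forall w, w \in Va' -> pos (s w) <> q) ->
    forall w, w \in Va -> pos w <> q.
  move=> eE ce nv w wV wq; have [sE dE H] := ends e eE.
  have ce' : cv (i e) (pos w) by rewrite wq.
  have := nv _ sE; have := nv _ dE.
  by case: (pd_avoid D (iE _ eE) wV ce') => ww; case: H => -[h1 h2]; rewrite h1 h2 -ww wq.
have ine e f : e \in Ea' -> f \in Ea' -> e != f -> i e != i f.
  by move=> eE fE; apply: contraNN => /eqP /ii -> //.
split.
- by move=> w w' wV w'V /= /(pd_inj D (sV _ wV) (sV _ w'V)); exact: si.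
- by move=> e /ends[].
- move=> e eE /=; have [_ _] := ends e eE; have A := pd_arc D (iE _ eE).
  by case=> -[-> ->] //; exact: arc_rev.
- move=> e w eE wV /= ce; have [sE dE H] := ends e eE.
  case: (pd_avoid D (iE _ eE) (sV _ wV) ce) => ww; case: H => -[h1 h2].
  + by left; apply: si => //; rewrite h1.
  + by right; apply: si => //; rewrite h2.
  + by right; apply: si => //; rewrite h2.
  + by left; apply: si => //; rewrite h1.
- move=> e f q eE fE ef ce cf nvq.
  have [Xef tr] := pd_cross D (iE _ eE) (iE _ fE) (ine _ _ eE fE ef) ce cf (nv _ _ eE ce nvq).
  by split => //; exact: XX.
- move=> e f g p q eE fE gE ef eg cep cfp ceq cgq nvp nvq.
  have [fg pq] := pd_one D (iE _ eE) (iE _ fE) (iE _ gE) (ine _ _ eE fE ef) (ine _ _ eE gE eg)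
    cep cfp ceq cgq (nv _ _ eE cep nvp) (nv _ _ eE ceq nvq).
  by split => //; exact: ii.
Qed.

End Basics.

Lemma pos_fin (I : finType) (Q : I -> R -> Prop) :
  (forall i, exists2 r, 0 < r & forall r', 0 < r' -> r' <= r -> Q i r') ->
  exists2 r, 0 < r & forall i r', 0 < r' -> r' <= r -> Q i r'.
Proof.
move=> H.
suff [r r0 rH] : exists2 r, 0 < r & forall i r', i \in enum I -> 0 < r' -> r' <= r -> Q i r'.
  by exists r => // i r'; apply: rH; rewrite mem_enum.
elim: (enum I) => [|i s [r r0 IH]]; first by exists 1 => //; exact: ltr01.
have [r1 r10 H1] := H i; exists (Num.min r r1); first by rewrite lt_min r0.
move=> j r'; rewrite inE => /orP[/eqP ->|js] r'0; rewrite le_min => /andP[a b].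
  exact: H1.
exact: IH.
Qed.

(** Keep the part [A] of the curve after its last visit to the disc of radius [r'] around [b]: it
    starts on the circle and stays outside from then on. The set [Xs] contains the crossing of the
    edge, if there is one. For small [r'] the part [A] retains this crossing and all points at
    distance at least [r0], and around each of its points other than the first it agrees with
    [C]. *)
Lemma radial_edge (b c : P) (C Xs : set P) (r0 : R) : 0 < r0 -> arc b c C -> Xs `<=` C -> ~ Xs b ->
  (forall x y, Xs x -> Xs y -> x = y) ->
  exists2 r : R, 0 < r & forall r', 0 < r' -> r' <= r -> exists (rr : P) (A : set P),
    [/\ `|b - rr| = r', arc rr c A /\ A `<=` C, forall x, A x -> `|b - x| <= r' -> x = rr,
        forall x, Xs x -> A x /\ r' < `|b - x| &
        (forall x, C x -> r0 <= `|b - x| -> A x) /\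
        forall x, A x -> x <> rr -> exists W : set P, [/\ open W, W x &
          forall y, W y -> C y <-> A y]].
Proof.
move=> rp0 [g [cg gi [g0 g1] gC Cg]] XsC Xsb Xs1.
have [kk kk0 kkH] : exists2 k : R, 0 < k & forall t, 0 <= t -> t < k -> `|b - g t| < r0.
  have : nbhs (g 0) [set x | `|b - x| < r0] by rewrite g0; apply/nbhs_plane; exists r0.
  move/(cg 0) => /nbhs_real[k k0 kH]; exists k => // t t0 tk.
  by apply: kH; rewrite sub0r normrN ger0_norm.
(* Before the parameter [d] the curve stays within [r0] of [b] and has not reached its crossing. The
   radius will be so small that the last visit to the disc happens before [d]. *)
have [d [d0 d1 dk dX]] : exists d : R, [/\ 0 < d, d < 1, d < kk & forall x, Xs x -> exists2 t, d <= t <= 1 & g t = x].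
  suff [d [d0 d1 dX]] : exists d : R, [/\ 0 < d, d < 1 & forall x, Xs x -> exists2 t, d <= t <= 1 & g t = x].
    exists (Num.min d (kk / 2)); split.
    - by rewrite lt_min; apply/andP; split; lra.
    - by rewrite gt_min d1.
    - by rewrite gt_min; apply/orP; right; lra.
    - move=> x /dX[t /andP[dt t1] tx]; exists t => //; rewrite t1 andbT.
      by rewrite ge_min dt.
  case: (pselect (exists x, Xs x)) => [[x Xx]|nX]; last first.
    exists (1/2); split; [by lra|by lra|] => x Xx; by case: nX; exists x.
  have [t /andP[t0 t1] tx] := Cg _ (XsC _ Xx).
  have tp : 0 < t.
    rewrite lt_neqAle t0 andbT eq_sym; apply/eqP => t00.
    by apply: Xsb; rewrite -g0 -t00 tx.
  exists (t / 2); split; [by lra|by lra|] => y /(Xs1 _ _ Xx) <-; exists t => //; lra.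
have K1 := arc_sub cg gi (ltW d0) d1 (lexx 1).
have nb : ~ [set x | exists2 r, d <= r <= 1 & g r = x] b.
  move=> [r /andP[dr r1]]; rewrite -g0 => E.
  have rI : inI r by rewrite /inI; lra.
  by have := gi _ _ rI (inI0 R) E; lra.
have [e e0 eH] := closed_away (arc_closed K1) nb.
exists (e / 2); first by lra.
move=> r rpos re.
have F0 : cball b r (g 0) by rewrite /cball /= g0 subrr normr0 ltW.
have [t [tI Ft Ht]] := last_hit cg (@cball_closed R b r) F0.
have td : t < d.
  rewrite ltNge; apply/negP => dt.
  have : e <= `|b - g t| by apply: eH; exists t => //; move: tI; rewrite /inI; lra.
  by move: Ft; rewrite /cball /=; lra.
have norm_t : `|b - g t| = r.
  apply/eqP; rewrite eq_le Ft /= leNgt; apply/negP => lt.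
  have oU : open [set x : P | `|b - x| < r].
    apply/open_plane => x /= xr; exists (r - `|b - x|); first by lra.
    move=> y xy; have := ler_normD (b - x) (x - y).
    by rewrite addrA subrK; lra.
  have : nbhs t (g @^-1` [set x : P | `|b - x| < r]).
    by apply: open_nbhs_nbhs; split => //; apply: open_comp => // s _; exact: cg.
  move/nbhs_real => [k k0 kH].
  pose s := t + Num.min (k / 2) ((1 - t) / 2).
  have mp : 0 < Num.min (k / 2) ((1 - t) / 2) by rewrite lt_min; apply/andP; split; lra.
  have mk : Num.min (k / 2) ((1 - t) / 2) <= k / 2 by rewrite ge_min lexx.
  have mt : Num.min (k / 2) ((1 - t) / 2) <= (1 - t) / 2 by rewrite ge_min lexx orbT.
  have /kH : `|t - s| < k.
    by rewrite /s opprD addrA subrr sub0r normrN gtr0_norm //; lra.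
  rewrite /preimage /= => sr.
  by apply: (Ht s); rewrite /s /cball /= ?ltW //; lra.
have t0 : 0 < t.
  rewrite lt_neqAle; move: (tI) => /andP[-> _]; rewrite andbT.
  by apply/eqP => t00; move: norm_t; rewrite -t00 g0 subrr normr0; lra.
have A2 := arc_sub cg gi (ltW t0) (lt_trans td d1) (lexx 1).
have A1 := arc_sub cg gi (lexx 0) t0 (ltW (lt_trans td d1)).
rewrite g1 in A2.
exists (g t), [set x | exists2 r, t <= r <= 1 & g r = x]; split => //.
- by split => // _ [s _ <-].
- move=> _ [s /andP[ts s1] <-] sr; congr g; apply/eqP.
  rewrite eq_le ts andbT leNgt; apply/negP => {}ts; exact: (Ht s).
- move=> x /[dup] Xx /dX[s /andP[ds s1] sx]; split; first by exists s => //; lra.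
  have : e <= `|b - x| by apply: eH; exists s => //; apply/andP; split.
  by lra.
- split.
    move=> x /Cg[s /andP[s0 s1] <-] rs; exists s => //; rewrite s1 andbT leNgt.
    by apply/negP => st; have := kkH s s0; lra.
  move=> _ [s /andP[ts s1] <-] st.
  exists (~` [set x | exists2 r, 0 <= r <= t & g r = x]); split.
  + exact: closed_openC (arc_closed A1).
  + move=> [s' /andP[s0 s't]] E; apply: st; congr g.
    have : s' = s by apply: gi => //; rewrite /inI; move: tI; rewrite /inI; lra.
    by lra.
  + move=> y ny; split=> [/Cg[s' /andP[s0 s1'] E]|[s' _ <-]] //.
    exists s' => //; apply/andP; split => //; rewrite leNgt; apply/negP => s't.
    by apply: ny; exists s' => //; rewrite s0 ltW.
Qed.

End PlaneDrawings.

(** * Contracting edges *)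

Section Contraction.
Variable R : realType.
Local Notation P := (R * R)%type.

Lemma seg_norm (a b x : P) : seg a b x -> exists2 t, inI t & x = a + t *: (b - a) /\ `|a - x| = t * `|a - b|.
Proof.
move=> [t tI ->]; exists t => //; split => //.
rewrite opprD addrA subrr sub0r normrN normrZ distrC.
by move: tI => /andP[t0 _]; rewrite (ger0_norm t0).
Qed.

Lemma seg_sub (a b x : P) : seg a b x -> seg x b `<=` seg a b.
Proof.
move=> [t /andP[t0 t1] ->] _ [s /andP[s0 s1] ->]; exists (t + s * (1 - t)).
  by rewrite /inI; apply/andP; split; nra.
by apply: pext; rewrite !pE; ring.
Qed.

Lemma seg_subl (a b x : P) : seg a b x -> seg a x `<=` seg a b.
Proof. by rewrite (seg_sym a b) (seg_sym a x); exact: seg_sub. Qed.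

Lemma seg_anti (a b x : P) : a != b -> seg a b x -> seg x b a -> x = a.
Proof.
move=> ab [t /andP[t0 t1] xE] [s /andP[s0 s1] aE].
have : (t + s * (1 - t)) *: (b - a) = 0.
  have : (x + s *: (b - x)) - a = 0 by rewrite -aE subrr.
  by move=> <-; rewrite xE; apply: pext; rewrite !pE; ring.
move/eqP; rewrite scaler_eq0 subr_eq0 (eq_sym b) (negbTE ab) orbF => /eqP E.
have -> : x = a + t *: (b - a) by [].
have -> : t = 0 by nra.
by rewrite scale0r addr0.
Qed.

Lemma seg_refl (a : P) : seg a a = [set a].
Proof.
apply/seteqP; split=> [x [t _ ->]|x ->] /=; last exact: seg_l.
by rewrite subrr scaler0 addr0.
Qed.

Lemma seg_closed (a b : P) : closed (seg a b).
Proof.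
case: (eqVneq a b) => [->|ab]; last exact: (arc_closed (seg_arc ab)).
by rewrite seg_refl; apply: compact_closed; [exact: hausdorff_plane|exact: compact_set1].
Qed.

Lemma open_away (b : P) (r : R) : open [set x : P | r < `|b - x|].
Proof.
have -> : [set x : P | r < `|b - x|] = ~` cball b r.
  by apply/seteqP; split=> x /=; rewrite /cball /= ltNge => /negP.
exact: closed_openC (@cball_closed R b r).
Qed.

(** * Straightening the edges around a vertex *)

Section Radial.
Variables (V E : finType) (Va : {set V}) (Ea : {set E}) (src dst : E -> V).
Variables (X : E -> E -> Prop) (pos : V -> P) (cv : E -> set P).
Hypothesis D : pdraw Va Ea src dst X pos cv.
Variables (b : V) (r0 : R).
Hypotheses (bV : b \in Va) (r0p : 0 < r0).

Definition at_vert (e : E) := (src e == b) || (dst e == b).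
Definition other_end (e : E) := if src e == b then dst e else src e.

Lemma at_vert_arc e : e \in Ea -> at_vert e -> arc (pos b) (pos (other_end e)) (cv e).
Proof.
move=> eE; rewrite /at_vert /other_end; have A := pd_arc D eE.
by case: eqP => [<- //|_ /= /eqP <-]; exact: arc_rev.
Qed.

Lemma radial_open : exists (rho : R) (rr : E -> P) (A : E -> set P),
  [/\ 0 < rho /\ rho < r0,
      forall w, w \in Va -> w != b -> rho < `|pos b - pos w|,
      forall e x, e \in Ea -> ~~ at_vert e -> cv e x -> rho < `|pos b - x| &
      forall e, e \in Ea -> at_vert e ->
        [/\ `|pos b - rr e| = rho, arc (rr e) (pos (other_end e)) (A e) /\ A e `<=` cv e,
            forall x, A e x -> `|pos b - x| <= rho -> x = rr e,
            forall f x, f \in Ea -> e != f -> cv e x -> cv f x ->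
              (forall w, w \in Va -> pos w <> x) -> A e x /\ rho < `|pos b - x| &
            (forall x, cv e x -> r0 <= `|pos b - x| -> A e x) /\
            forall x, A e x -> x <> rr e -> exists W : set P, [/\ open W, W x &
              forall y, W y -> cv e y <-> A e y]]].
Proof.
have [r1 r10 H1] : exists2 r : R, 0 < r & forall (w : V) r', 0 < r' -> r' <= r ->
    w \in Va -> w != b -> r' < `|pos b - pos w|.
  apply: pos_fin => w; case: (boolP ((w \in Va) && (w != b))) => [/andP[wV wb]|nw]; last first.
    by exists 1 => [|r' _ _ wV wb]; [exact: ltr01|rewrite wV wb in nw].
  have p : 0 < `|pos b - pos w|.
    by rewrite normr_gt0 subr_eq0; apply: contraNN wb => /eqP /(pd_inj D bV wV) ->.
  by exists (`|pos b - pos w| / 2) => [|r' _ r'H _ _]; lra.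
pose Xs e : set P := [set x | cv e x /\ exists f, [/\ f \in Ea, e != f, cv f x &
  forall w, w \in Va -> pos w <> x]].
pose good e (q : P * set P) rho :=
        [/\ `|pos b - q.1| = rho, arc q.1 (pos (other_end e)) q.2 /\ q.2 `<=` cv e,
            forall x, q.2 x -> `|pos b - x| <= rho -> x = q.1,
            forall x, Xs e x -> q.2 x /\ rho < `|pos b - x| &
            (forall x, cv e x -> r0 <= `|pos b - x| -> q.2 x) /\
            forall x, q.2 x -> x <> q.1 -> exists W : set P, [/\ open W, W x &
              forall y, W y -> cv e y <-> q.2 y]].
have [r2 r20 H2] : exists2 r : R, 0 < r & forall (e : E) r', 0 < r' -> r' <= r ->
    e \in Ea -> (~~ at_vert e -> forall x, cv e x -> r' < `|pos b - x|) /\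
      (at_vert e -> exists q, good e q r').
  apply: pos_fin => e; case: (boolP (e \in Ea)) => eE; last first.
    by exists 1 => [|r' _ _ //]; exact: ltr01.
  case: (boolP (at_vert e)) => ae.
    have := @radial_edge R (pos b) _ _ (Xs e) r0 r0p (at_vert_arc eE ae).
    case.
    - by move=> x [].
    - by move=> [_ [f [_ _ _ /(_ b bV)]]].
    - move=> x y [cx [f [fE ef cfx nx]]] [cy [g [gE eg cgy ny]]].
      by have [] := pd_one D eE fE gE ef eg cx cfx cy cgy nx ny.
    - move=> r rp H; exists r => // r' r'p r'r _; split => // _.
      by have [rr [A HA]] := H r' r'p r'r; exists (rr, A).
  have nb : ~ cv e (pos b).
    by move=> /(pd_avoid D eE bV)[/esym bE|/esym bE]; move: ae; rewrite /at_vert bE eqxx ?orbT.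
  have [k k0 kH] := closed_away (arc_closed (pd_arc D eE)) nb.
  by exists (k / 2) => [|r' r'0 r'k _]; [lra|split => // _ x /kH; lra].
pose rho := Num.min (r0 / 2) (Num.min r1 r2).
have hr0 : 0 < r0 / 2 by rewrite divr_gt0.
have rho0 : 0 < rho by rewrite !lt_min r10 r20 hr0.
have rhor0 : rho < r0 by rewrite gt_min ltr_pdivrMr // ltr_pMr // ltr1n.
have rhor1 : rho <= r1 by rewrite !ge_min lexx !orbT.
have rhor2 : rho <= r2 by rewrite !ge_min lexx !orbT.
have /boolp.choice[q qH] : forall e, exists qe : P * set P, e \in Ea -> at_vert e -> good e qe rho.
  move=> e.
  case: (boolP ((e \in Ea) && at_vert e)) => [/andP[eE ae]|ne]; last first.
    by exists (0, set0) => eE ae; rewrite eE ae in ne.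
  by have [_ /(_ ae)[qe qeH]] := H2 e rho rho0 rhor2 eE; exists qe.
exists rho, (fun e => (q e).1), (fun e => (q e).2); split => //.
- by move=> w wV wb; exact: H1.
- by move=> e x eE ae cx; have [h _] := H2 e rho rho0 rhor2 eE; exact: h.
- move=> e eE ae; have [a1 a2 a3 a4 a5] := qH e eE ae; split => //.
  by move=> f x fE ef ce cf nx; apply: a4; split => //; exists f.
Qed.

(** A common starting point of two cut edges would be a crossing at distance [rho], but the
    crossings on these edges are farther away. *)
Lemma radial_distinct (rho : R) (rr : E -> P) (A : E -> set P) : 0 < rho ->
  (forall w, w \in Va -> w != b -> rho < `|pos b - pos w|) ->
  (forall e, e \in Ea -> at_vert e ->
        [/\ `|pos b - rr e| = rho, arc (rr e) (pos (other_end e)) (A e) /\ A e `<=` cv e &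
            forall f x, f \in Ea -> e != f -> cv e x -> cv f x ->
              (forall w, w \in Va -> pos w <> x) -> A e x /\ rho < `|pos b - x|]) ->
  forall e f, e \in Ea -> f \in Ea -> at_vert e -> at_vert f -> e != f -> rr e <> rr f.
Proof.
move=> rho0 H1 H2 e f eE fE ae af ef rE.
have [ne [arce Ae] crosse] := H2 e eE ae; have [nf [arcf Af] _] := H2 f fE af.
have [re _ _] := arc_ends arce; have [rf _ _] := arc_ends arcf.
have := crosse f (rr e) fE ef (Ae _ re); rewrite {1}rE => /(_ (Af _ rf)) [].
  move=> w wV wr; case: (eqVneq w b) => [wb|wb].
    by move: ne; rewrite -wr wb subrr normr0; lra.
  by have := H1 w wV wb; rewrite wr ne ltxx.
by rewrite ne ltxx.
Qed.

(** Each edge at [b] is replaced inside the disc by the segment from [b] to the point where it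
    leaves the disc for good. These points are distinct and have equal distance from [b], so the
    segments meet only in [b] and no crossing arises. *)
Lemma radial : exists (rho : R) (cv' : E -> set P),
  [/\ 0 < rho /\ rho < r0, pdraw Va Ea src dst X pos cv',
      (forall w, w \in Va -> w != b -> rho < `|pos b - pos w|) /\
      (forall e x, e \in Ea -> ~~ at_vert e -> cv' e x -> rho < `|pos b - x|),
      forall e, e \in Ea -> at_vert e -> exists2 r : P, `|pos b - r| = rho &
        forall x, `|pos b - x| <= rho -> cv' e x <-> seg (pos b) r x &
      forall e x, e \in Ea -> r0 <= `|pos b - x| -> cv' e x <-> cv e x].
Proof.
have [rho [rr [A [[rho0 rhor0] HV Hn Ha]]]] := radial_open.
have rdist : forall e f, e \in Ea -> f \in Ea -> at_vert e -> at_vert f -> e != f -> rr e <> rr f.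
  by apply: (@radial_distinct rho rr A) => // e eE ae; have [] := Ha e eE ae.
pose cv' e := if at_vert e then seg (pos b) (rr e) `|` A e else cv e.
have segle e x : e \in Ea -> at_vert e -> seg (pos b) (rr e) x -> `|pos b - x| <= rho.
  move=> eE ae /seg_norm[t /andP[t0 t1] [_ ->]]; have [-> _ _ _ _] := Ha e eE ae.
  by nra.
have in_ball e x : e \in Ea -> cv' e x -> `|pos b - x| <= rho ->
    at_vert e /\ seg (pos b) (rr e) x.
  rewrite /cv' => eE; case: ifPn => ae; last by move=> /(Hn _ _ eE ae); lra.
  have [_ _ Ar _ _] := Ha e eE ae.
  case=> // Ax xr; split => //; rewrite (Ar _ Ax xr); exact: seg_r.
have loc e x : e \in Ea -> cv' e x -> rho < `|pos b - x| -> cv e x /\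
    exists W : set P, [/\ open W, W x & forall y, W y -> cv' e y <-> cv e y].
  rewrite /cv' => eE; case: ifPn => ae; last first.
    by move=> cx _; split => //; exists setT; split => //; exact: openT.
  have [nr [arcA Ac] Ar _ [_ Al]] := Ha e eE ae.
  case=> [/(segle _ _ eE ae)|Ax rx]; first by lra.
  split; first exact: Ac.
  have xr : x <> rr e by move=> xr; move: rx; rewrite xr nr ltxx.
  have [W [oW Wx WH]] := Al _ Ax xr.
  exists (W `&` [set y | rho < `|pos b - y|]); split => //.
    by apply: openI => //; exact: open_away.
  move=> y [Wy ry]; rewrite (WH _ Wy); split=> [[/(segle _ _ eE ae)|//]|Ay]; last by right.
  by move=> yr; move: ry => /=; lra.
have cross e f p : e \in Ea -> f \in Ea -> e != f -> cv' e p -> cv' f p ->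
    (forall w, w \in Va -> pos w <> p) -> rho < `|pos b - p|.
  move=> eE fE ef ce cf nv; rewrite ltNge; apply/negP => pr.
  have [ae se] := in_ball _ _ eE ce pr; have [af sf] := in_ball _ _ fE cf pr.
  apply: (rdist e f eE fE ae af ef).
  have [ne _ _ _ _] := Ha e eE ae; have [nf _ _ _ _] := Ha f fE af.
  have [t tI [pE pt]] := seg_norm se; have [s sI [pE' ps]] := seg_norm sf.
  have ts : t = s by apply: (@mulIf _ rho); [lra|rewrite -{1}ne -nf -pt -ps].
  have t0 : t != 0.
    by apply/eqP => t0; apply: (nv b bV); rewrite pE t0 scale0r addr0.
  have : t *: (rr e - pos b) = t *: (rr f - pos b).
    by apply: (@addrI _ (pos b)); rewrite -pE ts -pE'.
  by move/(scalerI t0)/addIr.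
exists rho, cv'; split => //.
- split.
  + exact: (pd_inj D).
  + exact: (pd_ends D).
  + move=> e eE; rewrite /cv'; case: ifPn => ae; last exact: (pd_arc D).
    have [nr [arcA Ac] Ar _ _] := Ha e eE ae.
    have bA : arc (pos b) (pos (other_end e)) (seg (pos b) (rr e) `|` A e).
      apply: arc_cat arcA _; last by move=> x [/(segle _ _ eE ae) xr Ax]; exact: Ar.
      apply: seg_arc; apply/eqP => br; move: nr; rewrite br subrr normr0; lra.
    move: bA ae; rewrite /other_end /at_vert; case: eqP => [<- //|_ bA /= /eqP ->].
    exact: arc_rev.
  + move=> e w eE wV; case: (lerP `|pos b - pos w| rho) => wr ce.
      have [ae _] := in_ball _ _ eE ce wr.
      have wb : w = b by apply: contraTeq wr => wb; rewrite -ltNge; exact: HV.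
      by move: ae; rewrite /at_vert wb => /orP[/eqP ->|/eqP ->]; [left|right].
    by have [c _] := loc _ _ eE ce wr; apply: (pd_avoid D).
  + move=> e f p eE fE ef ce cf nv; have pr := cross _ _ _ eE fE ef ce cf nv.
    have [c1 [W1 [oW1 W1p W1H]]] := loc _ _ eE ce pr.
    have [c2 [W2 [oW2 W2p W2H]]] := loc _ _ fE cf pr.
    have [Xef tr] := pd_cross D eE fE ef c1 c2 nv; split => //.
    apply: (@transversal_local R (W1 `&` W2) p (cv e) (cv f)) => //.
    * exact: openI.
    * by move=> y [W1y _]; exact: W1H.
    * by move=> y [_ W2y]; exact: W2H.
  + move=> e f g p q eE fE gE ef eg cep cfp ceq cgq nvp nvq.
    have pr := cross _ _ _ eE fE ef cep cfp nvp; have qr := cross _ _ _ eE gE eg ceq cgq nvq.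
    apply: (pd_one D eE fE gE ef eg) => //.
    * by have [] := loc _ _ eE cep pr.
    * by have [] := loc _ _ fE cfp pr.
    * by have [] := loc _ _ eE ceq qr.
    * by have [] := loc _ _ gE cgq qr.
- by split => // e x eE ae; rewrite /cv' (negbTE ae); exact: Hn.
- move=> e eE ae; exists (rr e); first by have [] := Ha e eE ae.
  move=> x xr; split=> [/(in_ball _ _ eE)/(_ xr)[]//|sx].
  by rewrite /cv' ae; left.
- move=> e x eE xr; rewrite /cv'; case: ifPn => // ae.
  have [nr [arcA Ac] Ar _ [Af _]] := Ha e eE ae.
  split=> [[/(segle _ _ eE ae)|/Ac //]|cx]; first by lra.
  by right; exact: Af.
Qed.

End Radial.

(* Simple polygonal arcs ending at q whose interior lies in W. *)
Inductive spoly (W : set P) (q : P) : P -> set P -> Prop :=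
| spoly_seg p : p != q -> (forall x, seg p q x -> x <> p -> x <> q -> W x) ->
    spoly W q p (seg p q)
| spoly_cons p w Q : p != w -> (forall x, seg p w x -> x <> p -> W x) ->
    spoly W q w Q -> seg p w `&` Q `<=` [set w] -> spoly W q p (seg p w `|` Q).

Lemma spoly_closed W q p Q : spoly W q p Q -> closed Q.
Proof.
elim=> {p Q} [p _ _|p w Q _ _ _ cQ _]; first exact: seg_closed.
by apply: closedU => //; exact: seg_closed.
Qed.

Lemma spoly_ends W q p Q : ~ W q -> spoly W q p Q -> [/\ Q p, Q q & p != q].
Proof.
move=> nW; elim=> {p Q} [p pq _|p w Q pw sW _ [Qw Qq wq] I].
  by split; [exact: seg_l|exact: seg_r|].
split; [by left; exact: seg_l|by right|].
apply/eqP => pq; have : (seg p w `&` Q) p by split; [exact: seg_l|rewrite pq].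
by move/I => /= E; rewrite E eqxx in pw.
Qed.

Lemma spoly_trunc W q p Q x : ~ W q -> spoly W q p Q -> Q x -> x <> q ->
  exists2 Q', spoly W q x Q' & Q' `<=` Q.
Proof.
move=> nW; elim=> {p Q} [p pq sW|p w Q pw sW spQ IH I].
  move=> sx xq; exists (seg x q); last exact: seg_sub.
  constructor; first exact/eqP.
  move=> y sy yx yq; apply: sW => //; first exact: (seg_sub sx).
  move=> yp; apply: yx; rewrite yp; apply/esym; apply: (seg_anti pq sx).
  by rewrite -yp.
move=> Qx xq; case: (pselect (Q x)) => [/IH/(_ xq)[Q' sp' Q'Q]|nQ].
  by exists Q' => // y /Q'Q; right.
case: Qx => // sx; exists (seg x w `|` Q); last first.
  by move=> y [/(seg_sub sx)|]; [left|right].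
have [Qw _ _] := spoly_ends nW spQ.
constructor => //.
- by apply/eqP => xw; apply: nQ; rewrite xw.
- move=> y sy yx; apply: sW; first exact: (seg_sub sx).
  move=> yp; apply: yx; rewrite yp; apply/esym; apply: (seg_anti pw sx).
  by rewrite -yp.
- by move=> y [/(seg_sub sx) sy Qy]; apply: I.
Qed.

Lemma seg_param (a b : P) : continuous (fun t : R => a + t *: (b - a)).
Proof. by apply: cont_addv; [exact: cont_cstv|apply: cont_scalev; [exact: cont_id|exact: cont_cstv]]. Qed.

(** If the new segment meets [Q], it is stopped at the point of [Q] that is nearest to [p'] on it,
    and [Q] is truncated to begin there. *)
Lemma spoly_extend W q p p' Q : ~ W q -> spoly W q p Q -> p' <> q ->
  (forall y, seg p' p y -> y <> p' -> W y) -> exists Q', spoly W q p' Q'.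
Proof.
move=> nW spQ p'q sW; have [Qp Qq pq] := spoly_ends nW spQ.
have g0 : Q (p + 0 *: (p' - p)) by rewrite scale0r addr0.
have [t [tI Qt Ht]] := last_hit (@seg_param p p') (spoly_closed spQ) g0.
set x := p + t *: (p' - p) in Qt.
have sx : seg p' p x by rewrite seg_sym; exists t.
have xq : x <> q.
  move=> xq; case: (pselect (x = p')) => [xp|xp]; first by apply: p'q; rewrite -xp.
  by apply: nW; rewrite -xq; exact: sW.
have [Q' sp' Q'Q] := spoly_trunc nW spQ Qt xq.
case: (pselect (x = p')) => [xp|xp]; first by exists Q'; rewrite -xp.
exists (seg p' x `|` Q'); constructor => //.
- by apply/eqP => E; apply: xp.
- by move=> y sy; apply: sW; exact: (seg_subl sx).
- move=> y [sy /Q'Q Qy] /=.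
  have pp' : p' - p != 0.
    rewrite subr_eq0; apply/eqP => E; apply: xp.
    by rewrite /x E subrr scaler0 addr0.
  move: sy => [s /andP[s0 s1] yE].
  have yE' : y = p + (1 - s + s * t) *: (p' - p).
    by rewrite yE /x; apply: pext; rewrite !pE; ring.
  case: (lerP (1 - s + s * t) t) => st.
    move: tI => /andP[t0 t1].
    case: (eqVneq s 1) => [s1'|s1']; first by rewrite yE s1' scale1r addrC subrK.
    have t1' : t = 1.
      have : (1 - s) * (1 - t) <= 0 by nra.
      have sp : 0 < 1 - s by rewrite subr_gt0 lt_neqAle s1'.
      by nra.
    by case: xp; rewrite /x t1' scale1r addrC subrK.
  have : ~ Q (p + (1 - s + s * t) *: (p' - p)).
    by apply: Ht => //; move: tI => /andP[t0 t1]; nra.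
  by rewrite -yE'.
Qed.

(** Call a point of [W] good if such an arc starts at it. Inside a small square contained in [W] one
    segment can be prepended, so the good points and the other points of [W] both form open sets,
    and the connected set [C] lies in one of them. *)
Lemma spoly_connected (W C : set P) (q : P) : open W -> ~ W q -> connected C -> C `<=` W ->
  (exists x Q, C x /\ spoly W q x Q) -> forall x, C x -> exists Q, spoly W q x Q.
Proof.
move=> oW nW cC CW [x0 [Q0 [Cx0 sp0]]].
pose B := [set x | W x /\ exists Q, spoly W q x Q].
have step x y e : (forall y : P, `|x - y| < e -> W y) -> `|x - y| < e ->
    (B x <-> B y).
  move=> eW xy.
  have sub a c : (forall z, seg a c z -> `|x - z| < e) -> W a -> B c -> B a.
    move=> ac Wa [Wc [Q sp]]; split => //.
    apply: (spoly_extend nW sp); first by move=> aq; rewrite aq in Wa.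
    by move=> z sz _; apply: eW; exact: ac.
  have sxy z : seg x y z -> `|x - z| < e.
    move=> /seg_norm[t /andP[t0 t1] [_ ->]]; have := normr_ge0 (x - y); nra.
  have x0' : `|x - x| < e by rewrite subrr normr0; have := normr_ge0 (x - y); lra.
  split; apply: sub => //; try exact: eW.
  by move=> z; rewrite seg_sym; exact: sxy.
have oB : open B.
  apply/open_plane => x Bx; have [Wx _] := Bx.
  have [e e0 eW] := (open_plane _).1 oW x Wx; exists e => // y xy.
  by apply/(step x y e).
have oC : open (W `\` B).
  apply/open_plane => x [Wx nB]; have [e e0 eW] := (open_plane _).1 oW x Wx.
  exists e => // y xy; split; first exact: eW.
  by move=> By; apply: nB; apply/(step x y e).
have E : C `&` B = C.
  apply: cC; first by exists x0; split => //; split; [exact: CW|exists Q0].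
    by exists B.
  exists (~` (W `\` B)); first exact: open_closedC.
  apply/seteqP; split=> x [Cx H]; split => //; first by move=> [].
  by apply: contrapT => nB; apply: H; split => //; exact: CW.
by move=> x Cx; have [_ [_ H]] : (C `&` B) x by rewrite E.
Qed.

End Contraction.

(** * Collapsing a polygonal arc *)

Section ContractEdge.
Variable R : realType.
Local Notation P := (R * R)%type.

Lemma away_compact (g : R -> P) (F : set P) : continuous g -> closed F ->
  (forall t, inI t -> ~ F (g t)) ->
  exists2 e : R, 0 < e & forall t y, inI t -> F y -> e <= `|g t - y|.
Proof.
move=> cg cF gF.
pose K := [set t | inI t /\ exists2 e : R, 0 < e & forall s y, 0 <= s -> s <= t -> F y -> e <= `|g s - y|].
have step t : inI t -> exists2 k : R, 0 < k & exists2 e : R, 0 < e &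
    forall s y, `|t - s| < k -> F y -> e <= `|g s - y|.
  move=> tI; have [e e0 eH] := closed_away cF (gF t tI).
  have : nbhs (g t) [set x | `|g t - x| < e / 2] by apply/nbhs_plane; exists (e / 2) => //; lra.
  move/(cg t) => /nbhs_real[k k0 kH]; exists k => //; exists (e / 2); first by lra.
  move=> s y /kH /= sk /eH ty; have := ler_normD (g t - g s) (g s - y).
  by rewrite addrA subrK; lra.
have K0 : K 0.
  split; first exact: inI0.
  have [k k0 [e e0 eH]] := step 0 (inI0 R); exists e => // s y s0 s0' Fy.
  have s00 : s = 0 by apply/eqP; rewrite eq_le s0 s0'.
  by apply: eH => //; rewrite s00 subrr normr0.
have hK : has_sup K by split; [exists 0|exists 1 => t [/andP[_ t1] _]].
have Kle t : K t -> t <= sup K by move=> Kt; apply: sup_upper_bound.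
have s0 : 0 <= sup K by exact: Kle.
have s1 : sup K <= 1 by apply: ge_sup; [exists 0|move=> t [/andP[_ t1] _]].
have [k k0 [e e0 eH]] := step (sup K) (introT andP (conj s0 s1)).
have [t Kt tk] := sup_adherent k0 hK.
have [tI [e' e'0 e'H]] := Kt.
have KS s : inI s -> s < sup K + k -> K s.
  move=> sI sk; split => //; exists (Num.min e e'); first by rewrite lt_min e0 e'0.
  move=> r y r0 rs Fy; rewrite ge_min; case: (lerP r t) => rt.
    by rewrite e'H ?orbT.
  by rewrite eH // ltr_norml; have := Kle _ Kt; lra.
have top : sup K = 1.
  apply/eqP; rewrite eq_le s1 /= leNgt; apply/negP => lt1.
  pose s := sup K + Num.min (k / 2) (1 - sup K).
  have mp : 0 < Num.min (k / 2) (1 - sup K) by rewrite lt_min; apply/andP; split; lra.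
  have mk : Num.min (k / 2) (1 - sup K) <= k / 2 by rewrite ge_min lexx.
  have mt : Num.min (k / 2) (1 - sup K) <= 1 - sup K by rewrite ge_min lexx orbT.
  have : K s by apply: KS; rewrite /s /inI; lra.
  by move/Kle; rewrite /s; lra.
have [_ [e2 e20 e2H]] : K 1 by apply: KS; [exact: inI1|rewrite top; lra].
by exists e2 => // t' y /andP[t0 t1] Fy; exact: e2H.
Qed.

(** Moves points horizontally to the right so that the segment from (-1, 0) to the origin is
    collapsed into the origin. At a height y other than 0 the factor min(1, |y|) keeps the map
    strictly increasing in x. The subtraction of N |y| confines the motion to the wedge N |y| < -x,
    and the second argument of the minimum stops it to the left of -1 - 1/N. *)
Definition cps (N : R) (q : P) : P :=
  (Num.max q.1 (Num.min (q.1 * Num.min 1 `|q.2| - N * `|q.2|)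
                        (q.1 + ((q.1 + 1) * N + 1) - N * `|q.2|)), q.2).

Definition unit_seg (q : P) := q.2 = 0 /\ -1 <= q.1 <= 0.

Lemma cps_cont1 N : continuous (fun q => (cps N q).1).
Proof.
have c1 : continuous (fun q : P => q.1) by apply: cont_fst; exact: cont_id.
have c2 : continuous (fun q : P => `|q.2|) by apply: cont_abs; apply: cont_snd; exact: cont_id.
have cN : continuous (fun q : P => - (N * `|q.2|)).
  by apply: cont_opp; apply: cont_mul => //; exact: cont_cst.
apply: cont_max => //; apply: cont_min; apply: cont_add => //.
  by apply: cont_mul => //; apply: cont_min => //; exact: cont_cst.
apply: cont_add => //; apply: cont_add; last exact: cont_cst.
by apply: cont_mul; [apply: cont_add => //; exact: cont_cst|exact: cont_cst].
Qed.

Lemma cps_cont N : continuous (cps N).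
Proof.
by apply: cont_pair; [exact: (@cps_cont1 N)|apply: cont_snd; exact: cont_id].
Qed.

Lemma cps_seg N q : 0 < N -> unit_seg q -> cps N q = (0, 0).
Proof.
move=> N0 [y0 /andP[x0 x1]]; rewrite /cps y0; congr (_, _).
rewrite normr0 mulr0 !subr0.
have -> : Num.min 1 (0 : R) = 0 by apply/min_idPr; exact: ler01.
rewrite mulr0.
have -> : Num.min 0 (q.1 + ((q.1 + 1) * N + 1)) = 0 by apply/min_idPl; nra.
exact/max_idPr.
Qed.

Lemma cps_mono N (x x' y : R) : 0 < N -> ~ unit_seg (x, y) -> ~ unit_seg (x', y) -> x < x' ->
  (cps N (x, y)).1 < (cps N (x', y)).1.
Proof.
move=> N0 nx nx' xx /=.
have c0 : 0 <= N * `|y| by apply: mulr_ge0; [exact: ltW|exact: normr_ge0].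
have f2 : x + ((x + 1) * N + 1) - N * `|y| < x' + ((x' + 1) * N + 1) - N * `|y| by nra.
case: (eqVneq y 0) => [y0|y0]; last first.
  have m0 : 0 < Num.min 1 `|y| by rewrite lt_min ltr01 normr_gt0.
  have f1 : x * Num.min 1 `|y| - N * `|y| < x' * Num.min 1 `|y| - N * `|y|.
    by rewrite ltrD2r ltr_pM2r.
  rewrite gt_max !lt_max xx /= lt_min !gt_min f1 f2 /= orbT.
  by rewrite orbT.
move: f2; rewrite y0 normr0 mulr0 !subr0.
have -> : Num.min 1 (0 : R) = 0 by apply/min_idPr; exact: ler01.
rewrite !mulr0 => f2.
have H' : x' < -1 \/ 0 < x'.
  apply: contrapT => H; apply: nx'; split; rewrite ?y0 //=.
  by apply/andP; split; rewrite leNgt; apply/negP => h; apply: H; [left|right].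
case: H' => x'0.
  rewrite gt_max !lt_max xx /=; apply/orP; right.
  have f3 : x + ((x + 1) * N + 1) < 0 by nra.
  by rewrite lt_min !gt_min f2 f3 !orbT.
by rewrite gt_max !lt_max xx gt_min x'0.
Qed.

Lemma cps_id1 N q : 0 < N -> - q.1 <= N * `|q.2| -> cps N q = q.
Proof.
move=> N0 h; rewrite /cps [RHS]surjective_pairing; congr (_, _).
apply/max_idPl; rewrite ge_min; apply/orP; left.
have m1 : Num.min 1 `|q.2| <= 1 by rewrite ge_min lexx.
have m0 : 0 <= Num.min 1 `|q.2| by rewrite le_min ler01 normr_ge0.
have c0 : 0 <= N * `|q.2| by apply: mulr_ge0; [exact: ltW|exact: normr_ge0].
by case: (lerP 0 q.1) => x0; nra.
Qed.

Lemma cps_id2 N q : 0 < N -> (q.1 + 1) * N + 1 <= 0 -> cps N q = q.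
Proof.
move=> N0 h; rewrite /cps [RHS]surjective_pairing; congr (_, _).
apply/max_idPl; rewrite ge_min; apply/orP; right.
have c0 : 0 <= N * `|q.2| by apply: mulr_ge0; [exact: ltW|exact: normr_ge0].
by lra.
Qed.

Lemma cps_off N q : 0 < N -> ~ unit_seg q -> cps N q <> (0, 0).
Proof.
move=> N0 nq [h1 h2].
have [x0|x0] : q.1 < -1 \/ 0 < q.1.
    apply: contrapT => H; apply: nq; split => //.
    by apply/andP; split; rewrite leNgt; apply/negP => h; apply: H; [left|right].
  move: h1; rewrite h2 normr0 mulr0 !subr0 => h1.
  have : Num.max q.1 (Num.min (q.1 * Num.min 1 0) (q.1 + ((q.1 + 1) * N + 1))) < 0.
    rewrite gt_max; apply/andP; split; first by lra.
    by rewrite gt_min; apply/orP; right; nra.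
  by rewrite h1 ltxx.
have : q.1 <= 0 by rewrite -h1 le_max lexx.
by lra.
Qed.

Section Conjugate.
Variables (p w : P).
Hypothesis pw : p != w.
Let u : P := w - p.
Let n2 : R := u.1 * u.1 + u.2 * u.2.

Let n2_gt0 : 0 < n2.
Proof.
have : u != 0 by rewrite subr_eq0 eq_sym.
move=> u0; rewrite /n2; case: (eqVneq u.1 0) => u1; last first.
  by rewrite ltr_pwDl // -?expr2 ?sqr_ge0 // exprn_even_gt0.
case: (eqVneq u.2 0) => u2; last by rewrite ltr_wpDl // -expr2 ?sqr_ge0 // exprn_even_gt0.
by case/eqP: u0; apply: pext.
Qed.

(** The similarity that takes [w] to the origin and [p] to (-1, 0), so that [cps] applies to the
    segment from [p] to [w]; its inverse is [of_unit]. *)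
Definition to_unit (z : P) : P :=
  (((z - w).1 * u.1 + (z - w).2 * u.2) / n2, (u.1 * (z - w).2 - u.2 * (z - w).1) / n2).
Definition of_unit (q : P) : P := (w.1 + q.1 * u.1 - q.2 * u.2, w.2 + q.1 * u.2 + q.2 * u.1).

Lemma of_unitK q : to_unit (of_unit q) = q.
Proof.
have n0 : u.1 * u.1 + u.2 * u.2 != 0 by rewrite gt_eqF ?n2_gt0.
by apply: pext; rewrite /to_unit /of_unit /n2 /=; field.
Qed.

Lemma to_unitK z : of_unit (to_unit z) = z.
Proof.
have n0 : u.1 * u.1 + u.2 * u.2 != 0 by rewrite gt_eqF ?n2_gt0.
by apply: pext; rewrite /to_unit /of_unit /n2 !pE /=; field.
Qed.

Lemma to_unit_line t (v : P) : to_unit (w + t *: (v - w)) = t *: to_unit v.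
Proof. by apply: pext; rewrite /to_unit !pE /=; ring. Qed.

Lemma to_unit_cont : continuous to_unit.
Proof.
have c1 : continuous (fun z : P => (z - w).1).
  by apply: cont_add; [apply: cont_fst; exact: cont_id|exact: cont_cst].
have c2 : continuous (fun z : P => (z - w).2).
  by apply: cont_add; [apply: cont_snd; exact: cont_id|exact: cont_cst].
apply: cont_pair; (apply: cont_mul; last exact: cont_cst); apply: cont_add.
- by apply: cont_mul => //; exact: cont_cst.
- by apply: cont_mul => //; exact: cont_cst.
- by apply: cont_mul => //; exact: cont_cst.
- by apply: cont_opp; apply: cont_mul => //; exact: cont_cst.
Qed.

Lemma of_unit_cont : continuous of_unit.
Proof.
have c1 : continuous (fun q : P => q.1) by apply: cont_fst; exact: cont_id.
have c2 : continuous (fun q : P => q.2) by apply: cont_snd; exact: cont_id.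
apply: cont_pair; apply: cont_add.
- by apply: cont_add; [exact: cont_cst|apply: cont_mul => //; exact: cont_cst].
- by apply: cont_opp; apply: cont_mul => //; exact: cont_cst.
- by apply: cont_add; [exact: cont_cst|apply: cont_mul => //; exact: cont_cst].
- by apply: cont_mul => //; exact: cont_cst.
Qed.

Lemma unit_segP z : seg p w z <-> unit_seg (to_unit z).
Proof.
split=> [|[h1 /andP[h2 h3]]].
  rewrite seg_sym => -[t /andP[t0 t1] ->]; rewrite to_unit_line.
  have -> : to_unit p = (-1, 0).
    have n0 : u.1 * u.1 + u.2 * u.2 != 0 by rewrite gt_eqF ?n2_gt0.
    by apply: pext; rewrite /to_unit /n2 /u !pE /= in n0 *; field.
  by split; rewrite !pE /=; [rewrite mulr0|lra].
rewrite -(to_unitK z) seg_sym; exists (- (to_unit z).1); first by rewrite /inI; lra.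
by apply: pext; rewrite /of_unit h1 /u !pE /=; ring.
Qed.

Lemma of_unit_dist (q q' : P) : `|of_unit q - of_unit q'| <=
  (`|q.1 - q'.1| + `|q.2 - q'.2|) * `|u|.
Proof.
have u1 : `|u.1| <= `|u| by rewrite pnorm le_max lexx.
have u2 : `|u.2| <= `|u| by rewrite pnorm le_max lexx orbT.
have a1 := normr_ge0 (q.1 - q'.1); have a2 := normr_ge0 (q.2 - q'.2).
rewrite pnorm_le; apply/andP; split.
  have -> : (of_unit q - of_unit q').1 = (q.1 - q'.1) * u.1 - (q.2 - q'.2) * u.2.
    by rewrite /of_unit !pE /=; ring.
  apply: (le_trans (ler_normB _ _)); rewrite !normrM mulrDl.
  by apply: lerD; apply: ler_wpM2l.
have -> : (of_unit q - of_unit q').2 = (q.1 - q'.1) * u.2 + (q.2 - q'.2) * u.1.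
  by rewrite /of_unit !pE /=; ring.
apply: (le_trans (ler_normD _ _)); rewrite !normrM mulrDl.
by apply: lerD; apply: ler_wpM2l.
Qed.

(* Push p along the segment [p, w] onto w; the support is a wedge at w so thin
   that it misses the rest of the polygonal arc. *)
Lemma collapse_map (w2 : P) (Q2 : set P) : w2 != w -> closed Q2 -> ~ Q2 w ->
  (seg w w2 `|` Q2) `&` seg p w `<=` [set w] ->
  exists psi : P -> P,
    [/\ continuous psi, forall z, seg p w z -> psi z = w,
        forall z, ~ seg p w z -> psi z <> w,
        forall x y, ~ seg p w x -> ~ seg p w y -> psi x = psi y -> x = y &
        (forall U, open U -> U `<=` ~` seg p w -> open (psi @` U)) /\
        forall x, (seg w w2 `|` Q2) x -> psi x = x].
Proof.
move=> w2w cQ2 nQ2 disj.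
have [dl dl0 dlH] : exists2 e : R, 0 < e & forall t y, inI t -> Q2 y -> e <= `|(w + t *: (p - w)) - y|.
  apply: (@away_compact (fun t => w + t *: (p - w))) => //; first exact: seg_param.
  move=> t tI Qt; apply: nQ2; rewrite -{1}(_ : w + t *: (p - w) = w) //.
  by apply: (disj _); split; [right|rewrite seg_sym; exists t].
set c2 := to_unit w2.
(* The next segment leaves [w] in the direction [c2], which does not point back along the segment
   from [w] to [p]. Hence it avoids every sufficiently thin wedge. *)
have c2H : exists2 N : R, 0 < N & forall N', N <= N' -> - c2.1 <= N' * `|c2.2|.
  case: (lerP 0 c2.1) => x2.
    exists 1; first exact: ltr01.
    by move=> N' N1; have := normr_ge0 c2.2; nra.
  have y2 : c2.2 != 0.
    apply/eqP => y2.
    pose t := Num.min 1 (- c2.1)^-1.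
    have t0 : 0 < t by rewrite lt_min ltr01 invr_gt0; lra.
    have t1 : t <= 1 by rewrite ge_min lexx.
    have tx : t * - c2.1 <= 1.
      have : t <= (- c2.1)^-1 by rewrite ge_min lexx orbT.
      by move=> h; rewrite -(@mulVf _ (- c2.1)); [apply: ler_wpM2r => //; lra|lra].
    have : (w + t *: (w2 - w)) = w.
      apply: (disj _); split; first by left; exists t => //; rewrite /inI ltW.
      apply/unit_segP; rewrite to_unit_line; split; rewrite !pE -/c2 ?y2 ?mulr0 //.
      by nra.
    move/eqP; rewrite -subr_eq0 addrAC subrr add0r scaler_eq0 subr_eq0 (negbTE w2w) orbF.
    by rewrite gt_eqF.
  exists (- c2.1 / `|c2.2|); first by rewrite divr_gt0 ?normr_gt0 //; lra.
  by move=> N'; rewrite ler_pdivrMr ?normr_gt0.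
have [N1 N10 N1H] := c2H.
(* The summand [N1] keeps the next segment out of the wedge. The points moved by the map are within
   3 |u| / N of the segment from [p] to [w], so the last summand makes them closer to it than [dl]
   and hence keeps them off [Q2]; the summand 1 makes that estimate uniform. *)
pose N := 1 + N1 + 3 * `|u| / dl.
have u0 : 0 < `|u| by rewrite normr_gt0 /u subr_eq0 eq_sym.
have q0 : 0 < 3 * `|u| / dl by rewrite divr_gt0 // mulr_gt0.
have N0 : 0 < N by rewrite /N; lra.
have N11 : N1 <= N by rewrite /N; lra.
have Nge1 : 1 <= N by rewrite /N; lra.
have Ndl : 3 * `|u| < N * dl.
  have : 3 * `|u| / dl < N by rewrite /N; lra.
  by rewrite ltr_pdivrMr.
exists (fun z => of_unit (cps N (to_unit z))); split.
- apply: (@cont_comp _ _ _ (fun z => cps N (to_unit z)) of_unit); last exact: of_unit_cont.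
  by apply: (@cont_comp _ _ _ to_unit (cps N)); [exact: to_unit_cont|exact: cps_cont].
- move=> z /unit_segP zs; rewrite cps_seg // /of_unit.
  by apply: pext => /=; ring.
- move=> z /unit_segP zs E; apply: (cps_off N0 zs).
  rewrite -(of_unitK (cps N (to_unit z))) E; apply: pext; rewrite /to_unit subrr /=; ring.
- move=> x y /unit_segP xs /unit_segP ys E.
  have {}E : cps N (to_unit x) = cps N (to_unit y).
    by rewrite -(of_unitK (cps _ (to_unit x))) E of_unitK.
  rewrite -(to_unitK x) -(to_unitK y); congr of_unit.
  move: xs ys E; case: (to_unit x) => x1 x2; case: (to_unit y) => y1 y2 xs ys E.
  have y2E : y2 = x2 by case: E => _ ->.
  rewrite y2E in ys E *.
  case: (ltgtP x1 y1) => [xy|xy|-> //].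
    by have := cps_mono N0 xs ys xy; rewrite E ltxx.
  by have := cps_mono N0 ys xs xy; rewrite E ltxx.
- split.
    move=> U oU UO.
    have -> : (fun z => of_unit (cps N (to_unit z))) @` U =
        to_unit @^-1` (cps N @` (of_unit @^-1` U)).
      apply/seteqP; split=> [_ [z Uz <-]|z [q Uq E]].
        by rewrite /preimage /= of_unitK; exists (to_unit z) => //=; rewrite to_unitK.
      by exists (of_unit q) => //; rewrite of_unitK E to_unitK.
    apply: open_comp; first by move=> z _; exact: to_unit_cont.
    apply: (@mono_open R (fun q => (cps N q).1) (~` [set q | unit_seg q])).
    + exact: cps_cont1.
    + have -> : ~` [set q | unit_seg q] = of_unit @^-1` (~` seg p w).
        by apply/seteqP; split=> q /=; rewrite /preimage /= unit_segP of_unitK.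
      apply: open_comp; first by move=> z _; exact: of_unit_cont.
      by apply: closed_openC; exact: seg_closed.
    + by move=> x x' y; exact: cps_mono.
    + by apply: open_comp => // q _; exact: of_unit_cont.
    + by move=> q /UO /=; rewrite unit_segP of_unitK.
  move=> x xQ; suff E : cps N (to_unit x) = to_unit x by rewrite E to_unitK.
  case: xQ => [[t /andP[t0 t1] ->]|Qx].
    rewrite to_unit_line; apply: cps_id1 => //; rewrite !pE -/c2 normrM (ger0_norm t0).
    by have := N1H N N11; nra.
  case: (lerP (- (to_unit x).1) (N * `|(to_unit x).2|)) => h1; first exact: cps_id1.
  case: (lerP (((to_unit x).1 + 1) * N + 1) 0) => h2; first exact: cps_id2.
  exfalso; set a := (to_unit x).1 in h1 h2; set b := (to_unit x).2 in h1 h2.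
  have b0 := normr_ge0 b.
  have a0 : a < 0 by nra.
  pose a' := Num.max (-1) a.
  have a'1 : -1 <= a' by rewrite le_max lexx.
  have a'0 : a' <= 0 by rewrite ge_max; apply/andP; split; lra.
  have aN : `|a - a'| * N <= 1.
    rewrite /a'; case: (lerP a (-1)) => ha.
      by rewrite ler0_norm; [nra|lra].
    by rewrite subrr normr0 mul0r.
  have bN : `|b| * N <= 2 by nra.
  have I : inI (- a') by rewrite /inI; lra.
  have := dlH _ _ I Qx.
  have -> : w + - a' *: (p - w) = of_unit (a', 0).
    by apply: pext; rewrite /of_unit /u !pE /=; ring.
  rewrite -(to_unitK x) => h3.
  have h4 : `|of_unit (a', 0) - of_unit (to_unit x)| <= (`|a' - a| + `|0 - b|) * `|u|.
    exact: of_unit_dist.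
  have h5 : dl <= (`|a - a'| + `|b|) * `|u|.
    by move: h4; rewrite sub0r normrN (distrC a'); exact: le_trans.
  have : dl * N <= 3 * `|u|.
    by apply: (le_trans (ler_wpM2r (ltW N0) h5)); nra.
  by rewrite mulrC; lra.
Qed.

End Conjugate.

Section ContractPoly.
Variables (V E : finType) (Va : {set V}) (Ea : {set E}) (src dst : E -> V).
Variables (X : E -> E -> Prop) (a b : V).
Hypotheses (aV : a \in Va) (bV : b \in Va) (ab : a != b).
Hypothesis nab : forall e, e \in Ea -> ~ ((src e = a /\ dst e = b) \/ (src e = b /\ dst e = a)).

Definition merge_vert (w : V) := if w == b then a else w.

Lemma contract_spoly W q p Q : ~ W q -> spoly W q p Q ->
  forall (pos : V -> P) (cv : E -> set P), pdraw Va Ea src dst X pos cv -> pos b = p -> pos a = q ->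
  (forall x, Q x -> x <> p -> x <> q ->
     (forall w, w \in Va -> pos w <> x) /\ (forall e, e \in Ea -> ~ cv e x)) ->
  drawable R (Va :\ b) Ea (merge_vert \o src) (merge_vert \o dst) X.
Proof.
move=> nW; elim=> {p Q} [p pq _|p w Q pw _ spQ IH disj] pos cv D pb pa avoid.
  (* No segment follows the last one. To apply [collapse_map], its prolongation beyond [q] is used
     as the next segment. *)
  have qq : q + (q - p) != q by rewrite -subr_eq0 addrAC subrr add0r subr_eq0 eq_sym.
  have [psi [cpsi psiZ psinZ psiI [psiO _]]] : exists psi : P -> P,
    [/\ continuous psi, forall z, seg p q z -> psi z = q,
        forall z, ~ seg p q z -> psi z <> q,
        forall x y, ~ seg p q x -> ~ seg p q y -> psi x = psi y -> x = y &
        (forall U, open U -> U `<=` ~` seg p q -> open (psi @` U)) /\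
        forall x, (seg q (q + (q - p)) `|` set0) x -> psi x = x].
    apply: collapse_map => //; first exact: closed0.
    move=> x [[|//]]; move=> [t /andP[t0 t1] ->] [s /andP[s0 s1]] E'.
    have : (1 - s + t) *: (q - p) = 0.
      have := subrr (p + s *: (q - p)); rewrite -{1}E' => <-.
      by apply: pext; rewrite !pE; ring.
    move/eqP; rewrite scaler_eq0 subr_eq0 (eq_sym q) (negbTE pq) orbF => /eqP h.
    have -> : t = 0 by lra.
    by rewrite scale0r addr0.
  have nvert w0 : w0 \in Va -> seg p q (pos w0) -> w0 = a \/ w0 = b.
    move=> w0V s0; case: (pselect (pos w0 = p)) => [h|h1].
      by right; apply: (pd_inj D) => //; rewrite pb.
    case: (pselect (pos w0 = q)) => [h|h2].
      by left; apply: (pd_inj D) => //; rewrite pa.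
    by have [/(_ w0 w0V)] := avoid _ s0 h1 h2.
  have ncv e x : e \in Ea -> cv e x -> seg p q x ->
      (x = q /\ (src e = a \/ dst e = a)) \/ (x = p /\ (src e = b \/ dst e = b)).
    move=> eE cx sx; case: (pselect (x = p)) => [h|h1].
      right; split => //; rewrite h -pb in cx.
      by case: (pd_avoid D eE bV cx) => ->; [left|right].
    case: (pselect (x = q)) => [h|h2].
      left; split => //; rewrite h -pa in cx.
      by case: (pd_avoid D eE aV cx) => ->; [left|right].
    by have [_ /(_ e eE)] := avoid _ sx h1 h2.
  eexists; eexists.
  apply: (@pdraw_transport R V E Va Ea src dst X pos cv D psi (~` seg p q) (Va :\ b) Ea merge_vert).
  - exact: subD1set.
  - by [].
  - by apply: closed_openC; exact: seg_closed.
  - exact: psiI.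
  - exact: psiO.
  - by move=> e x _ _; exact: cpsi.
  - by move=> x _; exact: cpsi.
  - move=> x y nx /contrapT sy; rewrite (psiZ _ sy); exact: psinZ.
  - move=> e x eE cx /contrapT sx; case: (ncv _ _ eE cx sx) => -[-> []] ->; rewrite ?pa ?pb;
      by [left|right].
  - move=> e x y eE cx cy /contrapT sx /contrapT sy.
    have [sd] := pd_neq D eE.
    case: (ncv _ _ eE cx sx) => -[-> hx]; case: (ncv _ _ eE cy sy) => -[-> hy] //.
      by case: (nab eE); case: hx hy => hx [] hy; [move: ab; rewrite -hx -hy eqxx|left|right|move: ab; rewrite -hx -hy eqxx].
    by case: (nab eE); case: hx hy => hx [] hy; [move: ab; rewrite -hx -hy eqxx|right|left|move: ab; rewrite -hx -hy eqxx].
  - by move=> w0; rewrite /merge_vert !inE => /andP[/negbTE ->].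
  - move=> e eE; have [sV dV] := pd_ends D eE.
    have H w0 : w0 \in Va -> merge_vert w0 \in Va :\ b /\ psi (pos (merge_vert w0)) = psi (pos w0).
      move=> w0V; rewrite /merge_vert; case: eqP => [->|/eqP wb].
        rewrite !inE ab aV pb pa; split => //.
        by rewrite !psiZ //; [exact: seg_l|exact: seg_r].
      by rewrite !inE wb w0V.
    by have [? ?] := H _ sV; have [? ?] := H _ dV.
  - move=> w0 w1; rewrite !inE => /andP[w0b w0V] /andP[w1b w1V].
    case: (pselect (seg p q (pos w0))) => s0; case: (pselect (seg p q (pos w1))) => s1.
    + case: (nvert _ w0V s0) => h0; case: (nvert _ w1V s1) => h1; rewrite h0 h1 //.
      * by rewrite h1 eqxx in w1b.
      * by rewrite h0 eqxx in w0b.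
    + by rewrite (psiZ _ s0) => /esym /psinZ.
    + by rewrite (psiZ _ s1) => /psinZ.
    + by move/(psiI _ _ s0 s1)/(pd_inj D w0V w1V).
have [Qw Qq wq] := spoly_ends nW spQ.
have [w2 [Q2 [w2w cQ2 nQ2 QE]]] : exists w2 Q2,
    [/\ w2 != w, closed Q2, ~ Q2 w & Q = seg w w2 `|` Q2].
  case: spQ => [w' w'q _|w' w2 Q' w'w2 _ sp' dj].
    by exists q, set0; rewrite setU0 eq_sym; split => //; exact: closed0.
  exists w2, Q'; rewrite eq_sym; split => //; first exact: (spoly_closed sp').
  move=> Qw'; have /dj /= E' : (seg w' w2 `&` Q') w' by split => //; exact: seg_l.
  by rewrite E' eqxx in w'w2.
have djQ : (seg w w2 `|` Q2) `&` seg p w `<=` [set w].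
  by rewrite -QE => x [Qx sx]; apply: disj.
have [psi [cpsi psiZ psinZ psiI [psiO psiid]]] := collapse_map pw w2w cQ2 nQ2 djQ.
rewrite -QE in psiid.
have nQp : ~ Q p.
  by move=> Qp; have /disj /= E' : (seg p w `&` Q) p; [split => //; exact: seg_l|rewrite E' eqxx in pw].
have pq : p <> q by move=> pq; apply: nQp; rewrite pq.
have sq x : seg p w x -> x <> q.
  move=> sx xq; have /disj /= E' : (seg p w `&` Q) x by split => //; rewrite xq.
  by move: wq; rewrite -E' xq eqxx.
have nvert w0 : w0 \in Va -> seg p w (pos w0) -> w0 = b.
  move=> w0V s0; case: (pselect (pos w0 = p)) => [h|h1].
    by apply: (pd_inj D) => //; rewrite pb.
  by have [/(_ w0 w0V)] := avoid (pos w0) (or_introl s0) h1 (sq _ s0).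
have ncv e x : e \in Ea -> cv e x -> seg p w x -> x = p /\ (src e = b \/ dst e = b).
  move=> eE cx sx; case: (pselect (x = p)) => [h|h1].
    split => //; rewrite h -pb in cx.
    by case: (pd_avoid D eE bV cx) => ->; [left|right].
  by have [_ /(_ e eE)] := avoid x (or_introl sx) h1 (sq _ sx).
have aux := @pdraw_transport R V E Va Ea src dst X pos cv D psi (~` seg p w) Va Ea id.
apply: (IH (psi \o pos) (fun e => psi @` cv e)).
- apply: aux => //.
  + by apply: closed_openC; exact: seg_closed.
  + by move=> e x _ _; exact: cpsi.
  + by move=> x _; exact: cpsi.
  + by move=> x y nx /contrapT sy; rewrite (psiZ _ sy); exact: psinZ.
  + by move=> e x eE cx /contrapT sx; case: (ncv _ _ eE cx sx) => -> [] ->; rewrite pb; [left|right].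
  + move=> e x y eE cx cy /contrapT sx /contrapT sy.
    by have [-> _] := ncv _ _ eE cx sx; have [-> _] := ncv _ _ eE cy sy.
  + by move=> e eE; have [? ?] := pd_ends D eE.
  + move=> w0 w1 w0V w1V.
    case: (pselect (seg p w (pos w0))) => s0; case: (pselect (seg p w (pos w1))) => s1.
    * by rewrite (nvert _ w0V s0) (nvert _ w1V s1).
    * by rewrite (psiZ _ s0) => /esym /psinZ.
    * by rewrite (psiZ _ s1) => /psinZ.
    * by move/(psiI _ _ s0 s1)/(pd_inj D w0V w1V).
- by rewrite /= pb psiZ //; exact: seg_l.
- by rewrite /= pa psiid.
- move=> x Qx xw xq.
  have nsx : ~ seg p w x by move=> sx; apply: xw; apply: disj.
  have xp : x <> p by move=> xp; apply: nsx; rewrite xp; exact: seg_l.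
  have [av ae] := avoid x (or_intror Qx) xp xq.
  have back y : psi y = x -> y = x.
    move=> yx; case: (pselect (seg p w y)) => sy; first by case: xw; rewrite -yx psiZ.
    by apply: psiI => //; rewrite yx psiid.
  split=> [w0 w0V /back|e eE [y cy /back yx]]; first exact: av.
  by apply: (ae e eE); rewrite -yx.
Qed.

End ContractPoly.
End ContractEdge.

(** * Rerouting and inserting edges *)

Section EdgeOperations.
Variable R : realType.
Local Notation P := (R * R)%type.

Lemma spoly_sub (W : set P) q p Q x : spoly W q p Q -> Q x -> [\/ x = p, x = q | W x].
Proof.
move=> sp; elim: sp => {p Q} [p _ sW|p w Q _ sW _ IH _].
  move=> sx; case: (pselect (x = p)) => xp; first by constructor 1.
  by case: (pselect (x = q)) => xq; [constructor 2|constructor 3; exact: sW].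
case: (pselect (x = p)) => xp; first by constructor 1.
case=> [sx|Qx]; first by constructor 3; exact: sW.
case: (IH Qx) => [xw|->|Wx]; [|by constructor 2|by constructor 3].
by constructor 3; apply: sW => //; rewrite xw; exact: seg_r.
Qed.

Lemma restrict_edges (V E : finType) (Va : {set V}) (Ea Eb : {set E}) (src dst : E -> V)
    (X Y : E -> E -> Prop) (pos : V -> P) (cv : E -> set P) : Eb \subset Ea ->
  (forall e f, e \in Eb -> f \in Eb -> e != f -> X e f -> Y e f) ->
  pdraw Va Ea src dst X pos cv -> pdraw Va Eb src dst Y pos cv.
Proof.
move=> /fintype.subsetP sE XY D.
apply: (@pdraw_relabel R V E Va Ea src dst X pos cv D V E Va Eb src dst Y id id) => //.
by move=> e /sE eE; have [? ?] := pd_ends D eE; split => //; left.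
Qed.

Section Contract.
Variables (V E : finType) (Va : {set V}) (Ea Eb : {set E}) (src dst : E -> V).
Variables (X : E -> E -> Prop) (pos : V -> P) (cv : E -> set P).
Hypothesis D : pdraw Va Ea src dst X pos cv.
Variables (e0 : E) (a b : V).
Hypotheses (e0E : e0 \in Ea) (e0X : forall f, f \in Ea -> ~ X e0 f).
Hypothesis e0ab : (src e0 = a /\ dst e0 = b) \/ (src e0 = b /\ dst e0 = a).
Hypothesis EbE : Eb \subset Ea :\ e0.
Hypothesis nab : forall e, e \in Eb -> ~ ((src e = a /\ dst e = b) \/ (src e = b /\ dst e = a)).

(** Once [e0] is straight near its ends, its interior is a connected subset of the open set [W] of
    all points that avoid the vertices and the other edges, because [e0] is uncrossed. So a
    polygonal arc leads from [b] to [a] through [W], and it can be collapsed. *)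
Lemma contract_edge :
  drawable R (Va :\ b) Eb (merge_vert a b \o src) (merge_vert a b \o dst) X.
Proof.
have [aV bV] : a \in Va /\ b \in Va.
  by have [? ?] := pd_ends D e0E; case: e0ab => -[<- <-].
have ab : a != b by have := pd_neq D e0E; case: e0ab => -[-> ->] //; rewrite eq_sym.
have pab : pos a != pos b by apply: contraNN ab => /eqP /(pd_inj D aV bV) ->.
(* Half the distance between the ends: the second straightening, which takes place within [h] of
   [a], does not affect the disc around [b]. *)
pose h := `|pos a - pos b| / 2.
have h0 : 0 < h by rewrite divr_gt0 // normr_gt0 subr_eq0.
have h2 : h + h = `|pos a - pos b| by rewrite /h; lra.
have [rb [cv1 [[rb0 rbh] D1 _ rad1 _]]] := radial D bV h0.
have [ra [cv2 [[ra0 rah] D2 _ rad2 eq2]]] := radial D1 aV h0.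
have e0a : at_vert src dst a e0 by rewrite /at_vert; case: e0ab => -[-> ->]; rewrite eqxx ?orbT.
have e0b : at_vert src dst b e0 by rewrite /at_vert; case: e0ab => -[-> ->]; rewrite eqxx ?orbT.
have [ca _ segA] := rad2 e0 e0E e0a.
have [cb _ segB'] := rad1 e0 e0E e0b.
have far x : `|pos b - x| <= rb -> h <= `|pos a - x|.
  move=> xb; have := ler_normD (pos a - x) (x - pos b).
  by rewrite addrA subrK (distrC x); lra.
have segB x : `|pos b - x| <= rb -> cv2 e0 x <-> seg (pos b) cb x.
  by move=> xb; rewrite (eq2 e0 x e0E (far x xb)) segB'.
pose W : set P := [set x | (forall e, e \in Ea -> e != e0 -> ~ cv2 e x) /\
  (forall w, w \in Va -> pos w <> x)].
have oW : open W.
  apply/open_plane => x [We Wv].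
  have [r1 r10 H1] : exists2 r : R, 0 < r & forall (e : E) r', 0 < r' -> r' <= r ->
      e \in Ea -> e != e0 -> forall y, `|x - y| < r' -> ~ cv2 e y.
    apply: pos_fin => e; case: (boolP ((e \in Ea) && (e != e0))) => [/andP[eE ee]|ne]; last first.
      by exists 1 => [|r' _ _ eE ee]; [exact: ltr01|rewrite eE ee in ne].
    have [k k0 kH] := closed_away (arc_closed (pd_arc D2 eE)) (We e eE ee).
    by exists k => // r' _ r'k _ _ y xy /kH; lra.
  have [r2 r20 H2] : exists2 r : R, 0 < r & forall (w : V) r', 0 < r' -> r' <= r ->
      w \in Va -> forall y, `|x - y| < r' -> pos w <> y.
    apply: pos_fin => w; case: (boolP (w \in Va)) => wV; last first.
      by exists 1 => [|r' _ _ //]; exact: ltr01.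
    exists `|x - pos w|; first by rewrite normr_gt0 subr_eq0; apply/eqP => /esym; exact: Wv.
    by move=> r' _ r'k _ y xy wy; move: xy; rewrite -wy; lra.
  exists (Num.min r1 r2); first by rewrite lt_min r10 r20.
  move=> y xy; have m0 : 0 < Num.min r1 r2 by rewrite lt_min r10 r20.
  split=> [e eE ee|w wV].
    by apply: (H1 e _ m0) xy => //; rewrite ge_min lexx.
  by apply: (H2 w _ m0) xy => //; rewrite ge_min lexx orbT.
have nWa : ~ W (pos a) by move=> [_ /(_ a aV)].
have [g [cg gi [g0 g1] gA Ag]] : arc (pos b) (pos a) (cv2 e0).
  by have := pd_arc D2 e0E; case: e0ab => -[-> ->] //; exact: arc_rev.
have gW t : 0 < t -> t < 1 -> W (g t).
  move=> t0 t1; have tI : inI t by rewrite /inI; lra.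
  have nv w : w \in Va -> pos w <> g t.
    move=> wV wt; have := pd_avoid D2 e0E wV; rewrite wt => /(_ (gA t)) H.
    have [wa|wb] : w = a \/ w = b by case: e0ab => -[<- <-]; case: H; by [left|right].
      by have := gi _ _ tI (inI1 R); rewrite -wt wa g1 => /(_ erefl); lra.
    by have := gi _ _ tI (inI0 R); rewrite -wt wb g0 => /(_ erefl); lra.
  split => // e eE ee ce.
  have ee' : e0 != e by rewrite eq_sym.
  by have [/(e0X eE)] := pd_cross D2 e0E eE ee' (gA t) ce nv.
pose C := g @` [set t | 0 < t /\ t < 1].
have onC x : cv2 e0 x -> x <> pos a -> x <> pos b -> C x.
  move=> /Ag[t /andP[t0 t1] <-] xa xb; exists t => //=; split.
    by rewrite lt_neqAle t0 andbT eq_sym; apply/eqP => t00; apply: xb; rewrite t00 g0.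
  by rewrite lt_neqAle t1 andbT; apply/eqP => t11; apply: xa; rewrite t11 g1.
have cC : connected C.
  apply: connected_continuous_connected; last exact: continuous_subspaceT.
  apply/connected_intervalP => x y /= [x0 x1] [y0 y1] z /andP[xz zy]; split; lra.
have CW : C `<=` W by move=> _ [t [t0 t1] <-]; exact: gW.
have near (s : R) (c : P) (rc : R) : inI s -> g s = c -> 0 < rc ->
    exists t, [/\ 0 < t, t < 1 & `|c - g t| <= rc].
  move=> sI gs rc0.
  have : nbhs (g s) [set x | `|c - x| < rc] by rewrite gs; apply/nbhs_plane; exists rc.
  move/(cg s) => /nbhs_real[k k0 kH].
  pose m := Num.min (k / 2) (1 / 2).
  have m0 : 0 < m by rewrite lt_min; apply/andP; split; lra.
  have mk : m <= k / 2 by rewrite ge_min lexx.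
  have m1 : m <= 1 / 2 by rewrite ge_min lexx orbT.
  move: sI => /andP[s0 s1]; case: (lerP s (1 / 2)) => s2.
    exists (s + m / 2); split; [by lra|by lra|].
    by apply: ltW; apply: kH; rewrite opprD addrA subrr sub0r normrN gtr0_norm; lra.
  exists (s - m / 2); split; [by lra|by lra|].
  by apply: ltW; apply: kH; rewrite opprB addrC subrK gtr0_norm; lra.
have onseg (v v' : V) (rv : R) c (x : P) : v \in Va -> v' \in Va -> v != v' ->
    (forall y, `|pos v - y| <= rv -> cv2 e0 y <-> seg (pos v) c y) ->
    cv2 e0 x -> `|pos v - x| <= rv -> rv < `|pos v - pos v'| ->
    forall y, seg (pos v) x y -> y <> pos v -> cv2 e0 y /\ y <> pos v'.
  move=> vV v'V vv' H cx xr rv' y sy yv.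
  have yr : `|pos v - y| <= rv.
    have [t /andP[t0 t1] [_ ->]] := seg_norm sy.
    by have := normr_ge0 (pos v - x); nra.
  split; last by move=> yv'; move: yr; rewrite yv'; lra.
  by apply/H => //; apply: (seg_subl _ sy); apply/H.
have ha : ra < `|pos a - pos b| by lra.
have hb : rb < `|pos b - pos a| by rewrite distrC; lra.
have [ta [ta0 ta1 tar]] := near 1 (pos a) ra (inI1 R) g1 ra0.
have [tb [tb0 tb1 tbr]] := near 0 (pos b) rb (inI0 R) g0 rb0.
have Cta : C (g ta) by exists ta.
have gne t : 0 < t -> t < 1 -> forall w, w \in Va -> g t <> pos w.
  by move=> t0 t1 w wV E'; have [_ /(_ w wV)] := gW t t0 t1; rewrite E'.
have spa : spoly W (pos a) (g ta) (seg (g ta) (pos a)).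
  constructor; first by apply/eqP; exact: gne.
  rewrite seg_sym => y sy yg ya; apply: CW.
  have [cy yb] := onseg a b ra ca (g ta) aV bV ab segA (gA ta) tar ha y sy ya.
  exact: onC.
have [Qb spb] : exists Q, spoly W (pos a) (g tb) Q.
  apply: (spoly_connected oW nWa cC CW); last by exists tb.
  by exists (g ta), (seg (g ta) (pos a)).
have [Q spQ] : exists Q, spoly W (pos a) (pos b) Q.
  apply: (spoly_extend nWa spb); first by move=> E'; rewrite E' eqxx in pab.
  move=> y sy yb; apply: CW.
  have ba : b != a by rewrite eq_sym.
  have [cy ya] := onseg b a rb cb (g tb) bV aV ba segB (gA tb) tbr hb y sy yb.
  exact: onC.
have sE : Eb \subset Ea by apply: fintype.subset_trans EbE _; exact: subD1set.
have D3 : pdraw Va Eb src dst X pos cv2 by apply: restrict_edges D2.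
apply: (contract_spoly aV bV ab nab nWa spQ D3) => // x Qx xb xa.
case: (spoly_sub spQ Qx) => // -[We Wv]; split => // e eE.
by have := fintype.subsetP EbE e eE; rewrite !inE => /andP[ee eE']; exact: We.
Qed.

End Contract.

Section Uncross.
Variables (V E : finType) (Va : {set V}) (Ea : {set E}) (src dst : E -> V).
Variables (X : E -> E -> Prop) (pos : V -> P) (cv : E -> set P).
Hypothesis D : pdraw Va Ea src dst X pos cv.
Variables (e f : E) (p : P).
Hypotheses (eE : e \in Ea) (fE : f \in Ea) (ef : e != f) (cep : cv e p) (cfp : cv f p).
Hypothesis nvp : forall w, w \in Va -> pos w <> p.
Hypothesis xv : src e != src f.

(* The crossing point becomes a vertex, which is then merged with the end
   src f of f along the initial part of f. *)
Lemma uncross : drawable R Va Ea src (fun g => if g == e then src f else dst g)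
  (fun g h => [/\ X g h, g != e, g != f, h != e & h != f]).
Proof.
have [se de] := pd_ends D eE; have [sf df] := pd_ends D fE.
have pn w : w \in Va -> p != pos w by move=> wV; apply/eqP => E'; exact: (nvp wV).
have [A1 [A2 [a1 a2 AE AI]]] := arc_split (pd_arc D eE) cep (pn _ se) (pn _ de).
have [B1 [B2 [b1 b2 BE BI]]] := arc_split (pd_arc D fE) cfp (pn _ sf) (pn _ df).
have fe : f != e by rewrite eq_sym.
have ucross g q : g \in Ea -> e != g -> cv e q -> cv g q ->
    (forall w, w \in Va -> pos w <> q) -> g = f /\ q = p.
  move=> gE eg ceq cgq nvq.
  by have [-> ->] := pd_one D eE fE gE ef eg cep cfp ceq cgq nvp nvq.
have ucross' g q : g \in Ea -> f != g -> cv f q -> cv g q ->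
    (forall w, w \in Va -> pos w <> q) -> g = e /\ q = p.
  move=> gE fg cfq cgq nvq.
  by have [-> ->] := pd_one D fE eE gE fe fg cfp cep cfq cgq nvp nvq.
(* As a vertex, [None] is the crossing point; as an edge, it is the initial part [B1] of [f]. The
   edge [e] keeps its initial part [A1] and [f] its final part [B2]. Merging [None] with [src f]
   then makes [e] end at [src f] and restores the ends of [f]. *)
pose pos' (w : option V) := if w is Some w then pos w else p.
pose cv' (g : option E) : set P :=
  if g is Some g then (if g == e then A1 else if g == f then B2 else cv g) else B1.
pose src' (g : option E) :=
  if g is Some g then (if g == f then None else Some (src g)) else Some (src f).
pose dst' (g : option E) :=
  if g is Some g then (if g == e then None else Some (dst g)) else None.
pose X' (g h : option E) :=
  if g is Some g then if h is Some h then [/\ X g h, g != e, g != f, h != e & h != f] else False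
  else False.
pose Va' := [set w | if w is Some w then w \in Va else true]%SET.
pose Ea' := [set g | if g is Some g then g \in Ea else true]%SET.
pose old (g : option E) := if g is Some g then g else f.
have cvo g q : cv' g q -> cv (old g) q.
  case: g => [g|] /=; last by rewrite BE; left.
  by case: eqP => [->|_]; [rewrite AE; left|case: eqP => [->|//]; rewrite BE; right].
have oldE g : g \in Ea' -> old g \in Ea by rewrite inE; case: g.
have nv' q : (forall w, w \in Va' -> pos' w <> q) -> q <> p /\ forall w, w \in Va -> pos w <> q.
  move=> H; split; first by move/esym; apply: (H None); rewrite inE.
  by move=> w wV; apply: (H (Some w)); rewrite inE.
have crossed g h q : g \in Ea' -> h \in Ea' -> g != h -> cv' g q -> cv' h q ->
    (forall w, w \in Va' -> pos' w <> q) ->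
    exists g' h', [/\ g = Some g' /\ h = Some h', g' != e /\ g' != f & h' != e /\ h' != f].
  move=> gE hE gh cg ch /nv'[qp nvq].
  have cg' := cvo _ _ cg; have ch' := cvo _ _ ch.
  have noe k : k \in Ea' -> cv (old k) q -> old k != e -> ~ cv e q.
    move=> kE ck ke ce; have [_ E'] := ucross (old k) q (oldE _ kE) ltac:(by rewrite eq_sym) ce ck nvq.
    exact: qp.
  have nof k : k \in Ea' -> cv (old k) q -> old k != f -> ~ cv f q.
    move=> kE ck kf cf; have [_ E'] := ucross' (old k) q (oldE _ kE) ltac:(by rewrite eq_sym) cf ck nvq.
    exact: qp.
  have B12 : B1 q -> B2 q -> False.
    by move=> q1 q2; apply: qp; have : (B1 `&` B2) q by []; rewrite BI.
  case: g gE gh cg cg' => [g|] gE gh cg cg'; last first.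
    case: h hE gh ch ch' => [h|//] hE gh ch ch'.
    case: (eqVneq h f) => [hf|hf]; last by case: (nof _ hE ch' hf).
    by move: ch; rewrite /= hf (negbTE fe) eqxx => ch; case: (B12 cg ch).
  case: h hE gh ch ch' => [h|] hE gh ch ch'; last first.
    case: (eqVneq g f) => [gf|gf]; last by case: (nof _ gE cg' gf).
    by move: cg; rewrite /= gf (negbTE fe) eqxx => cg; case: (B12 ch cg).
  have gh' : g != h by apply: contraNN gh => /eqP ->.
  exists g, h; split => //.
    split; apply/eqP => E'.
      by case: (noe (Some h) hE ch'); [rewrite /= -E' eq_sym|rewrite -E'].
    by case: (nof (Some h) hE ch'); [rewrite /= -E' eq_sym|rewrite -E'].
  split; apply/eqP => E'.
    by case: (noe (Some g) gE cg'); [rewrite /= -E'|rewrite -E'].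
  by case: (nof (Some g) gE cg'); [rewrite /= -E'|rewrite -E'].
have D' : pdraw Va' Ea' src' dst' X' pos' cv'.
  split.
  - move=> [w|] [w'|]; rewrite !inE //= => wV w'V.
    + by move/(pd_inj D wV w'V) => ->.
    + by move/(nvp wV).
    + by move/esym/(nvp w'V).
  - move=> [g|]; rewrite !inE /= => gE; last by rewrite sf.
    have [? ?] := pd_ends D gE.
    by case: eqP => _; case: eqP => _.
  - move=> [g|]; rewrite !inE /= => gE //.
    case: (eqVneq g e) => [->|ge]; first by rewrite (negbTE ef).
    by case: (eqVneq g f) => [->//|gf]; exact: (pd_arc D).
  - move=> g [w|]; rewrite !inE => gE wV cw.
    + have := pd_avoid D (oldE g _) wV (cvo _ _ cw); rewrite inE => /(_ gE).
      have nA2 q : A1 q -> q <> p -> ~ A2 q.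
        by move=> q1 qp q2; apply: qp; have : (A1 `&` A2) q by []; rewrite AI.
      have nB2 q : B1 q -> q <> p -> ~ B2 q.
        by move=> q1 qp q2; apply: qp; have : (B1 `&` B2) q by []; rewrite BI.
      have [_ a2d _] := arc_ends a2; have [b1s _ _] := arc_ends b1; have [_ b2d _] := arc_ends b2.
      case: g gE cw => [g|] gE /= cw.
        case: (eqVneq g e) cw => [ge|ge] cw.
          rewrite ge (negbTE ef); case=> [->|wd]; first by left.
          by case: (nA2 _ cw (nvp wV)); rewrite wd.
        case: (eqVneq g f) cw => [gf|gf] cw; last by case=> ->; [left|right].
        rewrite gf; case=> [ws|->]; last by right.
        by case: (nB2 (pos w)); [rewrite ws|exact: nvp|].
      case=> [->|wd]; first by left.
      by case: (nB2 _ cw (nvp wV)); rewrite wd.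
    + case: g gE cw => [g|] gE /= cw; last by right.
      case: (eqVneq g e) cw => [_|ge] cw; first by right.
      case: (eqVneq g f) cw => [_|gf] cw; first by left.
      have [gf' _] := ucross g p gE ltac:(by rewrite eq_sym) cep cw nvp.
      by rewrite gf' eqxx in gf.
  - move=> g h q gE hE gh cg ch nvq.
    have [g' [h' [[gE' hE'] [ge gf] [he hf]]]] := crossed g h q gE hE gh cg ch nvq.
    have [_ nvq'] := nv' _ nvq.
    have gh' : g' != h' by move: gh; rewrite gE' hE'; apply: contraNN => /eqP ->.
    move: gE hE cg ch; rewrite gE' hE' !inE /= (negbTE ge) (negbTE gf) (negbTE he) (negbTE hf).
    move=> gE hE cg ch; have [Xgh tr] := pd_cross D gE hE gh' cg ch nvq'.
    by split.
  - move=> g h k q r gE hE kE gh gk cgq chq cgr ckr nvq nvr.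
    have [g' [h' [[gE' hE'] [ge gf] [he hf]]]] := crossed g h q gE hE gh cgq chq nvq.
    have [g2 [k' [[gE2 kE'] _ [ke kf]]]] := crossed g k r gE kE gk cgr ckr nvr.
    have [_ nvq'] := nv' _ nvq; have [_ nvr'] := nv' _ nvr.
    have gh' : g' != h' by move: gh; rewrite gE' hE'; apply: contraNN => /eqP ->.
    have gk' : g' != k' by move: gk; rewrite gE' kE'; apply: contraNN => /eqP ->.
    move: gE hE kE cgq chq cgr ckr; rewrite gE' hE' kE' !inE /=.
    rewrite (negbTE ge) (negbTE gf) (negbTE he) (negbTE hf) (negbTE ke) (negbTE kf).
    move=> gE hE kE cgq chq cgr ckr.
    by have [-> ->] := pd_one D gE hE kE gh' gk' cgq chq cgr ckr nvq' nvr'.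
have Nab g : g \in (Ea' :\ None)%SET ->
    ~ ((src' g = Some (src f) /\ dst' g = None) \/ (src' g = None /\ dst' g = Some (src f))).
  case: g => [g|]; rewrite !inE //= => gE.
  case: (eqVneq g f) => [->|gf]; rewrite ?(negbTE fe).
    by case=> -[] // _ [] E'; have := pd_neq D fE; rewrite E' eqxx.
  case: (eqVneq g e) => [->|ge]; last by case=> -[].
  by case=> -[] // [] E' _; move: xv; rewrite E' eqxx.
have [pos2 [cv2 D2]] := @contract_edge _ _ Va' Ea' (Ea' :\ None)%SET src' dst' X' pos' cv' D' None
  (Some (src f)) None ltac:(by rewrite inE) (fun _ _ H => H) (or_introl (conj erefl erefl))
  ltac:(by []) Nab.
exists (pos2 \o Some), (cv2 \o Some).
apply: (pdraw_relabel D2).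
- by move=> ? ? _ _ [].
- by move=> ? ? _ _ [].
- by move=> w wV; rewrite !inE.
- by move=> g gE; rewrite !inE.
- move=> g gE; have [? ?] := pd_ends D gE; split => //; first by case: eqP.
  left; rewrite /= /merge_vert.
  by case: (eqVneq g f) => [->|gf] /=; [rewrite (negbTE fe)|case: (eqVneq g e) => [->|]].
- by [].
Qed.

End Uncross.

Section AddPath.
Variables (V E : finType) (Va : {set V}) (Ea : {set E}) (src dst : E -> V).
Variables (X : E -> E -> Prop) (pos : V -> P) (cv : E -> set P).
Hypothesis D : pdraw Va Ea src dst X pos cv.

Lemma arc_mid (a b : P) A : arc a b A -> exists p, [/\ A p, p != a & p != b].
Proof.
move=> [g [cg gi [g0 g1] gA Ag]]; exists (g (1/2)); split => //.
  apply/eqP; rewrite -g0; have I : inI (1/2 : R) by rewrite /inI; lra.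
  by move/(gi _ _ I (inI0 R)); lra.
apply/eqP; rewrite -g1; have I : inI (1/2 : R) by rewrite /inI; lra.
by move/(gi _ _ I (inI1 R)); lra.
Qed.

Lemma add_path (u v t : V) (e1 e2 : E) (A : set P) : u \in Va -> v \in Va -> t \notin Va ->
  e1 \notin Ea -> e2 \notin Ea -> e1 != e2 ->
  src e1 = u -> dst e1 = t -> src e2 = v -> dst e2 = t ->
  arc (pos u) (pos v) A ->
  (forall x, A x -> x <> pos u -> x <> pos v ->
    (forall w, w \in Va -> pos w <> x) /\ (forall e, e \in Ea -> ~ cv e x)) ->
  drawable R (t |: Va)%SET (e1 |: (e2 |: Ea))%SET src dst X.
Proof.
move=> uV vV tV e1E e2E e12 s1 d1 s2 d2 arcA avoid.
have [p [Ap pu pv]] := arc_mid arcA.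
have [A1 [A2 [a1 a2 AE AI]]] := arc_split arcA Ap pu pv.
have [pnv pne] := avoid p Ap (elimN eqP pu) (elimN eqP pv).
have tn w : w \in Va -> w != t by apply: contraTneq => ->.
have ut := tn _ uV; have vt := tn _ vV.
have ne1 e : e \in Ea -> e != e1 by apply: contraTneq => ->.
have ne2 e : e \in Ea -> e != e2 by apply: contraTneq => ->.
pose pos' w := if w == t then p else pos w.
pose cv' e := if e == e1 then A1 else if e == e2 then A2 else cv e.
have posV w : w \in Va -> pos' w = pos w by move=> /tn/negbTE; rewrite /pos' => ->.
have post : pos' t = p by rewrite /pos' eqxx.
have cv1 : cv' e1 = A1 by rewrite /cv' eqxx.
have cv2 : cv' e2 = A2 by rewrite /cv' eq_sym (negbTE e12) eqxx.
have cvE e : e \in Ea -> cv' e = cv e.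
  by move=> eE; rewrite /cv' (negbTE (ne1 _ eE)) (negbTE (ne2 _ eE)).
have A1A x : A1 x -> A x by rewrite AE; left.
have A2A x : A2 x -> A x by rewrite AE; right.
have A12 x : A1 x -> A2 x -> x = p.
  by move=> x1 x2; have : (A1 `&` A2) x by []; rewrite AI.
have Vx w : w \in Va -> A (pos w) -> w = u \/ w = v.
  move=> wV Aw; case: (pselect (pos w = pos u)) => [/(pd_inj D wV uV)|wu]; first by left.
  case: (pselect (pos w = pos v)) => [/(pd_inj D wV vV)|wv]; first by right.
  by have [/(_ w wV)] := avoid _ Aw wu wv.
have cross g h q : g \in (e1 |: (e2 |: Ea))%SET -> h \in (e1 |: (e2 |: Ea))%SET -> g != h ->
    cv' g q -> cv' h q -> (forall w, w \in (t |: Va)%SET -> pos' w <> q) ->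
    [/\ g \in Ea, h \in Ea, cv g q, cv h q & forall w, w \in Va -> pos w <> q].
  move=> gE hE gh cg ch nv.
  have nvq w : w \in Va -> pos w <> q.
    by move=> wV; rewrite -(posV _ wV); apply: nv; rewrite !inE wV orbT.
  have qp : q <> p by move=> E'; apply: (nv t); [rewrite !inE eqxx|rewrite post].
  have noA e : A q -> e \in Ea -> cv e q -> False.
    move=> Aq eE ce; have [] := avoid q Aq; [by move/esym; apply: nvq|by move/esym; apply: nvq|].
    by move=> _ /(_ e eE).
  move: gE hE cg ch; rewrite !inE => /or3P[/eqP gE|/eqP gE|gE] /or3P[/eqP hE|/eqP hE|hE];
    rewrite ?gE ?hE ?cv1 ?cv2 ?cvE //; move: gh; rewrite ?gE ?hE ?eqxx //= => _ cg ch.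
  - by case: qp; exact: A12.
  - by case: (noA h (A1A _ cg)).
  - by case: qp; exact: A12.
  - by case: (noA h (A2A _ cg)).
  - by case: (noA g (A1A _ ch)).
  - by case: (noA g (A2A _ ch)).
have [A1u A1p _] := arc_ends a1; have [A2p A2v _] := arc_ends a2.
exists pos', cv'; split.
- move=> w w'; rewrite !inE => /orP[/eqP ->|wV] /orP[/eqP ->|w'V] //; rewrite ?post ?posV //.
  + by move/esym/(pnv _ w'V).
  + by move/(pnv _ wV).
  + exact: (pd_inj D).
- move=> e; rewrite !inE => /or3P[/eqP ->|/eqP ->|eE].
  + by rewrite s1 d1 uV eqxx orbT.
  + by rewrite s2 d2 vV eqxx orbT.
  + by have [-> ->] := pd_ends D eE; rewrite !orbT.
- move=> e; rewrite !inE => /or3P[/eqP ->|/eqP ->|eE].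
  + by rewrite s1 d1 cv1 post posV.
  + by rewrite s2 d2 cv2 post posV //; exact: arc_rev.
  + by have [? ?] := pd_ends D eE; rewrite !posV // cvE //; exact: (pd_arc D).
- move=> e w; rewrite !inE => /or3P[/eqP ->|/eqP ->|eE] /orP[/eqP ->|wV]; rewrite ?post ?posV // ?cv1 ?cv2 ?cvE //.
  + by move=> _; right.
  + move=> A1w; case: (Vx _ wV (A1A _ A1w)) => wE; first by left; rewrite s1.
    by case: (pnv w wV); apply: A12 => //; rewrite wE.
  + by move=> _; right.
  + move=> A2w; case: (Vx _ wV (A2A _ A2w)) => wE; last by left; rewrite s2.
    by case: (pnv w wV); apply: A12 => //; rewrite wE.
  + by move/(pne _ eE).
  + exact: (pd_avoid D).
- move=> g h q gE hE gh cg ch nv; have [gE' hE' cg' ch' nvq] := cross g h q gE hE gh cg ch nv.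
  by rewrite !cvE //; exact: (pd_cross D).
- move=> g h k q r gE hE kE gh gk cgq chq cgr ckr nvq nvr.
  have [gE' hE' cg' ch' nvq'] := cross g h q gE hE gh cgq chq nvq.
  have [_ kE' cg2 ck' nvr'] := cross g k r gE kE gk cgr ckr nvr.
  exact: (pd_one D gE' hE' kE').
Qed.

(** The two arcs may meet in other points than [b]. Follow [A] backwards from [b] to its last point
    on [B]; the remainder of [A] is free of [B], and [B] leads from that point to [c]. *)
Lemma arc_join (a b c : P) (A B : set P) : arc a b A -> arc b c B -> a <> c ->
  exists2 C, arc a c C & C `<=` A `|` B.
Proof.
move=> aA aB ac; have [g [cg gi [g0 g1] gA Ag]] := arc_rev aA.
have [Bb Bc bc] := arc_ends aB.
have Bg0 : B (g 0) by rewrite g0.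
have [t [tI Bt Ht]] := last_hit cg (arc_closed aB) Bg0.
have subB x : B x -> x <> c -> exists2 B', arc x c B' & B' `<=` B.
  move=> Bx xc; case: (pselect (x = b)) => [->|xb]; first by exists B.
  have [B1 [B2 [_ b2 BE _]]] := arc_split aB Bx (introN eqP xb) (introN eqP xc).
  by exists B2 => // y; rewrite BE; right.
case: (eqVneq t 1) => [t1|t1].
  have [B' b' B'B] : exists2 B', arc a c B' & B' `<=` B by apply: subB => //; rewrite -g1 -t1.
  by exists B' => // y /B'B; right.
move: (tI) => /andP[t0 t1'].
have tl : t < 1 by rewrite lt_neqAle t1.
have A1 := arc_rev (arc_sub cg gi t0 tl (lexx 1)); rewrite g1 in A1.
case: (pselect (g t = c)) => [gc|gc].
  exists [set x | exists2 r, t <= r <= 1 & g r = x]; first by rewrite -gc.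
  by move=> _ [r _ <-]; left.
have [B' b' B'B] := subB _ Bt gc.
exists ([set x | exists2 r, t <= r <= 1 & g r = x] `|` B').
  apply: (arc_cat A1 b') => _ [[r /andP[tr r1] <-] /B'B Br] /=.
  congr g; apply/eqP; rewrite eq_le tr andbT leNgt; apply/negP => {}tr.
  exact: (Ht r).
by move=> x [[r _ <-]|/B'B]; [left|right].
Qed.

Lemma walk_arc (F : {set E}) (r : rel V) (u v : V) : F \subset Ea ->
  (forall x y, r x y -> exists2 e, e \in F &
     (src e = x /\ dst e = y) \/ (src e = y /\ dst e = x)) ->
  connect r u v -> u <> v -> u \in Va -> exists2 A, arc (pos u) (pos v) A &
     forall x, A x -> exists2 e, e \in F & cv e x.
Proof.
move=> /fintype.subsetP sF rF /connectP[s].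
elim: s u => [|w s IH] u /=; first by move=> _ -> .
case/andP=> ruw pw vE uv uV.
have [e eF ends] := rF _ _ ruw; have [sV dV] := pd_ends D (sF _ eF).
have wV : w \in Va by case: ends => -[h1 h2]; rewrite -?h2 // -h1.
have aE : arc (pos u) (pos w) (cv e).
  by have := pd_arc D (sF _ eF); case: ends => -[-> ->] //; exact: arc_rev.
case: (pselect (w = v)) => [<-|wv]; first by exists (cv e) => // x cx; exists e.
have [B aB BF] := IH w pw vE wv wV.
have vV : v \in Va.
  rewrite vE; move: pw wV {IH vE wv aB BF uv}; elim: s w {ruw ends aE} => //= y s IH w /andP[rwy py] wV.
  apply: IH => //; have [k kF ends'] := rF _ _ rwy; have [? ?] := pd_ends D (sF _ kF).
  by case: ends' => -[h1 h2]; rewrite -?h2 // -h1.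
have puv : pos u <> pos v by move/(pd_inj D uV vV).
have [C aC CAB] := arc_join aE aB puv.
by exists C => // x /CAB[cx|/BF]; [exists e|].
Qed.

End AddPath.
End EdgeOperations.

(** * Sums of drawings *)

Section Gluing.
Variable R : realType.
Local Notation P := (R * R)%type.

Lemma cont_scalev_at (T : topologicalType) (f : T -> R) (F : T -> P) (x : T) :
  {for x, continuous f} -> {for x, continuous F} -> {for x, continuous (fun t => f t *: F t)}.
Proof.
move=> cf cF.
have h1 : f t * (F t).1 @[t --> x] --> f x * (F x).1.
  by apply: (cvgM cf); apply: (continuous_comp cF); exact: cvg_fst.
have h2 : f t * (F t).2 @[t --> x] --> f x * (F x).2.
  by apply: (cvgM cf); apply: (continuous_comp cF); exact: cvg_snd.
exact: (cvg_pair h1 h2).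
Qed.

Definition off0 : set P := [set x | x <> 0].

Lemma off0_open : open off0.
Proof.
apply/open_plane => x x0; exists `|x|; first by rewrite normr_gt0; apply/eqP.
by move=> y; case: (pselect (y = 0)) => [->|//]; rewrite subr0 ltxx.
Qed.

Lemma open_of_inverse (psi phi : P -> P) :
  (forall x, off0 x -> off0 (psi x)) -> (forall y, off0 y -> off0 (phi y)) ->
  (forall x, off0 x -> phi (psi x) = x) -> (forall y, off0 y -> psi (phi y) = y) ->
  (forall y, off0 y -> {for y, continuous phi}) ->
  forall U, open U -> U `<=` off0 -> open (psi @` U).
Proof.
move=> H1 H2 K1 K2 cphi U oU UO; apply/open_plane => _ [x Ux <-].
have y0 := H1 _ (UO _ Ux).
have : nbhs (phi (psi x)) U by rewrite K1; [apply: open_nbhs_nbhs|exact: UO].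
move/(cphi _ y0) => /nbhs_plane[d d0 dU].
have [e e0 eO] := (open_plane _).1 off0_open _ y0.
exists (Num.min d e); first by rewrite lt_min d0 e0.
move=> y; rewrite lt_min => /andP[yd ye].
by exists (phi y); [exact: dU|apply: K2; exact: eO].
Qed.

(** Keeps the direction of [m z] but prescribes the norm r |z|. A positively homogeneous
    homeomorphism thereby becomes one that takes circles around the origin to such circles. *)
Definition ray_map (m : P -> P) (r : R) (z : P) : P := (r * `|z| / `|m z|) *: m z.

Lemma ray_map_norm (m : P -> P) r z : 0 < r -> m z <> 0 -> `|ray_map m r z| = r * `|z|.
Proof.
move=> r0 mz; have mp : 0 < `|m z| by rewrite normr_gt0; apply/eqP.
rewrite /ray_map normrZ ger0_norm; first by rewrite divfK // gt_eqF.
by rewrite divr_ge0 // mulr_ge0 // ltW.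
Qed.

Lemma ray_map_cont (m : P -> P) r (z : P) : continuous m -> m z <> 0 ->
  {for z, continuous (ray_map m r)}.
Proof.
move=> cm mz; apply: cont_scalev_at; last exact: cm.
apply: cvgM.
  apply: cvgM; first exact: cvg_cst.
  exact: norm_continuous.
apply: cvgV; first by rewrite normr_eq0; apply/eqP.
by apply: (continuous_comp (cm z)); exact: norm_continuous.
Qed.

Lemma ray_mapK (m m' : P -> P) r (z : P) : 0 < r -> m z <> 0 -> z <> 0 -> m' (m z) = z ->
  (forall c z, 0 < c -> m' (c *: z) = c *: m' z) -> ray_map m' r^-1 (ray_map m r z) = z.
Proof.
move=> r0 mz z0 mK hm'.
have mp : 0 < `|m z| by rewrite normr_gt0; apply/eqP.
have zp : 0 < `|z| by rewrite normr_gt0; apply/eqP.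
have c0 : 0 < r * `|z| / `|m z| by rewrite divr_gt0 // mulr_gt0.
rewrite {1}/ray_map ray_map_norm // mulKf ?gt_eqF // /ray_map hm' // mK.
move: (r * `|z| / `|m z|) c0 => c c0.
rewrite scalerA normrZ gtr0_norm //.
have -> : `|z| / (c * `|z|) * c = 1 by field; rewrite !gt_eqF.
by rewrite scale1r.
Qed.

Record polar_homeo (psi : P -> P) (rho : R) : Prop := PolarHomeo {
  ph_cont : forall x, off0 x -> {for x, continuous psi};
  ph_inj : forall x y, off0 x -> off0 y -> psi x = psi y -> x = y;
  ph_open : forall U, open U -> U `<=` off0 -> open (psi @` U);
  ph_norm : forall x, off0 x -> `|psi x| = `|x| / rho }.

Lemma ray_map_polar (k k' : P -> P) (rho : R) : 0 < rho -> continuous k -> continuous k' ->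
  (forall z, k' (k z) = z) -> (forall z, k (k' z) = z) ->
  (forall c z, 0 < c -> k (c *: z) = c *: k z) ->
  (forall c z, 0 < c -> k' (c *: z) = c *: k' z) -> k 0 = 0 -> k' 0 = 0 ->
  polar_homeo (ray_map k rho^-1) rho.
Proof.
move=> rho0 ck ck' kk kk' hk hk' k0 k'0.
have rV0 : 0 < rho^-1 by rewrite invr_gt0.
have nk z : off0 z -> k z <> 0 by move=> z0 E; apply: z0; rewrite -(kk z) E.
have nk' z : off0 z -> k' z <> 0 by move=> z0 E; apply: z0; rewrite -(kk' z) E.
have K1 x : off0 x -> ray_map k' rho (ray_map k rho^-1 x) = x.
  by move=> x0; rewrite -{1}(invrK rho) ray_mapK //; exact: nk.
have K2 x : off0 x -> ray_map k rho^-1 (ray_map k' rho x) = x.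
  by move=> x0; rewrite ray_mapK //; exact: nk'.
have n1 x : off0 x -> `|ray_map k rho^-1 x| = rho^-1 * `|x|.
  by move=> x0; rewrite ray_map_norm //; exact: nk.
have n2 x : off0 x -> `|ray_map k' rho x| = rho * `|x|.
  by move=> x0; rewrite ray_map_norm //; exact: nk'.
have nz (x : P) : off0 x -> 0 < `|x| by move=> x0; rewrite normr_gt0; apply/eqP.
have z1 x : off0 x -> off0 (ray_map k rho^-1 x).
  by move=> x0; apply/eqP; rewrite -normr_gt0 n1 // mulr_gt0 // nz.
have z2 x : off0 x -> off0 (ray_map k' rho x).
  by move=> x0; apply/eqP; rewrite -normr_gt0 n2 // mulr_gt0 // nz.
split.
- by move=> x x0; apply: ray_map_cont => //; exact: nk.
- by move=> x y x0 y0 E; rewrite -(K1 _ x0) E K1.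
- apply: (@open_of_inverse _ (ray_map k' rho)).
  + exact: z1.
  + exact: z2.
  + exact: K1.
  + exact: K2.
  + by move=> y y0; apply: ray_map_cont; [exact: ck'|exact: nk'].
- by move=> x x0; rewrite n1 // mulrC.
Qed.

Definition corner (b : bool) : P := if b then (1, 0) else (0, 1).

Lemma corner_norm b : `|corner b| = 1.
Proof.
by case: b; rewrite /corner pnorm /= normr0 normr1; [apply/max_idPl|apply/max_idPr].
Qed.

(** Independent points are sent to the two corners by a linear map and opposite points by a
    piecewise linear one; the norms are then corrected by [ray_map]. Two dependent points of equal
    norm that differ are opposite. *)
Lemma polar_straighten (p q : P) (rho : R) : 0 < rho -> `|p| = rho -> `|q| = rho -> p <> q ->
  exists psi, [/\ polar_homeo psi rho, psi p = corner true & psi q = corner false].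
Proof.
move=> rho0 np nq pq.
have cf : continuous (fun z : P => z.1) by apply: cont_fst; exact: cont_id.
have cs : continuous (fun z : P => z.2) by apply: cont_snd; exact: cont_id.
have fin (k k' : P -> P) : continuous k -> continuous k' ->
    (forall z, k' (k z) = z) -> (forall z, k (k' z) = z) ->
    (forall c z, 0 < c -> k (c *: z) = c *: k z) ->
    (forall c z, 0 < c -> k' (c *: z) = c *: k' z) -> k 0 = 0 -> k' 0 = 0 ->
    k p = corner true -> k q = corner false ->
    exists psi, [/\ polar_homeo psi rho, psi p = corner true & psi q = corner false].
  move=> ck ck' kk kk' hk hk' k0 k'0 kp kq; exists (ray_map k rho^-1); split.
  - exact: (@ray_map_polar k k').
  - by rewrite /ray_map kp np mulVf ?gt_eqF // corner_norm divr1 scale1r.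
  - by rewrite /ray_map kq nq mulVf ?gt_eqF // corner_norm divr1 scale1r.
pose dt := p.1 * q.2 - p.2 * q.1.
case: (eqVneq dt 0) => [dt0|dt0]; last first.
  apply: (fin (fun z => ((z.1 * q.2 - z.2 * q.1) / dt, (p.1 * z.2 - p.2 * z.1) / dt))
              (fun z => (z.1 * p.1 + z.2 * q.1, z.1 * p.2 + z.2 * q.2))).
  - by apply: cont_pair; (apply: cont_mul; last exact: cont_cst); apply: cont_add;
      [apply: cont_mul|apply: cont_opp; apply: cont_mul|apply: cont_mul|apply: cont_opp; apply: cont_mul] => //; exact: cont_cst.
  - by apply: cont_pair; apply: cont_add; apply: cont_mul => //; exact: cont_cst.
  - by move=> z; apply: pext => /=; rewrite /dt in dt0 *; field.
  - by move=> z; apply: pext => /=; rewrite /dt in dt0 *; field.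
  - by move=> c z _; apply: pext; rewrite !pE /=; ring.
  - by move=> c z _; apply: pext; rewrite !pE /=; ring.
  - by apply: pext => /=; ring.
  - by apply: pext => /=; ring.
  - by apply: pext => /=; rewrite /dt in dt0 *; field.
  - by apply: pext => /=; rewrite /dt in dt0 *; field.
have p0 : p != 0 by rewrite -normr_gt0 np.
pose n2 := p.1 * p.1 + p.2 * p.2.
have n20 : n2 != 0.
  apply/eqP => E; case/eqP: p0.
  have h1 := sqr_ge0 p.1; have h2 := sqr_ge0 p.2.
  have e1 : p.1 ^+ 2 = 0 by apply/eqP; rewrite eq_le h1 andbT; rewrite /n2 in E; lra.
  have e2 : p.2 ^+ 2 = 0 by apply/eqP; rewrite eq_le h2 andbT; rewrite /n2 in E; lra.
  by apply: pext; apply/eqP; rewrite -[_ == _](expf_eq0 _ 2) ?e1 ?e2.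
have qp : q = - p.
  pose l := (q.1 * p.1 + q.2 * p.2) / n2.
  have ql : q = l *: p.
    apply: pext; rewrite !pE /l.
      have h : q.1 * n2 = (q.1 * p.1 + q.2 * p.2) * p.1 - p.2 * dt by rewrite /n2 /dt; ring.
      by rewrite dt0 mulr0 subr0 in h; rewrite mulrAC -h mulfK.
    have h : q.2 * n2 = (q.1 * p.1 + q.2 * p.2) * p.2 + p.1 * dt by rewrite /n2 /dt; ring.
    by rewrite dt0 mulr0 addr0 in h; rewrite mulrAC -h mulfK.
  have : `|l| = 1.
    by apply: (@mulIf _ rho); rewrite ?gt_eqF // mul1r -{1}np -normrZ -ql.
  case: (lerP 0 l) => l0; first by rewrite ger0_norm // => l1; case: pq; rewrite ql l1 scale1r.
  by rewrite ltr0_norm // => l1; rewrite ql -[l]opprK l1 scaleN1r.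
pose x (z : P) := (z.1 * p.1 + z.2 * p.2) / n2.
pose y (z : P) := (p.1 * z.2 - p.2 * z.1) / n2.
have cx : continuous x.
  apply: cont_mul; last exact: cont_cst.
  by apply: cont_add; apply: cont_mul => //; exact: cont_cst.
have cy : continuous y.
  apply: cont_mul; last exact: cont_cst.
  by apply: cont_add; [|apply: cont_opp]; apply: cont_mul => //; exact: cont_cst.
have abs_hom c z : 0 < c -> `|c * z| = c * `|z| :> R by move=> c0; rewrite normrM gtr0_norm.
have half (a : R) : a / 2 + a / 2 = a by lra.
(* For opposite points no linear map will do. This map bends the line through [p] and [q] onto the
   two positive half-axes. Its inverse recovers x as the difference of the coordinates and y as
   their sum minus |x|. *)
apply: (fin (fun z => ((x z + y z + `|x z|) / 2, (y z + `|x z| - x z) / 2))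
  (fun z => ((z.1 - z.2) * p.1 - (z.1 + z.2 - `|z.1 - z.2|) * p.2,
             (z.1 - z.2) * p.2 + (z.1 + z.2 - `|z.1 - z.2|) * p.1))).
- apply: cont_pair; (apply: cont_mul; last exact: cont_cst); apply: cont_add.
  + exact: cont_add.
  + exact: cont_abs.
  + by apply: cont_add => //; exact: cont_abs.
  + exact: cont_opp.
- have cd : continuous (fun z : P => z.1 - z.2) by apply: cont_add => //; exact: cont_opp.
  have ca : continuous (fun z : P => z.1 + z.2 - `|z.1 - z.2|).
    by apply: cont_add; [exact: cont_add|apply: cont_opp; exact: cont_abs].
  apply: cont_pair; apply: cont_add.
  + by apply: cont_mul => //; exact: cont_cst.
  + by apply: cont_opp; apply: cont_mul => //; exact: cont_cst.
  + by apply: cont_mul => //; exact: cont_cst.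
  + by apply: cont_mul => //; exact: cont_cst.
- move=> z /=.
  have -> : (x z + y z + `|x z|) / 2 - (y z + `|x z| - x z) / 2 = x z by lra.
  have -> : (x z + y z + `|x z|) / 2 + (y z + `|x z| - x z) / 2 - `|x z| = y z by lra.
  by apply: pext => /=; rewrite /x /y /n2 in n20 *; field.
- move=> z /=; set a := z.1 - z.2; set b := z.1 + z.2 - `|a|.
  have xE : x (a * p.1 - b * p.2, a * p.2 + b * p.1) = a by rewrite /x /n2 /= in n20 *; field.
  have yE : y (a * p.1 - b * p.2, a * p.2 + b * p.1) = b by rewrite /y /n2 /= in n20 *; field.
  by rewrite xE yE; apply: pext => /=; rewrite /b /a; lra.
- move=> c z c0; have xc : x (c *: z) = c * x z by rewrite /x !pE; ring.
  have yc : y (c *: z) = c * y z by rewrite /y !pE; ring.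
  by rewrite xc yc abs_hom //; apply: pext; rewrite !pE /=; ring.
- move=> c z c0; rewrite !pE.
  have -> : c * z.1 - c * z.2 = c * (z.1 - z.2) by ring.
  by rewrite abs_hom //; apply: pext; rewrite !pE /=; ring.
- have x0 : x 0 = 0 by rewrite /x /=; ring.
  have y0 : y 0 = 0 by rewrite /y /=; ring.
  by rewrite x0 y0 normr0; apply: pext => /=; ring.
- by rewrite /= subrr normr0; apply: pext => /=; ring.
- have xp : x p = 1 by rewrite /x /n2 in n20 *; field.
  have yp : y p = 0 by rewrite /y /n2 in n20 *; field.
  by rewrite xp yp normr1; apply: pext => /=; lra.
- have xq : x q = -1 by rewrite qp /x /n2 /= in n20 *; field.
  have yq : y q = 0 by rewrite qp /y /n2 /= in n20 *; field.
  by rewrite xq yq normrN normr1; apply: pext => /=; lra.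
Qed.

Definition inversion (z : P) : P := (`|z| ^- 2) *: z.

Lemma inversion_norm z : off0 z -> `|inversion z| = `|z|^-1.
Proof.
move=> z0; have zp : 0 < `|z| by rewrite normr_gt0; apply/eqP.
rewrite /inversion normrZ ger0_norm; last by rewrite invr_ge0 exprn_ge0.
by rewrite expr2 invfM -mulrA mulVf ?mulr1 // gt_eqF.
Qed.

Lemma inversionK z : off0 z -> inversion (inversion z) = z.
Proof.
move=> z0; have zp : 0 < `|z| by rewrite normr_gt0; apply/eqP.
rewrite {1}/inversion inversion_norm // /inversion scalerA exprVn invrK.
by rewrite mulfV ?scale1r // expf_neq0 // gt_eqF.
Qed.

Lemma inversion_off0 z : off0 z -> off0 (inversion z).
Proof.
move=> z0; have zp : 0 < `|z| by rewrite normr_gt0; apply/eqP.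
by apply/eqP; rewrite -normr_gt0 inversion_norm // invr_gt0.
Qed.

Lemma inversion_cont z : off0 z -> {for z, continuous inversion}.
Proof.
move=> z0; have zp : 0 < `|z| by rewrite normr_gt0; apply/eqP.
apply: cont_scalev_at; last exact: cvg_id.
apply: cvgV; first by rewrite expf_neq0 // gt_eqF.
by rewrite /continuous_at expr2; apply: cvgM; exact: norm_continuous.
Qed.

(* A drawing from which a small disc around the vertex t has been removed: the
   edges ending at t now end at the points c e on the boundary of the region. *)
Record opened (V E : finType) (Va : {set V}) (Ea : {set E}) (src dst : E -> V)
    (X : E -> E -> Prop) (t : V) (out : set P) (c : E -> P)
    (pos : V -> P) (cv : E -> set P) : Prop := Opened {
  op_inj : {in Va :\ t &, injective pos};
  op_out : forall w, w \in Va -> w != t -> out (pos w);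
  op_ends : forall e, e \in Ea -> [/\ src e \in Va, dst e \in Va & src e != t];
  op_arc : forall e, e \in Ea ->
    arc (pos (src e)) (if dst e == t then c e else pos (dst e)) (cv e);
  op_sub : forall e x, e \in Ea -> cv e x -> out x \/ (dst e = t /\ x = c e);
  op_nout : forall e, e \in Ea -> dst e = t -> ~ out (c e);
  op_avoid : forall e w, e \in Ea -> w \in Va -> w != t -> cv e (pos w) ->
    w = src e \/ w = dst e;
  op_cross : forall e f p, e \in Ea -> f \in Ea -> e != f -> cv e p -> cv f p -> out p ->
    (forall w, w \in Va -> w != t -> pos w <> p) ->
    X e f /\ transversal_at (R := R) p (cv e) (cv f);
  op_one : forall e f g p q, e \in Ea -> f \in Ea -> g \in Ea -> e != f -> e != g ->
    cv e p -> cv f p -> cv e q -> cv g q -> out p -> out q ->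
    (forall w, w \in Va -> w != t -> pos w <> p) ->
    (forall w, w \in Va -> w != t -> pos w <> q) -> f = g /\ p = q }.

Lemma opened_transport (V E : finType) (Va : {set V}) (Ea : {set E}) (src dst : E -> V)
    (X : E -> E -> Prop) (t : V) (out out' O : set P) (c : E -> P)
    (pos : V -> P) (cv : E -> set P) (psi : P -> P) :
  opened Va Ea src dst X t out c pos cv -> open O ->
  (forall x, O x -> {for x, continuous psi}) ->
  (forall x y, O x -> O y -> psi x = psi y -> x = y) ->
  (forall U, open U -> U `<=` O -> open (psi @` U)) ->
  out `<=` O -> (forall e, e \in Ea -> dst e = t -> O (c e)) ->
  (forall x, O x -> out' (psi x) <-> out x) ->
  opened Va Ea src dst X t out' (psi \o c) (psi \o pos) (fun e => psi @` cv e).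
Proof.
move=> D oO cpsi ipsi opsi outO cO outE.
have cvO e x : e \in Ea -> cv e x -> O x.
  by move=> eE /(op_sub D eE)[/outO //|[dt ->]]; exact: cO.
have posO w : w \in Va -> w != t -> O (pos w) by move=> wV wt; apply: outO; exact: (op_out D).
have cvE e x : e \in Ea -> O x -> (psi @` cv e) (psi x) <-> cv e x.
  move=> eE Ox; split=> [[y cy yx]|cx]; last by exists x.
  by rewrite -(ipsi _ _ (cvO _ _ eE cy) Ox yx).
have cross e f p : e \in Ea -> f \in Ea -> (psi @` cv e) p -> (psi @` cv f) p -> out' p ->
    (forall w, w \in Va -> w != t -> psi (pos w) <> p) -> exists x,
    [/\ psi x = p, cv e x, cv f x, out x & forall w, w \in Va -> w != t -> pos w <> x].
  move=> eE fE [x cx <-] [y cy yx] o' nv; exists x.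
  have Ox := cvO _ _ eE cx; split => //.
  - by rewrite -(ipsi _ _ (cvO _ _ fE cy) Ox yx).
  - by apply/(outE _ Ox).
  - by move=> w wV wt wx; apply: (nv w wV wt); rewrite wx.
split.
- move=> w w'; rewrite !inE => /andP[wt wV] /andP[w't w'V] /= E'.
  by apply: (op_inj D); rewrite ?inE ?wt ?w't //; apply: ipsi => //; exact: posO.
- by move=> w wV wt /=; apply/outE; [exact: posO|exact: (op_out D)].
- exact: (op_ends D).
- move=> e eE /=; have := op_arc D eE.
  have -> : (if dst e == t then psi (c e) else psi (pos (dst e))) =
      psi (if dst e == t then c e else pos (dst e)) by case: ifP.
  apply: arc_image; first by move=> x cx; apply: cpsi; exact: (cvO e).
  by move=> x y cx cy; apply: ipsi; exact: (cvO e).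
- move=> e _ eE [x cx <-]; have Ox := cvO _ _ eE cx.
  by case: (op_sub D eE cx) => [ox|[dt ->]]; [left; apply/outE|right].
- by move=> e eE dt /=; rewrite outE; [exact: (op_nout D)|exact: cO].
- move=> e w eE wV wt /= cw; apply: (op_avoid D) => //.
  by apply/cvE => //; exact: posO.
- move=> e f p eE fE ef ce cf op nv.
  have [x [xp cx cx' ox nvx]] := cross e f p eE fE ce cf op nv.
  have [Xef tr] := op_cross D eE fE ef cx cx' ox nvx; split => //; rewrite -xp.
  apply: (@transversal_transport R psi O x (cv e) (cv f)) => //.
  + exact: outO.
  + by move=> y Oy; exact: cvE.
  + by move=> y Oy; exact: cvE.
- move=> e f g p q eE fE gE ef eg cep cfp ceq cgq op oq nvp nvq.
  have [x [xp cx cx' ox nvx]] := cross e f p eE fE cep cfp op nvp.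
  have [y [yq cy cy' oy nvy]] := cross e g q eE gE ceq cgq oq nvq.
  have [-> xy] := op_one D eE fE gE ef eg cx cx' cy cy' ox oy nvx nvy.
  by rewrite -xp -yq xy.
Qed.

Section OpenVertex.
Variables (V E : finType) (Va : {set V}) (Ea : {set E}) (src dst : E -> V).
Variables (X : E -> E -> Prop) (pos : V -> P) (cv : E -> set P).
Hypothesis D : pdraw Va Ea src dst X pos cv.
Variables (t : V) (lab : E -> bool).
Hypotheses (tV : t \in Va) (srct : forall e, e \in Ea -> src e != t).
Hypothesis lab_inj : forall e f, e \in Ea -> f \in Ea -> dst e = t -> dst f = t ->
  lab e = lab f -> e = f.

(** The label is a boolean and is injective on the edges at [t], so there are at most two of them.
    Cut at a small circle, they end in at most two points, which [polar_straighten] moves to the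
    corners; every opened drawing gets the same boundary in this way. *)
Lemma open_vertex : exists pos' cv',
  opened Va Ea src dst X t [set x | 1 < `|x|] (corner \o lab) pos' cv'.
Proof.
have [rho [rr [A [[rho0 _] HV Hn Ha]]]] := radial_open D tV (@ltr01 R).
have at_t e : e \in Ea -> at_vert src dst t e = (dst e == t).
  by move=> eE; rewrite /at_vert (negbTE (srct eE)).
have oth e : e \in Ea -> other_end src dst t e = src e.
  by move=> eE; rewrite /other_end (negbTE (srct eE)).
have rdist := @radial_distinct R V E Va Ea src dst pos cv t rho rr A rho0 HV
  ltac:(by move=> e eE ae; have [] := Ha e eE ae).
pose cv1 e := if dst e == t then A e else cv e.
have cv1s e x : e \in Ea -> cv1 e x -> cv e x.
  rewrite /cv1 => eE; case: ifPn => // dt.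
  by have [_ [_ Ac] _ _ _] := Ha e eE ltac:(by rewrite at_t); exact: Ac.
have loc e x : e \in Ea -> cv1 e x -> rho < `|pos t - x| ->
    exists W : set P, [/\ open W, W x & forall y, W y -> cv1 e y <-> cv e y].
  rewrite /cv1 => eE; case: ifPn => dt; last first.
    by exists setT; split => //; exact: openT.
  have [nr _ _ _ [_ Al]] := Ha e eE ltac:(by rewrite at_t).
  move=> Ax xr; have xn : x <> rr e by move=> xe; move: xr; rewrite xe nr ltxx.
  by have [W [oW Wx WH]] := Al _ Ax xn; exists W; split => // y Wy; rewrite (WH _ Wy).
have nvt p : rho < `|pos t - p| -> (forall w, w \in Va -> w != t -> pos w <> p) ->
    forall w, w \in Va -> pos w <> p.
  move=> pr nv w wV; case: (eqVneq w t) => [->|wt]; last exact: nv.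
  by move=> E'; move: pr; rewrite E' subrr normr0; lra.
have D1 : opened Va Ea src dst X t [set x | rho < `|pos t - x|] rr pos cv1.
  split.
  - by move=> w w'; rewrite !inE => /andP[_ wV] /andP[_ w'V]; exact: (pd_inj D).
  - by move=> w wV wt; exact: HV.
  - by move=> e eE; have [? ?] := pd_ends D eE; split => //; exact: srct.
  - move=> e eE; rewrite /cv1; case: ifPn => dt; last exact: (pd_arc D).
    have [_ [arcA _] _ _ _] := Ha e eE ltac:(by rewrite at_t).
    by rewrite oth // in arcA; exact: arc_rev.
  - move=> e x eE; rewrite /cv1; case: ifPn => [/eqP dt|dt] cx; last first.
      by left; apply: (Hn e) => //; rewrite at_t.
    have [nr _ Ar _ _] := Ha e eE ltac:(by rewrite at_t ?dt).
    case: (lerP `|pos t - x| rho) => xr; last by left.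
    by right; split => //; exact: Ar.
  - move=> e eE dt /=; have [-> _ _ _ _] := Ha e eE ltac:(by rewrite at_t ?dt).
    by rewrite ltxx.
  - by move=> e w eE wV wt /(cv1s _ _ eE); exact: (pd_avoid D).
  - move=> e f p eE fE ef ce cf op nv.
    have [Xef tr] := pd_cross D eE fE ef (cv1s _ _ eE ce) (cv1s _ _ fE cf) (nvt _ op nv).
    split => //.
    have [W1 [oW1 W1p W1H]] := loc _ _ eE ce op.
    have [W2 [oW2 W2p W2H]] := loc _ _ fE cf op.
    apply: (@transversal_local R (W1 `&` W2) p (cv e) (cv f)) => //.
    + exact: openI.
    + by move=> y [W1y _]; exact: W1H.
    + by move=> y [_ W2y]; exact: W2H.
  - move=> e f g p q eE fE gE ef eg cep cfp ceq cgq op oq nvp nvq.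
    by apply: (pd_one D eE fE gE ef eg) => //; try exact: nvt; exact: cv1s.
(* A label that no edge bears is assigned the point opposite to the other one, so that two distinct
   points are always available. *)
have [r [rt rf rne]] : exists r : bool -> P, [/\ forall b, `|r b| = rho, r true <> r false &
    forall e, e \in Ea -> dst e = t -> rr e - pos t = r (lab e)].
  have nrr e : e \in Ea -> dst e = t -> `|rr e - pos t| = rho.
    by move=> eE dt; have [<- _ _ _ _] := Ha e eE ltac:(by rewrite at_t ?dt); rewrite distrC.
  have nneg (p : P) : `|p| = rho -> - p <> p.
    move=> np E'; have : p + p = 0 by rewrite -{2}E' subrr.
    move/eqP; rewrite -mulr2n -scaler_nat scaler_eq0 pnatr_eq0 /= => /eqP p0.
    by move: np; rewrite p0 normr0; lra.
  case: (pselect (exists e, [/\ e \in Ea, dst e = t & lab e])) => [[e [eE et el]]|nT];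
  case: (pselect (exists f, [/\ f \in Ea, dst f = t & ~~ lab f])) => [[f [fE ft fl]]|nF].
  - exists (fun b => if b then rr e - pos t else rr f - pos t); split.
    + by case; exact: nrr.
    + move/addIr; apply: rdist => //; rewrite ?at_t ?et ?ft //.
      by apply/eqP => E'; move: fl; rewrite -E' el.
    + move=> g gE gt; case: ifPn => gl.
        by rewrite (lab_inj gE eE gt et) // gl el.
      by rewrite (lab_inj gE fE gt ft) // (negbTE gl) (negbTE fl).
  - exists (fun b => if b then rr e - pos t else - (rr e - pos t)); split.
    + by case; rewrite ?normrN; exact: nrr.
    + by move/esym/nneg; apply; exact: nrr.
    + move=> g gE gt; case: ifPn => gl; first by rewrite (lab_inj gE eE gt et) // gl el.
      by case: nF; exists g.
  - exists (fun b => if b then - (rr f - pos t) else rr f - pos t); split.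
    + by case; rewrite ?normrN; exact: nrr.
    + by move/nneg; apply; exact: nrr.
    + move=> g gE gt; case: ifPn => gl; first by case: nT; exists g.
      by rewrite (lab_inj gE fE gt ft) // (negbTE gl) (negbTE fl).
  - exists (fun b => if b then (rho, 0) else - (rho, 0)); split.
    + case; rewrite ?normrN pnorm /= normr0 gtr0_norm //; apply/max_idPl; exact: ltW.
    + by move/esym/nneg; apply; rewrite pnorm /= normr0 gtr0_norm //; apply/max_idPl; exact: ltW.
    + by move=> g gE gt; case: (boolP (lab g)) => gl; [case: nT|case: nF]; exists g.
have [psi [H psit psif]] := polar_straighten rho0 (rt true) (rt false) rf.
pose tr (z : P) := z - pos t.
have ctr : continuous tr.
  by apply: cont_addv; [exact: cont_id|exact: cont_cstv].
have D2 : opened Va Ea src dst X t [set x | rho < `|x|] (tr \o rr) (tr \o pos) (fun e => tr @` cv1 e).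
  apply: (opened_transport (O := setT) D1) => //.
  - exact: openT.
  - by move=> x _; exact: ctr.
  - by move=> x y _ _ /addIr.
  - move=> U oU _; have -> : tr @` U = (fun z => z + pos t) @^-1` U.
      apply/seteqP; split=> [_ [z Uz <-]|z Uz]; first by rewrite /preimage /= /tr subrK.
      by exists (z + pos t) => //; rewrite /tr addrK.
    apply: open_comp => // z _.
    by apply: cont_addv; [exact: cont_id|exact: cont_cstv].
  - by move=> x _ /=; rewrite /tr distrC.
have out0 (x : P) : rho < `|x| -> off0 x.
  by move=> xr x0; move: xr; rewrite x0 normr0; lra.
have D3 : opened Va Ea src dst X t [set x | 1 < `|x|] (psi \o (tr \o rr)) (psi \o (tr \o pos))
    (fun e => psi @` (tr @` cv1 e)).
  apply: (opened_transport (O := off0) D2).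
  - exact: off0_open.
  - exact: (ph_cont H).
  - exact: (ph_inj H).
  - exact: (ph_open H).
  - by move=> x; exact: out0.
  - move=> e eE et /= E'; have := rt (lab e); rewrite -(rne e eE et) -/(tr (rr e)) E' normr0; lra.
  - by move=> x x0 /=; rewrite (ph_norm H x0) ltr_pdivlMr // mul1r.
exists (psi \o (tr \o pos)), (fun e => psi @` (tr @` cv1 e)).
have cE e : e \in Ea -> dst e = t -> psi (tr (rr e)) = corner (lab e).
  by move=> eE et; rewrite /tr rne //; case: (lab e).
case: D3 => i1 i2 i3 i4 i5 i6 i7 i8 i9; split => //.
- by move=> e eE; have := i4 e eE; case: eqP => // et /=; rewrite cE.
- by move=> e x eE cx; case: (i5 e x eE cx) => [|[et ->]]; [left|right; rewrite /= cE].
- by move=> e eE et /=; rewrite -cE //; exact: i6.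
Qed.

(** The inversion exchanges the two sides of the unit circle and fixes both corners. Its image is at
    first the punctured disc; since no curve passes through the origin, the whole disc can take its
    place. *)
Lemma open_vertex_inside : exists pos' cv',
  opened Va Ea src dst X t [set x | `|x| < 1] (corner \o lab) pos' cv' /\
  forall w, w \in Va -> w != t -> off0 (pos' w).
Proof.
have [pos' [cv' D']] := open_vertex.
have out0 (x : P) : 1 < `|x| -> off0 x.
  by move=> xr x0; move: xr; rewrite x0 normr0; lra.
exists (inversion \o pos'), (fun e => inversion @` cv' e); split; last first.
  by move=> w wV wt; apply: inversion_off0; apply: out0; exact: (op_out D').
have c0 b : off0 (corner b) by apply/eqP; rewrite -normr_gt0 corner_norm.
have D2 : opened Va Ea src dst X t [set x | `|x| < 1 /\ x <> 0] (inversion \o (corner \o lab))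
    (inversion \o pos') (fun e => inversion @` cv' e).
  apply: (opened_transport (O := off0) D').
  - exact: off0_open.
  - exact: inversion_cont.
  - by move=> x y x0 y0 E'; rewrite -(inversionK x0) E' inversionK.
  - apply: (@open_of_inverse _ inversion).
    + exact: inversion_off0.
    + exact: inversion_off0.
    + exact: inversionK.
    + exact: inversionK.
    + exact: inversion_cont.
  - by move=> x; exact: out0.
  - by move=> e eE et; exact: c0.
  - move=> x x0 /=; have zp : 0 < `|x| by rewrite normr_gt0; apply/eqP.
    rewrite inversion_norm // invf_lt1 //.
    by split=> [[]//|]; split => //; exact: inversion_off0.
have cE b : inversion (corner b) = corner b.
  by rewrite /inversion corner_norm expr1n invr1 scale1r.
have nz e x : e \in Ea -> (inversion @` cv' e) x -> x <> 0.
  move=> eE /(op_sub D2 eE)[[]//|[_ ->]].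
  by rewrite /= cE; exact: c0.
case: D2 => i1 i2 i3 i4 i5 i6 i7 i8 i9; split => //.
- by move=> w wV wt; have [] := i2 w wV wt.
- by move=> e eE; have := i4 e eE; case: eqP => // et /=; rewrite cE.
- by move=> e x eE cx; case: (i5 e x eE cx) => [[]|[et ->]]; [left|right; rewrite /= cE].
- by move=> e eE et /=; rewrite corner_norm ltxx.
- by move=> e f p eE fE ef ce cf op nv; apply: i8 => //; split => //; exact: (nz e).
- move=> e f g p q eE fE gE ef eg cep cfp ceq cgq op oq nvp nvq.
  by apply: (i9 e f g) => //; split => //; exact: (nz e).
Qed.

End OpenVertex.

End Gluing.
Arguments corner R b : simpl never.

(** * Gluing two drawings and sums along at most two vertices *)

Section Sums.
Variable R : realType.
Local Notation P := (R * R)%type.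

Section Glue.
Variables (V1 E1 : finType) (Va1 : {set V1}) (Ea1 : {set E1}) (s1 d1 : E1 -> V1).
Variables (X1 : E1 -> E1 -> Prop) (t1 : V1) (lab1 : E1 -> bool).
Variables (V2 E2 : finType) (Va2 : {set V2}) (Ea2 : {set E2}) (s2 d2 : E2 -> V2).
Variables (X2 : E2 -> E2 -> Prop) (t2 : V2) (lab2 : E2 -> bool).
Hypotheses (D1 : drawable R Va1 Ea1 s1 d1 X1) (D2 : drawable R Va2 Ea2 s2 d2 X2).
Hypotheses (t1V : t1 \in Va1) (t2V : t2 \in Va2).
Hypotheses (s1t : forall e, e \in Ea1 -> s1 e != t1) (s2t : forall e, e \in Ea2 -> s2 e != t2).
Hypothesis lab1_inj : forall e f, e \in Ea1 -> f \in Ea1 -> d1 e = t1 -> d1 f = t1 ->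
  lab1 e = lab1 f -> e = f.
Hypothesis lab2_inj : forall e f, e \in Ea2 -> f \in Ea2 -> d2 e = t2 -> d2 f = t2 ->
  lab2 e = lab2 f -> e = f.

Definition glue_port (b : bool) : V1 + V2 := if b then inl t1 else inr t2.
Definition glue_src (e : E1 + E2) : V1 + V2 :=
  match e with inl e => inl (s1 e) | inr e => inr (s2 e) end.
Definition glue_dst (e : E1 + E2) : V1 + V2 :=
  match e with
  | inl e => if d1 e == t1 then glue_port (lab1 e) else inl (d1 e)
  | inr e => if d2 e == t2 then glue_port (lab2 e) else inr (d2 e)
  end.
Definition glue_cross (e f : E1 + E2) : Prop :=
  match e, f with
  | inl e, inl f => X1 e f | inr e, inr f => X2 e f | _, _ => False
  end.
Definition glue_vert : {set V1 + V2} :=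
  [set w | match w with inl w => w \in Va1 | inr w => w \in Va2 end]%SET.
Definition glue_edge : {set E1 + E2} :=
  [set e | match e with inl e => e \in Ea1 | inr e => e \in Ea2 end]%SET.

(* The vertices t1 and t2 are opened up, the second drawing is placed inside
   the disc left free by t1, and the two points where the edges of t1 meet those
   of t2 take over the names of t1 and t2. *)
Lemma glue_drawable : drawable R glue_vert glue_edge glue_src glue_dst glue_cross.
Proof.
have [p1' [c1' O1']] := D1; have [p2' [c2' O2']] := D2.
have [pos1 [cv1 O1]] := open_vertex O1' t1V s1t lab1_inj.
have [pos2 [cv2 [ O2 _]]] := open_vertex_inside O2' t2V s2t lab2_inj.
pose pos (w : V1 + V2) := match w with
  | inl w => if w == t1 then corner R true else pos1 w
  | inr w => if w == t2 then corner R false else pos2 w end.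
pose cv (e : E1 + E2) := match e with inl e => cv1 e | inr e => cv2 e end.
have nc b : `|corner R b| = 1 by exact: corner_norm.
have cne : corner R true <> corner R false.
  by case=> /eqP; rewrite oner_eq0.
have ppos b : pos (glue_port b) = corner R b by case: b; rewrite /= eqxx.
have pV b : glue_port b \in glue_vert by case: b; rewrite inE.
have out1 w : w \in Va1 -> w != t1 -> 1 < `|pos1 w| by exact: (op_out O1).
have out2 w : w \in Va2 -> w != t2 -> `|pos2 w| < 1 by exact: (op_out O2).
have sub1 e x : e \in Ea1 -> cv1 e x -> 1 < `|x| \/ (d1 e = t1 /\ x = corner R (lab1 e)).
  exact: (op_sub O1).
have sub2 e x : e \in Ea2 -> cv2 e x -> `|x| < 1 \/ (d2 e = t2 /\ x = corner R (lab2 e)).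
  exact: (op_sub O2).
have onlyport e w : e \in glue_edge -> w \in glue_vert -> cv e (pos w) -> `|pos w| = 1 ->
    w = glue_dst e.
  have portw x b : x \in glue_vert -> pos x = corner R b -> x = glue_port b.
    case: x => x; rewrite inE => xV; rewrite /pos.
      case: (eqVneq x t1) => [->|xt] E'; last by have := out1 _ xV xt; rewrite E' nc ltxx.
      by case: b E' => // /cne.
    case: (eqVneq x t2) => [->|xt] E'; last by have := out2 _ xV xt; rewrite E' nc ltxx.
    by case: b E' => // /esym/cne.
  case: e => e; rewrite inE => eE wV cw nw; rewrite /=.
    case: (sub1 _ _ eE cw) => [|[-> E']]; first by rewrite nw ltxx.
    by rewrite eqxx; exact: portw.
  case: (sub2 _ _ eE cw) => [|[-> E']]; first by rewrite nw ltxx.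
  by rewrite eqxx; exact: portw.
have cross e f p : e \in glue_edge -> f \in glue_edge -> e != f -> cv e p -> cv f p ->
    (forall w, w \in glue_vert -> pos w <> p) ->
    (exists e' f', [/\ e = inl e', f = inl f', 1 < `|p| & e' != f']) \/
    (exists e' f', [/\ e = inr e', f = inr f', `|p| < 1 & e' != f']).
  move=> eE fE ef ce cf nv.
  have ncr b : p <> corner R b by move=> E'; apply: (nv _ (pV b)); rewrite ppos.
  case: e eE ef ce => e; rewrite inE => eE ef ce; case: f fE ef cf => f; rewrite inE => fE ef cf.
  - left; exists e, f; split => //.
    by case: (sub1 _ _ eE ce) => // -[_ /ncr].
  - case: (sub1 _ _ eE ce) => [h1|[_ /ncr //]]; case: (sub2 _ _ fE cf) => [h2|[_ /ncr //]].
    by move: h1 h2; lra.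
  - case: (sub2 _ _ eE ce) => [h1|[_ /ncr //]]; case: (sub1 _ _ fE cf) => [h2|[_ /ncr //]].
    by move: h1 h2; lra.
  - right; exists e, f; split => //.
    by case: (sub2 _ _ eE ce) => // -[_ /ncr].
have nv1 p : (forall w, w \in glue_vert -> pos w <> p) ->
    forall w, w \in Va1 -> w != t1 -> pos1 w <> p.
  move=> nv w wV wt; have := nv (inl w); rewrite inE /= (negbTE wt); exact.
have nv2 p : (forall w, w \in glue_vert -> pos w <> p) ->
    forall w, w \in Va2 -> w != t2 -> pos2 w <> p.
  move=> nv w wV wt; have := nv (inr w); rewrite inE /= (negbTE wt); exact.
exists pos, cv; split.
- move=> [w|w] [w'|w']; rewrite !inE /= => wV w'V.
  + case: (eqVneq w t1) => [->|wt]; case: (eqVneq w' t1) => [->|w't] //.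
    * by move=> E'; have := out1 _ w'V w't; rewrite -E' nc ltxx.
    * by move=> E'; have := out1 _ wV wt; rewrite E' nc ltxx.
    * by move=> E'; rewrite (op_inj O1 _ _ E') // !inE ?wt ?w't.
  + case: (eqVneq w t1) => [->|wt]; case: (eqVneq w' t2) => [->|w't].
    * by move/cne.
    * by move=> E'; have := out2 _ w'V w't; rewrite -E' nc ltxx.
    * by move=> E'; have := out1 _ wV wt; rewrite E' nc ltxx.
    * by move=> E'; exfalso; have := out1 _ wV wt; have := out2 _ w'V w't; rewrite E'; lra.
  + case: (eqVneq w t2) => [->|wt]; case: (eqVneq w' t1) => [->|w't].
    * by move/esym/cne.
    * by move=> E'; have := out1 _ w'V w't; rewrite -E' nc ltxx.
    * by move=> E'; have := out2 _ wV wt; rewrite E' nc ltxx.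
    * by move=> E'; exfalso; have := out2 _ wV wt; have := out1 _ w'V w't; rewrite E'; lra.
  + case: (eqVneq w t2) => [->|wt]; case: (eqVneq w' t2) => [->|w't] //.
    * by move=> E'; have := out2 _ w'V w't; rewrite -E' nc ltxx.
    * by move=> E'; have := out2 _ wV wt; rewrite E' nc ltxx.
    * by move=> E'; rewrite (op_inj O2 _ _ E') // !inE ?wt ?w't.
- move=> [e|e]; rewrite inE => eE /=.
  + by have [h1 h2 _] := op_ends O1 eE; split; [rewrite inE|case: eqP => _; [exact: pV|rewrite inE]].
  + by have [h1 h2 _] := op_ends O2 eE; split; [rewrite inE|case: eqP => _; [exact: pV|rewrite inE]].
- move=> [e|e]; rewrite inE => eE.
  + have [_ _ st] := op_ends O1 eE; have := op_arc O1 eE.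
    rewrite /glue_src /glue_dst /= (negbTE st).
    by case: (eqVneq (d1 e) t1) => et; [rewrite ppos|rewrite /= (negbTE et)].
  + have [_ _ st] := op_ends O2 eE; have := op_arc O2 eE.
    rewrite /glue_src /glue_dst /= (negbTE st).
    by case: (eqVneq (d2 e) t2) => et; [rewrite ppos|rewrite /= (negbTE et)].
- move=> e w eE wV cw; case: (eqVneq `|pos w| 1) => [n1|n1].
    by right; exact: onlyport.
  case: w wV cw n1 => w; rewrite inE => wV; case: e eE => e; rewrite inE => eE /=.
  + case: (eqVneq w t1) => [->|wt] cw n1; first by rewrite nc eqxx in n1.
    case: (op_avoid O1 eE wV wt cw) => wE; first by left; rewrite wE.
    by right; rewrite -wE (negbTE wt).
  + case: (eqVneq w t1) => [->|wt] cw n1; first by rewrite nc eqxx in n1.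
    case: (sub2 _ _ eE cw) => [h|[_ E']]; first by exfalso; have := out1 _ wV wt; lra.
    by rewrite E' nc eqxx in n1.
  + case: (eqVneq w t2) => [->|wt] cw n1; first by rewrite nc eqxx in n1.
    case: (sub1 _ _ eE cw) => [h|[_ E']]; first by exfalso; have := out2 _ wV wt; lra.
    by rewrite E' nc eqxx in n1.
  + case: (eqVneq w t2) => [->|wt] cw n1; first by rewrite nc eqxx in n1.
    case: (op_avoid O2 eE wV wt cw) => wE; first by left; rewrite wE.
    by right; rewrite -wE (negbTE wt).
- move=> e f p eE fE ef ce cf nv.
  case: (cross e f p eE fE ef ce cf nv) => -[e' [f' [eE' fE' pr ef']]].
  + move: eE fE ce cf; rewrite eE' fE' !inE => eE fE ce cf.
    exact: (op_cross O1 eE fE ef' ce cf pr (nv1 _ nv)).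
  + move: eE fE ce cf; rewrite eE' fE' !inE => eE fE ce cf.
    exact: (op_cross O2 eE fE ef' ce cf pr (nv2 _ nv)).
- move=> e f g p q eE fE gE ef eg cep cfp ceq cgq nvp nvq.
  case: (cross e f p eE fE ef cep cfp nvp) => -[e' [f' [eE' fE' pr ef']]];
  case: (cross e g q eE gE eg ceq cgq nvq) => -[e2 [g' [eE2 gE' qr eg']]];
  move: eE2 eE fE gE cep cfp ceq cgq; rewrite eE' fE' gE' // !inE => -[ee];
  rewrite -ee in eg' => eE fE gE cep cfp ceq cgq.
  + by have [-> ->] := op_one O1 eE fE gE ef' eg' cep cfp ceq cgq pr qr (nv1 _ nvp) (nv1 _ nvq).
  + by have [-> ->] := op_one O2 eE fE gE ef' eg' cep cfp ceq cgq pr qr (nv2 _ nvp) (nv2 _ nvq).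
Qed.

End Glue.

Lemma contract_drawable (V E : finType) (Va : {set V}) (Ea : {set E}) (src dst : E -> V)
    (X : E -> E -> Prop) (e0 : E) (a b : V) :
  drawable R Va Ea src dst X -> e0 \in Ea -> (forall f, f \in Ea -> ~ X e0 f) ->
  (src e0 = a /\ dst e0 = b) \/ (src e0 = b /\ dst e0 = a) ->
  (forall e, e \in Ea -> e != e0 ->
     ~ ((src e = a /\ dst e = b) \/ (src e = b /\ dst e = a))) ->
  drawable R (Va :\ b)%SET (Ea :\ e0)%SET (merge_vert a b \o src) (merge_vert a b \o dst) X.
Proof.
move=> [pos [cv D]] e0E e0X ab nab; apply: (contract_edge D e0E e0X ab) => //.
by move=> e; rewrite !inE => /andP[ee eE]; exact: nab.
Qed.

Lemma drawable_relabel (V E V' E' : finType) (Va : {set V}) (Ea : {set E}) (src dst : E -> V)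
    (X : E -> E -> Prop) (Va' : {set V'}) (Ea' : {set E'}) (src' dst' : E' -> V')
    (X' : E' -> E' -> Prop) (s : V' -> V) (i : E' -> E) :
  drawable R Va Ea src dst X ->
  {in Va' &, injective s} -> {in Ea' &, injective i} ->
  (forall w, w \in Va' -> s w \in Va) -> (forall e, e \in Ea' -> i e \in Ea) ->
  (forall e, e \in Ea' -> [/\ src' e \in Va', dst' e \in Va' &
     (s (src' e) = src (i e) /\ s (dst' e) = dst (i e)) \/
     (s (src' e) = dst (i e) /\ s (dst' e) = src (i e))]) ->
  (forall e f, e \in Ea' -> f \in Ea' -> e != f -> X (i e) (i f) -> X' e f) ->
  drawable R Va' Ea' src' dst' X'.
Proof.
move=> [pos [cv D]] h1 h2 h3 h4 h5 h6; exists (pos \o s), (cv \o i).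
exact: (pdraw_relabel D).
Qed.

Section TwoSum.
Variables (V E : finType) (Va1 Va2 : {set V}) (Ea1 Ea2 : {set E}) (src dst : E -> V).
Variables (X : E -> E -> Prop) (u v t1 t2 : V) (f1 g1 f2 g2 : E).
Hypotheses (D1 : drawable R Va1 Ea1 src dst X) (D2 : drawable R Va2 Ea2 src dst X).
Hypotheses (uv : u != v) (VI : Va1 :&: Va2 = [set u; v]%SET).
Hypotheses (t1V : t1 \in Va1) (t2V : t2 \in Va2) (t1n : t1 \notin Va2) (t2n : t2 \notin Va1).
Hypotheses (f1E : f1 \in Ea1) (g1E : g1 \in Ea1) (f2E : f2 \in Ea2) (g2E : g2 \in Ea2).
Hypotheses (f1s : src f1 = u) (f1d : dst f1 = t1) (g1s : src g1 = v) (g1d : dst g1 = t1).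
Hypotheses (f2s : src f2 = u) (f2d : dst f2 = t2) (g2s : src g2 = v) (g2d : dst g2 = t2).
Hypothesis at1 : forall e, e \in Ea1 -> src e != t1 /\ (dst e = t1 -> e = f1 \/ e = g1).
Hypothesis at2 : forall e, e \in Ea2 -> src e != t2 /\ (dst e = t2 -> e = f2 \/ e = g2).
Hypothesis X0 : forall e h, e \in [:: f1; g1; f2; g2] -> ~ X e h.

(** After gluing at [t1] and [t2], the two copies of [u] are joined by the path formed by [f1] and
    [f2], and the two copies of [v] by that formed by [g1] and [g2]. These four edges are uncrossed,
    and contracting them identifies the copies. *)
Lemma two_sum : drawable R ((Va1 :|: Va2) :\ t1 :\ t2)%SET
  ((Ea1 :|: Ea2) :\ f1 :\ g1 :\ f2 :\ g2)%SET src dst X.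
Proof.
have [u1 u2] : u \in Va1 /\ u \in Va2.
  by have : u \in (Va1 :&: Va2)%SET; [rewrite VI !inE eqxx|rewrite finset.in_setI => /andP].
have [v1 v2] : v \in Va1 /\ v \in Va2.
  by have : v \in (Va1 :&: Va2)%SET; [rewrite VI !inE eqxx orbT|rewrite finset.in_setI => /andP].
have Vuv w : w \in Va1 -> w \in Va2 -> w = u \/ w = v.
  move=> w1 w2; have : w \in (Va1 :&: Va2)%SET by rewrite inE w1.
  by rewrite VI !inE => /orP[/eqP|/eqP]; [left|right].
have ne w w' (A : {set V}) : w \in A -> w' \notin A -> w != w' by move=> wA; apply: contraNneq => <-.
have ut1 : u != t1 by apply: ne u2 t1n. have vt1 : v != t1 by apply: ne v2 t1n.
have ut2 : u != t2 by apply: ne u1 t2n. have vt2 : v != t2 by apply: ne v1 t2n.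
have fg1 : f1 != g1 by apply: contraNneq uv => E'; rewrite -f1s E' g1s.
have fg2 : f2 != g2 by apply: contraNneq uv => E'; rewrite -f2s E' g2s.
pose l1 e := e == f1; pose l2 e := e == f2.
have inj1 e f : e \in Ea1 -> f \in Ea1 -> dst e = t1 -> dst f = t1 -> l1 e = l1 f -> e = f.
  move=> eE fE et ft; rewrite /l1; case: ((at1 eE).2 et) => ->; case: ((at1 fE).2 ft) => -> //;
  by rewrite eqxx eq_sym (negbTE fg1).
have inj2 e f : e \in Ea2 -> f \in Ea2 -> dst e = t2 -> dst f = t2 -> l2 e = l2 f -> e = f.
  move=> eE fE et ft; rewrite /l2; case: ((at2 eE).2 et) => ->; case: ((at2 fE).2 ft) => -> //;
  by rewrite eqxx eq_sym (negbTE fg2).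
have G := @glue_drawable V E Va1 Ea1 src dst X t1 l1 V E Va2 Ea2 src dst X t2 l2 D1 D2 t1V t2V
  (fun e eE => (at1 eE).1) (fun e eE => (at2 eE).1) inj1 inj2.
set gs := glue_src _ _ in G; set gd := glue_dst _ _ _ _ _ _ in G.
set gx := glue_cross _ _ in G; set gV := glue_vert _ _ in G; set gE := glue_edge _ _ in G.
have X0l e h : e \in [:: f1; g1; f2; g2] -> ~ gx (inl e) h /\ ~ gx (inr e) h.
  by move=> eL; split; case: h => h // Hx; exact: (X0 eL Hx).
have gdf1 : gd (inl f1) = inl t1 by rewrite /gd /= f1d eqxx /l1 eqxx.
have gdg1 : gd (inl g1) = inr t2 by rewrite /gd /= g1d eqxx /l1 eq_sym (negbTE fg1).
have gdf2 : gd (inr f2) = inl t1 by rewrite /gd /= f2d eqxx /l2 eqxx.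
have gdg2 : gd (inr g2) = inr t2 by rewrite /gd /= g2d eqxx /l2 eq_sym (negbTE fg2).
have gd1 e : e \in Ea1 -> e != f1 -> e != g1 -> dst e != t1 /\ gd (inl e) = inl (dst e).
  move=> eE ef eg; have dt : dst e != t1.
    by apply/eqP => /((at1 eE).2)[E'|E']; [rewrite E' eqxx in ef|rewrite E' eqxx in eg].
  by rewrite /gd /= (negbTE dt).
have gd2 e : e \in Ea2 -> e != f2 -> e != g2 -> dst e != t2 /\ gd (inr e) = inr (dst e).
  move=> eE ef eg; have dt : dst e != t2.
    by apply/eqP => /((at2 eE).2)[E'|E']; [rewrite E' eqxx in ef|rewrite E' eqxx in eg].
  by rewrite /gd /= (negbTE dt).
have gsl e : gs (inl e) = inl (src e) by [].
have gsr e : gs (inr e) = inr (src e) by [].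
have cE (A B C : Type) (f : B -> C) (g : A -> B) x : (f \o g) x = f (g x) by [].
clearbody gs gd.
pose m1 := merge_vert (inl u : V + V) (inl t1).
pose m2 := merge_vert (inl u : V + V) (inr u).
pose m3 := merge_vert (inl v : V + V) (inr t2).
pose m4 := merge_vert (inl v : V + V) (inr v).
have m1l w : w != t1 -> m1 (inl w) = inl w by move=> h; rewrite /m1 /merge_vert; case: eqP => // -[E']; rewrite E' eqxx in h.
have m1t : m1 (inl t1) = inl u by rewrite /m1 /merge_vert eqxx.
have m1r w : m1 (inr w) = inr w by rewrite /m1 /merge_vert.
have m2l w : m2 (inl w) = inl w by rewrite /m2 /merge_vert.
have m2u : m2 (inr u) = inl u by rewrite /m2 /merge_vert eqxx.
have m2r w : w != u -> m2 (inr w) = inr w by move=> h; rewrite /m2 /merge_vert; case: eqP => // -[E']; rewrite E' eqxx in h.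
have m3l w : m3 (inl w) = inl w by rewrite /m3 /merge_vert.
have m3t : m3 (inr t2) = inl v by rewrite /m3 /merge_vert eqxx.
have m3r w : w != t2 -> m3 (inr w) = inr w by move=> h; rewrite /m3 /merge_vert; case: eqP => // -[E']; rewrite E' eqxx in h.
have m4l w : m4 (inl w) = inl w by rewrite /m4 /merge_vert.
have m4v : m4 (inr v) = inl v by rewrite /m4 /merge_vert eqxx.
have m4r w : w != v -> m4 (inr w) = inr w by move=> h; rewrite /m4 /merge_vert; case: eqP => // -[E']; rewrite E' eqxx in h.
have m2n w : w != t2 -> m2 (inr w) <> inr t2.
  move=> wt; case: (eqVneq w u) => [->|wu]; first by rewrite m2u.
  by rewrite m2r // => -[h]; rewrite h eqxx in wt.
have m3n w : w != t2 -> m3 (m2 (inr w)) <> inl v.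
  move=> wt; case: (eqVneq w u) => [->|wu]; last by rewrite m2r // m3r.
  by rewrite m2u m3l => -[h]; move: uv; rewrite h eqxx.
have nt1 e : e \in Ea1 -> src e != t1 by move=> eE; exact: (at1 eE).1.
have nt2 e : e \in Ea2 -> src e != t2 by move=> eE; exact: (at2 eE).1.
have cases (Q : E + E -> Prop) : Q (inl f1) -> Q (inl g1) -> Q (inr f2) -> Q (inr g2) ->
    (forall e, e \in Ea1 -> dst e != t1 -> src e != t1 -> gd (inl e) = inl (dst e) -> Q (inl e)) ->
    (forall e, e \in Ea2 -> dst e != t2 -> src e != t2 -> gd (inr e) = inr (dst e) -> Q (inr e)) ->
    forall e, e \in gE -> Q e.
  move=> q1 q2 q3 q4 q5 q6 [e|e]; rewrite inE => eE.
    case: (eqVneq e f1) => [->//|ef]; case: (eqVneq e g1) => [->//|eg].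
    by have [h1 h2] := gd1 e eE ef eg; apply: q5 => //; exact: nt1.
  case: (eqVneq e f2) => [->//|ef]; case: (eqVneq e g2) => [->//|eg].
  by have [h1 h2] := gd2 e eE ef eg; apply: q6 => //; exact: nt2.
have inlE e : inl e \in gE = (e \in Ea1) by rewrite inE.
have inrE e : inr e \in gE = (e \in Ea2) by rewrite inE.
have G1 : drawable R (gV :\ inl t1)%SET (gE :\ inl f1)%SET (m1 \o gs) (m1 \o gd) gx.
  apply: contract_drawable G _ _ _ _.
  - by rewrite inlE.
  - by move=> f _; have [] := X0l f1 f; rewrite ?inE ?eqxx.
  - by left; rewrite gdf1 gsl f1s.
  - apply: cases; rewrite ?cE ?gsl ?gsr ?gdf1 ?gdg1 ?gdf2 ?gdg2 ?eqxx //.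
    + by move=> _ [] [] //.
    + by move=> _ [] [] //.
    + by move=> _ [] [] //.
    + move=> e eE dt st; rewrite ?cE ?gsl ?gsr => -> _ [] [] [] h1 [] h2; first by rewrite h2 eqxx in dt.
      by rewrite h1 eqxx in st.
    + by move=> e eE dt st; rewrite ?cE ?gsl ?gsr => -> _ [] [].
have G2 : drawable R (gV :\ inl t1 :\ inr u)%SET (gE :\ inl f1 :\ inr f2)%SET
    (m2 \o (m1 \o gs)) (m2 \o (m1 \o gd)) gx.
  apply: contract_drawable G1 _ _ _ _.
  - by rewrite !inE.
  - by move=> f _; have [] := X0l f2 f; rewrite ?inE ?eqxx ?orbT.
  - by right; rewrite !cE gsr gdf2 m1t m1r f2s.
  - move=> e; rewrite in_setD1 => /andP[ne1 eE]; move: e eE ne1; apply: cases;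
      rewrite ?cE ?gsl ?gsr ?gdf1 ?gdg1 ?gdf2 ?gdg2 ?eqxx ?m1t ?m1r ?g1s ?g2s //.
    + rewrite m1l // => _ _ [] [] //.
      by move=> [] h; move: uv; rewrite h eqxx.
    + by move=> _ _ [] [].
    + by move=> e eE dt st; rewrite ?cE ?gsl ?gsr => ->; rewrite !m1l // => _ _ [] [].
    + by move=> e eE dt st; rewrite ?cE ?gsl ?gsr => ->; rewrite !m1r => _ _ [] [].
have G3 : drawable R (gV :\ inl t1 :\ inr u :\ inr t2)%SET (gE :\ inl f1 :\ inr f2 :\ inl g1)%SET
    (m3 \o (m2 \o (m1 \o gs))) (m3 \o (m2 \o (m1 \o gd))) gx.
  apply: contract_drawable G2 _ _ _ _.
  - by rewrite !inE g1E andbT /=; apply: contraNneq fg1 => -[->].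
  - by move=> f _; have [] := X0l g1 f; rewrite ?inE ?eqxx ?orbT.
  - by left; rewrite !cE gsl gdg1 m1r g1s m1l // m2l m2r // eq_sym.
  - move=> e; rewrite !in_setD1 => /and3P[ne2 ne1 eE]; move: e eE ne1 ne2; apply: cases;
      rewrite ?cE ?gsl ?gsr ?gdf1 ?gdg1 ?gdf2 ?gdg2 ?eqxx ?m1t ?m1r ?g1s ?g2s //.
    + rewrite m2r; last by rewrite eq_sym.
      rewrite m2r; last by rewrite eq_sym.
      by move=> _ _ _ [] [].
    + by move=> e eE dt st; rewrite ?cE ?gsl ?gsr => ->; rewrite !m1l // !m2l => _ _ _ [] [].
    + move=> e eE dt st; rewrite ?cE ?gsl ?gsr => ->; rewrite !m1r => _ _ _.
      by case=> -[h1 h2]; [exact: (m2n _ dt h2)|exact: (m2n _ st h1)].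
have G4 : drawable R (gV :\ inl t1 :\ inr u :\ inr t2 :\ inr v)%SET
    (gE :\ inl f1 :\ inr f2 :\ inl g1 :\ inr g2)%SET
    (m4 \o (m3 \o (m2 \o (m1 \o gs)))) (m4 \o (m3 \o (m2 \o (m1 \o gd)))) gx.
  have vu : v != u by rewrite eq_sym.
  have t2u : t2 != u by rewrite eq_sym.
  apply: contract_drawable G3 _ _ _ _.
  - rewrite !in_setD1 inrE g2E; apply/and4P; split => //; apply/eqP => // -[E'].
    by move: fg2; rewrite E' eqxx.
  - by move=> f _; have [] := X0l g2 f; rewrite ?inE ?eqxx ?orbT.
  - by right; rewrite !cE gsr gdg2 g2s !m1r !m2r // m3t m3r.
  - move=> e; rewrite !in_setD1 => /and4P[ne3 ne2 ne1 eE]; move: e eE ne1 ne2 ne3; apply: cases;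
      rewrite ?cE ?gsl ?gsr ?gdf1 ?gdg1 ?gdf2 ?gdg2 ?eqxx ?m1t ?m1r ?g1s ?g2s //.
    + by move=> e eE dt st; rewrite ?cE ?gsl ?gsr => ->; rewrite !m1l // !m2l !m3l => _ _ _ _ [] [].
    + move=> e eE dt st; rewrite ?cE ?gsl ?gsr => ->; rewrite !m1r => _ _ _ _.
      by case=> -[h1 h2]; [exact: (m3n _ st h1)|exact: (m3n _ dt h2)].
pose s w : V + V := if w \in Va1 then inl w else inr w.
pose i e : E + E := if e \in Ea1 then inl e else inr e.
pose mm := m4 \o (m3 \o (m2 \o m1)).
have mml w : w != t1 -> mm (inl w) = inl w by move=> h; rewrite /mm /= m1l // m2l m3l m4l.
have mmr w : w \in Va2 -> w != t2 -> mm (inr w) = s w.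
  move=> wV h; rewrite /mm /s /= m1r; case: ifPn => w1.
    case: (Vuv _ w1 wV) => ->; first by rewrite m2u m3l m4l.
    by rewrite m2r ?[v == u]eq_sym // m3r // m4v.
  rewrite m2r; last by apply: contraNneq w1 => ->.
  by rewrite m3r // m4r //; apply: contraNneq w1 => ->.
have [p1' [c1' O1']] := D1; have [p2' [c2' O2']] := D2.
apply: (drawable_relabel (s := s) (i := i) G4).
- by move=> w w' _ _; rewrite /s; case: ifP => _; case: ifP => _ // [].
- by move=> w w' _ _; rewrite /i; case: ifP => _; case: ifP => _ // [].
- move=> w; rewrite !inE => /and3P[wt2 wt1 /orP[w1|w2]]; rewrite /s.
    by rewrite w1; apply/and5P; split => //; apply/eqP => -[E']; rewrite E' eqxx in wt1.
  case: ifPn => w1.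
    by apply/and5P; split => //; apply/eqP => -[E']; rewrite E' eqxx in wt1.
  apply/and5P; split => //; apply/eqP => -[E'].
  + by rewrite E' v1 in w1.
  + by rewrite E' u1 in w1.
- move=> e; rewrite !inE => /and5P[eg2 ef2 eg1 ef1 eE]; rewrite /i.
  case: ifPn => e1.
    by apply/and5P; split.
  by rewrite (negbTE e1) /= in eE; apply/and5P; split.
- move=> e; rewrite !inE => /and5P[eg2 ef2 eg1 ef1 eE]; rewrite /i.
  case: (boolP (e \in Ea1)) eE => [e1 _|e1 /orP[//|e2]].
    have [sV dV] := pd_ends O1' e1; have [dt gdE] := gd1 e e1 ef1 eg1; have st := nt1 e e1.
    split.
    + by rewrite sV st /= andbT; apply: ne sV t2n.
    + by rewrite dV dt /= andbT; apply: ne dV t2n.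
    + left; rewrite -[(_ \o _) _]/(mm (gs (inl e))) -[X in _ /\ _ = X]/(mm (gd (inl e))) gdE gsl !mml //.
      by rewrite /s sV dV.
  have [sV dV] := pd_ends O2' e2; have [dt gdE] := gd2 e e2 ef2 eg2; have st := nt2 e e2.
  split.
  + by rewrite sV st orbT andbT /=; apply: ne sV t1n.
  + by rewrite dV dt orbT andbT /=; apply: ne dV t1n.
  + by left; rewrite -[(_ \o _) _]/(mm (gs (inr e))) -[X in _ /\ _ = X]/(mm (gd (inr e))) gdE gsr !mmr.
- by move=> e f _ _ _; rewrite /i; case: ifP => _; case: ifP => _.
Qed.

End TwoSum.

(** Place one point more than [I] has elements on one side of the square around [c]; they cannot all
    be values of [f]. *)
Lemma free_direction (I : finType) (f : I -> P) (c : P) (rho : R) : 0 < rho ->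
  exists2 r, `|c - r| = rho & forall i, r <> f i.
Proof.
move=> rho0; apply: contrapT => H.
pose pt (k : 'I_#|I|.+1) : P := c + (rho, rho * (k%:R / #|I|.+1%:R)).
have ptn k : `|c - pt k| = rho.
  rewrite /pt opprD addrA subrr sub0r normrN pnorm /=.
  have k0 : 0 <= k%:R / #|I|.+1%:R :> R by rewrite divr_ge0 ?ler0n.
  have k1 : k%:R / #|I|.+1%:R <= 1 :> R.
    by rewrite ler_pdivrMr ?ltr0n // mul1r ler_nat ltnW.
  rewrite (gtr0_norm rho0) ger0_norm; last by apply: mulr_ge0 => //; exact: ltW.
  by apply/max_idPl; rewrite -[leRHS]mulr1; apply: ler_wpM2l => //; exact: ltW.
have ptf k : exists i, pt k = f i.
  by apply: contrapT => Hk; apply: H; exists (pt k) => // i E'; apply: Hk; exists i.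
have /boolp.choice[g gH] := ptf.
have gi : injective g.
  move=> k k' E'; have : pt k = pt k' by rewrite !gH E'.
  move/addrI => -[]; move/(mulfI (lt0r_neq0 rho0))/mulIf => h.
  have /eqP := h ltac:(by rewrite invr_eq0 pnatr_eq0).
  by rewrite eqr_nat => /eqP /val_inj.
by have := leq_card g gi; rewrite card_ord ltnn.
Qed.

Section Pendant.
Variables (V E : finType) (Va : {set V}) (Ea : {set E}) (src dst : E -> V).
Variables (X : E -> E -> Prop) (v : V).

Definition pend_src (e : option E) : option V := if e is Some e then Some (src e) else Some v.
Definition pend_dst (e : option E) : option V := if e is Some e then Some (dst e) else None.
Definition pend_cross (e f : option E) : Prop :=
  match e, f with Some e, Some f => X e f | _, _ => False end.
Definition pend_vert : {set option V} := [set w | if w is Some w then w \in Va else true]%SET.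
Definition pend_edge : {set option E} := [set e | if e is Some e then e \in Ea else true]%SET.

(** The new edge is a short segment in a direction that no straightened edge at [v] takes. As its
    new end has degree one, the drawing can be opened there, which makes [glue_drawable] applicable
    to sums along at most one vertex. *)
Lemma add_pendant : drawable R Va Ea src dst X -> v \in Va ->
  drawable R pend_vert pend_edge pend_src pend_dst pend_cross.
Proof.
move=> [pos [cv0 D0]] vV.
have [rho [cv [[rho0 _] D [HV Hn] Ha _]]] := radial D0 vV (@ltr01 R).
have /boolp.choice[rr rrH] : forall e, exists r : P, e \in Ea -> at_vert src dst v e ->
    `|pos v - r| = rho /\ forall x, `|pos v - x| <= rho -> cv e x <-> seg (pos v) r x.
  move=> e; case: (boolP ((e \in Ea) && at_vert src dst v e)) => [/andP[eE ae]|ne]; last first.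
    by exists 0 => eE ae; rewrite eE ae in ne.
  by have [r r1 r2] := Ha e eE ae; exists r.
have [r nr rne] := free_direction rr (pos v) rho0.
have sle x : seg (pos v) r x -> `|pos v - x| <= rho.
  by move=> /seg_norm[t /andP[t0 t1] [_ ->]]; rewrite nr; nra.
have vr : pos v != r by apply/eqP => E'; move: nr; rewrite E' subrr normr0; lra.
have meet e x : e \in Ea -> cv e x -> seg (pos v) r x -> x = pos v.
  move=> eE cx sx; have xr := sle _ sx.
  case: (boolP (at_vert src dst v e)) => ae; last by exfalso; have := Hn _ _ eE ae cx; lra.
  have [nre H] := rrH e eE ae; have sx' := (H x xr).1 cx.
  have [t tI [xE xt]] := seg_norm sx; have [s sI [xE' xs]] := seg_norm sx'.
  have ts : t = s by apply: (@mulIf _ rho); [lra|rewrite -{1}nr -nre -xt -xs].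
  case: (eqVneq t 0) => [t0|t0]; first by rewrite xE t0 scale0r addr0.
  have : t *: (r - pos v) = t *: (rr e - pos v).
    by apply: (@addrI _ (pos v)); rewrite -xE ts -xE'.
  by move/(scalerI t0)/addIr/rne.
have vmeet w : w \in Va -> seg (pos v) r (pos w) -> w = v.
  by move=> wV /sle wr; case: (eqVneq w v) => // wv; exfalso; have := HV _ wV wv; lra.
pose pos' (w : option V) := if w is Some w then pos w else r.
pose cv' (e : option E) := if e is Some e then cv e else seg (pos v) r.
have nrv w : w \in Va -> pos w <> r.
  move=> wV E'; have : w = v by apply: vmeet => //; rewrite E'; exact: seg_r.
  by move=> wv; rewrite wv in E'; rewrite E' eqxx in vr.
have nrc e : e \in Ea -> ~ cv e r.
  by move=> eE cr; have := meet _ _ eE cr (@seg_r R (pos v) r) => E'; rewrite E' eqxx in vr.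
have cross e f p : e \in pend_edge -> f \in pend_edge -> e != f -> cv' e p -> cv' f p ->
    (forall w, w \in pend_vert -> pos' w <> p) -> exists e' f',
    [/\ e = Some e' /\ f = Some f', e' \in Ea /\ f' \in Ea, e' != f' &
       forall w, w \in Va -> pos w <> p].
  move=> eE fE ef ce cf nv.
  have nv' w : w \in Va -> pos w <> p by move=> wV; apply: (nv (Some w)); rewrite inE.
  case: e eE ef ce => [e|] eE ef ce; case: f fE ef cf => [f|] fE ef cf //.
  - by exists e, f; move: eE fE; rewrite !inE.
  - by case: (nv' v vV); rewrite (meet e p) //; move: eE; rewrite inE.
  - by case: (nv' v vV); rewrite (meet f p) //; move: fE; rewrite inE.
exists pos', cv'; split.
- move=> [w|] [w'|]; rewrite !inE //= => wV w'V.
  + by move/(pd_inj D wV w'V) ->.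
  + by move/(nrv _ wV).
  + by move/esym/(nrv _ w'V).
- by move=> [e|]; rewrite !inE //= => /(pd_ends D).
- by move=> [e|]; rewrite !inE /=; [exact: (pd_arc D)|move=> _; exact: seg_arc].
- move=> [e|] [w|]; rewrite !inE /= => eE wV.
  + by move/(pd_avoid D eE wV) => [->|->]; [left|right].
  + by move/(nrc _ eE).
  + by move/(vmeet _ wV) ->; left.
  + by move=> _; right.
- move=> e f p eE fE ef ce cf nv; have [e' [f' [[E1 E2] [e'E f'E] ef' nv']]] := cross e f p eE fE ef ce cf nv.
  by move: ce cf; rewrite E1 E2 => ce cf; exact: (pd_cross D).
- move=> e f g p q eE fE gE ef eg cep cfp ceq cgq nvp nvq.
  have [e' [f' [[E1 E2] [e'E f'E] ef' nvp']]] := cross e f p eE fE ef cep cfp nvp.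
  have [e2 [g' [[E3 E4] [_ g'E] eg' nvq']]] := cross e g q eE gE eg ceq cgq nvq.
  have E5 : e' = e2 by move: E3; rewrite E1 => -[].
  rewrite -E5 in eg'; move: cep cfp ceq cgq; rewrite E1 E2 E4 => cep cfp ceq cgq.
  by have [-> ->] := pd_one D e'E f'E g'E ef' eg' cep cfp ceq cgq nvp' nvq'.
Qed.

End Pendant.

Section SmallSums.
Variables (V E : finType) (Va1 Va2 : {set V}) (Ea1 Ea2 : {set E}) (src dst : E -> V).
Variables (X : E -> E -> Prop).
Hypotheses (D1 : drawable R Va1 Ea1 src dst X) (D2 : drawable R Va2 Ea2 src dst X).

Let link v1 v2 (v1V : v1 \in Va1) (v2V : v2 \in Va2) :=
  @glue_drawable _ _ (pend_vert Va1) (pend_edge Ea1) (pend_src src v1) (pend_dst dst) (pend_cross X)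
    None (fun=> true) _ _ (pend_vert Va2) (pend_edge Ea2) (pend_src src v2) (pend_dst dst)
    (pend_cross X) None (fun=> true) (add_pendant D1 v1V) (add_pendant D2 v2V).

Let vtx w : option V + option V := if w \in Va1 then inl (Some w) else inr (Some w).
Let edg e : option E + option E := if e \in Ea1 then inl (Some e) else inr (Some e).

Let vtx_inj : injective vtx.
Proof. by move=> w w'; rewrite /vtx; case: ifP => _; case: ifP => _ // []. Qed.

Let edg_inj : injective edg.
Proof. by move=> w w'; rewrite /edg; case: ifP => _; case: ifP => _ // []. Qed.

Let link_ok v1 v2 (v1V : v1 \in Va1) (v2V : v2 \in Va2) : drawable R
  (glue_vert (pend_vert Va1) (pend_vert Va2)) (glue_edge (pend_edge Ea1) (pend_edge Ea2))
  (glue_src (pend_src src v1) (pend_src src v2))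
  (glue_dst (pend_dst dst) None (fun=> true) (pend_dst dst) None (fun=> true))
  (glue_cross (pend_cross X) (pend_cross X)).
Proof.
apply: (link v1V v2V); rewrite ?inE //.
- by case.
- by case.
- by move=> [e|] [f|] _ _.
- by move=> [e|] [f|] _ _.
Qed.

(** Both drawings receive a pendant edge and are glued at the pendant vertices; the two pendant
    edges are then left out. If one vertex set is empty there is nothing to glue. *)
Lemma zero_sum : Va1 :&: Va2 = finset.set0 -> drawable R (Va1 :|: Va2)%SET (Ea1 :|: Ea2)%SET src dst X.
Proof.
move=> VI; have [p1 [c1 P1]] := D1; have [p2 [c2 P2]] := D2.
have disj w : w \in Va2 -> w \in Va1 = false.
  by move=> w2; apply/negP => w1; have : w \in (Va1 :&: Va2)%SET by [rewrite inE w1]; rewrite VI inE.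
have [V10|[v1 v1V]] := set_0Vmem Va1.
  exists p2, c2; have -> : (Va1 :|: Va2 = Va2)%SET by rewrite V10 finset.set0U.
  have -> : (Ea1 :|: Ea2 = Ea2)%SET; last by [].
  by apply/finset.setP => e; rewrite !inE; case: (boolP (e \in Ea1)) => // /(pd_ends P1)[]; rewrite V10 inE.
have [V20|[v2 v2V]] := set_0Vmem Va2.
  exists p1, c1; have -> : (Va1 :|: Va2 = Va1)%SET by rewrite V20 finset.setU0.
  have -> : (Ea1 :|: Ea2 = Ea1)%SET; last by [].
  apply/finset.setP => e; rewrite !inE; case: (boolP (e \in Ea2)) => [/(pd_ends P2)[]|_]; last by rewrite orbF.
  by rewrite V20 inE.
apply: (drawable_relabel (s := vtx) (i := edg) (link_ok v1V v2V)).
- by move=> ? ? _ _; exact: vtx_inj.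
- by move=> ? ? _ _; exact: edg_inj.
- by move=> w; rewrite finset.in_setU /vtx; case: ifPn => [w1 _|w1 /orP[//|w2]]; rewrite !inE.
- by move=> e; rewrite finset.in_setU /edg; case: ifPn => [e1 _|e1 /orP[//|e2]]; rewrite !inE.
- move=> e; rewrite !inE /edg; case: ifPn => [e1 _|e1 /= e2].
    by have [sV dV] := pd_ends P1 e1; rewrite sV dV /vtx sV dV; split => //; left.
  by have [sV dV] := pd_ends P2 e2; rewrite sV dV !orbT /vtx !disj //; split => //; left.
- by move=> e f _ _ _; rewrite /edg; case: ifP => _; case: ifP.
Qed.

(** The pendant edges attached to the two copies of [v] form a path between them after gluing.
    Contracting both edges identifies the copies. *)
Lemma one_sum v : Va1 :&: Va2 = [set v]%SET -> drawable R (Va1 :|: Va2)%SET (Ea1 :|: Ea2)%SET src dst X.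
Proof.
move=> VI; have [p1 [c1 P1]] := D1; have [p2 [c2 P2]] := D2.
have [v1V v2V] : v \in Va1 /\ v \in Va2.
  by have : v \in (Va1 :&: Va2)%SET; [rewrite VI inE|rewrite finset.in_setI => /andP].
have disj w : w \in Va2 -> w \in Va1 -> w = v.
  by move=> w2 w1; have : w \in (Va1 :&: Va2)%SET by [rewrite inE w1]; rewrite VI inE => /eqP.
have G := link_ok v1V v2V.
set gs := glue_src _ _ in G; set gd := glue_dst _ _ _ _ _ _ in G.
set gx := glue_cross _ _ in G; set gV := glue_vert _ _ in G; set gE := glue_edge _ _ in G.
pose m1 := merge_vert (inl (Some v) : option V + option V) (inl None).
pose m2 := merge_vert (inl (Some v) : option V + option V) (inr (Some v)).
have cE (A B C : Type) (f : B -> C) (g : A -> B) x : (f \o g) x = f (g x) by [].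
have G1 : drawable R (gV :\ inl None)%SET (gE :\ inl None)%SET (m1 \o gs) (m1 \o gd) gx.
  apply: contract_drawable G _ _ _ _.
  - by rewrite !inE.
  - by move=> [[f|]|[f|]] _.
  - by left.
  - by move=> [[e|]|[e|]] // _ _ [] [].
have G2 : drawable R (gV :\ inl None :\ inr (Some v))%SET (gE :\ inl None :\ inr None)%SET
    (m2 \o (m1 \o gs)) (m2 \o (m1 \o gd)) gx.
  apply: contract_drawable G1 _ _ _ _.
  - by rewrite !inE.
  - by move=> [[f|]|[f|]] _.
  - by right.
  - by move=> [[e|]|[e|]] //; rewrite !inE // => _ _ [] [].
have m2r w : w \in Va2 -> m2 (inr (Some w)) = vtx w.
  move=> w2; rewrite /m2 /merge_vert /vtx; case: eqP => [[->]|wv]; first by rewrite v1V.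
  by case: ifPn => // /(disj _ w2) E'; case: wv; rewrite E'.
apply: (drawable_relabel (s := vtx) (i := edg) G2).
- by move=> ? ? _ _; exact: vtx_inj.
- by move=> ? ? _ _; exact: edg_inj.
- move=> w; rewrite finset.in_setU /vtx; case: ifPn => [w1 _|w1 /orP[//|w2]]; rewrite !inE //.
  by rewrite w2 !andbT; apply/eqP => -[E']; rewrite E' v1V in w1.
- by move=> e; rewrite finset.in_setU /edg; case: ifPn => [e1 _|e1 /orP[//|e2]]; rewrite !inE.
- move=> e; rewrite !inE /edg; case: ifPn => [e1 _|e1 /= e2].
    by have [sV dV] := pd_ends P1 e1; rewrite sV dV /vtx sV dV; split => //; left.
  have [sV dV] := pd_ends P2 e2; rewrite sV dV !orbT; split => //; left.
  by rewrite -!m2r.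
- by move=> e f _ _ _; rewrite /edg; case: ifP => _; case: ifP.
Qed.

End SmallSums.

(** * Drawings on two pages of a book *)

Section Book.
Variables (V E : finType) (Va : {set V}) (Ea : {set E}) (src dst : E -> V).
Variables (X : E -> E -> Prop) (ord : V -> nat) (page : E -> bool) (lo hi : E -> nat).
Hypothesis ord_inj : {in Va &, injective ord}.
Hypothesis ends : forall e, e \in Ea -> [/\ src e \in Va, dst e \in Va, (lo e < hi e)%N &
  (ord (src e) = lo e /\ ord (dst e) = hi e) \/ (ord (src e) = hi e /\ ord (dst e) = lo e)].
Hypothesis laminar : forall e f, e \in Ea -> f \in Ea -> e != f -> page e = page f ->
  [\/ (hi e <= lo f)%N, (hi f <= lo e)%N,
      [/\ (lo e <= lo f)%N, (hi f <= hi e)%N & (lo e < lo f)%N \/ (hi f < hi e)%N] |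
      [/\ (lo f <= lo e)%N, (hi e <= hi f)%N & (lo f < lo e)%N \/ (hi e < hi f)%N]].

(** The spine is the horizontal axis, and an edge is the parabola y = (x - lo)(hi - x) over its
    interval, reflected on the second page. Inside the inner one of two distinct nested intervals
    the outer parabola is strictly higher, so curves meet only at vertices. *)
Lemma book : drawable R Va Ea src dst X.
Proof.
pose pos w : P := ((ord w)%:R, 0).
pose sg e : R := if page e then 1 else -1.
pose h e (x : R) : R := (x - (lo e)%:R) * ((hi e)%:R - x).
pose cv e : set P := [set q | (lo e)%:R <= q.1 <= (hi e)%:R /\ q.2 = sg e * h e q.1].
have lohi e : e \in Ea -> (lo e)%:R < (hi e)%:R :> R by move=> /ends[_ _ h1 _]; rewrite ltr_nat.
have sg0 e : sg e != 0 by rewrite /sg; case: ifP; rewrite ?oppr_eq0 oner_eq0.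
have arcE e : e \in Ea -> arc ((lo e)%:R, 0) ((hi e)%:R, 0) (cv e).
  move=> eE; have lh := lohi e eE.
  pose f (t : R) := (lo e)%:R + clamp t * ((hi e)%:R - (lo e)%:R).
  have cf : continuous f.
    apply: cont_add; first exact: cont_cst.
    by apply: cont_mul; [exact: clamp_cont|exact: cont_cst].
  exists (fun t => (f t, sg e * h e (f t))); split.
  - apply: cont_pair => //; apply: cont_mul; first exact: cont_cst.
    apply: cont_mul; first by apply: cont_add => //; exact: cont_cst.
    by apply: cont_add; [exact: cont_cst|exact: cont_opp].
  - move=> s t sI tI [] /addrI E' _; rewrite !clamp_id // in E'.
    by apply: (mulIf _ E'); rewrite subr_eq0 gt_eqF.
  - rewrite /f !clamp_id ?inI0 ?inI1 // mul0r addr0 mul1r addrC subrK.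
    by split; apply: pext => //=; rewrite /h subrr ?mul0r ?mulr0.
  - move=> t; split => //=; have /andP[c0 c1] := clampI t; rewrite /f.
    by apply/andP; split; nra.
  - move=> [x y] [/andP[/= x0 x1] yE]; exists ((x - (lo e)%:R) / ((hi e)%:R - (lo e)%:R)).
      by rewrite /inI divr_ge0 ?ler_pdivrMr ?mul1r; lra.
    have fE : f ((x - (lo e)%:R) / ((hi e)%:R - (lo e)%:R)) = x.
      rewrite /f clamp_id; last by rewrite /inI divr_ge0 ?ler_pdivrMr ?mul1r; lra.
      by rewrite divfK; [lra|rewrite subr_eq0 gt_eqF].
    by rewrite fE; apply: pext.
have zero e x : sg e * h e x = 0 -> x = (lo e)%:R \/ x = (hi e)%:R.
  move/eqP; rewrite mulf_eq0 (negbTE (sg0 e)) /= mulf_eq0 !subr_eq0.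
  by case/orP => /eqP ->; [left|right].
have endv e x : e \in Ea -> x = (lo e)%:R \/ x = (hi e)%:R -> exists2 w, w \in Va & pos w = (x, 0).
  move=> eE H; have [sV dV _ K] := ends eE.
  by case: H K => -> [[k1 k2]|[k1 k2]]; [exists (src e)|exists (dst e)|exists (dst e)|exists (src e)]; rewrite // /pos ?k1 ?k2.
have nocross e f p : e \in Ea -> f \in Ea -> e != f -> cv e p -> cv f p ->
    exists2 w, w \in Va & pos w = p.
  move=> eE fE ef [/andP[a1 a2] ay] [/andP[b1 b2] by'].
  have pE : p = (p.1, p.2) by case: (p).
  case: (eqVneq p.2 0) => [y0|y0].
    rewrite pE y0; apply: (endv e) => //; apply: zero; by rewrite -ay.
  exfalso.
  have pg : page e = page f.
    have he : 0 <= h e p.1 by rewrite /h mulr_ge0 // subr_ge0.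
    have hf : 0 <= h f p.1 by rewrite /h mulr_ge0 // subr_ge0.
    move: ay by'; rewrite /sg; case: (page e); case: (page f) => //;
      rewrite ?mul1r ?mulN1r => h1 h2; case/eqP: y0; lra.
  have hE : h e p.1 = h f p.1.
    by apply: (mulfI (sg0 e)); rewrite -ay by' /sg pg.
  have h0 : h e p.1 != 0 by apply: contraNneq y0 => E'; rewrite ay E' mulr0.
  have h0' : h f p.1 != 0 by rewrite -hE.
  have e1 : (lo e)%:R < p.1.
    by rewrite lt_neqAle a1 andbT; apply: contraNneq h0 => <-; rewrite /h subrr mul0r.
  have e2 : p.1 < (hi e)%:R.
    by rewrite lt_neqAle a2 andbT; apply: contraNneq h0 => ->; rewrite /h subrr mulr0.
  have f1 : (lo f)%:R < p.1.
    by rewrite lt_neqAle b1 andbT; apply: contraNneq h0' => <-; rewrite /h subrr mul0r.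
  have f2 : p.1 < (hi f)%:R.
    by rewrite lt_neqAle b2 andbT; apply: contraNneq h0' => ->; rewrite /h subrr mulr0.
  move: hE; rewrite /h => hE.
  case: (laminar eE fE ef pg) => [l|l|[l1 l2 l3]|[l1 l2 l3]].
  - by have : (hi e)%:R <= (lo f)%:R :> R by [rewrite ler_nat]; lra.
  - by have : (hi f)%:R <= (lo e)%:R :> R by [rewrite ler_nat]; lra.
  - have k1 : (lo e)%:R <= (lo f)%:R :> R by rewrite ler_nat.
    have k2 : (hi f)%:R <= (hi e)%:R :> R by rewrite ler_nat.
    case: l3 => l3.
      by have k3 : (lo e)%:R < (lo f)%:R :> R by [rewrite ltr_nat]; nra.
    by have k3 : (hi f)%:R < (hi e)%:R :> R by [rewrite ltr_nat]; nra.
  - have k1 : (lo f)%:R <= (lo e)%:R :> R by rewrite ler_nat.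
    have k2 : (hi e)%:R <= (hi f)%:R :> R by rewrite ler_nat.
    case: l3 => l3.
      by have k3 : (lo f)%:R < (lo e)%:R :> R by [rewrite ltr_nat]; nra.
    by have k3 : (hi e)%:R < (hi f)%:R :> R by [rewrite ltr_nat]; nra.
exists pos, cv; split.
- by move=> w w' wV w'V [] /eqP; rewrite eqr_nat => /eqP; exact: ord_inj.
- by move=> e /ends[].
- move=> e eE; have [_ _ _ H] := ends eE; have := arcE e eE.
  by rewrite /pos; case: H => -[-> ->] //; exact: arc_rev.
- move=> e w eE wV [_ /= /esym/zero H]; have [sV dV _ K] := ends eE.
  have [E'|E'] : ord w = lo e \/ ord w = hi e.
    by case: H => /eqP; rewrite eqr_nat => /eqP; [left|right].
  + by case: K => -[k1 k2]; [left|right]; apply: ord_inj => //; rewrite ?k1 ?k2.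
  + by case: K => -[k1 k2]; [right|left]; apply: ord_inj => //; rewrite ?k1 ?k2.
- move=> e f p eE fE ef ce cf nv; have [w wV wp] := nocross e f p eE fE ef ce cf.
  by case: (nv w wV).
- move=> e f g p q eE fE gE ef eg cep cfp _ _ nvp _.
  by have [w wV wp] := nocross e f p eE fE ef cep cfp; case: (nvp w wV).
Qed.

End Book.

End Sums.

(** * Drawings of simple graphs *)

Section SimpleDrawings.
Variable R : realType.
Local Notation P := (R * R)%type.

Lemma edgeC (V : finType) (u v : V) : edge u v = edge v u.
Proof. by rewrite /edge finset.setUC. Qed.

Lemma edge_in (V : finType) (u v w : V) : (w \in edge u v) = (w == u) || (w == v).
Proof. by rewrite !inE. Qed.

Lemma edge_inj (V : finType) (u v x y : V) : u != v -> edge u v = edge x y ->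
  (u = x /\ v = y) \/ (u = y /\ v = x).
Proof.
move=> uv E; have : u \in edge x y by rewrite -E edge_in eqxx.
have : v \in edge x y by rewrite -E edge_in eqxx orbT.
rewrite !edge_in => /orP[/eqP vx|/eqP vx] /orP[/eqP ux|/eqP ux]; auto;
  by rewrite ux vx eqxx in uv.
Qed.

Lemma edge_injr (V : finType) (u v w : V) : edge u v = edge u w -> v = w.
Proof.
move=> E; have : v \in edge u w by rewrite -E edge_in eqxx orbT.
have : w \in edge u v by rewrite E edge_in eqxx orbT.
by rewrite !edge_in => /orP[/eqP ->|/eqP ->//] /orP[/eqP ->|/eqP ->].
Qed.

Lemma edge_card (V : finType) (u v : V) : u != v -> #|edge u v| = 2.
Proof. by move=> uv; rewrite cards2 uv. Qed.

Lemma card_edge (V : finType) (a : {set V}) (u : V) : #|a| = 2 -> u \in a ->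
  exists2 v, a = edge u v & u != v.
Proof.
move=> a2 ua; move: a2; rewrite (cardsD1 u) ua => -[] /eqP/cards1P[v vE]; exists v.
  by rewrite -(finset.setD1K ua) vE.
have : v \in (a :\ u)%SET by rewrite vE inE.
by rewrite !inE eq_sym => /andP[].
Qed.

Definition set_src (V : finType) (x0 : V) (a : {set V}) : V := odflt x0 [pick x in a].
Definition set_dst (V : finType) (x0 : V) (a : {set V}) : V :=
  odflt x0 [pick x in (a :\ set_src x0 a)%SET].

Lemma set_srcP (V : finType) (x0 : V) (a : {set V}) : #|a| = 2 ->
  a = edge (set_src x0 a) (set_dst x0 a).
Proof.
move=> a2; have sa : set_src x0 a \in a.
  rewrite /set_src; case: pickP => [x //|h].
  by move: a2; rewrite (eq_card h) card0.
have [v aE nv] := card_edge a2 sa.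
rewrite {1}aE; congr edge; rewrite /set_dst; case: pickP => [x|/(_ v)].
  by rewrite inE {2}aE edge_in inE => /andP[/negbTE ->] /= /eqP.
by rewrite inE aE edge_in inE -aE eqxx orbT andbT eq_sym nv.
Qed.

(* [pdraw] for simple graphs, where an edge is the set of its two ends. *)
Definition sdraw (V : finType) (Va : {set V}) (Ea : {set {set V}})
    (X : {set V} -> {set V} -> Prop) (pos : V -> P) (cv : {set V} -> set P) :=
  exists src dst, (forall a, a \in Ea -> a = edge (src a) (dst a)) /\
    pdraw Va Ea src dst X pos cv.

Definition sdrawable (V : finType) (Va : {set V}) (Ea : {set {set V}})
    (X : {set V} -> {set V} -> Prop) := exists pos cv, sdraw Va Ea X pos cv.

Lemma sdraw_drawable (V : finType) (Va : {set V}) Ea X pos cv (src dst : {set V} -> V) :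
  sdraw Va Ea X pos cv -> (forall a, a \in Ea -> a = edge (src a) (dst a)) ->
  pdraw Va Ea src dst X pos cv.
Proof.
case=> s [d [sd D]] sd'.
apply: (@pdraw_relabel R V _ Va Ea s d X pos cv D V _ Va Ea src dst X id id) => // a aE.
have [sV dV] := pd_ends D aE; have ne := pd_neq D aE.
have := sd a aE; rewrite {1}(sd' a aE) => /esym/(edge_inj ne)[[<- <-]|[<- <-]]; split => //; auto.
Qed.

Lemma drawable_sdrawable (V : finType) (Va : {set V}) Ea X (src dst : {set V} -> V) :
  drawable R Va Ea src dst X -> (forall a, a \in Ea -> a = edge (src a) (dst a)) ->
  sdrawable Va Ea X.
Proof. by move=> [pos [cv D]] sd; exists pos, cv, src, dst. Qed.

Section Basics.
Variables (V : finType) (Va : {set V}) (Ea : {set {set V}}).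
Variables (X : {set V} -> {set V} -> Prop) (pos : V -> P) (cv : {set V} -> set P).
Hypothesis D : sdraw Va Ea X pos cv.

Lemma sd_card a : a \in Ea -> #|a| = 2.
Proof.
by case: D => s [d [sd D0]] aE; rewrite (sd a aE) cards2 (pd_neq D0 aE).
Qed.

Lemma sd_sub a w : a \in Ea -> w \in a -> w \in Va.
Proof.
case: D => s [d [sd D0]] aE; rewrite {1}(sd a aE) edge_in.
by have [sV dV] := pd_ends D0 aE; case/orP => /eqP ->.
Qed.

(** Orient [a] away from [u] and [b] away from [v], so that [uncross] makes the curve of [a] run
    from [u] to [v]. This curve represents the edge uv afterwards, and an earlier curve of uv is
    discarded. *)
Lemma sd_uncross a b p u v : a \in Ea -> b \in Ea -> a != b -> cv a p -> cv b p ->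
  (forall w, w \in Va -> pos w <> p) -> u \in a -> v \in b -> u != v ->
  sdrawable Va (edge u v |: (Ea :\ a))%SET
    (fun c d => [/\ X c d, c != edge u v, c != b, d != edge u v & d != b]).
Proof.
move=> aE bE ab cap cbp nvp ua vb uv.
have [u' aE' uu'] := card_edge (sd_card aE) ua.
have [v' bE' vv'] := card_edge (sd_card bE) vb.
pose src c := if c == a then u else if c == b then v else set_src u c.
pose dst c := if c == a then u' else if c == b then v' else set_dst u c.
have sd c : c \in Ea -> c = edge (src c) (dst c).
  move=> cE; rewrite /src /dst; case: eqP => [->//|_]; case: eqP => [->//|_].
  by apply: set_srcP; exact: sd_card.
have D1 := sdraw_drawable D sd.
have xv : src a != src b by rewrite /src eqxx [b == a]eq_sym (negbTE ab) eqxx.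
have D2 := uncross D1 aE bE ab cap cbp nvp xv.
pose i c := if c == edge u v then a else c.
pose src' c := if c == edge u v then u else src c.
pose dst' c := if c == edge u v then v else dst c.
have sb : src b = v by rewrite /src eq_sym (negbTE ab) eqxx.
have uV := sd_sub aE ua; have vV := sd_sub bE vb.
have cE c : c \in (edge u v |: (Ea :\ a))%SET -> c != edge u v -> c \in Ea /\ c != a.
  by rewrite !inE => /orP[/eqP ->|/andP[? ?] _]; rewrite ?eqxx.
apply: (@drawable_sdrawable V Va _ _ src' dst'); last first.
  move=> c cE'; rewrite /src' /dst'; case: eqP => [//|/eqP ne].
  by apply: sd; have [] := cE c cE' ne.
apply: (@drawable_relabel R V _ V _ Va Ea _ _ _ Va _ src' dst' _ id i D2) => //.
- move=> c d cI dI; rewrite /i; case: eqP => [->|/eqP ne]; case: eqP => [->//|/eqP ne'] //.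
    by have [_ da] := cE _ dI ne' => E; rewrite E eqxx in da.
  by have [_ ca] := cE _ cI ne => E; rewrite E eqxx in ca.
- by move=> c cI; rewrite /i; case: eqP => [_//|/eqP ne]; have [] := cE _ cI ne.
- move=> c cI; rewrite /src' /dst' /i; case: eqP => [_|/eqP ne].
    by rewrite eqxx sb /src eqxx; split => //; left.
  have [cE1 ca] := cE _ cI ne; have [h1 h2] := pd_ends D1 cE1.
  by rewrite (negbTE ca); split => //; left.
- move=> c d cI dI cd; rewrite /i; case: eqP => [_ []|/eqP ne]; first by rewrite eqxx.
  by case: eqP => [_ []|/eqP ne' [h1 h2 h3 h4 h5]]; [rewrite eqxx|split].
Qed.

Lemma sd_add_path (u v t : V) (A : set P) : u \in Va -> v \in Va -> t \notin Va ->
  arc (pos u) (pos v) A ->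
  (forall x, A x -> x <> pos u -> x <> pos v ->
    (forall w, w \in Va -> pos w <> x) /\ (forall a, a \in Ea -> ~ cv a x)) ->
  sdrawable (t |: Va)%SET (edge u t |: (edge v t |: Ea))%SET X.
Proof.
move=> uV vV tV arcA avoid.
have uv : u != v by have [_ _] := arc_ends arcA; apply: contraNneq => ->.
have ut : u != t by apply: contraNneq tV => <-.
have vt : v != t by apply: contraNneq tV => <-.
have tE a : a \in Ea -> t \notin a by move=> aE; apply: contraNN tV; exact: sd_sub.
have utE : edge u t \notin Ea by apply/negP => /tE; rewrite edge_in eqxx orbT.
have vtE : edge v t \notin Ea by apply/negP => /tE; rewrite edge_in eqxx orbT.
pose src c := if c == edge u t then u else if c == edge v t then v else set_src u c.
pose dst c := if c == edge u t then t else if c == edge v t then t else set_dst u c.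
have uvt : edge v t != edge u t.
  by apply/eqP => /(edge_inj vt)[[E _]|[E _]]; [rewrite E eqxx in uv|rewrite E eqxx in vt].
have sd c : c \in (edge u t |: (edge v t |: Ea))%SET -> c = edge (src c) (dst c).
  rewrite /src /dst !inE; case: eqP => [->//|_]; case: eqP => [->//|_] /= cE.
  by apply: set_srcP; exact: sd_card.
apply: (@drawable_sdrawable V _ _ _ src dst) => //.
have D1 : pdraw Va Ea src dst X pos cv.
  by apply: sdraw_drawable => // a aE; apply: sd; rewrite !inE aE !orbT.
apply: (add_path D1 uV vV tV utE vtE _ _ _ _ _ arcA avoid);
  by rewrite /src /dst ?eqxx ?(negbTE uvt) // eq_sym.
Qed.

Lemma sd_walk (F : {set {set V}}) (u v : V) : F \subset Ea ->
  connect [rel x y | edge x y \in F] u v -> u <> v -> u \in Va ->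
  exists2 A, arc (pos u) (pos v) A & forall x, A x -> exists2 a, a \in F & cv a x.
Proof.
move=> FE; case: D => s [d [sd D0]]; apply: (walk_arc D0 FE) => x y /= xyF.
have xyE := fintype.subsetP FE _ xyF; exists (edge x y) => //.
have := sd _ xyE; move=> /esym; have ne := pd_neq D0 xyE.
by case/(edge_inj ne) => -[-> ->]; auto.
Qed.

End Basics.

Lemma sd_relabel (V V' : finType) (x0 : V') (Va : {set V}) (Ea : {set {set V}}) X
    (Va' : {set V'}) (Ea' : {set {set V'}}) X' (s : V' -> V) :
  sdrawable Va Ea X -> {in Va' &, injective s} -> (forall w, w \in Va' -> s w \in Va) ->
  (forall a, a \in Ea' -> [/\ #|a| = 2, a \subset Va' & (s @: a)%SET \in Ea]) ->
  (forall a b, a \in Ea' -> b \in Ea' -> a != b -> X (s @: a)%SET (s @: b)%SET -> X' a b) ->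
  sdrawable Va' Ea' X'.
Proof.
move=> [pos [cv D]] sI sV sE sX.
have sd a : a \in Ea' -> a = edge (set_src x0 a) (set_dst x0 a).
  by case/sE => a2 _ _; exact: set_srcP.
apply: (@drawable_sdrawable V' Va' Ea' X' (set_src x0) (set_dst x0)) => //.
case: D => src [dst [sd0 D]].
have sub a w : a \in Ea' -> w \in a -> w \in Va' by case/sE => _ /fintype.subsetP h _; exact: h.
apply: (@drawable_relabel R V _ V' _ Va Ea src dst X Va' Ea' _ _ X' s (fun a => s @: a)%SET) => //.
- by exists pos, cv.
- move=> a b aE bE E; apply/finset.setP => w; apply/idP/idP => wa.
    have : s w \in (s @: b)%SET by rewrite -E; exact: imset_f.
    by case/imsetP=> w' w'b /(sI _ _ (sub _ _ aE wa) (sub _ _ bE w'b)) ->.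
  have : s w \in (s @: a)%SET by rewrite E; exact: imset_f.
  by case/imsetP=> w' w'b /(sI _ _ (sub _ _ bE wa) (sub _ _ aE w'b)) ->.
- by move=> a /sE[].
- move=> a aE; have [a2 _ saE] := sE a aE.
  have uA : set_src x0 a \in a by rewrite {2}(sd a aE) edge_in eqxx.
  have vA : set_dst x0 a \in a by rewrite {2}(sd a aE) edge_in eqxx orbT.
  split; [exact: (sub a)|exact: (sub a)|].
  have E : (s @: a)%SET = edge (s (set_src x0 a)) (s (set_dst x0 a)).
    by rewrite {1}(sd a aE) /edge finset.imsetU1 imset_set1.
  have ne := pd_neq D saE; have := sd0 _ saE; rewrite {1}E => /esym.
  by case/(edge_inj ne) => -[-> ->]; auto.
Qed.

Lemma sd_restrict (V : finType) (Va Va' : {set V}) (Ea Ea' : {set {set V}}) X X' :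
  sdrawable Va Ea X -> Va' \subset Va ->
  (forall a, a \in Ea' -> a \in Ea /\ a \subset Va') ->
  (forall a b, a \in Ea' -> b \in Ea' -> a != b -> X a b -> X' a b) ->
  sdrawable Va' Ea' X'.
Proof.
move=> D /fintype.subsetP sV sE sX; have [pos [cv D0]] := D.
have [x0 _] : exists x0 : V, True by case: D0 => s [_ _]; exists (s finset.set0).
have idE (a : {set V}) : (id @: a)%SET = a by exact: imset_id.
apply: (sd_relabel x0 (s := id) D) => //.
  by move=> a aE; have [aEa aV] := sE a aE; rewrite idE; split => //; exact: (sd_card D0).
by move=> a b; rewrite !idE; exact: sX.
Qed.

Section Sums.
Variables (V : finType) (Va1 Va2 : {set V}) (Ea1 Ea2 : {set {set V}}).
Variable (X : {set V} -> {set V} -> Prop).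
Hypotheses (D1 : sdrawable Va1 Ea1 X) (D2 : sdrawable Va2 Ea2 X).

Let orient (src dst : {set V} -> V) (Va : {set V}) Ea : sdrawable Va Ea X ->
  (forall a, a \in Ea -> a = edge (src a) (dst a)) -> drawable R Va Ea src dst X.
Proof. by move=> [pos [cv D]] sd; exists pos, cv; exact: sdraw_drawable. Qed.

Let setsrc x0 : forall a, a \in (Ea1 :|: Ea2)%SET -> a = edge (set_src x0 a) (set_dst x0 a).
Proof.
have [p1 [c1 E1]] := D1; have [p2 [c2 E2]] := D2.
by move=> a; rewrite inE => /orP[/(sd_card E1)|/(sd_card E2)]; exact: set_srcP.
Qed.

Lemma sd_zero_sum : (Va1 :&: Va2)%SET = finset.set0 -> sdrawable (Va1 :|: Va2)%SET (Ea1 :|: Ea2)%SET X.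
Proof.
have [_ [_ [s _]]] := D1; set x0 := s finset.set0.
move=> E; apply: (@drawable_sdrawable V _ _ _ (set_src x0) (set_dst x0)); last exact: setsrc.
apply: zero_sum => //; apply: orient => // a aE; apply: setsrc; by rewrite inE aE ?orbT.
Qed.

Lemma sd_one_sum v : (Va1 :&: Va2)%SET = [set v]%SET -> sdrawable (Va1 :|: Va2)%SET (Ea1 :|: Ea2)%SET X.
Proof.
move=> E; apply: (@drawable_sdrawable V _ _ _ (set_src v) (set_dst v)); last exact: setsrc.
apply: (one_sum _ _ E); apply: orient => // a aE; apply: setsrc; by rewrite inE aE ?orbT.
Qed.

Lemma sd_two_sum u v t1 t2 : u != v -> (Va1 :&: Va2)%SET = edge u v ->
  t1 \in Va1 -> t2 \in Va2 -> t1 \notin Va2 -> t2 \notin Va1 ->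
  edge u t1 \in Ea1 -> edge v t1 \in Ea1 -> edge u t2 \in Ea2 -> edge v t2 \in Ea2 ->
  (forall a, a \in Ea1 -> t1 \in a -> a = edge u t1 \/ a = edge v t1) ->
  (forall a, a \in Ea2 -> t2 \in a -> a = edge u t2 \/ a = edge v t2) ->
  (forall a b : {set V}, (t1 \in a) || (t2 \in a) -> ~ X a b) ->
  sdrawable ((Va1 :|: Va2) :\ t1 :\ t2)%SET
    [set a in (Ea1 :|: Ea2)%SET | (t1 \notin a) && (t2 \notin a)]%SET X.
Proof.
move=> uv VI t1V t2V t1n t2n f1 g1 f2 g2 at1 at2 X0.
have [p1 [c1 E1]] := D1; have [p2 [c2 E2]] := D2.
have t12 : t1 != t2 by apply: contraNneq t1n => ->.
have uin : u \in Va1 /\ u \in Va2.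
  by apply/andP; rewrite -finset.in_setI VI edge_in eqxx.
have vin : v \in Va1 /\ v \in Va2.
  by apply/andP; rewrite -finset.in_setI VI edge_in eqxx orbT.
have ut1 : u != t1 by apply: contraNneq t1n => <-; case: uin.
have vt1 : v != t1 by apply: contraNneq t1n => <-; case: vin.
have ut2 : u != t2 by apply: contraNneq t2n => <-; case: uin.
have vt2 : v != t2 by apply: contraNneq t2n => <-; case: vin.
have t1E2 a : a \in Ea2 -> t1 \notin a.
  by move=> aE; apply: contraNN t1n; exact: (sd_sub E2).
have t2E1 a : a \in Ea1 -> t2 \notin a.
  by move=> aE; apply: contraNN t2n; exact: (sd_sub E1).
pose src (a : {set V}) := if (t1 \in a) || (t2 \in a) then (if u \in a then u else v) else set_src u a.
pose dst (a : {set V}) := if t1 \in a then t1 else if t2 \in a then t2 else set_dst u a.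
have sd a : a \in (Ea1 :|: Ea2)%SET -> a = edge (src a) (dst a).
  move=> aE; have aE' := setsrc u aE; rewrite /src /dst.
  case: (boolP (t1 \in a)) => ta /=.
    have aE1 : a \in Ea1 by move: aE; rewrite inE => /orP[//|/t1E2]; rewrite ta.
    case: (at1 a aE1 ta) => ->; rewrite edge_in ?eqxx //.
    by rewrite (negbTE uv) (negbTE ut1).
  case: (boolP (t2 \in a)) => ta' //.
  have aE2 : a \in Ea2 by move: aE; rewrite inE => /orP[/t2E1|//]; rewrite ta'.
  case: (at2 a aE2 ta') => ->; rewrite edge_in ?eqxx //.
  by rewrite (negbTE uv) (negbTE ut2).
have tin1 w : t1 \in edge w t1 by rewrite edge_in eqxx orbT.
have tin2 w : t2 \in edge w t2 by rewrite edge_in eqxx orbT.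
have tn12 w : w != t1 -> t1 \notin edge w t2 by move=> h; rewrite edge_in negb_or eq_sym h t12.
have D1' : drawable R Va1 Ea1 src dst X.
  by apply: orient => // a aE; apply: sd; rewrite inE aE.
have D2' : drawable R Va2 Ea2 src dst X.
  by apply: orient => // a aE; apply: sd; rewrite inE aE orbT.
have vnu t : u != t -> u \notin edge v t by move=> h; rewrite edge_in negb_or uv h.
have uIn t : u \in edge u t by rewrite edge_in eqxx.
have D3 : drawable R ((Va1 :|: Va2) :\ t1 :\ t2)%SET
    ((Ea1 :|: Ea2) :\ edge u t1 :\ edge v t1 :\ edge u t2 :\ edge v t2)%SET src dst X.
  apply: (@two_sum R V _ Va1 Va2 Ea1 Ea2 src dst X u v t1 t2) => //.
  - by rewrite /src tin1 uIn.
  - by rewrite /dst tin1.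
  - by rewrite /src tin1 (negbTE (vnu _ ut1)).
  - by rewrite /dst tin1.
  - by rewrite /src tin2 orbT uIn.
  - by rewrite /dst tin2 (negbTE (tn12 _ ut1)).
  - by rewrite /src tin2 orbT (negbTE (vnu _ ut2)).
  - by rewrite /dst tin2 (negbTE (tn12 _ vt1)).
  - move=> a aE; have aE' : a \in (Ea1 :|: Ea2)%SET by rewrite inE aE.
    have := sd a aE' => aS; split; last first.
      by move=> dE; apply: at1 => //; rewrite aS dE tin1.
    apply/eqP => sE; have ta : t1 \in a by rewrite aS sE edge_in eqxx.
    move: sE; rewrite /src ta /=; case: ifP => _ E.
      by rewrite E eqxx in ut1.
    by rewrite E eqxx in vt1.
  - move=> a aE; have aE' : a \in (Ea1 :|: Ea2)%SET by rewrite inE aE orbT.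
    have := sd a aE' => aS; split; last first.
      by move=> dE; apply: at2 => //; rewrite aS dE tin2.
    apply/eqP => sE; have ta : t2 \in a by rewrite aS sE edge_in eqxx.
    move: sE; rewrite /src ta orbT /=; case: ifP => _ E.
      by rewrite E eqxx in ut2.
    by rewrite E eqxx in vt2.
  - move=> a b; rewrite !inE => /or4P[] /eqP ->; apply: X0; rewrite ?tin1 ?tin2 ?orbT //.
have D4 : sdrawable ((Va1 :|: Va2) :\ t1 :\ t2)%SET
    ((Ea1 :|: Ea2) :\ edge u t1 :\ edge v t1 :\ edge u t2 :\ edge v t2)%SET X.
  by apply: (drawable_sdrawable D3) => a; rewrite !inE => /and5P[_ _ _ _ aE]; apply: sd; rewrite inE.
apply: (sd_restrict D4) => // a; rewrite !inE => /andP[aE /andP[ta ta']].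
split.
  rewrite aE andbT; apply/and4P; split; [apply: contraNneq ta'|apply: contraNneq ta'|apply: contraNneq ta|apply: contraNneq ta] => ->;
    by rewrite ?tin1 ?tin2.
apply/fintype.subsetP => w wa; rewrite !inE.
rewrite (contraNneq _ ta') ?(contraNneq _ ta) /=; try by move=> <-.
by case/orP: aE => aE; rewrite ?(sd_sub E1 aE wa) ?(sd_sub E2 aE wa) ?orbT.
Qed.

End Sums.

Lemma sd_book (V : finType) (x0 : V) (Va : {set V}) (Ea : {set {set V}}) X (ord : V -> nat)
    (page : {set V} -> bool) (lo hi : {set V} -> nat) :
  {in Va &, injective ord} ->
  (forall a, a \in Ea -> exists u v, [/\ a = edge u v, u \in Va, v \in Va, lo a = ord u &
     hi a = ord v] /\ (ord u < ord v)%N) ->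
  (forall a b, a \in Ea -> b \in Ea -> a != b -> page a = page b ->
     [\/ (hi a <= lo b)%N, (hi b <= lo a)%N, (lo a <= lo b)%N && (hi b <= hi a)%N |
      (lo b <= lo a)%N && (hi a <= hi b)%N]) ->
  sdrawable Va Ea X.
Proof.
move=> oI ends lam.
have sd a : a \in Ea -> a = edge (set_src x0 a) (set_dst x0 a).
  case/ends=> u [v [[aE uV vV _ _] uv]]; apply: set_srcP; rewrite aE; apply: edge_card.
  by apply: contraTneq uv => ->; rewrite ltnn.
apply: (drawable_sdrawable _ sd); apply: (@book R V _ Va Ea _ _ X ord page lo hi) => //.
  move=> a aE; have [u [v [[aE' uV vV -> ->] uv]]] := ends a aE.
  have nuv : u != v by apply: contraTneq uv => ->; rewrite ltnn.
  by have := sd a aE; rewrite {1}aE' => /(edge_inj nuv)[[<- <-]|[<- <-]]; split => //; auto.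
move=> a b aE bE ab pab; have h : ~ (lo a = lo b /\ hi a = hi b).
  have [u [v [[aE' uV vV -> ->] _]]] := ends a aE; have [x [y [[bE' xV yV -> ->] _]]] := ends b bE.
  by case=> /(oI _ _ uV xV) ux /(oI _ _ vV yV) vy; rewrite aE' bE' ux vy eqxx in ab.
have st (m n m' n' : nat) : (m <= n)%N -> (n' <= m')%N -> ~ (m = n /\ m' = n') -> (m < n)%N \/ (n' < m')%N.
  rewrite [(m <= n)%N]leq_eqVlt [(n' <= m')%N]leq_eqVlt => /orP[/eqP ->|]; last by left.
  by case/orP=> [/eqP ->|]; [case|right].
have h' : ~ (lo b = lo a /\ hi b = hi a) by case=> h1 h2; apply: h.
case: (lam a b aE bE ab pab) => [h1|h1|/andP[h1 h2]|/andP[h1 h2]].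
- by constructor 1.
- by constructor 2.
- by constructor 3; split => //; exact: st.
- by constructor 4; split => //; exact: st.
Qed.

(** The crossing relation that links the two notions of drawing: the drawings of all of [G] in the
    sense of [sdraw] with this relation are the restricted ones. All namings of the four ends are
    covered. *)
Definition allowed (S : set crossing_type) (G : sgraph) (a b : {set G}) : Prop :=
  (a :&: b)%SET = finset.set0 /\
  forall u v x y, a = edge u v -> b = edge x y -> S (type_of_crossing u v x y).

Lemma restricted_sdraw S (G : sgraph) (x0 : G) : restricted R S G ->
  sdrawable [set: G]%SET (edges G) (@allowed S G).
Proof.
move=> [D [[dD one dis] typ]]; exists (Defs.pos D), (curve D), (set_src x0), (set_dst x0).
have ed a : a \in edges G -> exists u v, adj u v /\ a = edge u v.
  by rewrite inE => /existsP[u /existsP[v /andP[uv /eqP ->]]]; exists u, v.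
have ne u v : adj u v -> u != v :> G by apply: contraTneq => ->; rewrite adj_irrefl.
have sd a : a \in edges G -> a = edge (set_src x0 a) (set_dst x0 a).
  by case/ed=> u [v [/ne uv ->]]; apply: set_srcP; exact: edge_card.
have crs a b p : a \in edges G -> b \in edges G -> a != b -> curve D a p -> curve D b p ->
    (forall w, w \in [set: G]%SET -> Defs.pos D w <> p) -> crosses D a b p.
  move=> aE bE ab ca cb nv; split => //; move=> [w _ wp]; exact: (nv w).
split=> //; split.
- by move=> u v _ _; exact: (pos_inj dD).
- by move=> a _; rewrite !inE.
- move=> a aE; apply/arcP; have := sd a aE => aS.
  by rewrite {3}aS; apply: (curve_simple dD); rewrite -edges_adj -aS.
- move=> a w aE _ cw; have : w \in a.
    by apply: contrapT => /negP wa; exact: (curve_avoids dD aE wa).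
  by rewrite {1}(sd a aE) edge_in => /orP[/eqP|/eqP]; auto.
- move=> a b p aE bE ab ca cb nv; have cr := crs a b p aE bE ab ca cb nv.
  split; last exact: (crosses_transversal dD).
  split; first exact: (dis _ _ _ cr).
  by move=> u v x y aE' bE'; apply: (typ u v x y p); rewrite -aE' -bE'.
- move=> a b c p q aE bE cE ab ac cap cbp caq ccq nvp nvq.
  by apply: (one a b c p q); apply: crs.
Qed.

Lemma sdraw_restricted S (G : sgraph) :
  sdrawable [set: G]%SET (edges G) (@allowed S G) -> restricted R S G.
Proof.
move=> [pos [cv [src [dst [sd D]]]]]; exists (DrawingData pos cv).
have crs a b p : crosses (DrawingData pos cv) a b p -> [/\ a \in edges G, b \in edges G, a != b,
    cv a p /\ cv b p & forall w, w \in [set: G]%SET -> pos w <> p].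
  by case=> aE bE ab [ca cb] nr; split => // w _ wp; apply: nr; exists w.
have one a b c p q : crosses (DrawingData pos cv) a b p -> crosses (DrawingData pos cv) a c q -> b = c /\ p = q.
  by move=> /crs[aE bE ab [ca cb] nv] /crs[_ cE ac [ca' cc] nv']; apply: (pd_one D aE bE cE).
have al a b p : crosses (DrawingData pos cv) a b p -> allowed S a b.
  by move=> /crs[aE bE ab [ca cb] nv]; have [] := pd_cross D aE bE ab ca cb nv.
split; last by move=> u v x y p /al[_]; exact.
split=> //; last by move=> a b p /al[].
split.
- by move=> u v; apply: (pd_inj D).
- move=> u v uv; apply/arcP; have uvE : edge u v \in edges G by rewrite edges_adj.
  have nuv : u != v by apply: contraTneq uv => ->; rewrite adj_irrefl.
  have := pd_arc D uvE; have := sd _ uvE => /(edge_inj nuv)[[<- <-]//|[<- <-]]; exact: arc_rev.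
- move=> a w aE; rewrite {1}(sd a aE) edge_in negb_or => /andP[/eqP h1 /eqP h2] cw.
  by have [] := pd_avoid D aE (finset.in_setT w) cw.
- move=> a b; case: (pselect (exists p0, crosses (DrawingData pos cv) a b p0)) => [[p0 h0]|no].
    apply: (@sub_finite_set _ _ [set p0]); last exact: finite_set1.
    by move=> p /= h; have [_ ->] := one _ _ _ _ _ h h0.
  suff -> : [set p | crosses (DrawingData pos cv) a b p] = classical_sets.set0 by exact: finite_set0.
  by apply/seteqP; split => p //= h; apply: no; exists p.
- by move=> a b p /crs[aE bE ab [ca cb] nv]; have [] := pd_cross D aE bE ab ca cb nv.
Qed.

Lemma restricted_empty S (G : sgraph) : (forall v : G, False) -> restricted R S G.
Proof.
move=> emp; have noe a : a \in edges G -> False by rewrite inE => /existsP[u]; case: (emp u).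
exists (DrawingData (fun _ => (0, 0)) (fun _ => classical_sets.set0)).
have nc a b p : crosses (DrawingData (fun _ : G => (0, 0) : P) (fun _ => classical_sets.set0)) a b p -> False.
  by case=> /noe.
split; last by move=> u; case: (emp u).
split; [|by move=> a b c p q /nc|by move=> a b p /nc].
split; [by move=> u|by move=> u|by move=> a w /noe| |by move=> a b p /nc].
move=> a b; suff -> : [set p | crosses (DrawingData (fun _ : G => (0, 0) : P) (fun _ => classical_sets.set0)) a b p] = classical_sets.set0 by exact: finite_set0.
by apply/seteqP; split => p //= /nc.
Qed.

End SimpleDrawings.

(** * From skeletons to the graph *)

Section CycleOrder.
Variables (V K : finType) (C : {set V}) (F : {set K}) (ends : K -> {set V}).
Hypotheses (ends2 : forall e, e \in F -> #|ends e| = 2) (endsC : forall e, e \in F -> ends e \subset C).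
Hypothesis deg2 : {in C, forall v, #|[set e in F | v \in ends e]%SET| = 2}.
Let r : rel V := fun u v => [exists e in F, ends e == edge u v].
Hypotheses (C3 : (2 < #|C|)%N) (conn : connected_on r C).

Let rP u v : reflect (exists2 e, e \in F & ends e = edge u v) (r u v).
Proof. by apply: (iffP exists_inP) => -[e eF /eqP]; exists e => //; apply/eqP. Qed.

Let rC u v : r u v -> [/\ u \in C, v \in C & u != v].
Proof.
case/rP=> e eF eE; have /fintype.subsetP sub := endsC eF; rewrite eE in sub; split.
- by apply: sub; rewrite edge_in eqxx.
- by apply: sub; rewrite edge_in eqxx orbT.
- by have := ends2 eF; rewrite eE cards2; case: eqP.
Qed.

Let rsym u v : r u v = r v u.
Proof. by rewrite /r edgeC. Qed.

Let two_edges v y z : y != z -> r v y -> r v z ->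
  (forall e, e \in F -> v \in ends e -> ends e = edge v y \/ ends e = edge v z) /\
  (forall e e', e \in F -> e' \in F -> v \in ends e -> ends e = ends e' -> e = e').
Proof.
move=> yz ry rz; have [vC _ _] := rC ry.
case/rP: ry => e1 e1F E1; case/rP: rz => e2 e2F E2.
have e12 : e1 != e2 by apply: contraNneq yz => E; rewrite E E2 in E1; rewrite (edge_injr E1).
have all e : e \in F -> v \in ends e -> e = e1 \/ e = e2.
  move=> eF ve; have : [set e1; e2]%SET = [set e in F | v \in ends e]%SET.
    apply/eqP; rewrite eqEcard deg2 // cards2 e12 andbT; apply/fintype.subsetP => f.
    by rewrite !inE => /orP[] /eqP ->; rewrite ?e1F ?e2F ?E1 ?E2 edge_in eqxx.
  move/finset.setP/(_ e); rewrite !inE eF ve /= => /orP[/eqP|/eqP]; auto.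
split=> [e eF ve|e e' eF e'F ve EE]; first by case: (all e eF ve) => ->; auto.
have ve' : v \in ends e' by rewrite -EE.
have ne : edge v y <> edge v z by move/edge_injr => h; rewrite h eqxx in yz.
case: (all e eF ve) (all e' e'F ve') => -> [] -> // in EE *; move: EE; rewrite E1 E2 //.
by move/esym.
Qed.

Let other_edge v e : v \in C -> exists2 g, g \in F & v \in ends g /\ g != e.
Proof.
move=> vC; have /eqP := deg2 vC => /cards2P[e1 [e2 [e12 E]]].
have /andP[f1 v1] : (e1 \in F) && (v \in ends e1).
  by have /finset.setP/(_ e1) := E; rewrite !inE eqxx.
have /andP[f2 v2] : (e2 \in F) && (v \in ends e2).
  by have /finset.setP/(_ e2) := E; rewrite !inE eqxx orbT.
case: (eqVneq e1 e) => [<-|ne]; last by exists e1.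
by exists e2 => //; rewrite eq_sym.
Qed.

Let simple_path (p : seq V) := [&& uniq p, sorted r p & all (mem C) p].

Let longest : exists2 p, simple_path p & (0 < size p)%N /\ forall q, simple_path q -> (size q <= size p)%N.
Proof.
have ub n : [exists t : n.-tuple V, simple_path t] -> (n <= #|V|)%N.
  case/existsP=> t /and3P[ut _ _]; rewrite -(size_tuple t) -(card_uniqP ut); exact: max_card.
have [x xC] : exists x, x \in C by apply/card_gt0P; apply: leq_ltn_trans C3.
have ex : exists n, [exists t : n.-tuple V, simple_path t].
  by exists 1%N; apply/existsP; exists [tuple x]; rewrite /simple_path /= xC.
case: (ex_maxnP ex ub) => m /existsP[t tP] mmax; exists t => //.
rewrite size_tuple; split.
  by apply: mmax; apply/existsP; exists [tuple x]; rewrite /simple_path /= xC.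
by move=> q qP; apply: mmax; apply/existsP; exists (in_tuple q).
Qed.

(** Take a longest path. Maximality keeps the neighbours of its ends on the path, and degree two
    those of its inner vertices, so connectedness makes it contain all vertices. Its ends are then
    adjacent, and no edges other than those of this cycle remain. *)
Lemma cycle_order : exists c : seq V, [/\ uniq c, c =i C, {in F &, injective ends} &
  exists x0, [/\ forall i, (i.+1 < size c)%N -> r (nth x0 c i) (nth x0 c i.+1),
    r (nth x0 c 0) (nth x0 c (size c).-1) &
    forall e, e \in F ->
      (exists2 i, (i.+1 < size c)%N & ends e = edge (nth x0 c i) (nth x0 c i.+1)) \/
      ends e = edge (nth x0 c 0) (nth x0 c (size c).-1)]].
Proof.
have [p /and3P[up sp pC] [p0 pmax]] := longest.
have [x0 [q pE]] : exists x0 q, p = x0 :: q by case: (p) p0 => // a q _; exists a, q.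
pose c := nth x0 p; pose n := size p.
have c0 : c 0%N = x0 by rewrite /c pE.
have cin i : (i < n)%N -> c i \in p by move=> h; rewrite mem_nth.
have cI i j : (i < n)%N -> (j < n)%N -> c i = c j -> i = j.
  by move=> hi hj /eqP; rewrite nth_uniq // => /eqP.
have cne i j : (i < n)%N -> (j < n)%N -> i != j -> c i != c j.
  by move=> hi hj; apply: contra => /eqP/(cI _ _ hi hj)/eqP.
have inC i : (i < n)%N -> c i \in C by move=> /cin/(allP pC).
have idx v : v \in p -> exists2 i, (i < n)%N & v = c i.
  by move=> vp; exists (index v p); rewrite ?index_mem // /c nth_index.
have step i : (i.+1 < n)%N -> r (c i) (c i.+1).
  move: sp; rewrite /c /n pE /= => /(pathP x0) h; exact: h.
have step' i : (0 < i)%N -> (i < n)%N -> r (c i) (c i.-1).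
  by case: i => // i _ hi; rewrite rsym /=; exact: step.
have endL y : r (c 0%N) y -> y \in p.
  move=> ry; apply: contraT => yp; have [_ yC _] := rC ry.
  suff /pmax : simple_path (y :: p) by rewrite /= ltnn.
  by rewrite /simple_path /= yp up yC pC !andbT pE /= -c0 rsym ry /=; move: sp; rewrite pE c0.
have endR y : r (c n.-1) y -> y \in p.
  move=> ry; apply: contraT => yp; have [_ yC _] := rC ry.
  suff /pmax : simple_path (rcons p y) by rewrite size_rcons ltnn.
  rewrite /simple_path rcons_uniq yp up all_rcons /= yC pC !andbT.
  have lE : last x0 q = c n.-1 by rewrite /c /n pE /= nth_last.
  by move: sp; rewrite pE /= rcons_path lE ry andbT.
have closed v y : v \in p -> r v y -> y \in p.
  case/idx=> i hi -> ry; case: (posnP i) => [i0|i0]; first by apply: endL; rewrite -i0.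
  case: (leqP n i.+1) => hn; first by apply: endR; have <- : i = n.-1 by move: hi hn; clear; lia.
  have ne : c i.+1 != c i.-1 by apply: cne; move: hi i0 hn; clear; lia.
  have [two _] := two_edges ne (step _ hn) (step' _ i0 hi).
  case/rP: ry => e eF eE; have := two e eF; rewrite eE edge_in eqxx => /(_ isT).
  by case=> /edge_injr ->; apply: cin; move: hi i0 hn; clear; lia.
have Cp : C \subset p.
  have x0p : x0 \in p by rewrite pE inE eqxx.
  have x0C := allP pC _ x0p.
  apply/fintype.subsetP => v vC; have /connectP[s ss ->] := conn x0C vC.
  elim: s x0 x0p ss {pE c c0 cin cI cne inC idx step step' endL endR x0C} => //= w s IH x xp /andP[/and3P[_ _ rxw]].
  by apply: IH; exact: (closed x).
have n3 : (2 < n)%N by apply: leq_trans C3 _; rewrite /n -(card_uniqP up); exact: subset_leq_card.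
(* The second edge at the first vertex leads to some [c j]. An inner vertex [c j] already has its
   two edges along the path, so j would be 1 and the edge would equal the first one; hence j is the
   last index. *)
have r0n : r (c 0%N) (c n.-1).
  have r01 : r (c 0%N) (c 1%N) by apply: step; exact: ltnW.
  have [f fF fE] := rP _ _ r01.
  have [g gF [vg gf]] := other_edge f (inC 0%N (ltnW (ltnW n3))).
  have [y gE ne] := card_edge (ends2 gF) vg.
  have ry : r (c 0%N) y by apply/rP; exists g.
  have [j hj yE] := idx _ (endL _ ry); rewrite {}yE in gE ne ry.
  case: (eqVneq j n.-1) => [<-//|jn].
  have j0 : (0 < j)%N by case: (posnP j) ne => // ->; rewrite eqxx.
  have hj' : (j.+1 < n)%N by move: hj jn n3; clear; lia.
  have ne' : c j.+1 != c j.-1 by apply: cne; move: hj' j0; clear; lia.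
  have [two uni] := two_edges ne' (step _ hj') (step' _ j0 hj).
  have jg : c j \in ends g by rewrite gE edge_in eqxx orbT.
  have h0 : c 0%N \in ends g by rewrite gE edge_in eqxx.
  have j1 : j = 1%N.
    have n0 : (0 < n)%N by exact: ltnW (ltnW n3).
    have hp : (j.-1 < n)%N by move: hj; clear; lia.
    case: (two g gF jg) => E; move: h0; rewrite E edge_in => /orP[/eqP h|/eqP h].
    - by have := cI _ _ n0 hj h; move: j0; clear; lia.
    - by have := cI _ _ n0 hj' h; move: j0; clear; lia.
    - by have := cI _ _ n0 hj h; move: j0; clear; lia.
    - by have := cI _ _ n0 hp h; move: j0; clear; lia.
  by case/eqP: gf; apply: (uni g f gF fF jg); rewrite gE fE j1.
pose good (a : {set V}) := (exists2 i, (i.+1 < n)%N & a = edge (c i) (c i.+1)) \/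
    a = edge (c 0%N) (c n.-1).
have local i : (i < n)%N -> exists y z, [/\ y != z, r (c i) y, r (c i) z, good (edge (c i) y) & good (edge (c i) z)].
  move=> hi; case: (posnP i) => [->|i0].
    exists (c 1%N), (c n.-1); split => //.
    - by apply: cne; move: n3; clear; lia.
    - by apply: step; exact: ltnW.
    - by left; exists 0%N => //; exact: ltnW.
    - by right.
  have g1 : good (edge (c i) (c i.-1)) by left; exists i.-1; rewrite ?prednK // edgeC.
  case: (leqP n i.+1) => hn.
    have iE : i = n.-1 by move: hi hn; clear; lia.
    exists (c i.-1), (c 0%N); split => //.
    - by apply: cne; move: hi hn n3; clear; lia.
    - exact: step'.
    - by rewrite iE rsym.
    - by right; rewrite iE edgeC.
  exists (c i.-1), (c i.+1); split => //.
  - by apply: cne; move: hi i0 hn; clear; lia.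
  - exact: step'.
  - exact: step.
  - by left; exists i.
have edge_at e : e \in F -> exists2 i, (i < n)%N & c i \in ends e.
  move=> eF; have [v ve] : exists v, v \in ends e by apply/card_gt0P; rewrite ends2.
  have /idx[i hi vE] := fintype.subsetP Cp _ (fintype.subsetP (endsC eF) _ ve).
  by exists i => //; rewrite -vE.
exists p; split => //.
- by move=> v; apply/idP/idP => [/(allP pC)//|/(fintype.subsetP Cp)].
- move=> e e' eF e'F; have [i hi ve] := edge_at e eF.
  have [y [z [yz ry rz _ _]]] := local i hi; have [_ uni] := two_edges yz ry rz.
  exact: uni.
- exists x0; split => // e eF; have [i hi ve] := edge_at e eF.
  have [y [z [yz ry rz gy gz]]] := local i hi; have [two _] := two_edges yz ry rz.
  by case: (two e eF ve) => ->.
Qed.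

(** Go round the cycle the other way. This will show that two cycles stay connected when they are
    merged at a common virtual edge that is then deleted. *)
Lemma cycle_minus_edge e u v : e \in F -> ends e = edge u v ->
  connect [rel a b | [exists f in (F :\ e)%SET, ends f == edge a b]] u v.
Proof.
move=> eF eE; have [c [uc cC einj [x0 [step cl all]]]] := cycle_order.
set r' := SimplRel _; pose n := size c; pose k := nth x0 c.
have n3 : (2 < n)%N by rewrite /n -(card_uniqP uc) (eq_card cC).
have n0 : (0 < n)%N by exact: ltnW (ltnW n3).
have nn : (n.-1 < n)%N by rewrite prednK.
have kI i j : (i < n)%N -> (j < n)%N -> k i = k j -> i = j.
  by move=> hi hj /eqP; rewrite (nth_uniq x0 hi hj uc) => /eqP.
have sym a b : connect r' a b = connect r' b a.
  by apply: sym_connect_sym => {}a {}b; rewrite /r' /= edgeC.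
have keep a b : r a b -> edge a b <> ends e -> connect r' a b.
  move=> /rP[f fF fE] ne; apply: connect1; apply/exists_inP; exists f; last by rewrite fE.
  by rewrite !inE fF andbT; apply/eqP => E; apply: ne; rewrite -fE E.
have kne i : (i.+1 < n)%N -> k i != k i.+1.
  by move=> h; apply/eqP => /(kI _ _ (ltnW h) h) E; have := ltnSn i; rewrite {1}E ltnn.
have run i d : (i + d < n)%N -> (forall j, (i <= j)%N -> (j < i + d)%N -> edge (k j) (k j.+1) <> ends e) ->
    connect r' (k i) (k (i + d)%N).
  elim: d => [|d IH]; first by rewrite addn0 connect0.
  rewrite addnS => h ne; apply: connect_trans (IH (ltnW h) _) _.
    by move=> j h1 h2; apply: ne => //; exact: leqW.
  by apply: keep; [exact: step|apply: ne => //; exact: leq_addr].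
suff [a [b [abE con]]] : exists a b, ends e = edge a b /\ connect r' a b.
  have nab : a != b by have := ends2 eF; rewrite abE cards2; case: eqP.
  by have := abE; rewrite eE => /esym/(edge_inj nab)[[<- <-]//|[<- <-]]; rewrite sym.
case: (all e eF) => [[i hi iE]|clE].
  exists (k i), (k i.+1); split => //.
  have h0 : connect r' (k 0%N) (k i).
    apply: (run 0%N i); first exact: ltnW.
    move=> j _ ji; rewrite iE => /(edge_inj (kne j _)); rewrite add0n in ji.
    have hj : (j.+1 < n)%N by exact: leq_trans (_ : j.+2 <= i.+1)%N (ltnW hi).
    case=> // -[h1 h2].
      by have := kI _ _ (ltnW hj) (ltnW hi) h1 => E; rewrite E ltnn in ji.
    by have := kI _ _ (ltnW hj) hi h1 => E; rewrite E ltnNge leqnSn in ji.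
  have h1 : connect r' (k i.+1) (k n.-1).
    have hd : (i.+1 + (n.-1 - i.+1) = n.-1)%N by move: hi; clear; lia.
    have := run i.+1 (n.-1 - i.+1)%N; rewrite hd; apply => // j j1 j2; rewrite iE.
    have hj : (j.+1 < n)%N by move: j2 n0; clear; lia.
    move=> /(edge_inj (kne j hj)) [[h1 h2]|[h1 h2]].
      by have := kI _ _ (ltnW hj) (ltnW hi) h1 => E; rewrite E ltnn in j1.
    by have := kI _ _ hj (ltnW hi) h2 => E; rewrite -E in j1; move: j1; clear; lia.
  have h2 : connect r' (k 0%N) (k n.-1).
    apply: keep => //; rewrite iE => E.
    have := edge_inj (kne i hi) (esym E) => -[[g1 g2]|[g1 g2]].
      have e1 := kI _ _ (ltnW hi) n0 g1; have e2 := kI _ _ hi nn g2.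
      by move: e1 e2 n3; clear; lia.
    by have := kI _ _ hi n0 g2.
  by rewrite sym in h0; rewrite sym in h1; apply: connect_trans h0 _; exact: connect_trans h2 h1.
exists (k 0%N), (k n.-1); split => //.
apply: (run 0%N n.-1) => // j _; rewrite add0n => hj; rewrite clE => E.
have hj' : (j.+1 < n)%N by move: hj; clear; lia.
have := edge_inj (kne j hj') E => -[[g1 g2]|[g1 g2]].
  have e1 := kI _ _ (ltnW hj') n0 g1; have e2 := kI _ _ hj' nn g2.
  by move: e1 e2 n3; clear; lia.
by have := kI _ _ hj' n0 g2.
Qed.

End CycleOrder.

Lemma sd_book_order (R : realType) (V : finType) (x0 : V) (Va : {set V}) (Ea : {set {set V}}) X
    (ord : V -> nat) (page : {set V} -> bool) :
  {in Va &, injective ord} ->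
  (forall a, a \in Ea -> #|a| = 2 /\ a \subset Va) ->
  (forall u v x y, edge u v \in Ea -> edge x y \in Ea -> (ord u < ord v)%N -> (ord x < ord y)%N ->
     page (edge u v) = page (edge x y) ->
     [|| (ord v <= ord x)%N, (ord y <= ord u)%N, (ord u <= ord x)%N && (ord y <= ord v)%N |
      (ord x <= ord u)%N && (ord v <= ord y)%N]) ->
  sdrawable R Va Ea X.
Proof.
move=> oI ends lam.
pose hi (a : {set V}) := \max_(w in a) ord w.
(* On a set of two vertices, the sum minus the maximum is the minimum. *)
pose lo (a : {set V}) := (\sum_(w in a) ord w - hi a)%N.
have val u v : (ord u < ord v)%N -> lo (edge u v) = ord u /\ hi (edge u v) = ord v.
  move=> uv; have ne : u != v by apply: contraTneq uv => ->; rewrite ltnn.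
  have hE : hi (edge u v) = ord v.
    by rewrite /hi /edge big_setU1 ?inE //= big_set1; apply/maxn_idPr; exact: ltnW.
  by split => //; rewrite /lo hE /edge big_setU1 ?inE //= big_set1 addnK.
have rep a : a \in Ea -> exists u v, [/\ a = edge u v, u \in Va, v \in Va, lo a = ord u &
     hi a = ord v] /\ (ord u < ord v)%N.
  move=> aE; have [a2 /fintype.subsetP aV] := ends a aE.
  have [u ua] : exists u, u \in a by apply/card_gt0P; rewrite a2.
  have [v aE' uv] := card_edge a2 ua; have va : v \in a by rewrite aE' edge_in eqxx orbT.
  have uV := aV _ ua; have vV := aV _ va.
  case: (ltngtP (ord u) (ord v)) => h.
  - by exists u, v; have [l1 l2] := val _ _ h; rewrite aE'.
  - by exists v, u; have [l1 l2] := val _ _ h; rewrite aE' edgeC.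
  - by rewrite (oI _ _ uV vV h) eqxx in uv.
apply: (@sd_book R V x0 Va Ea X ord page lo hi) => //.
move=> a b aE bE _; have [u [v [[aE' _ _ -> ->] uv]]] := rep a aE.
have [x [y [[bE' _ _ -> ->] xy]]] := rep b bE; rewrite aE' bE' => pg.
rewrite aE' in aE; rewrite bE' in bE.
by case/or4P: (lam u v x y aE bE uv xy pg) => h; [constructor 1|constructor 2|constructor 3|constructor 4].
Qed.

Lemma edgesP (G : sgraph) (a : {set G}) :
  reflect (exists u v, adj u v /\ a = edge u v) (a \in edges G).
Proof.
rewrite inE; apply: (iffP existsP) => [[u /existsP[v /andP[uv /eqP ->]]]|[u [v [uv ->]]]].
  by exists u, v.
by exists u; apply/existsP; exists v; rewrite uv eqxx.
Qed.

Lemma adj_neq (G : sgraph) (u v : G) : adj u v -> u != v.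
Proof. by apply: contraTneq => ->; rewrite adj_irrefl. Qed.

Lemma edges_card (G : sgraph) (a : {set G}) : a \in edges G -> #|a| = 2.
Proof. by case/edgesP=> u [v [/adj_neq uv ->]]; exact: edge_card. Qed.

Lemma imset_edge (V V' : finType) (s : V -> V') (u v : V) : (s @: edge u v)%SET = edge (s u) (s v).
Proof. by rewrite /edge finset.imsetU1 imset_set1. Qed.

Lemma type_disjoint (S : set crossing_type) (G : sgraph) (u v x y : G) :
  S `<=` [set Full; AlmostFull; Bowtie]%classic -> S (type_of_crossing u v x y) ->
  (adj u x && adj v y) || (adj u y && adj v x).
Proof.
move=> SS /SS; rewrite /type_of_crossing.
by case: (adj u x); case: (adj u y); case: (adj v x); case: (adj v y) => //= -[[]|].
Qed.

(** The type of a crossing is determined by the adjacencies and non-adjacencies between its four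
    ends, so it is reflected by every map that preserves both on the vertices in question. *)
Lemma allowed_map (S : set crossing_type) (G G' : sgraph) (s : G' -> G) (Q a b : {set G'}) :
  {in Q &, forall u v, adj (s u) (s v) = adj u v} -> a \subset Q -> b \subset Q ->
  allowed S (s @: a)%SET (s @: b)%SET -> allowed S a b.
Proof.
move=> sadj /fintype.subsetP aQ /fintype.subsetP bQ [dis typ]; split.
  apply/finset.setP => w; rewrite !inE; apply/negP => /andP[wa wb].
  have := finset.in_setI (s w) (s @: a)%SET (s @: b)%SET.
  by rewrite dis finset.in_set0 !imset_f.
move=> u v x y aE bE; have := typ (s u) (s v) (s x) (s y).
rewrite aE bE !imset_edge => /(_ erefl erefl); rewrite /type_of_crossing.
have uQ : u \in Q by apply: aQ; rewrite aE edge_in eqxx.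
have vQ : v \in Q by apply: aQ; rewrite aE edge_in eqxx orbT.
have xQ : x \in Q by apply: bQ; rewrite bE edge_in eqxx.
have yQ : y \in Q by apply: bQ; rewrite bE edge_in eqxx orbT.
by rewrite !sadj.
Qed.

Section Reroute.
Variables (R : realType) (V : finType) (Va : {set V}) (Ea : {set {set V}}).
Variables (X : {set V} -> {set V} -> Prop) (pos : V -> R * R) (cv : {set V} -> set (R * R)).
Hypothesis D : sdraw Va Ea X pos cv.

Lemma sd_strengthen (Y : {set V} -> {set V} -> Prop) :
  (forall a b p, a \in Ea -> b \in Ea -> a != b -> cv a p -> cv b p ->
     (forall w, w \in Va -> pos w <> p) -> X a b -> Y a b) -> sdraw Va Ea Y pos cv.
Proof.
case: D => src [dst [sd D0]] XY; exists src, dst; split => //.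
case: (D0) => h1 h2 h3 h4 h5 h6; split => // a b p aE bE ab ca cb nv.
by have [Xab tr] := h5 a b p aE bE ab ca cb nv; split => //; exact: (XY a b p).
Qed.

Lemma sd_cross a b p : a \in Ea -> b \in Ea -> a != b -> cv a p -> cv b p ->
  (forall w, w \in Va -> pos w <> p) -> X a b.
Proof. by case: D => src [dst [sd D0]] *; have [] := @pd_cross _ _ _ _ _ _ _ _ _ _ D0 a b p. Qed.

(* The rerouted path u, t, v runs along the first part of the edge {u, t} and
   then along b towards v. *)
Lemma sd_reroute u v t b p : edge u t \in Ea -> b \in Ea -> edge u t != b ->
  cv (edge u t) p -> cv b p -> (forall w, w \in Va -> pos w <> p) ->
  v \in b -> t \notin b -> u != v ->
  (forall a, a \in Ea -> t \in a -> a = edge u t \/ a = edge v t) ->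
  sdrawable R Va (edge v t |: Ea)%SET (fun c d => [/\ X c d, t \notin c & t \notin d]).
Proof.
set a := edge u t => aE bE ab cap cbp nvp vb tb uv att.
have ta : t \in a by rewrite edge_in eqxx orbT.
have ua : u \in a by rewrite edge_in eqxx.
have ut : u != t by have := sd_card D aE; rewrite /a cards2; case: eqP.
have vt : v != t by apply: contraNneq tb => <-.
have [v' bE' vv'] := card_edge (sd_card D bE) vb.
pose src c := if c == a then u else if c == b then v else set_src u c.
pose dst c := if c == a then t else if c == b then v' else set_dst u c.
have sd c : c \in Ea -> c = edge (src c) (dst c).
  move=> cE; rewrite /src /dst; case: eqP => [->//|_]; case: eqP => [->//|_].
  by apply: set_srcP; exact: (sd_card D).
have D1 := sdraw_drawable D sd.
have sa : src a = u by rewrite /src eqxx.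
have sb : src b = v by rewrite /src eq_sym (negbTE ab) eqxx.
have xv : src a != src b by rewrite sa sb.
have [pos2 [cv2 D2]] := uncross D1 aE bE ab cap cbp nvp xv.
pose Eb := [set c in Ea | t \notin c]%SET; pose Vb := (Va :\ t)%SET.
have D3 : sdraw Vb Eb (fun c d => [/\ X c d, t \notin c & t \notin d]) pos2 cv2.
  exists src, dst; split; first by move=> c; rewrite inE => /andP[cE _]; exact: sd.
  apply: (@pdraw_relabel R V _ Va Ea _ _ _ pos2 cv2 D2 V _ Vb Eb src dst _ id id) => //.
  - by move=> w; rewrite inE => /andP[].
  - by move=> c; rewrite inE => /andP[].
  - move=> c; rewrite inE => /andP[cE tc]; have [h1 h2] := pd_ends D1 cE.
    have ca : c != a by apply: contraNneq tc => ->.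
    rewrite (negbTE ca); move: tc; rewrite {1}(sd c cE) edge_in negb_or => /andP[n1 n2].
    by rewrite !inE eq_sym n1 h1 eq_sym n2 h2; split => //; left.
  - by move=> c d; rewrite !inE => /andP[_ tc] /andP[_ td] _ [].
have uV : u \in Vb by rewrite !inE ut (sd_sub D aE ua).
have vV : v \in Vb by rewrite !inE vt (sd_sub D bE vb).
have tV : t \notin Vb by rewrite !inE eqxx.
(* After [uncross] the curve of [a] joins [u] to [v] and is uncrossed. It is no longer used as an
   edge, but as the arc along which [t] is put back. *)
have arcA : arc (pos2 u) (pos2 v) (cv2 a).
  by have := pd_arc D2 aE; rewrite eqxx sa sb.
have nvx x : cv2 a x -> x <> pos2 u -> x <> pos2 v -> forall w, w \in Va -> pos2 w <> x.
  move=> cx xu xv' w wV wx; have := pd_avoid D2 aE wV; rewrite wx => /(_ cx).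
  by rewrite eqxx sa sb => -[E|E]; [apply: xu|apply: xv']; rewrite -E wx.
have D4 := sd_add_path (t := t) D3 uV vV tV arcA.
apply: (sd_restrict (D4 _)).
- move=> x cx xu xv'; have nv := nvx x cx xu xv'; split => [w|c].
    by rewrite inE => /andP[_]; exact: nv.
  rewrite inE => /andP[cE tc] cc; have ac : a != c by apply: contraNneq tc => <-.
  by have [[]] := pd_cross D2 aE cE ac cx cc nv; rewrite eqxx.
- by apply/fintype.subsetP => w wV; rewrite !inE wV andbT; case: eqP.
- move=> c; rewrite !inE => cI.
  have tV' : t \in Va by exact: (sd_sub D aE).
  have vV' : v \in Va by exact: (sd_sub D bE).
  split; last first.
    case/orP: cI => [/eqP ->|cE]; apply/fintype.subsetP => w; last exact: (sd_sub D).
    by rewrite edge_in => /orP[/eqP ->|/eqP ->].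
  case/orP: cI => [->|cE]; first by rewrite orbT.
  case: (boolP (t \in c)) => tc; last by rewrite cE !orbT.
  by case: (att c cE tc) => ->; rewrite eqxx ?orbT.
- by [].
Qed.

End Reroute.

(** * Gluing the skeletons along the tree *)

Section Growth.
Variables (R : realType) (S : set crossing_type) (H : sgraph) (T : spr_data H).
Hypothesis hT : is_spr_tree T.
Let pT := spr_pre_tree hT.

(** The graph [H] together with a new vertex for each skeleton edge, adjacent to both ends of that
    edge. Each skeleton+ and each partially glued graph is an induced subgraph of it, so crossing
    types can be taken in this graph throughout. *)
Definition big_adj : rel (H + sk_edge T) := fun a b =>
  match a, b with
  | inl u, inl v => adj u v
  | inl u, inr f => u \in sk_ends f
  | inr f, inl u => u \in sk_ends f
  | inr _, inr _ => false
  end.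

Lemma big_adj_sym : symmetric big_adj.
Proof. by move=> [u|f] [v|g] //=; rewrite adj_sym. Qed.

Lemma big_adj_irrefl : irreflexive big_adj.
Proof. by move=> [u|f] //=; rewrite adj_irrefl. Qed.

Definition big : sgraph := SGraph big_adj_sym big_adj_irrefl.

(** The graph obtained by gluing the skeletons+ of the nodes in [A]. Of the new vertices only those
    of virtual edges that leave [A] remain; those of links within [A] have been used up. *)
Definition piece_vert (A : {set node T}) : {set big} :=
  [set w : big | match w with
    | inl v => [exists x in A, v \in sk_vert x]
    | inr f => [&& virtual f, sk_node f \in A & sk_node (twin f) \notin A]
    end]%SET.

Definition piece_edge (A : {set node T}) : {set {set big}} :=
  [set a in edges big | a \subset piece_vert A]%SET.

(** The crossing relation that [sd_two_sum] needs: the edges at the new vertices, which are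
    contracted, must be uncrossed. *)
Definition free_of_virtual (a b : {set big}) : Prop :=
  [/\ @allowed S big a b, forall f, inr f \notin a & forall f, inr f \notin b].

Local Notation pdrawable A := (sdrawable R (piece_vert A) (piece_edge A) free_of_virtual).

Lemma piece_edgeE A a : (a \in piece_edge A) = (a \in edges big) && (a \subset piece_vert A).
Proof. by rewrite [LHS]inE. Qed.

Lemma piece_l A v : (inl v \in piece_vert A) = [exists x in A, v \in sk_vert x].
Proof. by rewrite inE. Qed.

Lemma piece_r A f : (inr f \in piece_vert A) =
  [&& virtual f, sk_node f \in A & sk_node (twin f) \notin A].
Proof. by rewrite inE. Qed.

Lemma piece1_l x v : (inl v \in piece_vert [set x]%SET) = (v \in sk_vert x).
Proof.
rewrite piece_l; apply/exists_inP/idP => [[z]|vx]; first by rewrite inE => /eqP ->.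
by exists x; rewrite ?inE.
Qed.

Lemma piece1_r x f : (inr f \in piece_vert [set x]%SET) = (virtual f) && (sk_node f == x).
Proof.
rewrite piece_r !inE; case: (boolP (virtual f)) => vf //=.
by case: eqP => [<-|] //=; rewrite (pt_twin_node pT).
Qed.

Lemma ends_pair (f : sk_edge T) : exists u v, sk_ends f = edge u v /\ u != v.
Proof.
have /eqP/cards2P[u [v [uv E]]] := pt_ends_card pT f.
by exists u, v.
Qed.

(** A 2-sum at the ends of [e], with the new vertices of [e] and of [twin e] as the vertices to be
    opened. As [A] lies on the near side of [e], the two pieces share only the ends of [e]. *)
Lemma piece_grow (A : {set node T}) (e : sk_edge T) : (forall (f : sk_edge T) z, virtual f -> sk_node f \in A -> sk_node (twin f) \notin A ->
    z \in A -> z \notin far f) ->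
  virtual e -> sk_node e \in A -> sk_node (twin e) \notin A ->
  pdrawable A -> pdrawable [set sk_node (twin e)]%SET -> pdrawable (sk_node (twin e) |: A)%SET.
Proof.
set y := sk_node (twin e) => inv ve eA yA D1 D2.
have [u [v [eE uv]]] := ends_pair e.
have vt := pt_twin_virtual pT ve; have te := pt_twin_ends pT ve.
have yf : y \in far e by exact: far_twin_node.
have nyx : sk_node e != y by rewrite eq_sym (pt_twin_node pT).
have subx w : w \in sk_ends e -> w \in sk_vert (sk_node e) by exact: (fintype.subsetP (pt_ends_sub pT e)).
have suby w : w \in sk_ends e -> w \in sk_vert y.
  by rewrite -te; exact: (fintype.subsetP (pt_ends_sub pT (twin e))).
have edge_t A' f a : a \in piece_edge A' -> inr f \in a -> sk_ends f = edge u v ->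
    a = @edge big (inl u) (inr f) \/ a = @edge big (inl v) (inr f).
  rewrite inE => /andP[/edgesP[w [w' [ww' ->]]] _]; rewrite edge_in => h fE.
  case/orP: h => /eqP E; rewrite -E in ww' *.
    by case: w' ww' => [w'|//] /=; rewrite fE edge_in => /orP[/eqP ->|/eqP ->]; rewrite edgeC; auto.
  by case: w ww' => [w|//] /=; rewrite fE edge_in => /orP[/eqP ->|/eqP ->]; auto.
have edge_in_t A' f w : inr f \in piece_vert A' -> w \in sk_ends f -> inl w \in piece_vert A' ->
    @edge big (inl w) (inr f) \in piece_edge A'.
  move=> fA wf wA; rewrite inE (edges_adj (H := big)) /= wf; apply/fintype.subsetP => z.
  by rewrite edge_in => /orP[/eqP ->|/eqP ->].
have t1V : (inr e : big) \in piece_vert A by rewrite piece_r ve eA yA.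
have t2V : (inr (twin e) : big) \in piece_vert [set y]%SET by rewrite piece1_r vt eqxx.
have inA w : w \in sk_ends e -> (inl w : big) \in piece_vert A.
  by move=> we; rewrite piece_l; apply/exists_inP; exists (sk_node e) => //; exact: subx.
have iny w : w \in sk_ends e -> (inl w : big) \in piece_vert [set y]%SET.
  by move=> we; rewrite piece1_l; exact: suby.
have ue : u \in sk_ends e by rewrite eE edge_in eqxx.
have we : v \in sk_ends e by rewrite eE edge_in eqxx orbT.
have D3 := @sd_two_sum R big _ _ _ _ _ D1 D2 (inl u) (inl v) (inr e) (inr (twin e)).
apply: (sd_restrict (D3 _ _ _ _ _ _ _ _ _ _ _ _ _)) => //.
- apply/finset.setP => -[w|f]; rewrite finset.in_setI edge_in.
    rewrite piece1_l piece_l; apply/andP/orP => [[/exists_inP[z zA wz] wy]|h].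
      have : w \in sk_ends e by apply: (far_ends pT ve _ yf wz wy); exact: inv.
      by rewrite eE edge_in => /orP[/eqP ->|/eqP ->]; rewrite !eqxx; auto.
    have wE : w \in sk_ends e by rewrite eE edge_in; case: h => /eqP[->]; rewrite eqxx ?orbT.
    by rewrite suby //; split => //; apply/exists_inP; exists (sk_node e) => //; exact: subx.
  rewrite piece1_r piece_r; apply/negP => /andP[/and3P[_ fA _] /andP[_ /eqP fy]].
  by rewrite fy (negbTE yA) in fA.
- by rewrite piece1_r ve /= (negbTE nyx).
- by rewrite piece_r (negbTE yA) andbF.
- by apply: edge_in_t => //; exact: inA.
- by apply: edge_in_t => //; exact: inA.
- by apply: edge_in_t; rewrite ?te //; exact: iny.
- by apply: edge_in_t; rewrite ?te //; exact: iny.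
- by move=> a aE ta; exact: (edge_t A).
- by move=> a aE ta; apply: (edge_t [set y]%SET) => //; rewrite te.
- by move=> a b /orP[] h [_ /(_ _)/negbTE n _]; rewrite n in h.
- apply/fintype.subsetP => -[w|f].
    rewrite piece_l => /exists_inP[z]; rewrite !inE => /orP[/eqP ->|zA] wz.
      by apply/orP; right; apply/exists_inP; exists y; rewrite ?inE.
    by apply/orP; left; apply/exists_inP; exists z.
  rewrite piece_r !inE negb_or => /and3P[vf fA /andP[ty tA]].
  have fe : f != e by apply: contraNneq ty => ->.
  have ft : f != twin e.
    by apply: contraNneq tA => ->; rewrite (pt_twinK pT).
  have -> : (inr f == inr (twin e) :> big) = false by apply/eqP => -[/eqP]; rewrite (negbTE ft).
  have -> : (inr f == inr e :> big) = false by apply/eqP => -[/eqP]; rewrite (negbTE fe).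
  by rewrite vf tA ty /=; case/orP: fA => ->; rewrite ?orbT.
- move=> a; rewrite inE => /andP[aG aA]; split => //.
  have noe : (inr e : big) \notin a.
    apply/negP => /(fintype.subsetP aA); rewrite piece_r => /and3P[_ _].
    by rewrite !inE eqxx.
  have not_ : (inr (twin e) : big) \notin a.
    apply/negP => /(fintype.subsetP aA); rewrite piece_r => /and3P[_ _].
    by rewrite (pt_twinK pT) // !inE eA orbT.
  rewrite finset.in_set finset.in_setU !piece_edgeE aG noe not_ !andbT /=.
  case/edgesP: aG aA noe not_ => w [w' [ww' ->]] aA noe not_.
  have wA : w \in piece_vert (y |: A)%SET by apply: (fintype.subsetP aA); rewrite edge_in eqxx.
  have wA' : w' \in piece_vert (y |: A)%SET by apply: (fintype.subsetP aA); rewrite edge_in eqxx orbT.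
  have split_l z : (inl z : big) \in piece_vert (y |: A)%SET ->
      (inl z : big) \in piece_vert A \/ (inl z : big) \in piece_vert [set y]%SET.
    rewrite piece1_l !piece_l => /exists_inP[k]; rewrite !inE => /orP[/eqP ->|kA] zk; first by right.
    by left; apply/exists_inP; exists k.
  have sub2 A' (p q : big) : p \in piece_vert A' -> q \in piece_vert A' -> edge p q \subset piece_vert A'.
    by move=> h1 h2; apply/fintype.subsetP => z; rewrite edge_in => /orP[/eqP ->|/eqP ->].
  (* An edge of [H] between the two pieces is real in a single skeleton. On whichever side of [e]
     that node lies, the end from the other side belongs to the separator, so the edge is contained
     in one of the pieces. *)
  have mixed p q : adj p q -> (inl p : big) \in piece_vert A -> (inl q : big) \in piece_vert [set y]%SET ->
      p \in sk_ends e \/ q \in sk_ends e.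
    rewrite piece1_l piece_l => pq /exists_inP[z zA pz] qy.
    have pqE : edge p q \in edges H by rewrite edges_adj.
    have [g vg gE] := pt_real_ex pT pqE.
    have gsub k : k \in edge p q -> k \in sk_vert (sk_node g).
      by rewrite -gE; exact: (fintype.subsetP (pt_ends_sub pT g)).
    case: (boolP (sk_node g \in far e)) => gf.
      left; apply: (far_ends pT ve (inv e z ve eA yA zA) gf pz).
      by apply: gsub; rewrite edge_in eqxx.
    right; apply: (far_ends pT ve gf yf _ qy).
    by apply: gsub; rewrite edge_in eqxx orbT.
  have mixed_t p f : p \in sk_ends f -> (inr f : big) \in piece_vert (y |: A)%SET -> inr f != inr e :> big ->
      inr f != inr (twin e) :> big -> edge (inl p : big) (inr f) \subset piece_vert A \/
      edge (inl p : big) (inr f) \subset piece_vert [set y]%SET.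
    move=> pf; rewrite piece_r !inE negb_or => /and3P[vf fA /andP[ty tA]] _ _.
    have psub : p \in sk_vert (sk_node f) by exact: (fintype.subsetP (pt_ends_sub pT f)).
    case/orP: fA => fA; [right|left]; apply: sub2.
    - by rewrite piece1_l -(eqP fA).
    - by rewrite piece1_r vf fA.
    - by rewrite piece_l; apply/exists_inP; exists (sk_node f).
    - by rewrite piece_r vf fA tA.
  have nin (p : big) : p \in edge w w' -> p != inr e /\ p != inr (twin e).
    by move=> pw; split; [apply: contraNneq noe => <-|apply: contraNneq not_ => <-].
  suff [h|h] : edge w w' \subset piece_vert A \/ edge w w' \subset piece_vert [set y]%SET.
  + by rewrite h.
  + by rewrite h orbT.
  have w_in : w \in edge w w' by rewrite edge_in eqxx.
  have w'_in : w' \in edge w w' by rewrite edge_in eqxx orbT.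
  case: (nin _ w_in) (nin _ w'_in) => n1 n2 [n1' n2'].
  case: w w' ww' wA wA' n1 n2 n1' n2' {aA noe not_ nin w_in w'_in} => [p|f] [q|g] //= ww' wA wA' n1 n2 n1' n2'.
  + case: (split_l _ wA) (split_l _ wA') => [h1|h1] [h2|h2].
    * by left; exact: sub2.
    * by case: (mixed _ _ ww' h1 h2) => h; [right|left]; apply: sub2 => //; [exact: iny|exact: inA].
    * rewrite adj_sym in ww'.
      by case: (mixed _ _ ww' h2 h1) => h; [right|left]; apply: sub2 => //; [exact: iny|exact: inA].
    * by right; exact: sub2.
  + exact: mixed_t.
  + by rewrite edgeC; exact: mixed_t.
Qed.

Lemma pieces_restricted : (forall x, pdrawable [set x]%SET) -> restricted R S H.
Proof.
move=> base.
have [x0 _] : exists x0 : node T, True by have /card_gt0P[x] := pt_nonempty pT; exists x.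
(* Expresses that [A] is a subtree: it lies on the near side of each link that leaves it. *)
pose inv (A : {set node T}) := forall (f : sk_edge T) z, virtual f -> sk_node f \in A -> sk_node (twin f) \notin A ->
    z \in A -> z \notin far f.
suff [A [_ AN _ DA]] : exists A : {set node T}, [/\ x0 \in A, #|A| = #|node T|, inv A & pdrawable A].
  have AT z : z \in A.
    have /eqP : A = [set: node T]%SET.
      by apply/eqP; rewrite eqEcard finset.subsetT cardsT AN /=.
    by move/eqP ->; rewrite finset.in_setT.
  have [v0 _] : exists v : H, v \in sk_vert x0.
    have := spr_kind hT x0; case: (kind x0) => [[h _ _]|[h _]|[_ [h _]]]; apply/card_gt0P.
    - exact: leq_trans h.
    - by rewrite h.
    - exact: leq_trans h.
  apply: sdraw_restricted; apply: (sd_relabel v0 (s := fun v => inl v : big) DA).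
  - by move=> u v _ _ [].
  - move=> w _; rewrite piece_l; have [x xw] := pt_vert_ex pT w.
    by apply/exists_inP; exists x.
  - move=> a aE; split; [exact: edges_card|exact: finset.subsetT|].
    case/edgesP: aE => u [v [uv ->]]; rewrite imset_edge inE (edges_adj (H := big)) /= uv.
    apply/fintype.subsetP => w; rewrite edge_in => /orP[] /eqP ->; rewrite piece_l.
      by have [x xw] := pt_vert_ex pT u; apply/exists_inP; exists x.
    by have [x xw] := pt_vert_ex pT v; apply/exists_inP; exists x.
  - move=> a b _ _ _ [al _ _].
    by apply: (@allowed_map S big H _ [set: H]%SET a b _ _ _ al); rewrite ?finset.subsetT.
suff : forall k, (k < #|node T|)%N -> exists A : {set node T},
    [/\ x0 \in A, #|A| = k.+1, inv A & pdrawable A].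
  by move=> /(_ #|node T|.-1); rewrite prednK ?(pt_nonempty pT) //; apply.
elim=> [|k IH] kN.
  exists [set x0]%SET; split => //; rewrite ?inE ?cards1 //.
  by move=> f z vf; rewrite !finset.in_set1 => /eqP fx _ /eqP ->; rewrite -fx (near_far pT).
have [A [x0A AN iA DA]] := IH (ltnW kN).
have [y yA] : exists y, y \notin A.
  apply/existsP; rewrite -negb_forall; apply/negP => /forallP AA.
  by have : #|A| = #|node T| by [apply: eq_card => y; rewrite AA]; rewrite AN => E; rewrite E ltnn in kN.
have [e [ve eA tA]] : exists e, [/\ virtual e, sk_node e \in A & sk_node (twin e) \notin A].
  apply: contrapT => no; have /connectP[p pp yE] := pt_connected pT x0 y; case/negP: yA.
  rewrite yE; suff walk : forall z, z \in A -> path (@tree_adj H T) z p -> last z p \in A by exact: walk.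
  elim: p {pp yE} => //= z p IHp w wA /andP[/existsP[f /and3P[vf /eqP fw /eqP fz]]]; apply: IHp.
  apply: contrapT => /negP zA; apply: no; exists f; split => //; first by rewrite fw.
  by rewrite fz.
exists (sk_node (twin e) |: A)%SET; split.
- by rewrite !inE x0A orbT.
- by rewrite cardsU1 tA AN.
- move=> f z vf; rewrite !finset.in_setU1 negb_or => fA /andP[ty tA'] zA.
  have vt := pt_twin_virtual pT ve.
  have fe : f != e by apply: contraNneq ty => ->.
  case/orP: fA => fA.
    have ft : twin e != f by apply: contraNneq tA' => <-; rewrite (pt_twinK pT).
    case/orP: zA => [/eqP ->|zA]; first by rewrite -(eqP fA) (near_far pT).
    apply: (far_disjoint pT vt vf _ ft); first by rewrite (eqP fA).
    by rewrite (far_compl pT) // iA.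
  case/orP: zA => [/eqP ->|zA]; last exact: iA.
  rewrite -(far_step pT vf ve); first exact: iA.
    by rewrite eq_sym.
  by apply: contraNneq tA' => <-.
- exact: piece_grow.
Qed.

Lemma piece1_edge x (w w' : big) : edge w w' \in piece_edge [set x]%SET ->
  [/\ big_adj w w', w \in piece_vert [set x]%SET & w' \in piece_vert [set x]%SET].
Proof.
rewrite piece_edgeE (edges_adj (H := big)) => /andP[ww /fintype.subsetP sub].
by split => //; apply: sub; rewrite edge_in eqxx ?orbT.
Qed.

Lemma piece_edge_ok A a : a \in piece_edge A -> #|a| = 2 /\ a \subset piece_vert A.
Proof. by rewrite piece_edgeE => /andP[aE aA]; split => //; exact: (@edges_card big). Qed.

(** On the spine, [u] comes first, [v] last and the new vertices between them. The edges at [u] form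
    one page, where their intervals start at a common point; all other edges end at [v] and form the
    other page. *)
Lemma P_node x : kind x = Pnode -> pdrawable [set x]%SET.
Proof.
move=> kx; have := spr_kind hT x; rewrite kx => -[/eqP/cards2P[u [v [uv xE]]] _].
pose M := #|sk_edge T|.+1.
pose ord (w : big) : nat := match w with inl w' => if w' == u then 0 else M
  | inr f => (enum_rank f).+1 end.
have rk (f : sk_edge T) : (enum_rank f < #|sk_edge T|)%N by exact: ltn_ord.
have ordM w : (ord w <= M)%N.
  by case: w => [w|f] /=; [case: ifP|rewrite ltnS ltnW].
have in2 w : (inl w : big) \in piece_vert [set x]%SET -> w = u \/ w = v.
  by rewrite piece1_l xE !inE => /orP[/eqP|/eqP]; auto.
have uE : ord (inl u) = 0%N by rewrite /= eqxx.
have vE : ord (inl v) = M by rewrite /= eq_sym (negbTE uv).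
apply: (@sd_book_order R big (inl u) _ _ _ ord (fun a => inl u \in a)).
- move=> [w|f] [w'|g] wx wx'.
  + case: (in2 _ wx) (in2 _ wx') => -> [] -> //; rewrite ?uE ?vE //.
  + by case: (in2 _ wx) => ->; rewrite ?uE ?vE //= => -[E]; have := rk g; rewrite -E ltnn.
  + by case: (in2 _ wx') => ->; rewrite ?uE ?vE //= => -[E]; have := rk f; rewrite E ltnn.
  + by move=> /= -[/ord_inj/enum_rank_inj ->].
- exact: piece_edge_ok.
- move=> w1 w2 w3 w4 h1 h2 o1 o2 pg.
  have low (w w' : big) : inl u \in edge w w' -> (ord w < ord w')%N -> ord w = 0%N.
    by rewrite edge_in => /orP[/eqP <-|/eqP <-]; rewrite uE.
  have high (w w' : big) : edge w w' \in piece_edge [set x]%SET -> inl u \notin edge w w' ->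
      (ord w < ord w')%N -> ord w' = M.
    move=> /piece1_edge[ww wx wx']; rewrite edge_in negb_or => /andP[n1 n2] oo.
    have vM (q : H) : (inl q : big) \in piece_vert [set x]%SET -> (inl u : big) != inl q -> ord (inl q) = M.
      by case/in2=> -> //; rewrite eqxx.
    case: w' ww wx' n2 oo => [q|g] ww wx' n2 oo; first exact: vM.
    case: w ww wx n1 oo => [q|//] ww wx n1 oo.
    by have := leq_trans oo (ordM (inr g)); rewrite (vM _ wx n1) ltnn.
  case: (boolP (inl u \in edge w1 w2)) pg => u1 pg.
    rewrite (low _ _ u1 o1) (low _ _ (esym pg) o2) /=.
    by case/orP: (leq_total (ord w2) (ord w4)) => ->; rewrite ?orbT.
  rewrite (high _ _ h1 u1 o1) (high _ _ h2 _ o2) ?leqnn -?pg //.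
  by case/orP: (leq_total (ord w1) (ord w3)) => ->; rewrite ?orbT.
Qed.

(** The skeleton+ of a cycle is outerplanar with respect to the cyclic order in which each new
    vertex is placed between the ends of its edge. Hence a single page is enough. *)
Lemma S_node x : kind x = Snode -> pdrawable [set x]%SET.
Proof.
move=> kx; have := spr_kind hT x; rewrite kx => -[x3 con deg].
have cyc := @cycle_order _ _ (sk_vert x) (sk_edges x) (@sk_ends H T) _ _ deg x3 con.
have [|e|c [uc cx einj [v0 [_ _ cE]]]] := cyc.
- by move=> e _; exact: (pt_ends_card pT).
- by rewrite inE => /eqP <-; exact: (pt_ends_sub pT).
set n := size c in cE; pose cl := edge (nth v0 c 0) (nth v0 c n.-1).
have n3 : (2 < n)%N by rewrite /n -(card_uniqP uc) (eq_card cx).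
have idx i : (i < n)%N -> index (nth v0 c i) c = i by move=> h; rewrite index_uniq.
(* The i-th vertex has position 2i. The sum of the indices of the ends gives 2i+1 for the new vertex
   of the edge that follows it. For the closing edge this sum would be n-1, so its new vertex is
   placed last, at 2n-1. *)
pose ord (w : big) : nat := match w with inl w' => (index w' c).*2
  | inr f => if sk_ends f == cl then n.*2.-1 else \sum_(w in sk_ends f) index w c end.
pose part (f : sk_edge T) (w : big) := match w with inl p => p \in sk_ends f | inr g => g == f end.
have cne i : (i.+1 < n)%N -> nth v0 c i != nth v0 c i.+1.
  move=> h; have h' : (i < n)%N by exact: ltnW.
  by rewrite (nth_uniq v0 h' h uc) neq_ltn ltnSn.
have n0 : (0 < n)%N by exact: ltnW (ltnW n3).
have nn : (n.-1 < n)%N by rewrite prednK.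
have nI i j : (i < n)%N -> (j < n)%N -> nth v0 c i = nth v0 c j -> i = j.
  by move=> hi hj /eqP; rewrite (nth_uniq v0 hi hj uc) => /eqP.
have c0n : nth v0 c 0 != nth v0 c n.-1.
  by rewrite (nth_uniq v0 n0 nn uc); move: n3; clear; lia.
have normal i : (i.+1 < n)%N -> edge (nth v0 c i) (nth v0 c i.+1) != cl.
  move=> h; have h' : (i < n)%N by exact: ltnW.
  apply/eqP => /(edge_inj (cne _ h))[[h1 h2]|[h1 h2]].
    by have := nI _ _ h' n0 h1; have := nI _ _ h nn h2; move: n3; clear; lia.
  by have := nI _ _ h n0 h2.
have ord_n f i : (i.+1 < n)%N -> sk_ends f = edge (nth v0 c i) (nth v0 c i.+1) -> ord (inr f) = i.*2.+1.
  move=> h fE; rewrite /ord fE (negbTE (normal _ h)) /edge big_setU1 ?inE ?cne //= big_set1.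
  by rewrite !idx ?(ltnW h) //; clear; lia.
have ord_cl f : sk_ends f = cl -> ord (inr f) = n.*2.-1 by move=> fE; rewrite /ord fE eqxx.
have ord_part f w : f \in sk_edges x -> part f w ->
    (exists i, [/\ (i.+1 < n)%N, (i.*2 <= ord w)%N & (ord w <= i.*2.+2)%N] /\
      sk_ends f = edge (nth v0 c i) (nth v0 c i.+1)) \/
    sk_ends f = cl /\ (ord w = 0 \/ ord w = n.-1.*2 \/ ord w = n.*2.-1)%N.
  move=> fx pw; case: (cE f fx) => [[i h fE]|fE]; [left; exists i; split => //|right; split => //].
    case: w pw => [p|g] /=; last first.
      by move/eqP=> ->; rewrite -/(ord (inr f)) (ord_n f i) //; split => //; clear; lia.
    rewrite fE edge_in => /orP[/eqP ->|/eqP ->]; rewrite idx ?(ltnW h) //; split => //; clear; lia.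
  case: w pw => [p|g] /=; last by move/eqP=> ->; rewrite fE eqxx; auto.
  rewrite fE edge_in => /orP[/eqP ->|/eqP ->]; rewrite idx //; try (move: n3; clear; lia); auto.
have edge_part (w w' : big) : edge w w' \in piece_edge [set x]%SET -> exists2 f, f \in sk_edges x & part f w /\ part f w'.
  case/piece1_edge; case: w w' => [p|f] [q|g] //=.
  - rewrite !piece1_l => pq px qx; have [e ex eE] := sk_pair pT px qx pq.
    by exists e => //; rewrite eE !edge_in !eqxx orbT.
  - by move=> pg _; rewrite piece1_r => /andP[_ gx]; exists g; rewrite ?inE.
  - by move=> pg; rewrite piece1_r => /andP[_ gx] _; exists f; rewrite ?inE.
have spec (w w' : big) : edge w w' \in piece_edge [set x]%SET -> (ord w < ord w')%N ->
    (exists i, [/\ (i < n)%N, (i.*2 <= ord w)%N, (ord w' <= i.*2.+2)%N & (ord w' <= n.*2.-1)%N]) \/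
    ord w = 0%N /\ (ord w' = n.-1.*2 \/ ord w' = n.*2.-1).
  move=> /edge_part[f fx [p1 p2]] o12.
  case: (ord_part f w fx p1) => [[i [[h1 h2 h3] fE]]|[fE h1]];
    case: (ord_part f w' fx p2) => [[j [[k1 k2 k3] fE']]|[fE' h2']].
  - left; exists i; have ij : i = j.
      have := fE; rewrite fE' => /(edge_inj (cne _ k1))[[e1 e2]|[e1 e2]].
        by rewrite (nI _ _ (ltnW k1) (ltnW h1) e1).
      by have := nI _ _ (ltnW k1) h1 e1; have := nI _ _ k1 (ltnW h1) e2; clear; lia.
    rewrite -ij in k1 k3; split => //; first exact: ltnW.
    by move: k1 k3; clear; lia.
  - by have := normal _ h1; rewrite -fE fE' eqxx.
  - by have := normal _ k1; rewrite -fE' fE eqxx.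
  - move: h1 h2' o12 n3; move: (ord w) (ord w') => l h.
    move=> [->|[->|->]] [->|[->|->]] o12 h3; try (exfalso; move: o12 h3; clear; lia).
    + by right; auto.
    + by right; auto.
    + by left; exists n.-1; move: h3; clear; split; lia.
have odd_r g : (inr g : big) \in piece_vert [set x]%SET -> odd (ord (inr g)).
  rewrite piece1_r => /andP[_ gx]; have gX : g \in sk_edges x by rewrite inE.
  case: (cE g gX) => [[i hi gE]|gE]; first by rewrite (ord_n g i) //= odd_double.
  by rewrite (ord_cl g) //; move: n0; clear; case: n => // k _; rewrite doubleS /= odd_double.
apply: (@sd_book_order R big (inl v0) _ _ _ ord (fun=> true)).
- move=> [w|f] [w'|g] wx wx'.
  + rewrite /= => /double_inj E; congr inl.
    have wc : w \in c by rewrite cx -piece1_l.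
    have wc' : w' \in c by rewrite cx -piece1_l.
    by rewrite -(nth_index v0 wc) E (nth_index v0 wc').
  + by move=> E; have := odd_r g wx'; rewrite -E /= odd_double.
  + by move=> E; have := odd_r f wx; rewrite E /= odd_double.
  + move: wx wx'; rewrite !piece1_r => /andP[_ fx] /andP[_ gx] E; congr inr.
    have fX : f \in sk_edges x by rewrite inE.
    have gX : g \in sk_edges x by rewrite inE.
    apply: einj => //; move: E.
    case: (cE f fX) (cE g gX) => [[i hi fE]|fE] [[j hj gE]|gE]; last by rewrite fE gE.
    - by rewrite (ord_n f i) // (ord_n g j) // => -[/double_inj ij]; rewrite fE gE ij.
    - by rewrite (ord_n f i) // (ord_cl g) // => h; exfalso; move: h hi; clear; lia.
    - by rewrite (ord_n g j) // (ord_cl f) // => h; exfalso; move: h hj; clear; lia.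
- exact: piece_edge_ok.
- move=> w1 w2 w3 w4 h1 h2 o1 o2 _; have s1 := spec _ _ h1 o1; have s2 := spec _ _ h2 o2; move: s1 s2 o1 o2 n3.
  move: (ord w1) (ord w2) (ord w3) (ord w4) => l h l' h'; clear.
  move=> [[i [i1 i2 i3 i4]]|[-> i1]] [[j [j1 j2 j3 j4]]|[-> j1]] lh lh' n3; lia.
Qed.

Section Rnode.
Variable x : node T.
Hypotheses (kx : kind x = Rnode) (SS : S `<=` [set Full; AlmostFull; Bowtie]%classic).
Hypothesis res : restricted R S (skeleton_plus x).

Let sk0 : exists v0, v0 \in sk_vert x.
Proof.
by have := spr_kind hT x; rewrite kx => -[_ [h _]]; apply/card_gt0P; exact: leq_trans h.
Qed.

Definition to_skeleton (x0 : skeleton_plus x) (w : big) : skeleton_plus x :=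
  match w with
  | inl v => oapp (fun v' : {v : H | v \in sk_vert x} => inl v') x0 (insub v)
  | inr f => oapp (fun f' : {e : sk_edge T | (e \in sk_edges x) && virtual e} => inr f') x0 (insub f)
  end.

Let to_skeleton_adj x0 : {in piece_vert [set x]%SET &,
  forall u v, adj (to_skeleton x0 u) (to_skeleton x0 v) = big_adj u v}.
Proof.
have fv f : (inr f : big) \in piece_vert [set x]%SET -> (f \in sk_edges x) && virtual f.
  by rewrite piece1_r inE andbC.
move=> [u|f] [v|g]; rewrite ?piece1_l; move=> h1 h2; rewrite /to_skeleton.
- rewrite (insubT (fun v => v \in sk_vert x) h1) (insubT (fun v => v \in sk_vert x) h2) /=.
  apply/andP/idP => [[ne /exists_inP[e ex /andP[/eqP eE imp]]]|uv].
    case: (boolP (virtual e)) imp => [//|ve _].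
    by rewrite -edges_adj -eE; exact: (pt_real_edge pT).
  split; first by apply: contraTneq uv => -[->]; rewrite adj_irrefl.
  by have [e ex eE] := sk_pair pT h1 h2 uv; apply/exists_inP; exists e => //; rewrite eE eqxx uv implybT.
- have g1 := fv _ h2.
  by rewrite (insubT (fun v => v \in sk_vert x) h1) (insubT (fun e => (e \in sk_edges x) && virtual e) g1).
- have g1 := fv _ h1.
  by rewrite (insubT (fun v => v \in sk_vert x) h2) (insubT (fun e => (e \in sk_edges x) && virtual e) g1).
- have g1 := fv _ h1; have g2 := fv _ h2.
  by rewrite (insubT (fun e => (e \in sk_edges x) && virtual e) g1)
             (insubT (fun e => (e \in sk_edges x) && virtual e) g2).
Qed.

Let to_skeleton_inj x0 : {in piece_vert [set x]%SET &, injective (to_skeleton x0)}.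
Proof.
have fv f : (inr f : big) \in piece_vert [set x]%SET -> (f \in sk_edges x) && virtual f.
  by rewrite piece1_r inE andbC.
move=> [u|f] [v|g]; rewrite ?piece1_l; move=> h1 h2; rewrite /to_skeleton.
- by rewrite (insubT (fun v => v \in sk_vert x) h1) (insubT (fun v => v \in sk_vert x) h2) => -[->].
- have g1 := fv _ h2.
  by rewrite (insubT (fun v => v \in sk_vert x) h1) (insubT (fun e => (e \in sk_edges x) && virtual e) g1).
- have g1 := fv _ h1.
  by rewrite (insubT (fun v => v \in sk_vert x) h2) (insubT (fun e => (e \in sk_edges x) && virtual e) g1).
- have g1 := fv _ h1; have g2 := fv _ h2.
  by rewrite (insubT (fun e => (e \in sk_edges x) && virtual e) g1)
             (insubT (fun e => (e \in sk_edges x) && virtual e) g2) => -[->].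
Qed.

Let free_of (L : seq (sk_edge T)) (a b : {set big}) : Prop :=
  @allowed S big a b /\ forall f, f \in L -> inr f \notin a /\ inr f \notin b.

Let start : sdrawable R (piece_vert [set x]%SET) (piece_edge [set x]%SET) (free_of [::]).
Proof.
have [v0 v0x] := sk0; pose x0 : skeleton_plus x := inl (Sub v0 v0x).
have D := restricted_sdraw x0 res.
apply: (sd_relabel (inl v0 : big) (s := to_skeleton x0) D).
- exact: to_skeleton_inj.
- by move=> w _; rewrite finset.in_setT.
- move=> a aE; have [a2 aP] := piece_edge_ok aE; split => //.
  move: aE; rewrite piece_edgeE => /andP[/edgesP[w [w' [ww ->]]] /fintype.subsetP sub].
  rewrite imset_edge edges_adj to_skeleton_adj //; apply: sub; by rewrite edge_in eqxx ?orbT.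
- move=> a b /piece_edge_ok[_ aP] /piece_edge_ok[_ bP] _ al; split => //.
  exact: (allowed_map (@to_skeleton_adj x0) aP bP al).
Qed.

(** The new vertices are freed of crossings one after the other. Progress is not lost, since the
    drawing produced by [sd_reroute] has only crossings of pairs that were permitted before. *)
Lemma R_node : pdrawable [set x]%SET.
Proof.
suff /(_ (enum (sk_edge T))) D : forall L, sdrawable R (piece_vert [set x]%SET) (piece_edge [set x]%SET) (free_of L).
  apply: (sd_restrict D) => // a; first by move=> aE; have [] := piece_edge_ok aE.
  by move=> b _ _ _ [al h]; split => // f; have [] := h f; rewrite ?mem_enum.
elim=> [|f L [pos [cv D]]]; first exact: start.
set Va := piece_vert _ in D *; set Ea := piece_edge _ in D *.
have sub a w : a \in Ea -> w \in a -> w \in Va by exact: (sd_sub D).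
case: (boolP ((inr f : big) \in Va)) => fV; last first.
  apply: (@sd_restrict R big Va Va Ea Ea (free_of L)); [by exists pos, cv|exact: subxx| |].
    by move=> a aE; have [] := piece_edge_ok aE.
  move=> a b aE bE _ [al h]; split => // g; rewrite inE => /orP[/eqP ->|]; last exact: h.
  by split; apply: contraNN fV; exact: sub.
have att u v a : sk_ends f = edge u v -> a \in Ea -> (inr f : big) \in a ->
    a = @edge big (inl u) (inr f) \/ a = @edge big (inl v) (inr f).
  rewrite piece_edgeE => fE /andP[/edgesP[w [w' [ww' ->]]] _]; rewrite edge_in => h.
  case/orP: h => /eqP E; rewrite -E in ww' *.
    by case: w' ww' => [w'|//] /=; rewrite fE edge_in => /orP[/eqP ->|/eqP ->]; rewrite edgeC; auto.
  by case: w ww' => [w|//] /=; rewrite fE edge_in => /orP[/eqP ->|/eqP ->]; auto.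
have inE_t w : w \in sk_ends f -> @edge big (inl w) (inr f) \in Ea.
  move=> wf; rewrite piece_edgeE (edges_adj (H := big)) /= wf; apply/fintype.subsetP => z.
  rewrite edge_in => /orP[/eqP ->|/eqP -> //]; rewrite piece1_l.
  move: fV; rewrite piece1_r => /andP[_ /eqP <-]; exact: (fintype.subsetP (pt_ends_sub pT f)).
have fix_crossing u v b p : sk_ends f = edge u v -> u != v -> b \in Ea -> @edge big (inl u) (inr f) != b ->
    cv (@edge big (inl u) (inr f)) p -> cv b p -> (forall w, w \in Va -> pos w <> p) ->
    sdrawable R Va Ea (free_of (f :: L)).
  move=> fE uv bE ab ca cb nv; have uf : u \in sk_ends f by rewrite fE edge_in eqxx.
  have vf : v \in sk_ends f by rewrite fE edge_in eqxx orbT.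
  have aE := inE_t _ uf; have [[dis typ] _] := sd_cross D aE bE ab ca cb nv.
  have disj (w : big) : w \in @edge big (inl u) (inr f) -> w \notin b.
    move=> wa; apply/negP => wb; have := finset.in_setI w (@edge big (inl u) (inr f)) b.
    by rewrite dis finset.in_set0 wa wb.
  (* By the type of the crossing, the new vertex is adjacent to an end of [b]. Its only neighbours
     are [u] and [v], and [b] is disjoint from the edge at [u] that it crosses. *)
  have vb : (inl v : big) \in b.
    have [y1 [y2 [_ bE']]] : exists y1 y2, big_adj y1 y2 /\ b = edge y1 y2.
      by move: bE; rewrite piece_edgeE => /andP[/edgesP].
    have nbr y : y \in b -> big_adj (inr f) y -> (inl v : big) \in b.
      case: y => [y|//] yb /=; rewrite fE edge_in => /orP[/eqP E|/eqP <-//].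
      by have := disj (inl u); rewrite edge_in eqxx -E yb => /(_ isT).
    have := type_disjoint SS (typ _ _ _ _ erefl bE').
    by case/orP=> /andP[_]; apply: nbr; rewrite bE' edge_in eqxx ?orbT.
  have tb : (inr f : big) \notin b by apply: disj; rewrite edge_in eqxx orbT.
  have D' := sd_reroute D aE bE ab ca cb nv vb tb _ (fun a => @att u v a fE).
  apply: (sd_restrict (D' _)) => //.
  - move=> a aE'; have [_ ?] := piece_edge_ok aE'; by split => //; rewrite finset.in_setU1 aE' orbT.
  - move=> a c _ _ _ [[al h] ha hc]; split => // g; rewrite inE => /orP[/eqP ->//|]; exact: h.
have [u [v [fE uv]]] := ends_pair f.
have vu : v != u by rewrite eq_sym.
have fE' : sk_ends f = edge v u by rewrite edgeC.
case: (pselect (exists b p, [/\ b \in Ea, @edge big (inl u) (inr f) != b,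
    cv (@edge big (inl u) (inr f)) p /\ cv b p & forall w, w \in Va -> pos w <> p])).
  by case=> b [p [bE ab [ca cb] nv]]; exact: (fix_crossing u v b p).
move=> no1; case: (pselect (exists b p, [/\ b \in Ea, @edge big (inl v) (inr f) != b,
    cv (@edge big (inl v) (inr f)) p /\ cv b p & forall w, w \in Va -> pos w <> p])).
  by case=> b [p [bE ab [ca cb] nv]]; exact: (fix_crossing v u b p).
move=> no2; exists pos, cv; apply: (sd_strengthen D) => a b p aE bE ab ca cb nv [al h].
have no a' b' : a' \in Ea -> b' \in Ea -> a' != b' -> cv a' p -> cv b' p -> (inr f : big) \notin a'.
  move=> aE' bE' ab' ca' cb'; apply/negP => fa; case: (att u v a' fE aE' fa) => E; rewrite E in ab' ca'.
    by apply: no1; exists b', p.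
  by apply: no2; exists b', p.
split=> // g; rewrite inE => /orP[/eqP ->|]; last exact: h.
split; first exact: (no a b).
by apply: (no b a) => //; rewrite eq_sym.
Qed.

End Rnode.

Lemma tree_restricted : S `<=` [set Full; AlmostFull; Bowtie]%classic ->
  (forall x : node T, kind x = Rnode -> restricted R S (skeleton_plus x)) -> restricted R S H.
Proof.
move=> SS res; apply: pieces_restricted => x; case kx: (kind x).
- exact: S_node.
- exact: P_node.
- exact: R_node kx SS (res x kx).
Qed.

End Growth.

(** * Gluing the blocks *)

Section Blocks.
Variables (R : realType) (S : set crossing_type) (G : sgraph).
Hypothesis blocks : forall B : {set G}, biconnected_component B -> restricted R S (induced_subgraph B).

Let inner (U : {set G}) : {set {set G}} := [set a in edges G | a \subset U]%SET.

Let inner_ok U a : a \in inner U -> #|a| = 2 /\ a \subset U.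
Proof. by rewrite inE => /andP[/edges_card]. Qed.

Let small (U : {set G}) (x0 : G) : (#|U| <= 2)%N -> sdrawable R U (inner U) (@allowed S G).
Proof.
move=> U2; apply: (@sd_book_order R G x0 _ _ _ (fun v => enum_rank v) (fun=> true)).
- by move=> u v _ _ /ord_inj/enum_rank_inj.
- exact: inner_ok.
- have EU a : a \in inner U -> a = U.
    by case/inner_ok=> a2 aU; apply/eqP; rewrite eqEcard aU a2.
  move=> u v x y /EU h1 /EU h2 uv xy _.
  have nuv : u != v by apply: contraTneq uv => ->; rewrite ltnn.
  have := h1; rewrite -h2 => /(edge_inj nuv)[[<- <-]|[h3 h4]]; first by rewrite !leqnn !orbT.
  by have := ltn_trans uv; rewrite h3 h4 => /(_ _ xy); rewrite ltnn.
Qed.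

(** A 2-connected set of maximum size that contains [U] is a block, and the drawing of this block is
    restricted to [U]. *)
Let biconnected (U : {set G}) (x0 : G) : k_connected 2 (@adj G) U -> sdrawable R U (inner U) (@allowed S G).
Proof.
move=> U2; pose P (C : {set G}) := `[< k_connected 2 (@adj G) C >] && (U \subset C).
have PU : P U by rewrite /P subxx andbT; apply/asboolP.
have [C CP Cmax] := arg_maxnP (fun C : {set G} => #|C|) PU.
case/andP: CP => /asboolP C2 UC.
have bC : biconnected_component C.
  split => // D CD D2; apply/esym/eqP; rewrite eqEcard CD /=; apply: Cmax.
  by rewrite /P (fintype.subset_trans UC CD) andbT; apply/asboolP.
have Csub := fintype.subsetP UC.
have [c0 c0U] : exists c, c \in U by apply/card_gt0P; case: U2 => h _; exact: leq_trans h.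
pose y0 : induced_subgraph C := Sub c0 (Csub _ c0U).
have D := restricted_sdraw y0 (blocks bC).
pose s (v : G) : induced_subgraph C := insubd y0 v.
have sv v : v \in U -> val (s v) = v by move=> vU; rewrite /s val_insubd (Csub _ vU).
have sadj : {in U &, forall u v, adj (s u) (s v) = adj u v}.
  by move=> u v uU vU; rewrite /= /induced_adj !sv.
apply: (sd_relabel x0 (s := s) D).
- by move=> u v uU vU E; rewrite -(sv u uU) E sv.
- by move=> w _; rewrite finset.in_setT.
- move=> a aE; have [a2 aU] := inner_ok aE; split => //.
  move: aE; rewrite inE => /andP[/edgesP[u [v [uv aE]]] _]; rewrite aE in aU *.
  rewrite imset_edge edges_adj sadj //; apply: (fintype.subsetP aU); by rewrite edge_in eqxx ?orbT.
- move=> a b /inner_ok[_ aU] /inner_ok[_ bU] _; exact: (allowed_map sadj aU bU).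
Qed.

(** Induction on the size of [U], without reference to a tree of blocks. If [U] is larger than two
    and not 2-connected, a set [W] of at most one vertex separates it. A component of the rest,
    together with [W], and the complement of this component are drawn by induction; they overlap in
    at most one vertex. *)
Let all_sets (x0 : G) (U : {set G}) : sdrawable R U (inner U) (@allowed S G).
Proof.
have [n] := ubnP #|U|; elim: n U => // n IH U; rewrite ltnS => Un.
case: (leqP #|U| 2) => U2; first exact: small.
case: (pselect (k_connected 2 (@adj G) U)) => [|/not_andP[|/existsNP[W /not_implyP[W2 nc]]]] //.
  exact: biconnected.
pose A := (U :\: W)%SET; pose r := [rel x y | [&& x \in A, y \in A & @adj G x y]].
have [u [v [uA vA nuv]]] : exists u v, [/\ u \in A, v \in A & ~~ connect r u v].
  apply: contrapT => no; apply: nc => u v uA vA; apply: contrapT => /negP h.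
  by apply: no; exists u, v.
pose C := [set z in A | connect r u z]%SET.
pose U1 := (C :|: (U :&: W))%SET; pose U2' := (U :\: C)%SET.
have CU z : z \in C -> z \in U by rewrite !inE => /andP[/andP[_ ->]].
have CW z : z \in C -> z \notin W by rewrite !inE => /andP[/andP[]].
have uC : u \in C by rewrite inE uA connect0.
have vC : v \notin C by rewrite inE (negbTE nuv) andbF.
have UI : (U1 :&: U2')%SET = (U :&: W)%SET.
  apply/finset.setP => z; rewrite !(finset.in_setI, finset.in_setU, finset.in_setD).
  by case: (boolP (z \in C)) => zC //=; rewrite ?(negbTE (CW _ zC)) ?andbF //; case: (z \in U); rewrite ?andbT ?andbF.
have UU : (U1 :|: U2')%SET = U.
  apply/finset.setP => z; rewrite !(finset.in_setI, finset.in_setU, finset.in_setD).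
  by case: (boolP (z \in C)) => zC /=; [rewrite CU|case: (z \in U); rewrite ?orbT].
have D1 : sdrawable R U1 (inner U1) (@allowed S G).
  apply: IH; apply: leq_trans Un; apply: proper_card; apply/properP; split.
    by rewrite -UU; exact: finset.subsetUl.
  exists v; first by move: vA; rewrite inE => /andP[].
  rewrite !(finset.in_setI, finset.in_setU) (negbTE vC) /=.
  by move: vA; rewrite inE => /andP[/negbTE -> _]; rewrite andbF.
have D2 : sdrawable R U2' (inner U2') (@allowed S G).
  apply: IH; apply: leq_trans Un; apply: proper_card; apply/properP; split.
    exact: finset.subsetDl.
  by exists u; rewrite ?CU // inE uC.
have D3 : sdrawable R (U1 :|: U2')%SET (inner U1 :|: inner U2')%SET (@allowed S G).
  case: (posnP #|U :&: W|) => [/eqP|UW0].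
    rewrite cards_eq0 => /eqP UW0; apply: (sd_zero_sum D1 D2); by rewrite UI.
  have /eqP/cards1P[w wE] : #|(U :&: W)%SET| = 1.
    apply/eqP; rewrite eqn_leq UW0 andbT.
    by apply: leq_trans (subset_leq_card (finset.subsetIr U W)) _.
  by apply: (sd_one_sum (v := w) D1 D2); rewrite UI.
rewrite UU in D3; apply: (sd_restrict D3) => // a aI; have [a2 aU] := inner_ok aI; split => //.
move: aI; rewrite inE => /andP[aE _]; rewrite finset.in_setU !(finset.in_set (fun a : {set G} => _ && _)) aE /=.
case/edgesP: aE aU => p [q [pq ->]] /fintype.subsetP aU.
have pU : p \in U by apply: aU; rewrite edge_in eqxx.
have qU : q \in U by apply: aU; rewrite edge_in eqxx orbT.
have step z z' : z \in C -> z' \in U -> @adj G z z' -> z' \in U1.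
  move=> zC z'U zz'; rewrite !(finset.in_setI, finset.in_setU) z'U /=.
  case: (boolP (z' \in W)) => z'W; rewrite ?orbT // orbF.
  have z'A : z' \in A by rewrite inE z'W.
  move: zC; rewrite !inE => /andP[zA con]; move: z'A; rewrite inE => -> /=.
  apply: (connect_trans con); apply: connect1; rewrite /= zz' andbT.
  by apply/andP; split; rewrite !inE // z'W.
have sub2 (Q : {set G}) : p \in Q -> q \in Q -> edge p q \subset Q.
  by move=> h1 h2; apply/fintype.subsetP => z; rewrite edge_in => /orP[/eqP ->|/eqP ->].
have CU1 z : z \in C -> z \in U1 by rewrite finset.in_setU => ->.
apply/orP; case: (boolP (p \in C)) => pC.
  by left; apply: sub2; [exact: CU1|exact: (step p)].
case: (boolP (q \in C)) => qC.
  by left; apply: sub2; [apply: (step q) => //; rewrite adj_sym|exact: CU1].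
by right; apply: sub2; rewrite finset.in_setD ?pC ?qC.
Qed.

Lemma blocks_restricted : restricted R S G.
Proof.
case: (pickP (fun _ : G => true)) => [x0 _|emp]; last first.
  by apply: restricted_empty => v; have := emp v.
apply: sdraw_restricted; apply: (sd_restrict (all_sets x0 [set: G]%SET)) => // a aE.
by rewrite inE aE finset.subsetT.
Qed.

End Blocks.

(** * Existence of SPR-trees *)

(** Paths can be lifted along [pi] because each step lifts and the points of a fibre are connected
    to one another. It transfers connectedness to a tree in which a node has been split into two. *)
Lemma lift_connect (N N' : finType) (r : rel N) (r' : rel N') (pi : N' -> N) (I : pred N') :
  (forall n m, I n -> I m -> pi n = pi m -> connect r' n m) ->
  (forall a b, r a b -> exists n m, [/\ I n, I m, pi n = a, pi m = b & r' n m]) ->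
  forall n m, I n -> I m -> connect r (pi n) (pi m) -> connect r' n m.
Proof.
move=> fib lift n m In Im /connectP[p]; elim: p n In => [|b p IH] n In /=.
  by move=> _ /esym; exact: fib.
case/andP=> /lift[n1 [m1 [In1 Im1 n1E m1E rr]]] pp mE.
apply: (connect_trans (fib _ _ In In1 (esym n1E))); apply: (connect_trans (connect1 rr)).
by apply: IH => //; rewrite m1E.
Qed.

Lemma push_connect (N N' : finType) (r : rel N) (r' : rel N') (q : N -> N') :
  (forall a b, r a b -> connect r' (q a) (q b)) ->
  forall a b, connect r a b -> connect r' (q a) (q b).
Proof.
move=> h a b /connectP[p pp ->]; elim: p a pp => [|c p IH] a /=; first by rewrite connect0.
by case/andP=> /h ac /IH; exact: connect_trans.
Qed.

Definition color_class (K V : finType) (F : {set K}) (ends : K -> {set V}) (c : pred K) (b : bool) : {set V} :=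
  [set v | [exists f in F, (c f == b) && (v \in ends f)]]%SET.

Lemma color_classP (K V : finType) (F : {set K}) (ends : K -> {set V}) (c : pred K) (b : bool) v :
  reflect (exists f, [/\ f \in F, c f = b & v \in ends f]) (v \in color_class F ends c b).
Proof.
rewrite inE; apply: (iffP exists_inP) => [[f fF /andP[/eqP cf vf]]|[f [fF cf vf]]]; exists f => //.
by rewrite cf eqxx.
Qed.

(** Separations are described by colouring edges, so that parallel edges need no special treatment.
    The boundary is the separator, and a node is split along a colouring whose boundary consists of
    two vertices. *)
Definition boundary (K V : finType) (F : {set K}) (ends : K -> {set V}) (c : pred K) : {set V} :=
  (color_class F ends c true :&: color_class F ends c false)%SET.

(* 2-connectedness of a multigraph, expressed by edge colourings. *)
Definition nonseparable (K V : finType) (F : {set K}) (ends : K -> {set V}) : Prop :=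
  forall c : pred K, (exists2 f, f \in F & c f) -> (exists2 f, f \in F & ~~ c f) ->
    (2 <= #|boundary F ends c|)%N.

Record good_node (H : sgraph) (T : spr_data H) (x : node T) : Prop := GoodNode {
  gn_cover : forall v, v \in sk_vert x -> exists2 f, f \in sk_edges x & v \in sk_ends f;
  gn_nonsep : nonseparable (sk_edges x) (@sk_ends H T);
  gn_three : (2 < #|sk_edges x|)%N }.

(** * Splitting a node along a 2-separator *)

Section Split.
Variables (H : sgraph) (T : spr_data H).
Hypothesis hT : pre_tree T.
Hypothesis good : forall x : node T, good_node x.
Variables (x : node T) (c : pred (sk_edge T)).
Let F := sk_edges x.
Let side (b : bool) := color_class F (@sk_ends H T) c b.
Let B := boundary F (@sk_ends H T) c.
Hypothesis B2 : #|B| = 2.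
Hypothesis sides : forall b, (2 <= #|[set f in F | c f == b]%SET|)%N.

Let other (f : sk_edge T) := (sk_node f == x) && ~~ c f.

(** Edges of [x] with colour [true] stay at [Some x], the others move to the new node [None];
    [inr true] and [inr false] are the new pair of twins, with ends [B]. The kind is a mere
    placeholder, as kinds are assigned after the last split. *)
Definition split_spr : spr_data H := @SprData H (option (node T)) (fun _ => Snode)
  (fun n => match n with Some z => if z == x then side true else sk_vert z | None => side false end)
  (sk_edge T + bool)%type
  (fun f => match f with
    | inl f => if other f then None else Some (sk_node f)
    | inr b => if b then Some x else None
    end)
  (fun f => match f with inl f => sk_ends f | inr _ => B end)
  (fun f => match f with inl f => virtual f | inr _ => true end)
  (fun f => match f with inl f => inl (twin f) | inr b => inr (~~ b) end).

Let half (b : bool) : node split_spr := if b then Some x else None.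
Let old (f : sk_edge T) : sk_edge split_spr := inl f.
Let pi (n : node split_spr) : node T := if n is Some z then z else x.

Let FE f : (f \in F) = (sk_node f == x).
Proof. by rewrite inE. Qed.

Let node_old f : pi (sk_node (old f)) = sk_node f.
Proof. by rewrite /= /other; case: (eqVneq (sk_node f) x) => [->|] //=; case: ifP. Qed.

Let node_side f : sk_node f = x -> sk_node (old f) = half (c f).
Proof. by move=> fx; rewrite /= /other fx eqxx /=; case: (c f). Qed.

Let node_far f : sk_node f != x -> sk_node (old f) = Some (sk_node f).
Proof. by rewrite /= /other => /negbTE ->. Qed.

Let pi_half n : pi n = x -> n = half true \/ n = half false.
Proof. by case: n => [z /= ->|]; [left|right]. Qed.

Let vert_half b : sk_vert (half b) = side b.
Proof. by case: b; rewrite /= ?eqxx. Qed.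

Let vert_far z : z != x -> sk_vert (Some z : node split_spr) = sk_vert z.
Proof. by move=> /negbTE /= ->. Qed.

Let side_sub b v : v \in side b -> v \in sk_vert x.
Proof.
case/color_classP=> f [fF _ vf]; rewrite FE in fF; rewrite -(eqP fF).
exact: (fintype.subsetP (pt_ends_sub hT f)).
Qed.

Let vert_pi n v : v \in sk_vert n -> v \in sk_vert (pi n).
Proof.
case: n => [z|]; last exact: side_sub.
rewrite /=; case: (eqVneq z x) => [->|]//; exact: side_sub.
Qed.

Let vert_old f v : v \in sk_ends f -> v \in sk_vert (sk_node (old f)).
Proof.
move=> vf; case: (eqVneq (sk_node f) x) => [fx|fx].
  by rewrite node_side // vert_half; apply/color_classP; exists f; rewrite FE fx eqxx.
by rewrite node_far // vert_far //; exact: (fintype.subsetP (pt_ends_sub hT f)).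
Qed.

Let bridge_adj (b : bool) : tree_adj (half b) (half (~~ b)).
Proof. by apply/existsP; exists (inr b); case: b; rewrite /= !eqxx. Qed.

Lemma split_pre_tree : pre_tree split_spr.
Proof.
have Bin v b : v \in B -> v \in side b by rewrite finset.in_setI; case: b => /andP[].
split.
- by move=> [f|b]; [exact: (pt_ends_card hT)|exact: B2].
- move=> [f|b]; first by apply/fintype.subsetP => v; exact: vert_old.
  by apply/fintype.subsetP => v vB; rewrite -/(half b) vert_half; exact: Bin.
- by move=> [f|b] //=; exact: (pt_twin_virtual hT).
- by move=> [f|b] //=; [move=> vf; rewrite (pt_twinK hT)|rewrite negbK].
- by move=> [f|b] //=; exact: (pt_twin_ends hT).
- move=> [f|[]] //= vf; apply: contraNneq (pt_twin_node hT vf) => /(congr1 pi).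
  by rewrite (node_old f) (node_old (twin f)) => ->.
- by rewrite card_option.
- move=> n m; apply: (lift_connect (r := @tree_adj H T) (pi := pi) (I := predT)) => //.
  + move=> {}n {}m _ _ E; case: (eqVneq (pi n) x) => [nx|nx].
      have mx : pi m = x by rewrite -E.
      have b01 := connect1 (bridge_adj true); have b10 := connect1 (bridge_adj false).
      by case: (pi_half nx) (pi_half mx) => -> [] ->; rewrite ?connect0.
    case: n m E nx => [z|] [w|] //=; rewrite ?eqxx //; first by move=> -> _; rewrite connect0.
    by move=> -> /eqP.
  + move=> a b /existsP[f /and3P[vf /eqP fa /eqP fb]].
    exists (sk_node (old f)), (sk_node (old (twin f))); rewrite !node_old; split => //.
    by apply/existsP; exists (old f); rewrite /= vf !eqxx.
  + exact: (pt_connected hT).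
- have -> : [set f : sk_edge split_spr | virtual f]%SET =
      (inr true |: (inr false |: (inl @: [set f : sk_edge T | virtual f])))%SET.
    apply/finset.setP => -[f|[]]; rewrite !inE ?eqxx ?orbT //=.
    apply/idP/imsetP => [vf|[g]]; first by exists f; rewrite ?inE.
    by rewrite inE => vg [->].
  have nl b (A : {set sk_edge T}) : (inr b : sk_edge split_spr) \notin (inl @: A)%SET by apply/imsetP => -[].
  rewrite !cardsU1 !inE !negb_or /= !nl /= card_imset; last by move=> f g [].
  by rewrite (pt_acyclic hT) card_option; have := pt_nonempty hT; case: #|node T| => // k _; rewrite doubleS.
- by move=> [f|b] //=; exact: (pt_real_edge hT).
- by move=> a aE; have [f vf fE] := pt_real_ex hT aE; exists (old f).
- by move=> [f|b] [g|b'] //= vf vg E; rewrite (pt_real_inj hT vf vg E).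
- move=> v; have [z vz] := pt_vert_ex hT v; case: (eqVneq z x) => [zx|zx]; last by exists (Some z); rewrite vert_far.
  rewrite zx in vz; have [f fF vf] := gn_cover (good x) vz.
  by exists (half (c f)); rewrite vert_half; apply/color_classP; exists f.
- move=> v n m vn vm.
  apply: (lift_connect (r := @tree_adj_at H T v) (pi := pi) (I := fun n => v \in sk_vert n)) => //.
  + have bridge_at b : v \in B -> connect (@tree_adj_at H split_spr v) (half b) (half (~~ b)).
      by move=> vB; apply: connect1; apply/existsP; exists (inr b); case: b => /=; rewrite !eqxx vB.
    move=> {vn vm}n {}m vn vm E; case: (eqVneq (pi n) x) => [nx|nx].
      have mx : pi m = x by rewrite -E.
      case: (pi_half nx) (pi_half mx) vn vm => -> [] ->; rewrite ?connect0 // !vert_half => h1 h2.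
        by apply: (bridge_at true); rewrite finset.in_setI h1.
      by apply: (bridge_at false); rewrite finset.in_setI h2.
    case: n m E nx {vn vm} => [z|] [w|] //=; rewrite ?eqxx //; first by move=> -> _; rewrite connect0.
    by move=> -> /eqP.
  + move=> a b /existsP[f /and4P[vf vE /eqP fa /eqP fb]].
    exists (sk_node (old f)), (sk_node (old (twin f))); rewrite !node_old; split => //.
    * exact: vert_old.
    * by apply: vert_old; rewrite (pt_twin_ends hT).
    * by apply/existsP; exists (old f); rewrite /= vf vE !eqxx.
  + by apply: (pt_vert_connected hT); exact: vert_pi.
Qed.

Let edge_half b (f : sk_edge split_spr) : (f \in sk_edges (half b)) =
  match f with inl f => (f \in F) && (c f == b) | inr b' => b' == b end.
Proof.
rewrite inE; case: f => [f|b']; last by case: b b' => [] [] //=; rewrite eqxx.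
rewrite -/(old f) FE; case: (eqVneq (sk_node f) x) => [fx|fx].
  by rewrite node_side //; case: (c f); case: b; rewrite /= ?eqxx.
by rewrite node_far //; case: b => //=; apply/eqP => -[/eqP]; rewrite (negbTE fx).
Qed.

Let edge_half_old b f : (old f \in sk_edges (half b)) = (f \in F) && (c f == b).
Proof. exact: edge_half b (inl f). Qed.

Lemma split_good (n : node split_spr) : good_node n.
Proof.
have halfP b : good_node (half b).
  split.
  - move=> v; rewrite vert_half => /color_classP[f [fF cf vf]]; exists (old f) => //.
    by rewrite edge_half_old fF cf eqxx.
  - move=> c' [f1 f1F c1] [f2 f2F c2].
    (* A colouring of one half is extended to the whole skeleton by giving all edges of the other
       half the colour of the new virtual edge. This does not enlarge the boundary. *)
    pose c0 f := if c f == b then c' (old f) else c' (inr b).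
    have [g gF gb] : exists2 g, g \in F & (c g == b) = false.
      have /card_gt0P[g] : (0 < #|[set f in F | c f == ~~ b]%SET|)%N by exact: ltnW (sides _).
      rewrite inE => /andP[gF /eqP gb]; exists g => //; rewrite gb; by case: (b).
    have back (f : sk_edge split_spr) : f \in sk_edges (half b) -> exists2 f0, f0 \in F & c0 f0 = c' f.
      rewrite edge_half; case: f => [f /andP[fF fb]|b' /eqP ->]; first by exists f; rewrite ?/c0 ?fb.
      by exists g; rewrite ?/c0 ?gb.
    have [g1 g1F e1] := back _ f1F; have [g2 g2F e2] := back _ f2F.
    have h1 : exists2 f, f \in F & c0 f by exists g1; rewrite ?e1.
    have h2 : exists2 f, f \in F & ~~ c0 f by exists g2; rewrite ?e2.
    apply: leq_trans (gn_nonsep (good x) h1 h2) _; apply: subset_leq_card.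
    apply/fintype.subsetP => v; rewrite finset.in_setI => /andP[/color_classP[k1 [k1F ck1 vk1]] /color_classP[k2 [k2F ck2 vk2]]].
    have wit k b' : k \in F -> c k = b -> c0 k = b' -> v \in sk_ends k ->
        v \in color_class (sk_edges (half b)) (@sk_ends H split_spr) c' b'.
      move=> kF kb ck vk; apply/color_classP; exists (old k).
      by rewrite edge_half_old kF kb eqxx -ck /c0 kb eqxx.
    have wit' b' : c' (inr b) = b' -> v \in B ->
        v \in color_class (sk_edges (half b)) (@sk_ends H split_spr) c' b'.
      by move=> cb vB; apply/color_classP; exists (inr b); rewrite edge_half eqxx.
    have inB k k' : k \in F -> k' \in F -> v \in sk_ends k -> v \in sk_ends k' -> c k = b -> c k' = ~~ b -> v \in B.
      move=> kF kF' vk vk' kb kb'; rewrite finset.in_setI; apply/andP.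
      by case: (b) kb kb' => kb kb'; split; apply/color_classP; [exists k|exists k'|exists k'|exists k].
    have cases k : c k = b \/ c k = ~~ b /\ c0 k = c' (inr b).
      by rewrite /c0; case: eqP => [->|]; [left|case: (c k); case: (b); auto].
    rewrite finset.in_setI; case: (cases k1) (cases k2) => [d1|[d1 z1]] [d2|[d2 z2]].
    + by rewrite (wit k1) // (wit k2).
    + by rewrite (wit k1) // (wit' false) // -?z2 //; exact: (inB k1 k2).
    + by rewrite (wit k2 false) // (wit' true) // -?z1 //; exact: (inB k2 k1).
    + by rewrite z2 -z1 ck1 in ck2.
  - have -> : sk_edges (half b) = (inr b |: (inl @: [set f in F | c f == b]))%SET.
      apply/finset.setP => -[f|b']; rewrite edge_half !inE /=.
        apply/idP/imsetP => [h|[g]]; first by exists f; rewrite ?inE.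
        by rewrite finset.in_set FE => h [->].
      by rewrite orbC; case: imsetP => [[]//|_].
    rewrite cardsU1 card_imset; last by move=> f g [].
    rewrite (_ : inr b \notin _) //; first exact: sides.
    by apply/imsetP => -[].
case: n => [z|]; last exact: (halfP false).
case: (eqVneq z x) => [->|zx]; first exact: (halfP true).
have edgeE f : (old f \in sk_edges (Some z : node split_spr)) = (f \in sk_edges z).
  rewrite !(finset.in_set (fun f => sk_node f == _)); case: (eqVneq (sk_node f) x) => [fx|fx].
    have xz : (x == z) = false by rewrite eq_sym; exact: negbTE.
    by rewrite node_side // fx xz; case: (c f) => //; apply/eqP => -[/eqP]; rewrite xz.
  by rewrite node_far.
have noinr b : (inr b : sk_edge split_spr) \notin sk_edges (Some z : node split_spr).
  by rewrite inE; case: b => //=; apply/eqP => -[/eqP]; rewrite eq_sym (negbTE zx).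
split.
- by move=> v; rewrite vert_far // => /(gn_cover (good z))[f fz vf]; exists (old f); rewrite ?edgeE.
- move=> c' [[f1|b] f1F c1]; last by rewrite (negbTE (noinr b)) in f1F.
  move=> [[f2|b] f2F c2]; last by rewrite (negbTE (noinr b)) in f2F.
  rewrite edgeE in f1F; rewrite edgeE in f2F.
  have h1 : exists2 f, f \in sk_edges z & c' (old f) by exists f1.
  have h2 : exists2 f, f \in sk_edges z & ~~ c' (old f) by exists f2.
  apply: leq_trans (gn_nonsep (good z) h1 h2) _; apply: subset_leq_card.
  apply/fintype.subsetP => v; rewrite !finset.in_setI => /andP[/color_classP[k1 [k1F ck1 vk1]] /color_classP[k2 [k2F ck2 vk2]]].
  by apply/andP; split; apply/color_classP; [exists (old k1)|exists (old k2)]; rewrite edgeE.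
- apply: leq_trans (gn_three (good z)) _.
  rewrite -(card_imset _ (_ : injective old)); last by move=> f g [].
  by apply: subset_leq_card; apply/fintype.subsetP => f /imsetP[g gz ->]; rewrite edgeE.
Qed.

End Split.

(** * The tree with a single node *)

Section InitialTree.
Variable H : sgraph.
Hypothesis con2 : k_connected 2 (@adj H) [set: H]%SET.

Definition one_node_spr : spr_data H := @SprData H unit (fun _ => Snode) (fun _ => [set: H]%SET)
  {a : {set H} | a \in edges H} (fun _ => tt) (fun e => val e) (fun _ => false) id.

Lemma one_node_pre_tree : pre_tree one_node_spr.
Proof.
split => //.
- by move=> e; apply: edges_card; exact: (valP e).
- by move=> e; exact: finset.subsetT.
- by rewrite card_unit.
- by move=> [] [].
- rewrite card_unit /=; apply/eqP; rewrite cards_eq0; apply/eqP/finset.setP => e.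
  by rewrite !finset.inE.
- by move=> e _; exact: (valP e).
- by move=> a aE; exists (Sub a aE : sk_edge one_node_spr).
- by move=> e f _ _; exact: val_inj.
- by move=> v; exists tt; rewrite finset.in_setT.
- by move=> v [] [].
Qed.

Let sk_all (f : sk_edge one_node_spr) (n : node one_node_spr) : f \in sk_edges n.
Proof. by rewrite inE; case: n. Qed.

Let cover (v : H) : exists f : sk_edge one_node_spr, v \in sk_ends f.
Proof.
case: con2 => H3 con.
have [w wv] : exists w, w != v.
  have /card_gt0P[w] : (0 < #|[set: H] :\ v|)%N.
    by move: H3; rewrite (cardsD1 v) finset.in_setT /= => /ltnW.
  by rewrite !inE andbT; exists w.
have c0 : (#|@finset.set0 H| < 2)%N by rewrite cards0.
have := con _ c0 v w; rewrite !finset.setD0 !finset.in_setT => /(_ isT isT).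
case/connectP => -[|z p] /=; first by move=> _ E; rewrite E eqxx in wv.
case/andP=> /and3P[_ _ vz] _ _; have vzE : edge v z \in edges H by rewrite edges_adj.
by exists (Sub (edge v z) vzE); rewrite /= edge_in eqxx.
Qed.

(** If the boundary had at most one vertex, then each edge would have an end outside of it. By
    2-connectedness a walk that avoids the boundary leads from an edge of one colour to an edge of
    the other, but along such a walk the colour cannot change. *)
Let one_node_nonsep n : nonseparable (@sk_edges H one_node_spr n) (@sk_ends H one_node_spr).
Proof.
move=> c [e1 _ c1] [e2 _ c2]; rewrite leqNgt; apply/negP => B2.
set B := boundary _ _ _ in B2.
have outside (f : sk_edge one_node_spr) : exists2 p, p \in val f & p \notin B.
  apply: contrapT => no; have : val f \subset B.
    by apply/fintype.subsetP => p pf; apply: contrapT => /negP pB; apply: no; exists p.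
  by move/subset_leq_card; rewrite (edges_card (valP f)) leqNgt B2.
have [p pe1 pB] := outside e1; have [q qe2 qB] := outside e2.
have mono (f f' : sk_edge one_node_spr) w : w \notin B -> w \in val f -> w \in val f' -> c f -> c f'.
  move=> wB wf wf' cf; apply: contraNT wB => cf'; rewrite finset.in_setI; apply/andP.
  by split; apply/color_classP; [exists f|exists f']; split => //; exact: negbTE.
have /(_ p q) := con2.2 B B2; rewrite !finset.in_setD !finset.in_setT pB qB => /(_ isT isT)/connectP[s ss qE].
set r := SimplRel _ in ss; rewrite qE in qB qe2.
suff walk : forall w, (exists2 f : sk_edge one_node_spr, w \in val f & c f) -> path r w s ->
    exists2 f : sk_edge one_node_spr, last w s \in val f & c f.
  have [|f qf cf] := walk p _ ss; first by exists e1.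
  by case/negP: c2; exact: (mono f e2 _ qB qf qe2 cf).
elim: s {ss qE qB qe2} => //= z s IH w [f wf cf] /andP[/and3P[wB _ wz]]; apply: IH.
have wzE : edge w z \in edges H by rewrite edges_adj.
exists (Sub (edge w z) wzE : sk_edge one_node_spr); first by rewrite /= edge_in eqxx orbT.
by apply: (mono f _ w _ wf _ cf); [move: wB; rewrite inE => /andP[]|rewrite /= edge_in eqxx].
Qed.

Lemma one_node_good (n : node one_node_spr) : good_node n.
Proof.
split.
- by move=> v _; have [f vf] := cover v; exists f.
- exact: one_node_nonsep.
- rewrite ltnNge; apply/negP => F2; case: con2 => H3 _.
  have [v0 _] : exists v0 : H, true.
    by have /card_gt0P[v0 _] : (0 < #|[set: H]%SET|)%N := ltnW (ltnW H3); exists v0.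
  have [e1 _] := cover v0.
  have [v ve1] : exists v, v \notin sk_ends e1.
    apply: contrapT => no; have : [set: H]%SET \subset sk_ends e1.
      by apply/fintype.subsetP => v _; apply: contrapT => /negP h; apply: no; exists v.
    by move/subset_leq_card; rewrite (pt_ends_card one_node_pre_tree) leqNgt H3.
  have [e2 ve2] := cover v.
  have e12 : e1 != e2 by apply: contraNneq ve1 => ->.
  have FE : sk_edges n = [set e1; e2]%SET.
    apply/esym/eqP; rewrite eqEcard cards2 e12 F2 andbT.
    by apply/fintype.subsetP => e _; exact: sk_all.
  (* If [e1] and [e2] were the only edges, colouring [e1] alone would make their intersection the
     boundary. It would have two vertices, so the edges would have the same ends, although [v] is an
     end of [e2] only. *)
  have := @one_node_nonsep n (pred1 e1).
  have -> : boundary (sk_edges n) (@sk_ends H one_node_spr) (pred1 e1) = (sk_ends e1 :&: sk_ends e2)%SET.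
    apply/finset.setP => w; rewrite !finset.in_setI; apply/andP/andP.
      case=> /color_classP[f [_ /= /eqP -> wf]] /color_classP[g [gF /= ge wg]].
      by move: gF ge wg; rewrite FE !inE => /orP[/eqP ->|/eqP ->//]; rewrite eqxx.
    case=> w1 w2; split; apply/color_classP; [exists e1|exists e2]; rewrite sk_all /= ?eqxx //.
    by rewrite eq_sym (negbTE e12).
  have h1 : exists2 f, f \in sk_edges n & pred1 e1 f by exists e1; rewrite ?sk_all /= ?eqxx.
  have h2 : exists2 f, f \in sk_edges n & ~~ pred1 e1 f by exists e2; rewrite ?sk_all //= eq_sym.
  move=> /(_ h1 h2) h; have : (sk_ends e1 :&: sk_ends e2)%SET = sk_ends e2.
    by apply/eqP; rewrite eqEcard finset.subsetIr (pt_ends_card one_node_pre_tree).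
  by move/finset.setP/(_ v); rewrite finset.in_setI (negbTE ve1) ve2.
Qed.

End InitialTree.

Definition node_ok (H : sgraph) (T : spr_data H) (x : node T) : Prop :=
  match kind x with
  | Snode => is_cycle x
  | Pnode => is_dipole x
  | Rnode => is_3connected_simple x
  end.

(** * Skeletons that cannot be split further *)

Section Unsplittable.
Variables (H : sgraph) (T : spr_data H).
Hypothesis hT : pre_tree T.
Variable x : node T.
Hypothesis good : good_node x.
Let F := sk_edges x.
Let ends := @sk_ends H T.
Hypothesis unsplit : forall c : pred (sk_edge T),
  (forall b, (2 <= #|[set f in F | c f == b]%SET|)%N) -> #|boundary F ends c| <> 2.

Let endsV f v : f \in F -> v \in ends f -> v \in sk_vert x.
Proof. by rewrite inE => /eqP <-; exact: (fintype.subsetP (pt_ends_sub hT f)). Qed.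

Let ends2 f : #|ends f| = 2.
Proof. exact: (pt_ends_card hT). Qed.

(** Colour two parallel edges against all others: the boundary consists of their two ends. As the
    node cannot be split there, only one other edge exists; it has the same ends, which leaves no
    room for a third vertex. *)
Let simple : (2 < #|sk_vert x|)%N -> {in F &, injective ends}.
Proof.
move=> V3 e f eF fF ef; apply: contrapT => /eqP ne.
pose c : pred (sk_edge T) := pred2 e f.
have cE g b : g \in F -> c g = b -> if b then ends g = ends e else g != e /\ g != f.
  by move=> gF <-; rewrite /c /=; case: eqP => [->//|_]; case: eqP => [->//|_].
have [g gF cg] : exists2 g, g \in F & ~~ c g.
  apply: contrapT => no; have : F \subset [set e; f]%SET.
    apply/fintype.subsetP => g gF; rewrite !inE; apply: contrapT => /negP h; by apply: no; exists g.
  by move/subset_leq_card; rewrite cards2 ne leqNgt (gn_three good).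
have Be : boundary F ends c \subset ends e.
  apply/fintype.subsetP => v; rewrite finset.in_setI => /andP[/color_classP[k [kF ck vk]] _].
  by have /= := cE k true kF ck => <-.
have B2 : (2 <= #|boundary F ends c|)%N.
  by apply: (gn_nonsep good); [exists e; rewrite ?/c /= ?eqxx|exists g].
have BE : boundary F ends c = ends e by apply/eqP; rewrite eqEcard Be ends2.
apply: (unsplit (c := c)); last by rewrite BE ends2.
case.
  have : ([set e; f] \subset [set k in F | c k == true])%SET.
    by apply/fintype.subsetP => k; rewrite 4!inE => /orP[] /eqP ->; rewrite ?eF ?fF /c /= eqxx ?orbT.
  by move/subset_leq_card; rewrite cards2 ne.
rewrite ltnNge; apply/negP => h; suff : sk_vert x \subset ends e.
  by move/subset_leq_card; rewrite ends2 leqNgt V3.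
have uni k : k \in F -> ~~ c k -> k = g.
  move=> kF ck; have /card_le1_eqP := h; apply; by rewrite inE ?kF ?gF /= eqbF_neg.
apply/fintype.subsetP => v /(gn_cover good)[k kF vk]; case ck: (c k).
  by have /= := cE k true kF ck => <-.
have kg := uni k kF (negbT ck); rewrite {}kg in vk.
have : ends e \subset ends g.
  rewrite -BE; apply/fintype.subsetP => w; rewrite finset.in_setI => /andP[_ /color_classP[k' [k'F ck' wk']]].
  by rewrite -(uni k' k'F (negbT ck')).
by move=> sub; have /eqP -> : ends e == ends g by rewrite eqEcard sub !ends2.
Qed.

(** On three vertices, at least three edges without parallel ones can only form a triangle. Longer
    cycles arise by merging. *)
Lemma unsplittable_cycle : #|sk_vert x| = 3 -> is_cycle x.
Proof.
move=> V3; have V3' : (2 < #|sk_vert x|)%N by rewrite V3.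
have inj := simple V3'.
have imE : (ends @: F)%SET = [set a : {set H} | a \subset sk_vert x & #|a| == 2]%SET.
  apply/eqP; rewrite eqEcard cards_draws V3 (card_in_imset inj) (gn_three good) andbT.
  apply/fintype.subsetP => a /imsetP[f fF ->]; rewrite inE ends2 eqxx andbT.
  by apply/fintype.subsetP => v; exact: endsV.
have pair u v : u \in sk_vert x -> v \in sk_vert x -> u != v -> exists2 f, f \in F & ends f = edge u v.
  move=> ux vx uv; have : edge u v \in (ends @: F)%SET.
    rewrite imE inE edge_card // eqxx andbT; apply/fintype.subsetP => w.
    by rewrite edge_in => /orP[/eqP ->|/eqP ->].
  by case/imsetP=> f fF ->; exists f.
split => //.
- move=> u v ux vx; case: (eqVneq u v) => [->|uv]; first by rewrite connect0.
  apply: connect1; rewrite /= ux vx /=; have [f fF fE] := pair u v ux vx uv.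
  by apply/exists_inP; exists f => //; apply/eqP.
- move=> v vx.
  have injv : {in [set e in F | v \in ends e]%SET &, injective ends}.
    by move=> e f; rewrite !(finset.in_set (fun e => (e \in F) && _)) => /andP[eF _] /andP[fF _]; exact: inj.
  rewrite -(card_in_imset injv).
  have -> : (ends @: [set e in F | v \in ends e])%SET = (edge v @: (sk_vert x :\ v))%SET.
    apply/finset.setP => a; apply/imsetP/imsetP.
      case=> f; rewrite finset.in_set => /andP[fF vf] ->.
      have [w fE vw] := card_edge (ends2 f) vf; exists w => //.
      by rewrite !inE eq_sym vw; apply: (endsV fF); rewrite fE edge_in eqxx orbT.
    case=> w; rewrite !inE eq_sym => /andP[vw wx] ->; have [f fF fE] := pair v w vx wx vw.
    by exists f => //; rewrite finset.in_set fF fE edge_in eqxx.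
  rewrite card_imset; last by move=> u w /edge_injr.
  by have := cardsD1 v (sk_vert x); rewrite V3 vx add1n => -[<-].
Qed.

(** Suppose that [X], with at most two vertices, separates [u] from [v]. Colour the edges that touch
    the component [C] of [u]. The boundary lies in [X], so by nonseparability it has exactly two
    vertices, and the node could be split there. *)
Lemma unsplittable_3connected : (3 < #|sk_vert x|)%N -> is_3connected_simple x.
Proof.
move=> V4; have V3 : (2 < #|sk_vert x|)%N by exact: ltnW.
split; first exact: simple.
split => // X X3 u v uA vA; apply: contrapT => /negP nuv.
set A := (sk_vert x :\: X)%SET in uA vA nuv; set r := SimplRel _ in nuv.
pose C := [set z in A | connect r u z]%SET.
have uC : u \in C by rewrite inE uA connect0.
have vC : v \notin C by rewrite inE (negbTE nuv) andbF.
have CA z : z \in C -> z \in A by rewrite inE => /andP[].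
have step f z w : f \in F -> z \in C -> z \in ends f -> w \in ends f -> w \in A -> w \in C.
  move=> fF zC zf wf wA; case: (eqVneq z w) => [<-//|zw].
  have [w' fE zw'] := card_edge (ends2 f) zf.
  have ww' : w = w' by move: wf; rewrite fE edge_in eq_sym (negbTE zw) => /eqP.
  rewrite inE wA /=; have := zC; rewrite inE => /andP[zA con].
  apply: (connect_trans con); apply: connect1; rewrite /= zA wA /=.
  by apply/exists_inP; exists f => //; rewrite ww' -fE.
pose c : pred (sk_edge T) := fun f => [exists z in C, z \in ends f].
have touch f z : z \in C -> z \in ends f -> c f by move=> zC zf; apply/exists_inP; exists z.
have nC w : w \in color_class F ends c false -> w \notin C.
  by case/color_classP=> f [fF cf wf]; apply/negP => wC; rewrite (touch f w wC wf) in cf.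
have nA w : w \in color_class F ends c true -> w \in A -> w \in C.
  by case/color_classP=> f [fF /exists_inP[z zC zf] wf] wA; exact: (step f z).
have BX : boundary F ends c \subset X.
  apply/fintype.subsetP => w; rewrite finset.in_setI => /andP[wt wf].
  apply: contrapT => /negP wX; case/negP: (nC w wf); apply: nA => //.
  by rewrite inE wX /=; case/color_classP: wt => f [fF _ wf']; exact: endsV wf'.
have ux : u \in sk_vert x by move: uA; rewrite inE => /andP[].
have vx : v \in sk_vert x by move: vA; rewrite inE => /andP[].
have [f fF uf] := gn_cover good ux; have [g gF vg] := gn_cover good vx.
have cf : c f by exact: (touch f u).
have cg : ~~ c g.
  apply/negP => cg; case/negP: vC; apply: nA => //; apply/color_classP; by exists g.
have B2 : #|boundary F ends c| = 2.
  apply/eqP; rewrite eqn_leq (leq_trans (subset_leq_card BX)) //=.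
  by apply: (gn_nonsep good); [exists f|exists g].
(* If the edge at [w] were the only one of its colour, it would contain [w] in addition to the two
   boundary vertices, three ends in all. *)
have many b w : w \in color_class F ends c b -> w \notin boundary F ends c ->
    (2 <= #|[set f in F | c f == b]%SET|)%N.
  case/color_classP=> k [kF ck wk] wB; rewrite ltnNge; apply/negP => h.
  have sub : boundary F ends c \subset (ends k :\ w)%SET.
    apply/fintype.subsetP => z zB; rewrite inE (_ : z \notin _) /=; last by rewrite inE; apply: contraNneq wB => <-.
    have : z \in color_class F ends c b by move: zB; rewrite finset.in_setI; case: (b) => /andP[].
    case/color_classP=> k' [k'F ck' zk']; have /card_le1_eqP := h => /(_ k k') <- //; first by rewrite inE kF ck /=.
    by rewrite inE k'F ck' /=.
  have := subset_leq_card sub; rewrite B2 leqNgt.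
  by have := cardsD1 w (ends k); rewrite ends2 wk add1n => -[<-].
apply: (unsplit (c := c)) => // -[].
  apply: (many true u); first by apply/color_classP; exists f.
  by rewrite finset.in_setI negb_and orbC; apply/orP; left; apply/negP => /nC; rewrite uC.
apply: (many false v); first by apply/color_classP; exists g; split => //; exact: negbTE.
by rewrite finset.in_setI negb_and; apply/orP; left; apply/negP => /nA/(_ vA); rewrite (negbTE vC).
Qed.

End Unsplittable.

(** With n nodes there are at least 3n skeleton edges. Of these 2(n-1) are virtual, and the others
    are distinct edges of [H], so n is bounded and the splitting comes to an end. *)
Lemma good_tree_bound (H : sgraph) (T : spr_data H) : pre_tree T -> (forall x : node T, good_node x) ->
  (#|node T| <= #|edges H|)%N.
Proof.
move=> hT good.
have lower : (#|node T| * 3 <= #|sk_edge T|)%N.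
  rewrite -sum_nat_const -[#|sk_edge T|]sum1_card (partition_big (@sk_node H T) predT) //=.
  by apply: leq_sum => x _; rewrite sum1dep_card; exact: (gn_three (good x)).
have real : (#|[set e : sk_edge T | ~~ virtual e]%SET| <= #|edges H|)%N.
  rewrite -(@card_in_imset _ _ (@sk_ends H T)); last first.
    by move=> e f; rewrite !inE => ve vf; exact: (pt_real_inj hT).
  apply: subset_leq_card; apply/fintype.subsetP => a /imsetP[e]; rewrite inE => ve ->.
  exact: (pt_real_edge hT).
have : #|sk_edge T| = (#|[set e : sk_edge T | virtual e]%SET| + #|[set e : sk_edge T | ~~ virtual e]%SET|)%N.
  by rewrite -(cardsC [set e : sk_edge T | virtual e]%SET); congr addn; apply: eq_card => e; rewrite !inE.
rewrite (pt_acyclic hT); have := pt_nonempty hT; move: lower real.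
move: #|node T| #|sk_edge T| #|edges H| #|_| => n k m j; clear; lia.
Qed.

Lemma kinded_tree (H : sgraph) : k_connected 2 (@adj H) [set: H]%SET ->
  exists T : spr_data H, pre_tree T /\ forall x : node T, node_ok x.
Proof.
move=> con2.
pose P n := `[< exists T : spr_data H, [/\ pre_tree T, forall x : node T, good_node x & #|node T| = n] >].
have ex : exists n, P n.
  exists #|node (one_node_spr H)|; apply/asboolP; exists (one_node_spr H).
  by split; [exact: one_node_pre_tree|exact: one_node_good|].
have ub n : P n -> (n <= #|edges H|)%N by case/asboolP=> T [hT good <-]; exact: good_tree_bound.
case: (ex_maxnP ex ub) => n /asboolP[T [hT good nE]] nmax.
have unsplit x (c : pred (sk_edge T)) : (forall b, (2 <= #|[set f in sk_edges x | c f == b]%SET|)%N) ->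
    #|boundary (sk_edges x) (@sk_ends H T) c| <> 2.
  move=> sides B2; have : (#|node (split_spr x c)| <= n)%N.
    apply: nmax; apply/asboolP; exists (split_spr x c); split => //.
      exact: split_pre_tree.
    by move=> y; exact: split_good.
  by rewrite card_option nE ltnn.
(* In a tree with the maximum number of nodes the kind is determined by the number of vertices; all
   cycles are triangles at this stage. *)
pose k (x : node T) := if #|sk_vert x| == 2 then Pnode else if #|sk_vert x| == 3 then Snode else Rnode.
exists (@SprData H (node T) k (@sk_vert H T) (sk_edge T) (@sk_node H T) (@sk_ends H T) (@virtual H T) (@twin H T)).
split; first by case: hT => *; split.
move=> x; rewrite /node_ok /= /k; case: eqP => V2; first by split => //; exact: (gn_three (good x)).
case: eqP => V3; first exact: (unsplittable_cycle hT (good x) (unsplit x) V3).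
apply: (unsplittable_3connected hT (good x) (unsplit x)).
have [f fF] : exists f, f \in sk_edges x by apply/card_gt0P; exact: leq_trans (gn_three (good x)).
have := subset_leq_card (pt_ends_sub hT f); rewrite (pt_ends_card hT).
move: fF; rewrite inE => /eqP ->; move: V2 V3; clear; lia.
Qed.

(** * Merging two adjacent nodes of the same kind *)

Section Merge.
Variables (H : sgraph) (T : spr_data H).
Hypotheses (hT : pre_tree T) (ok : forall x : node T, node_ok x).
Variable e : sk_edge T.
Hypothesis ve : virtual e.
Let x := sk_node e.
Let y := sk_node (twin e).

Let xy : x != y.
Proof. by rewrite eq_sym; exact: (pt_twin_node hT). Qed.

Let node' : finType := {n : node T | n != y}.
Let edge' : finType := {f : sk_edge T | (f != e) && (f != twin e)}.
Let x' : node' := Sub x xy.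
Let q (n : node T) : node' := insubd x' n.

(** The node [y] is absorbed by [x], while [e] and [twin e] disappear. The default value of [insubd]
    is taken by real edges at most: the twin of a remaining virtual edge remains as well. *)
Definition merge_spr : spr_data H := @SprData H node' (fun n => kind (val n))
  (fun n => if val n == x then (sk_vert x :|: sk_vert y)%SET else sk_vert (val n))
  edge' (fun f => q (sk_node (val f))) (fun f => sk_ends (val f)) (fun f => virtual (val f))
  (fun f => insubd f (twin (val f))).

Let valq n : val (q n) = if n == y then x else n.
Proof. by rewrite /q val_insubd /=; case: eqP. Qed.

Let qval (n : node') : q (val n) = n.
Proof. by apply: val_inj; rewrite valq (negbTE (valP n)). Qed.

Let twin_val (f : sk_edge merge_spr) : virtual f -> val (twin f) = twin (val f).
Proof.
move=> vf; rewrite /= val_insubd; case: ifP => // /negbT.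
have /andP[fe ft] := valP f; rewrite negb_and !negbK => /orP[] /eqP E.
  by have := congr1 (@twin H T) E; rewrite (pt_twinK hT vf) => E'; case/eqP: ft.
by have E' := twin_inj hT vf ve E; case/eqP: fe.
Qed.

Let vert_q n v : v \in sk_vert n -> v \in sk_vert (q n : node merge_spr).
Proof.
rewrite /= valq; case: (eqVneq n y) => [->|ny] vn; first by rewrite eqxx inE vn orbT.
by case: (eqVneq n x) vn => [->|] //; rewrite inE => ->.
Qed.

Let vert_ex (n : node merge_spr) v : v \in sk_vert n -> exists2 m, q m = n & v \in sk_vert m.
Proof.
rewrite /=; case: eqP => [nx|_] vn; last by exists (val n); rewrite ?qval.
have nE : n = x' by apply: val_inj.
move: vn; rewrite inE => /orP[vn|vn]; [exists x|exists y] => //; rewrite nE.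
  exact: (qval x').
by apply: val_inj; rewrite valq eqxx.
Qed.

(** No other link becomes a loop: its two nodes lie on the same side of [e] by [far_step], whereas
    [x] and [y] lie on different sides. *)
Let other_edge f : virtual f -> f != e -> f != twin e -> q (sk_node (twin f)) != q (sk_node f).
Proof.
move=> vf fe ft; apply/eqP => /(congr1 val); rewrite !valq.
have fs := far_step hT ve vf fe ft; have yf : y \in far e by exact: far_twin_node.
have xf : x \notin far e by exact: (near_far hT ve).
case: eqP => [ty|_]; case: eqP => [fy|_] E.
- by have := pt_twin_node hT vf; rewrite ty fy eqxx.
- by rewrite -E ty yf (negbTE xf) in fs.
- by rewrite fy E yf (negbTE xf) in fs.
- by have := pt_twin_node hT vf; rewrite E eqxx.
Qed.

Lemma merge_card : #|node merge_spr| = #|node T|.-1.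
Proof. by rewrite card_sig -(cardC1 y); apply: eq_card. Qed.

Lemma merge_pre_tree : pre_tree merge_spr.
Proof.
have Sube f : f != e -> f != twin e -> exists f' : sk_edge merge_spr, val f' = f.
  by move=> fe ft; have h : (f != e) && (f != twin e) by [rewrite fe]; exists (Sub f h).
have qe : q x = x' /\ q y = x'.
  by split; apply: val_inj; rewrite valq ?eqxx //; case: eqP.
split.
- by move=> f; exact: (pt_ends_card hT).
- by move=> f; apply/fintype.subsetP => v vf; apply: vert_q; exact: (fintype.subsetP (pt_ends_sub hT (val f))).
- by move=> f vf; rewrite /= -/(twin f) (twin_val vf); exact: (pt_twin_virtual hT).
- move=> f vf; apply: val_inj; rewrite twin_val ?twin_val //; first exact: (pt_twinK hT).
  by rewrite /= -/(twin f) twin_val //; exact: (pt_twin_virtual hT).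
- by move=> f vf; rewrite /= -/(twin f) (twin_val vf); exact: (pt_twin_ends hT).
- move=> f vf; rewrite /= -/(twin f) (twin_val vf).
  by have /andP[fe ft] := valP f; exact: other_edge.
- by apply/card_gt0P; exists x'.
- move=> n m; rewrite -(qval n) -(qval m).
  apply: (push_connect (r := @tree_adj H T)); last exact: (pt_connected hT).
  move=> a b /existsP[f /and3P[vf /eqP <- /eqP <-]].
  case: (eqVneq f e) => [->|fe]; first by rewrite -/x -/y qe.1 qe.2 connect0.
  case: (eqVneq f (twin e)) => [->|ft]; first by rewrite (pt_twinK hT) // -/x -/y qe.1 qe.2 connect0.
  have [f' f'E] := Sube f fe ft; have vf' : virtual f' by rewrite /= f'E.
  apply: connect1; apply/existsP; exists f'; apply/and3P; split => //; first by rewrite /= f'E.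
  by change (q (sk_node (val (twin f'))) == q (sk_node (twin f))); rewrite (twin_val vf') f'E.
- have vE : (val @: [set f : sk_edge merge_spr | virtual f])%SET = ([set f : sk_edge T | virtual f] :\ e :\ twin e)%SET.
    apply/finset.setP => f; rewrite !inE; apply/imsetP/and3P.
      by case=> f'; rewrite inE => vf ->; have /andP[] := valP f'.
    by case=> ft fe vf; have [f' f'E] := Sube f fe ft; exists f'; rewrite ?inE /= f'E.
  have -> : #|[set f : sk_edge merge_spr | virtual f]%SET| = #|([set f : sk_edge T | virtual f] :\ e :\ twin e)%SET|.
    by rewrite -vE card_imset //; exact: val_inj.
  have := pt_acyclic hT; rewrite (cardsD1 e) inE ve (cardsD1 (twin e)) !inE (twin_neq hT) // (pt_twin_virtual hT) //=.
  rewrite merge_card; move: #|_| #|_| => a b; clear; lia.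
- by move=> f; exact: (pt_real_edge hT).
- move=> a aE; have [f vf fE] := pt_real_ex hT aE.
  have fe : f != e by apply: contraNneq vf => ->.
  have ft : f != twin e by apply: contraNneq vf => ->; exact: (pt_twin_virtual hT).
  by have [f' f'E] := Sube f fe ft; exists f'; rewrite /= f'E.
- by move=> f g vf vg E; apply: val_inj; exact: (pt_real_inj hT vf vg E).
- by move=> v; have [n vn] := pt_vert_ex hT v; exists (q n); exact: vert_q.
- move=> v n m /vert_ex[a <- va] /vert_ex[b <- vb].
  apply: (push_connect (r := @tree_adj_at H T v)); last exact: (pt_vert_connected hT).
  move=> {va vb}a {}b /existsP[f /and4P[vf vE /eqP <- /eqP <-]].
  case: (eqVneq f e) => [->|fe]; first by rewrite -/x -/y qe.1 qe.2 connect0.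
  case: (eqVneq f (twin e)) => [->|ft]; first by rewrite (pt_twinK hT) // -/x -/y qe.1 qe.2 connect0.
  have [f' f'E] := Sube f fe ft; have vf' : virtual f' by rewrite /= f'E.
  apply: connect1; apply/existsP; exists f'; apply/and4P; split => //; [by rewrite /= f'E|by rewrite /= f'E|].
  by change (q (sk_node (val (twin f'))) == q (sk_node (twin f))); rewrite (twin_val vf') f'E.
Qed.

Let edges' (n : node merge_spr) := [set f | [&& f != e, f != twin e & q (sk_node f) == n]]%SET.

Let edges'P (P : pred (sk_edge T)) (n : node merge_spr) :
  #|[set f in sk_edges n | P (val f)]%SET| = #|[set f in edges' n | P f]%SET|.
Proof.
have <- : (val @: [set f in sk_edges n | P (val f)])%SET = [set f in edges' n | P f]%SET.
  apply/finset.setP => f; rewrite !inE; apply/imsetP/andP.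
    case=> f'; rewrite !inE => /andP[fn Pf] ->; have /andP[-> ->] := valP f'.
    by split.
  case=> /and3P[fe ft fn] Pf; have h : (f != e) && (f != twin e) by rewrite fe.
  by exists (Sub f h : sk_edge merge_spr) => //; rewrite !inE; apply/andP; split.
by rewrite card_imset //; exact: val_inj.
Qed.

Let adj'P (n : node merge_spr) u v :
  reflect (exists2 f, f \in edges' n & sk_ends f = edge u v) (sk_adj n u v).
Proof.
apply: (iffP exists_inP) => [[f fn /eqP fE]|[f]].
  exists (val f) => //; rewrite inE; have /andP[-> ->] := valP f.
  by move: fn; rewrite inE.
rewrite inE => /and3P[fe ft fn] fE; have h : (f != e) && (f != twin e) by rewrite fe.
by exists (Sub f h : sk_edge merge_spr); rewrite ?inE //= fE.
Qed.

Let edges_far (n : node merge_spr) : val n != x -> edges' n = sk_edges (val n).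
Proof.
move=> nx; apply/finset.setP => f; rewrite !inE; apply/and3P/eqP => [[_ _ /eqP fn]|fn].
  have := congr1 val fn; rewrite valq; case: eqP => // fy xn.
  by rewrite -xn eqxx in nx.
split.
- by apply: contraNneq nx => E; rewrite -fn E.
- by apply: contraNneq (valP n) => E; rewrite -fn E.
- by rewrite fn qval.
Qed.

Let edges_x : edges' x' = ((sk_edges x :\ e) :|: (sk_edges y :\ twin e))%SET.
Proof.
apply/finset.setP => f; rewrite !inE -(inj_eq val_inj) valq /=.
case: (eqVneq (sk_node f) y) => [fy|fy].
  have fe : f != e by apply: contraNneq xy => E; rewrite -fy E.
  by rewrite fe fy eqxx [y == x]eq_sym (negbTE xy); case: (f == twin e).
have ft : f != twin e by apply: contraNneq fy => ->.
by rewrite ft; case: (f == e); case: (sk_node f == x).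
Qed.

Let ok_far (n : node merge_spr) : val n != x -> node_ok n.
Proof.
move=> nx; have := ok (val n); rewrite /node_ok /=.
have vE : sk_vert n = sk_vert (val n) by rewrite /= (negbTE nx).
have aE : sk_adj n =2 sk_adj (val n).
  move=> u v; apply/adj'P/exists_inP; rewrite edges_far // => -[f fn /eqP fE]; exists f => //.
have conE A : connected_on (sk_adj (val n)) A -> connected_on (sk_adj n) A.
  move=> con u v uA vA; rewrite (@eq_connect _ _ [rel a b | [&& a \in A, b \in A & sk_adj (val n) a b]]); first exact: con.
  by move=> a b /=; rewrite aE.
case: (kind (val n)).
- case=> V3 con deg; split; rewrite vE //; first exact: conE.
  by move=> v vn; rewrite -(deg v vn) (edges'P (fun f => v \in sk_ends f)) edges_far.
- case=> V2 E3; split; first by rewrite vE.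
  have := edges'P predT n; rewrite edges_far // => E.
  have -> : sk_edges n = [set f in sk_edges n | predT (val f)]%SET by apply/finset.setP => f; rewrite !inE andbT.
  by rewrite E (eq_card (_ : _ =i sk_edges (val n))) // => f; rewrite !inE andbT.
- case=> inj [V4 con]; split; last by split; rewrite vE // => X X3; apply: conE; exact: con.
  move=> f g fn gn fg; apply: val_inj; have sub h : h \in sk_edges n -> val h \in sk_edges (val n).
    by move=> hn; rewrite -edges_far // inE; have /andP[-> ->] := valP h; move: hn; rewrite inE.
  by apply: inj fg; exact: sub.
Qed.

Hypothesis same : kind x = kind y.
Hypothesis notR : kind x <> Rnode.

(** Two cycles with a common edge form a cycle once this edge is deleted: its ends lose one edge in
    each cycle, every other vertex lies in only one of them, and [cycle_minus_edge] yields
    connectedness. Two dipoles have the same pair of vertices and keep at least two edges each. *)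
Let ok_x : node_ok (x' : node merge_spr).
Proof.
have vE : sk_vert (x' : node merge_spr) = (sk_vert x :|: sk_vert y)%SET by rewrite /= eqxx.
have eyx f : f \in sk_edges x -> f \in sk_edges y -> False.
  by rewrite !inE => /eqP ->; exact/negP.
have te := pt_twin_ends hT ve.
have ex v : v \in sk_ends e -> v \in sk_vert x by exact: (fintype.subsetP (pt_ends_sub hT e)).
have ey v : v \in sk_ends e -> v \in sk_vert y.
  by rewrite -te; exact: (fintype.subsetP (pt_ends_sub hT (twin e))).
have eF : e \in sk_edges x by rewrite inE.
have tF : twin e \in sk_edges y by rewrite inE.
have := ok x; have := ok y; rewrite /node_ok /= -same; case kx: (kind x) notR => // _.
- move=> [V3y cony degy] [V3x conx degx]; split; rewrite ?vE.
  + by apply: leq_trans V3x _; apply: subset_leq_card; exact: finset.subsetUl.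
  + set V' := (sk_vert x :|: sk_vert y)%SET.
    rewrite /connected_on; set r' := SimplRel _.
    have endsV f v : f \in edges' x' -> v \in sk_ends f -> v \in V'.
      rewrite edges_x !inE => /orP[/andP[_ /eqP fx]|/andP[_ /eqP fx]] vf;
        by rewrite -fx (fintype.subsetP (pt_ends_sub hT f) _ vf) ?orbT.
    have stp f a b : f \in edges' x' -> sk_ends f = edge a b -> r' a b.
      move=> fx fE; rewrite /r' /= !(endsV f) ?fE ?edge_in ?eqxx ?orbT //=.
      by apply/adj'P; exists f.
    have one (z : node T) (e0 : sk_edge T) : e0 \in sk_edges z -> (sk_edges z :\ e0)%SET \subset edges' x' ->
        is_cycle z -> forall a b, a \in sk_vert z -> b \in sk_vert z -> connect r' a b.
      move=> e0z sub [V3 con deg] a b az bz.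
      apply: (connect_sub _ (con a b az bz)) => {az bz}a {}b /and3P[az bz /exists_inP[f fz /eqP fE]].
      case: (eqVneq f e0) => [fe|fe]; last first.
        by apply: connect1; apply: (stp f) => //; apply: (fintype.subsetP sub); rewrite finset.in_setD1 fe.
      rewrite fe in fE.
      have cyc := @cycle_minus_edge _ _ (sk_vert z) (sk_edges z) (@sk_ends H T) _ _ deg V3 con e0 a b e0z fE.
      apply: (connect_sub _ (cyc _ _)).
      * move=> c d /exists_inP[k kz /eqP kE]; apply: connect1; apply: (stp k) => //.
        exact: (fintype.subsetP sub).
      * by move=> k _; exact: (pt_ends_card hT).
      * by move=> k; rewrite inE => /eqP <-; exact: (pt_ends_sub hT).
    have conX := one x e eF _ (And3 V3x conx degx); have conY := one y (twin e) tF _ (And3 V3y cony degy).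
    rewrite edges_x finset.subsetUl finset.subsetUr in conX conY.
    have [u ue] : exists u, u \in sk_ends e by apply/card_gt0P; rewrite (pt_ends_card hT).
    have conXu a : a \in V' -> connect r' a u /\ connect r' u a.
      rewrite inE => /orP[ax|ay]; first by split; apply: conX => //; exact: ex.
      by split; apply: conY => //; exact: ey.
    move=> a b /conXu[h _] /conXu[_ h']; exact: connect_trans h h'.
  + move=> v vV; rewrite (edges'P (fun f => v \in sk_ends f)) edges_x.
    pose Dx := [set f in sk_edges x | v \in sk_ends f]%SET; pose Dy := [set f in sk_edges y | v \in sk_ends f]%SET.
    have -> : [set f in ((sk_edges x :\ e) :|: (sk_edges y :\ twin e))%SET | v \in sk_ends f]%SET =
        ((Dx :\ e) :|: (Dy :\ twin e))%SET.
      by apply/finset.setP => f; rewrite !inE andb_orl !andbA.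
    have dis : ((Dx :\ e) :&: (Dy :\ twin e))%SET = finset.set0.
      apply/finset.setP => f; rewrite finset.in_set0; apply/negP.
      rewrite !finset.in_setI !finset.in_setD1 !(finset.in_set (fun f => (f \in _) && _)).
      by case/andP=> /and3P[_ fx _] /and3P[_ fy _]; exact: (eyx f).
    rewrite cardsU dis cards0 subn0.
    have := cardsD1 e Dx; have := cardsD1 (twin e) Dy.
    have -> : (e \in Dx) = (v \in sk_ends e) by rewrite (finset.in_set (fun f => (f \in _) && _)) eF.
    have -> : (twin e \in Dy) = (v \in sk_ends e) by rewrite (finset.in_set (fun f => (f \in _) && _)) tF te.
    have zero (z : node T) : v \notin sk_vert z -> #|[set f in sk_edges z | v \in sk_ends f]%SET| = 0%N.
      move=> vz; apply/eqP; rewrite cards_eq0; apply/eqP/finset.setP => f; rewrite finset.in_set0 !inE.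
      apply/negP => /andP[/eqP fz vf]; case/negP: vz; rewrite -fz.
      exact: (fintype.subsetP (pt_ends_sub hT f)).
    case: (boolP (v \in sk_ends e)) => vE'.
      by rewrite (degx v (ex v vE')) (degy v (ey v vE')) !add1n => -[<-] [<-].
    rewrite !add0n => <- <-; move: vV; rewrite inE => /orP[vx|vy].
      rewrite [#|Dx|](degx v vx) [#|Dy|]zero ?addn0 //.
      apply: contraNN vE' => vy; apply: (far_ends hT ve _ _ vx vy); first exact: (near_far hT ve).
      exact: far_twin_node.
    rewrite [#|Dy|](degy v vy) [#|Dx|]zero ?add0n //.
    apply: contraNN vE' => vx; apply: (far_ends hT ve _ _ vx vy); first exact: (near_far hT ve).
    exact: far_twin_node.
- move=> [V2y E3y] [V2x E3x]; split.
    have h1 : sk_ends e = sk_vert x.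
      by apply/eqP; rewrite eqEcard V2x (pt_ends_card hT) leqnn andbT; exact: (pt_ends_sub hT).
    have h2 : sk_ends e = sk_vert y.
      by apply/eqP; rewrite eqEcard V2y (pt_ends_card hT) leqnn andbT -te; exact: (pt_ends_sub hT).
    by rewrite vE -h1 -h2 finset.setUid (pt_ends_card hT).
  have -> : #|sk_edges (x' : node merge_spr)| = #|edges' x'|.
    have := edges'P predT x' => E.
    have -> : sk_edges (x' : node merge_spr) = [set f in sk_edges (x' : node merge_spr) | predT (val f)]%SET.
      by apply/finset.setP => f; rewrite [RHS]inE andbT.
    by rewrite E; apply: eq_card => f; rewrite [LHS]inE andbT.
  rewrite edges_x cardsU.
  have -> : ((sk_edges x :\ e) :&: (sk_edges y :\ twin e))%SET = finset.set0.
    apply/finset.setP => f; rewrite finset.in_set0; apply/negP.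
    by rewrite !finset.in_setI !finset.in_setD1 => /andP[/andP[_ fx] /andP[_ fy]]; exact: (eyx f).
  rewrite cards0 subn0; have := cardsD1 e (sk_edges x); have := cardsD1 (twin e) (sk_edges y).
  rewrite eF tF; move: E3x E3y; move: #|_| #|_| #|_| #|_| => a b c d; clear; lia.
Qed.

Lemma merge_ok (n : node merge_spr) : node_ok n.
Proof.
case: (eqVneq (val n) x) => [nx|nx]; last exact: ok_far.
by have -> : n = x' by [exact: val_inj]; exact: ok_x.
Qed.

End Merge.

Lemma spr_tree_exists (H : sgraph) : k_connected 2 (@adj H) [set: H]%SET ->
  exists T : spr_data H, is_spr_tree T.
Proof.
move=> con2.
pose P n := `[< exists T : spr_data H, [/\ pre_tree T, forall x : node T, node_ok x & #|node T| = n] >].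
have ex : exists n, P n.
  by have [T [hT ok]] := kinded_tree con2; exists #|node T|; apply/asboolP; exists T.
case: (ex_minnP ex) => n /asboolP[T [hT ok nE]] nmin; exists T.
have red : forall x y : node T, tree_adj x y -> kind x = kind y -> kind x = Rnode.
  move=> x y /existsP[e /and3P[ve /eqP ex' /eqP ey]] same; apply: contrapT => notR.
  have : (n <= #|node (merge_spr hT ve)|)%N.
    apply: nmin; apply/asboolP; exists (merge_spr hT ve); split => //; first exact: merge_pre_tree.
    by apply: merge_ok => //; rewrite ex' ?ey.
  by rewrite merge_card nE; have := pt_nonempty hT; rewrite nE; clear; lia.
by case: hT => *; split.
Qed.

(** * From the graph to skeletons *)

(** Restricts a drawing without changing its positions and curves, so that an arc found in the
    larger drawing can be used in the smaller one. *)
Lemma sdraw_sub (R : realType) (V : finType) (Va Va' : {set V}) (Ea Ea' : {set {set V}}) X X' pos cv :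
  @sdraw R V Va Ea X pos cv -> Va' \subset Va ->
  (forall a, a \in Ea' -> a \in Ea /\ a \subset Va') ->
  (forall a b, a \in Ea' -> b \in Ea' -> a != b -> X a b -> X' a b) ->
  @sdraw R V Va' Ea' X' pos cv.
Proof.
move=> [src [dst [sd D]]] /fintype.subsetP sV sE sX; exists src, dst; split.
  by move=> a /sE[aE _]; exact: sd.
apply: (@pdraw_relabel R V _ Va Ea src dst X pos cv D V _ Va' Ea' src dst X' id id) => //.
- by move=> a /sE[].
- move=> a aE'; have [aE /fintype.subsetP sub] := sE a aE'; rewrite {1}(sd a aE) in sub.
  by split; [apply: sub|apply: sub|left] => //; rewrite edge_in eqxx ?orbT.
Qed.

(** * The vertices cut off by a virtual edge *)

Section Interior.
Variables (H : sgraph) (T : spr_data H).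
Hypothesis hT : is_spr_tree T.
Let pT := spr_pre_tree hT.
Implicit Types (f g : sk_edge T).

(* The vertices that the 2-separator sk_ends f cuts off from the node of f. *)
Definition interior_of f : {set H} :=
  [set w | (w \notin sk_ends f) && [exists z in far f, w \in sk_vert z]]%SET.

Lemma interior_adj f a p : virtual f -> a \in interior_of f -> adj a p ->
  p \in interior_of f \/ p \in sk_ends f.
Proof.
move=> vf; rewrite inE => /andP[ae /exists_inP[z zf az]] ap.
have az' : exists2 z, z \in far f & a \in sk_vert z by exists z.
have [z' z'f pz'] := adj_far pT vf az' ae ap.
case: (boolP (p \in sk_ends f)) => pe; first by right.
by left; rewrite inE pe; apply/exists_inP; exists z'.
Qed.

Lemma interior_skeleton f a : virtual f -> a \in interior_of f -> a \notin sk_vert (sk_node f).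
Proof.
move=> vf; rewrite inE => /andP[ae /exists_inP[z zf az]]; apply: contraNN ae => ax.
exact: (far_ends pT vf (near_far pT vf) zf).
Qed.

Lemma interior_disjoint f g a : virtual f -> virtual g -> sk_node f = sk_node g -> f != g ->
  a \in interior_of f -> a \notin interior_of g.
Proof.
move=> vf vg fg ne; rewrite inE => /andP[ae /exists_inP[z zf az]]; apply: contraNN ae.
rewrite inE => /andP[_ /exists_inP[z' z'g az']].
apply: (far_ends pT vf _ zf az' az); apply: (far_disjoint pT vg vf) => //.
by rewrite eq_sym.
Qed.

(** A node beyond [f] with three vertices has one outside the separator. Only a P-node has fewer. As
    [H] is simple, at most one edge of the P-node is real, so there is a virtual edge besides
    [twin f], and it leads farther to a node that is not a P-node. *)
Lemma interior_nonempty f : virtual f -> exists a, a \in interior_of f.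
Proof.
move=> vf; set y := sk_node (twin f); have yf : y \in far f by exact: far_twin_node.
have big z : z \in far f -> (2 < #|sk_vert z|)%N -> exists a, a \in interior_of f.
  move=> zf z3; have [a az ae] : exists2 a, a \in sk_vert z & a \notin sk_ends f.
    apply: contrapT => no; have : sk_vert z \subset sk_ends f.
      by apply/fintype.subsetP => a az; apply: contrapT => /negP h; apply: no; exists a.
    by move/subset_leq_card; rewrite (pt_ends_card pT) leqNgt z3.
  by exists a; rewrite inE ae; apply/exists_inP; exists z.
move: (spr_kind hT y); case ky: (kind y); [case=> V3 _ _|case=> V2 E3|case=> _ [V4 _]].
- exact: (big y).
- have tF : twin f \in sk_edges y by rewrite inE.
  have endsE g : g \in sk_edges y -> sk_ends g = sk_vert y.
    rewrite inE => /eqP gy; apply/eqP; rewrite eqEcard V2 (pt_ends_card pT) leqnn andbT -gy.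
    exact: (pt_ends_sub pT).
  have [g [gy gt vg]] : exists g, [/\ sk_node g = y, g != twin f & virtual g].
    apply: contrapT => no; have real g : g \in (sk_edges y :\ twin f)%SET -> ~~ virtual g.
      rewrite !inE => /andP[gt /eqP gy]; apply/negP => vg; by apply: no; exists g.
    have : (#|(sk_edges y :\ twin f)%SET| <= 1)%N.
      apply/card_le1_eqP => g h gF hF; apply: (pt_real_inj pT); rewrite ?real //.
      move: gF hF; rewrite !finset.in_setD1 => /andP[_ gy] /andP[_ hy].
      by rewrite (endsE g gy) (endsE h hy).
    by rewrite leqNgt; have := cardsD1 (twin f) (sk_edges y); rewrite tF add1n => E; rewrite E ltnS in E3; rewrite E3.
  have gf : g != f by apply: contraTneq yf => E; rewrite -gy E (near_far pT).
  set z := sk_node (twin g); have zf : z \in far f by rewrite -(far_step pT vf vg gf gt) gy.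
  have yz : tree_adj y z by apply/existsP; exists g; rewrite vg gy !eqxx.
  move: (spr_kind hT z); case kz: (kind z); [case=> V3 _ _|move=> _|case=> _ [V4 _]].
  + exact: (big z).
  + by have := spr_reduced hT yz; rewrite ky kz => /(_ erefl).
  + by apply: (big z) => //; exact: ltnW.
- by apply: (big y) => //; exact: ltnW.
Qed.

Hypothesis con2 : k_connected 2 (@adj H) [set: H]%SET.

Definition interior_rel f : rel H :=
  fun p q => adj p q && ((p \in interior_of f) || (q \in interior_of f)).

Lemma interior_rel_sym f : symmetric (interior_rel f).
Proof. by move=> p q; rewrite /interior_rel adj_sym orbC. Qed.

(** By 2-connectedness an interior vertex is joined to u in the graph without v, and to v in the
    graph without u. Such a walk can leave the interior only through the end that has not been
    deleted. *)
Lemma interior_walk f u v : virtual f -> sk_ends f = edge u v -> u != v ->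
  connect (interior_rel f) u v.
Proof.
move=> vf fE uv; have [a aW] := interior_nonempty vf.
have half w w' : sk_ends f = edge w w' -> w != w' -> connect (interior_rel f) a w.
  move=> fE' ww'; have card1 : (#|[set w']%SET| < 2)%N by rewrite cards1.
  have aw' : a != w'.
    by apply: contraTneq aW => ->; rewrite inE fE' edge_in eqxx orbT.
  have := con2.2 _ card1 a w; rewrite !inE aw' ww' => /(_ isT isT)/connectP[s ss wE].
  elim: s a aW ss wE {aw'} => [|q s IH] p pW /=.
    by move=> _ wE; move: pW; rewrite -wE inE fE' edge_in eqxx.
  case/andP=> /and3P[_ qw' pq] ss wE.
  have r1 : connect (interior_rel f) p q by apply: connect1; rewrite /interior_rel pq pW.
  apply: (connect_trans r1); case: (interior_adj vf pW pq) => [qW|]; first exact: IH.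
  rewrite fE' edge_in => /orP[/eqP ->|/eqP E]; first by rewrite connect0.
  by rewrite E !inE eqxx in qw'.
have h1 := half u v fE uv.
have h2 : connect (interior_rel f) a v by apply: (half v u); [rewrite edgeC|rewrite eq_sym].
rewrite (sym_connect_sym (interior_rel_sym f)) in h1; exact: connect_trans h1 h2.
Qed.

End Interior.

(** * Replacing the vertices cut off by new vertices of degree two *)

Section Forward.
Variables (R : realType) (S : set crossing_type) (H : sgraph) (T : spr_data H).
Hypothesis hT : is_spr_tree T.
Hypothesis SS : S `<=` [set Full; AlmostFull; Bowtie]%classic.
Hypothesis con2 : k_connected 2 (@adj H) [set: H]%SET.
Let pT := spr_pre_tree hT.
Variable x : node T.
Local Notation big := (big T).
Local Notation W := (@interior_of H T).
Implicit Types (f g : sk_edge T).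

(* The virtual edges of L have been replaced by their new vertices, those not
   in L are still represented by the vertices that they separate. *)
Definition state_vert (L : seq (sk_edge T)) : {set big} :=
  [set w : big | match w with
    | inl v => (v \in sk_vert x) || [exists f, [&& virtual f, sk_node f == x, f \notin L & v \in W f]]
    | inr f => [&& virtual f, sk_node f == x & f \in L]
    end]%SET.

Definition state_edge L : {set {set big}} := [set a in edges big | a \subset state_vert L]%SET.

Definition state L := sdrawable R (state_vert L) (state_edge L) (@allowed S big).

Lemma state_edgeE L a : (a \in state_edge L) = (a \in edges big) && (a \subset state_vert L).
Proof. by rewrite [LHS]inE. Qed.

Lemma state_edge2 L (w w' : big) : (edge w w' \in state_edge L) =
  [&& big_adj w w', w \in state_vert L & w' \in state_vert L].
Proof.
rewrite state_edgeE (edges_adj (H := big)); congr andb.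
apply/fintype.subsetP/andP => [sub|[h1 h2] z]; last by rewrite edge_in => /orP[/eqP ->|/eqP ->].
by split; apply: sub; rewrite edge_in eqxx ?orbT.
Qed.

Lemma state_edgeP L a : a \in state_edge L -> exists w w', [/\ a = edge w w', big_adj w w',
  w \in state_vert L & w' \in state_vert L].
Proof.
move=> aE; have := aE; rewrite state_edgeE => /andP[/edgesP[w [w' [_ E]]] _].
by rewrite E state_edge2 in aE; case/and3P: aE => *; exists w, w'.
Qed.

Lemma state_edge_ok L a : a \in state_edge L -> #|a| = 2 /\ a \subset state_vert L.
Proof. by rewrite state_edgeE => /andP[aE aA]; split => //; exact: (@edges_card big). Qed.

Section Step.
Variables (L : seq (sk_edge T)) (f : sk_edge T) (u v : H).
Hypotheses (vf : virtual f) (fx : sk_node f = x) (fL : f \notin L).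
Hypotheses (fE : sk_ends f = edge u v) (uv : u != v).
Local Notation Vn := (state_vert (f :: L)).
Local Notation En := (state_edge (f :: L)).
Local Notation t := (inr f : big).
Local Notation il := (fun p : H => inl p : big).

Let in_x p : p \in sk_ends f -> p \in sk_vert x.
Proof. by rewrite -fx; exact: (fintype.subsetP (pt_ends_sub pT f)). Qed.

Let vert_x K p : p \in sk_vert x -> il p \in state_vert K.
Proof. by move=> px; rewrite inE px. Qed.

Let vert_W a : a \in W f -> il a \in state_vert L.
Proof.
by move=> aW; rewrite inE; apply/orP; right; apply/existsP; exists f; rewrite vf fx eqxx fL.
Qed.

Let new_l p : il p \in Vn -> il p \in state_vert L /\ p \notin W f.
Proof.
rewrite !(finset.in_set (fun w : big => match w with inl _ => _ | inr _ => _ end)).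
case/orP=> [px|/existsP[g /and4P[vg /eqP gx gL pg]]].
  rewrite px; split => //; apply/negP => /(interior_skeleton hT vf).
  by rewrite fx px.
move: gL; rewrite inE negb_or => /andP[gf gL]; split.
  by apply/orP; right; apply/existsP; exists g; rewrite vg gx eqxx gL.
by apply: (interior_disjoint hT vg vf _ gf pg); rewrite gx fx.
Qed.

Let old_vert w : w \in Vn -> w != t -> w \in state_vert L.
Proof.
case: w => [p /new_l[]//|g]; rewrite !(finset.in_set (fun w : big => match w with inl _ => _ | inr _ => _ end)).
case/and3P=> -> -> /=; rewrite inE => /orP[/eqP ->|//]; by rewrite eqxx.
Qed.

Let nb a w : a \in W f -> w \in state_vert L -> big_adj (il a) w ->
  exists2 p, w = il p & p \in W f \/ p \in sk_ends f.
Proof.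
move=> aW; case: w => [p _ ap|g]; first by exists p => //; exact: (interior_adj hT vf aW ap).
rewrite inE => /and3P[_ /eqP gx _] ag; have := interior_skeleton hT vf aW.
by rewrite fx -gx (fintype.subsetP (pt_ends_sub pT g) _ ag).
Qed.

Let nb_new a w : a \in W f -> w \in Vn -> w != t -> big_adj (il a) w ->
  exists2 p, w = il p & p \in sk_ends f.
Proof.
move=> aW wV wt aw; have [p wE [pW|pe]] := nb aW (old_vert wV wt) aw; last by exists p.
by rewrite wE in wV; have [_] := new_l wV; rewrite pW.
Qed.

Let at_t c : c \in En -> t \in c -> c = edge (il u) t \/ c = edge (il v) t.
Proof.
case/state_edgeP=> w [w' [-> ww' _ _]]; rewrite edge_in => /orP[] /eqP E; rewrite -E in ww' *.
  by case: w' ww' => [w'|//] /=; rewrite fE edge_in => /orP[/eqP ->|/eqP ->]; rewrite edgeC; auto.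
by case: w ww' => [w|//] /=; rewrite fE edge_in => /orP[/eqP ->|/eqP ->]; auto.
Qed.

Let away c : c \in En -> t \notin c -> c \in state_edge L.
Proof.
case/state_edgeP=> w [w' [-> ww' wV wV']]; rewrite edge_in negb_or => /andP[h1 h2].
by rewrite state_edge2 ww' !old_vert // eq_sym.
Qed.

Let away_W c a : c \in En -> a \in W f -> il a \notin c.
Proof.
move=> /state_edge_ok[_ /fintype.subsetP sub] aW; apply/negP => /sub /new_l[_].
by rewrite aW.
Qed.

Let ue : u \in sk_ends f. Proof. by rewrite fE edge_in eqxx. Qed.
Let we : v \in sk_ends f. Proof. by rewrite fE edge_in eqxx orbT. Qed.

Let uW p : p \in sk_ends f -> p \notin W f.
Proof. by move=> pe; rewrite inE pe. Qed.

Let subst (a : H) (w : big) : big := if w == t then il a else w.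

Let subst_id a (c : {set big}) : t \notin c -> (subst a @: c)%SET = c.
Proof.
move=> tc; rewrite -[RHS]imset_id; apply: eq_in_imset => w wc.
by rewrite /subst; case: eqP => // E; rewrite -E wc in tc.
Qed.

Let subst_inj a : a \in W f -> {in Vn &, injective (subst a)}.
Proof.
move=> aW w w' wV wV'; have na z : z \in Vn -> z <> il a.
  by move=> zV zE; rewrite zE in zV; have [_] := new_l zV; rewrite aW.
rewrite /subst; case: eqP => [->|_]; case: eqP => [->|_] // E.
  by case: (na w').
by case: (na w).
Qed.

Let subst_vert a : a \in W f -> forall w, w \in Vn -> subst a w \in state_vert L.
Proof. by move=> aW w wV; rewrite /subst; case: eqP => [_|/eqP]; [exact: vert_W|exact: old_vert]. Qed.

Lemma state_step_common a : a \in W f -> adj a u -> adj a v -> state L -> state (f :: L).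
Proof.
move=> aW au av D.
have sadj : {in Vn &, forall w w', big_adj (subst a w) (subst a w') = big_adj w w'}.
  (* Among the vertices that are kept, [a] has the same neighbours as the new vertex, namely u and
     v. *)
  have ta w : w \in Vn -> w != t -> big_adj (il a) w = big_adj t w.
    move=> wV wt; apply/idP/idP => [aw|].
      by have [p -> pe] := nb_new aW wV wt aw.
    by case: w {wV wt} => [p|//] /=; rewrite fE edge_in => /orP[] /eqP ->.
  move=> w w' wV wV'; rewrite /subst; case: (eqVneq w t) => [->|wt]; case: (eqVneq w' t) => [->|wt'] //.
  - by rewrite /= adj_irrefl.
  - exact: ta.
  - by rewrite big_adj_sym ta // big_adj_sym.
apply: (sd_relabel (il u) (s := subst a) D).
- exact: subst_inj.
- exact: subst_vert.
- move=> c cE; have [c2 cV] := state_edge_ok cE; split => //.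
  case/state_edgeP: cE => w [w' [-> ww' wV wV']].
  by rewrite imset_edge state_edge2 sadj // ww' !subst_vert.
- move=> c d /state_edge_ok[_ cV] /state_edge_ok[_ dV] _.
  exact: (@allowed_map S big big (subst a) Vn c d sadj cV dV).
Qed.

Hypothesis no_common : forall a, a \in W f -> adj a u -> adj a v -> False.
Variables (pos : big -> R * R) (cv : {set big} -> set (R * R)).
Hypothesis D : sdraw (state_vert L) (state_edge L) (@allowed S big) pos cv.

(** Rerouting replaces the edge ab by an uncrossed edge from [a] to v. As [a] is adjacent to u, the
    path u, a, v can then take the part of the path u, t, v. *)
Let step_crossed a b p : a \in W f -> b \in W f -> adj a u -> adj a b ->
  @edge big (il u) (il v) \in state_edge L -> cv (edge (il a) (il b)) p -> cv (edge (il u) (il v)) p ->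
  (forall w, w \in state_vert L -> pos w <> p) -> state (f :: L).
Proof.
move=> aW bW au ab uvE ca cu nv.
have abE : @edge big (il a) (il b) \in state_edge L by rewrite state_edge2 /= ab !vert_W.
have nab : a != b by apply: contraTneq ab => ->; rewrite adj_irrefl.
have aw z : z \in sk_ends f -> a != z by move=> ze; apply: contraTneq aW => ->; exact: uW.
have bw z : z \in sk_ends f -> b != z by move=> ze; apply: contraTneq bW => ->; exact: uW.
have ine (z z' : H) : z != z' -> il z != il z' by move=> h; apply/eqP => -[/eqP]; rewrite (negbTE h).
have abuv : @edge big (il a) (il b) != edge (il u) (il v).
  by apply/eqP => /(edge_inj (ine _ _ nab))[[[E] _]|[[E] _]];
    [have := aw _ ue|have := aw _ we]; rewrite E eqxx.
have D2 := sd_uncross D abE uvE abuv ca cu nv (u := il a) (v := il v).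
rewrite !edge_in !eqxx orbT in D2; have {}D2 := D2 isT isT (ine _ _ (aw _ we)).
(* A kept edge that crosses ua would avoid u and have an end adjacent to [a] by the type of the
   crossing. Among the kept vertices only u and v can be adjacent to [a], and adjacency to v is
   excluded by [no_common]. *)
have a_in (c : {set big}) d1 d2 : c = edge d1 d2 -> c \in En -> t \notin c -> il u \notin c ->
    big_adj (il a) d1 || big_adj (il a) d2 -> False.
  move=> cE cEn tc uc h; have [_ /fintype.subsetP sub] := state_edge_ok cEn.
  have key d : d \in c -> big_adj (il a) d -> False.
    move=> dc ad; have dt : d != t by apply: contraNneq tc => <-.
    have [q dE qe] := nb_new aW (sub _ dc) dt ad; rewrite dE in dc ad.
    move: qe; rewrite fE edge_in => /orP[/eqP E|/eqP E]; rewrite E in dc ad.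
      by rewrite dc in uc.
    exact: (no_common aW au).
  case/orP: h; apply: key; rewrite cE edge_in eqxx ?orbT //.
apply: (sd_relabel (il u) (s := subst a) D2).
- exact: subst_inj.
- exact: subst_vert.
- move=> c cE; have [c2 cV] := state_edge_ok cE; split => //.
  rewrite finset.in_setU1 finset.in_setD1.
  case: (boolP (t \in c)) => tc; last first.
    rewrite subst_id // away // andbT; apply/orP; right.
    by apply: contraNneq (away_W cE aW) => ->; rewrite edge_in eqxx.
  case: (at_t cE tc) => ->; rewrite imset_edge /subst eqxx /=; last by rewrite edgeC eqxx.
  rewrite state_edge2 /= adj_sym au vert_x ?in_x // vert_W // !andbT; apply/orP; right.
  have ua : u != a by rewrite eq_sym aw.
  apply/eqP => /(edge_inj (ine _ _ ua))[[[E] _]|[[E] _]]; first by rewrite E eqxx in ua.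
  by have := bw _ ue; rewrite E eqxx.
- move=> c d cE dE cd [al cn _ dn _].
  have dis : t \notin c -> t \notin d -> allowed S c d by move=> tc td; rewrite !subst_id // in al.
  have tv k : k \in En -> t \in k -> (subst a @: k)%SET != edge (il a) (il v) -> k = edge (il u) t.
    move=> kE tk; case: (at_t kE tk) => -> //; rewrite imset_edge /subst eqxx /=.
    by rewrite edgeC eqxx.
  have imt : (subst a @: edge (il u) t)%SET = edge (il u) (il a) by rewrite imset_edge /subst eqxx.
  have notin (k k' : {set big}) (z : big) : (k :&: k')%SET = finset.set0 -> z \in k -> z \notin k'.
    by move=> E zk; apply/negP => zk'; have := finset.in_setI z k k'; rewrite E finset.in_set0 zk zk'.
  case: (boolP (t \in c)) => tc; case: (boolP (t \in d)) => td; last exact: dis.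
  + by rewrite (tv c cE tc cn) (tv d dE td dn) eqxx in cd.
  + exfalso; rewrite (tv c cE tc cn) imt (subst_id a td) in al; case: al => di typ.
    have [d1 [d2 [dE' _ _ _]]] := state_edgeP dE.
    have ud : il u \notin d by apply: (notin _ _ _ di); rewrite edge_in eqxx.
    apply: (a_in d d1 d2 dE' dE td ud).
    by have := type_disjoint SS (typ _ _ _ _ erefl dE') => /orP[] /andP[_ /= ->]; rewrite ?orbT.
  + exfalso; rewrite (tv d dE td dn) imt (subst_id a tc) in al; case: al => di typ.
    have [c1 [c2 [cE' _ _ _]]] := state_edgeP cE.
    have uc : il u \notin c by rewrite finset.setIC in di; apply: (notin _ _ _ di); rewrite edge_in eqxx.
    apply: (a_in c c1 c2 cE' cE tc uc).
    have := type_disjoint SS (typ _ _ _ _ cE' erefl); move=> /orP[] /andP[h1 h2].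
      by apply/orP; right; rewrite big_adj_sym; exact: h2.
    by apply/orP; left; rewrite big_adj_sym; exact: h1.
Qed.

Lemma state_step : state (f :: L).
Proof.
case: (pselect (exists a b p, [/\ a \in W f, b \in W f, adj a b, @edge big (il u) (il v) \in state_edge L &
    [/\ cv (edge (il a) (il b)) p, cv (edge (il u) (il v)) p & forall w, w \in state_vert L -> pos w <> p]])).
  case=> a [b [p [aW bW ab uvE [ca cu nv]]]].
  have abE : @edge big (il a) (il b) \in state_edge L by rewrite state_edge2 /= ab !vert_W.
  have abuv : @edge big (il a) (il b) != edge (il u) (il v).
    apply/eqP => E; have : il a \in @edge big (il u) (il v) by rewrite -E edge_in eqxx.
    by rewrite edge_in => /orP[] /eqP[E']; move: aW; rewrite E' (negbTE (uW _)) // ?ue ?we.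
  have [_ typ] := sd_cross D abE uvE abuv ca cu nv.
  have /orP[/andP[/= au bv]|/andP[/= av bu]] := type_disjoint SS (typ _ _ _ _ erefl erefl).
    exact: (@step_crossed a b p).
  by apply: (@step_crossed b a p) => //; rewrite 1?adj_sym // edgeC.
move=> no_cross.
pose F := [set c in state_edge L | [exists a in W f, il a \in c]]%SET.
have FE : F \subset state_edge L by apply/fintype.subsetP => c; rewrite inE => /andP[].
have con : connect [rel a b | edge a b \in F] (il u) (il v).
  apply: (push_connect (r := interior_rel f) (q := il)); last exact: (interior_walk hT con2).
  move=> p q /andP[pq pqW]; apply: connect1; rewrite /= inE state_edge2 /= pq /=.
  have inL a b : a \in W f -> adj a b -> il b \in state_vert L.
    by move=> aW ab; case: (interior_adj hT vf aW ab) => [/vert_W//|/in_x/vert_x].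
  case/orP: pqW => hW; rewrite (vert_W hW) /=.
    rewrite (inL _ _ hW pq) /=; apply/exists_inP; exists p => //; by rewrite edge_in eqxx.
  rewrite (inL q p) 1?adj_sym //=; apply/exists_inP; exists q => //; by rewrite edge_in eqxx orbT.
have nuv : il u <> il v by move=> [E]; move: uv; rewrite E eqxx.
have uV : il u \in state_vert L by apply: vert_x; exact: in_x.
have [A arcA AF] := sd_walk D FE con nuv uV.
pose Vb := (Vn :\ t)%SET; pose Eb := [set c in En | t \notin c]%SET.
have D' : sdraw Vb Eb (fun c d => [/\ @allowed S big c d, t \notin c & t \notin d]) pos cv.
  apply: (sdraw_sub D).
  - by apply/fintype.subsetP => w; rewrite !inE -!(finset.in_set (fun w : big => match w with inl _ => _ | inr _ => _ end)) => /andP[wt wV]; exact: old_vert.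
  - move=> c; rewrite finset.in_set => /andP[cE tc]; split; first exact: away.
    have [_ /fintype.subsetP sub] := state_edge_ok cE.
    by apply/fintype.subsetP => w wc; rewrite finset.in_setD1 sub // andbT; apply: contraNneq tc => <-.
  - by move=> c d; rewrite !(finset.in_set (fun c => (c \in En) && _)) => /andP[_ tc] /andP[_ td] _ al; split.
have inVb p : p \in sk_ends f -> il p \in Vb.
  by move=> pe; rewrite finset.in_setD1 /=; apply: vert_x; exact: in_x.
have tVb : t \notin Vb by rewrite finset.in_setD1 eqxx.
have D2 := sd_add_path D' (inVb _ ue) (inVb _ we) tVb arcA.
(* Let a kept edge [c] cross an edge of the walk with ends [a1] and [a2], where [a1] is interior. By
   the type, one end of [c] is adjacent to [a1] and the other to [a2], and kept neighbours of
   interior vertices are u or v. If [a2] is interior too, then [c] is uv, contrary to [no_cross]. If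
   [a2] is u or v, then the end of [c] adjacent to [a1] is the other one of the two, contrary to
   [no_common]. *)
have avoid z : A z -> z <> pos (il u) -> z <> pos (il v) ->
    (forall w, w \in Vb -> pos w <> z) /\ (forall c, c \in Eb -> ~ cv c z).
  move=> Az zu zv; have [a aF az] := AF z Az.
  move: aF; rewrite finset.in_set => /andP[aE /exists_inP[a1 a1W a1a]].
  have [src [dst [sd D0]]] := D.
  have [a2' aE' a12] := card_edge (sd_card D aE) a1a.
  have adj12 : big_adj (il a1) a2' by rewrite aE' state_edge2 in aE; case/and3P: aE.
  have a2V : a2' \in state_vert L by apply: (sd_sub D aE); rewrite aE' edge_in eqxx orbT.
  have [a2 a2E a2We] := nb a1W a2V adj12; rewrite a2E in aE' {a12 a2V} adj12.
  have ends_z w : w \in state_vert L -> w \in a -> pos w = z -> w \notin Vn.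
    move=> wV wa wz; apply/negP => wn.
    have : w = il a1 \/ w = il a2 by move: wa; rewrite aE' edge_in => /orP[] /eqP ->; auto.
    case=> E; rewrite E in wn wz; have [_] := new_l wn; first by rewrite a1W.
    case: a2We => [->//|]; rewrite fE edge_in => /orP[] /eqP E' _; rewrite E' in wz.
      by apply: zu.
    by apply: zv.
  have in_a w : w \in state_vert L -> cv a (pos w) -> w \in a.
    by move=> wV /(pd_avoid D0 aE wV) h; rewrite (sd a aE) edge_in; case: h => ->; rewrite eqxx ?orbT.
  have nvb w : w \in Vb -> pos w <> z.
    rewrite finset.in_setD1 => /andP[wt wn] wz; have wV := old_vert wn wt.
    have wa : w \in a by apply: in_a => //; rewrite wz.
    by have := ends_z w wV wa wz; rewrite wn.
  split=> // c; rewrite finset.in_set => /andP[cE tc] cz; have cL := away cE tc.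
  have ac : a != c by apply: contraNneq (away_W cE a1W) => <-.
  have nv w : w \in state_vert L -> pos w <> z.
    move=> wV wz; have wa : w \in a by apply: in_a => //; rewrite wz.
    have wc : w \in c.
      have := pd_avoid D0 cL wV; rewrite wz => /(_ cz) h.
      by rewrite (sd c cL) edge_in; case: h => ->; rewrite eqxx ?orbT.
    have := ends_z w wV wa wz; have [_ /fintype.subsetP sub] := state_edge_ok cE.
    by rewrite sub.
  have [di typ] := sd_cross D aE cL ac az cz nv.
  have [c1 [c2 [cE' _ c1V c2V]]] := state_edgeP cE.
  have key d : d \in c -> big_adj (il a1) d -> exists2 p, d = il p & p \in sk_ends f /\ p != a2.
    move=> dc ad; have [_ /fintype.subsetP sub] := state_edge_ok cE.
    have dt : d != t by apply: contraNneq tc => <-.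
    have [p dE pe] := nb_new a1W (sub _ dc) dt ad; exists p => //; split => //.
    apply/eqP => E; have := finset.in_setI d a c; rewrite di finset.in_set0 dc andbT aE' dE E edge_in eqxx orbT.
    by [].
  have key2 d : d \in c -> a2 \in W f -> big_adj (il a2) d -> exists2 p, d = il p & p \in sk_ends f.
    move=> dc a2W ad; have [_ /fintype.subsetP sub] := state_edge_ok cE.
    by apply: (nb_new a2W (sub _ dc) _ ad); apply: contraNneq tc => <-.
  have c1c : c1 \in c by rewrite cE' edge_in eqxx.
  have c2c : c2 \in c by rewrite cE' edge_in eqxx orbT.
  have fin d d' : d \in c -> d' \in c -> c = edge d d' -> big_adj (il a1) d -> big_adj (il a2) d' -> False.
    move=> dc d'c cdd' h1 h2; have [p dE [pe pa2]] := key d dc h1.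
    case: a2We => [a2W|a2e].
      have [p' d'E p'e] := key2 d' d'c a2W h2.
      apply: no_cross; exists a1, a2, z; rewrite -aE'.
      have -> : @edge big (il u) (il v) = c.
        have npp : p != p' by have := sd_card D cL; rewrite cdd' dE d'E cards2; case: (eqVneq p p') => // ->; rewrite eqxx.
        move: pe p'e; rewrite cdd' dE d'E fE !edge_in => /orP[] /eqP E1 /orP[] /eqP E2;
          by rewrite E1 E2 ?eqxx // in npp *; rewrite edgeC.
      by split.
    have h1' : adj a1 p by rewrite dE in h1.
    move: pe a2e pa2; rewrite fE !edge_in => /orP[] /eqP Ep /orP[] /eqP Ea; rewrite ?Ep ?Ea ?eqxx // => _;
      rewrite Ep in h1'; rewrite Ea /= in adj12; [exact: (no_common a1W h1' adj12)|exact: (no_common a1W adj12 h1')].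
  have := type_disjoint SS (typ _ _ _ _ aE' cE') => /orP[] /andP[/= h1 h2].
    exact: (fin c1 c2).
  by apply: (fin c2 c1) => //; rewrite edgeC.
apply: (sd_restrict (D2 avoid)).
- by apply/fintype.subsetP => w wV; rewrite finset.in_setU1 finset.in_setD1 wV andbT; case: eqP.
- move=> c cE; have [_ cV] := state_edge_ok cE; split => //; rewrite !finset.in_setU1.
  case: (boolP (t \in c)) => tc; first by case: (at_t cE tc) => ->; rewrite eqxx ?orbT.
  by rewrite (finset.in_set (fun c => (c \in En) && _)) cE tc !orbT.
- by move=> c d _ _ _ [].
Qed.

End Step.

Lemma state_all : state [::] -> forall L, uniq L -> (forall f, f \in L -> virtual f && (sk_node f == x)) -> state L.
Proof.
move=> st0; elim=> [//|f L IH] /= /andP[fL uL] inx.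
have /andP[vf /eqP fx] := inx f (mem_head _ _).
have D : state L by apply: IH => // g gL; apply: inx; rewrite inE gL orbT.
have [u [v [fE uv]]] := ends_pair hT f.
case: (pselect (exists a, [/\ a \in W f, adj a u & adj a v])) => [[a [aW au av]]|no].
  exact: (state_step_common vf fx fL fE aW au av D).
have [pos [cv D0]] := D; apply: (state_step vf fx fL fE uv _ D0).
by move=> a aW au av; apply: no; exists a.
Qed.

(** The state for the empty list is an induced subgraph of [H] and inherits its drawing. The state
    for the list of all virtual edges of [x] contains a copy of the skeleton+ as an induced
    subgraph, because of [sk_pair]. *)
Lemma skeleton_plus_restricted : restricted R S H -> (0 < #|sk_vert x|)%N -> restricted R S (skeleton_plus x).
Proof.
move=> res /card_gt0P[v0 v0x].
have st0 : state [::].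
  have D := restricted_sdraw v0 res.
  pose s (w : big) : H := if w is inl p then p else v0.
  have lft w : w \in state_vert [::] -> exists p, w = inl p.
    by case: w => [p _|g]; [exists p|rewrite inE !andbF].
  have sadj : {in state_vert [::] &, forall w w', adj (s w) (s w') = big_adj w w'}.
    by move=> w w' /lft[p ->] /lft[q ->].
  apply: (sd_relabel (inl v0 : big) (s := s) D).
  - by move=> w w' /lft[p ->] /lft[q ->] /= ->.
  - by move=> w _; rewrite finset.in_setT.
  - move=> c cE; have [c2 cV] := state_edge_ok cE; split => //.
    case/state_edgeP: cE => w [w' [-> ww' wV wV']].
    by rewrite imset_edge edges_adj sadj.
  - move=> c d /state_edge_ok[_ cV] /state_edge_ok[_ dV] _.
    exact: (@allowed_map S H big s _ c d sadj cV dV).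
pose L := enum [set f | virtual f && (sk_node f == x)]%SET.
have LE f : (f \in L) = virtual f && (sk_node f == x) by rewrite mem_enum inE.
have D : state L by apply: state_all => //; [exact: enum_uniq|move=> f; rewrite LE].
pose s (w : skeleton_plus x) : big := match w with inl p => inl (val p) | inr f => inr (val f) end.
have sadj w w' : big_adj (s w) (s w') = adj w w'.
  case: w w' => [p|f] [q|g] //=.
  apply/idP/andP => [pq|[_ /exists_inP[e ex /andP[/eqP eE imp]]]].
    split; first by apply: contraTneq pq => ->; rewrite adj_irrefl.
    have [e ex eE] := sk_pair pT (valP p) (valP q) pq.
    by apply/exists_inP; exists e => //; rewrite eE eqxx pq implybT.
  case: (boolP (virtual e)) imp => [_ //|ve _].
  by rewrite -edges_adj -eE; exact: (pt_real_edge pT).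
have sV w : s w \in state_vert L.
  case: w => [p|f]; rewrite inE /=; first by rewrite (valP p).
  have /andP[fx vf] := valP f; rewrite inE in fx.
  by apply/and3P; split => //; rewrite LE vf fx.
apply: sdraw_restricted; apply: (sd_relabel (inl (Sub v0 v0x) : skeleton_plus x) (s := s) D).
- by move=> [p|f] [q|g] _ _ //= [] /val_inj ->.
- by move=> w _; exact: sV.
- move=> c cE; split; [exact: edges_card|exact: finset.subsetT|].
  case/edgesP: cE => w [w' [ww' ->]].
  by rewrite imset_edge state_edge2 sadj ww' !sV.
- move=> c d _ _ _ al.
  have sadjT : {in [set: skeleton_plus x]%SET &, forall w w', big_adj (s w) (s w') = adj w w'} by move=> w w' _ _.
  by apply: (@allowed_map S big (skeleton_plus x) s _ c d sadjT _ _ al); rewrite finset.subsetT.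
Qed.

End Forward.

Section InducedSubgraph.
Variables (G : sgraph) (B : {set G}).

Lemma induced_k_connected k : k_connected k (@adj G) B ->
  k_connected k (@adj (induced_subgraph B)) [set: induced_subgraph B]%SET.
Proof.
case=> Bk con; split.
  by rewrite cardsT card_sig (eq_card (_ : _ =i B)).
move=> X Xk u v; rewrite !finset.in_setD !finset.in_setT !andbT => uX vX.
have Xk' : (#|(val @: X)%SET| < k)%N by rewrite card_imset //; exact: val_inj.
have inX (w : induced_subgraph B) : w \notin X -> val w \in (B :\: val @: X)%SET.
  by move=> wX; rewrite finset.in_setD (valP w) andbT; apply: contraNN wX => /imsetP[z zX /val_inj ->].
have lift a : a \in (B :\: val @: X)%SET -> exists2 n : induced_subgraph B, n \notin X & val n = a.
  rewrite finset.in_setD => /andP[aX aB]; exists (Sub a aB : induced_subgraph B) => //.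
  by apply: contraNN aX => nX; apply/imsetP; exists (Sub a aB).
have := con _ Xk' _ _ (inX u uX) (inX v vX).
apply: (lift_connect (pi := val) (I := fun n => n \notin X)) => //.
  by move=> n m _ _ /val_inj ->; rewrite connect0.
move=> a b /and3P[/lift[n nX <-] /lift[m mX <-] ab]; exists n, m; split => //=.
by rewrite !finset.in_setD !finset.in_setT nX mX.
Qed.

Lemma induced_restricted (R : realType) (S : set crossing_type) : (exists v, v \in B) ->
  restricted R S G -> restricted R S (induced_subgraph B).
Proof.
move=> [v0 v0B] res; have D := restricted_sdraw v0 res.
pose s (w : induced_subgraph B) : G := val w.
apply: sdraw_restricted; apply: (sd_relabel (Sub v0 v0B : induced_subgraph B) (s := s) D).
- by move=> u v _ _; exact: val_inj.
- by move=> w _; rewrite finset.in_setT.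
- move=> a aE; split; [exact: edges_card|exact: finset.subsetT|].
  by case/edgesP: aE => u [v [uv ->]]; rewrite imset_edge edges_adj.
- move=> a b _ _ _ al.
  by apply: (@allowed_map S G (induced_subgraph B) s [set: induced_subgraph B]%SET a b _ _ _ al);
    rewrite ?finset.subsetT.
Qed.

End InducedSubgraph.

Theorem theorem3p1 (R : realType) (S : set crossing_type) (G : sgraph) :
  S !=set0 -> S `<=` [set Full; AlmostFull; Bowtie] ->
  (restricted R S G <->
   forall (B : {set G}) (T : spr_data (induced_subgraph B)) (x : node T),
     biconnected_component B -> is_spr_tree T -> kind x = Rnode ->
     restricted R S (skeleton_plus x)).
Proof.
move=> _ SS; split=> [res B T x [B2 _] hT kx|res].
  apply: (skeleton_plus_restricted hT SS (induced_k_connected B2)).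
    apply: induced_restricted res; apply/card_gt0P; case: B2 => B3 _.
    exact: leq_trans B3.
  by have := spr_kind hT x; rewrite kx => -[_ [x4 _]]; exact: leq_trans x4.
apply: blocks_restricted => B bB; have [T hT] := spr_tree_exists (induced_k_connected bB.1).
by apply: (tree_restricted hT SS) => x kx; exact: (res B T x bB hT kx).
Qed.
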